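(* Let $\mathcal{B}$ be a $\mathbb{C}$-linearly independent family of elements of $\mathbb{C}\cdot E_2\oplus M_{\ast}$. Then the family of iterated integrals $$(I(f_1,\ldots,f_n;\tau)\mid n\ge0,\ f_i\in\mathcal{B})$$ is linearly independent over $\mathrm{Frac}(QM_{\ast})\cong\mathbb{C}(E_2,E_4,E_6)$.
   Context: All modular and quasimodular forms are for $\mathrm{SL}_2(\mathbb{Z})$; $\mathfrak{H}$ is the upper half-plane with coordinate $\tau$ and $q=e^{2\pi i\tau}$. $M_{\ast}=\bigoplus_k M_k=\mathbb{C}[E_4,E_6]$ is the algebra of holomorphic modular forms, where $E_{2k}(\tau)=1-\frac{4k}{B_{2k}}\sum_{n\ge1}n^{2k-1}\frac{q^n}{1-q^n}$ (with $B_{2k}$ the Bernoulli numbers). $QM_{\ast}=\mathbb{C}[E_2,E_4,E_6]$ is the algebra of quasimodular forms, viewed as an algebra of holomorphic functions on $\mathfrak{H}$ (so $\mathrm{Frac}(QM_{\ast})$ is a field of meromorphic functions on $\mathfrak{H}$). Regularized iterated integrals: let $W$ be the $\mathbb{C}$-algebra of holomorphic $f:\mathfrak{H}\to\mathbb{C}$ with an everywhere convergent Fourier series $f=\sum_{n\ge0}a_nq^n$, and let $f^{\infty}=a_0$. Let $\mathbb{C}\langle W\rangle$ be the space of $\mathbb{C}$-linear combinations of tensors $[f_1|\ldots|f_n]$, $f_i\in W$, $n\geq 0$, with the shuffle product $[f_1|\ldots|f_r]\,⧢\,[f_{r+1}|\ldots|f_{r+s}]=\sum_{\sigma\in\Sigma_{r,s}}[f_{\sigma(1)}|\ldots|f_{\sigma(r+s)}]$,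 where $\Sigma_{r,s}$ is the set of permutations $\sigma$ of $\{1,\ldots,r+s\}$ with $\sigma^{-1}(1)<\ldots<\sigma^{-1}(r)$ and $\sigma^{-1}(r+1)<\ldots<\sigma^{-1}(r+s)$. Define a linear map $R$ on $\mathbb{C}\langle W\rangle$ by $R[f_1|\ldots|f_n]=\sum_{i=0}^n(-1)^{n-i}[f_1|\ldots|f_i]\,⧢\,[f_n^{\infty}|\ldots|f_{i+1}^{\infty}]$. For $f_1,\ldots,f_n\in W$ set $$I(f_1,\ldots,f_n;\tau)=(2\pi i)^n\sum_{i=0}^n(-1)^{n-i}\int_{\tau}^{i\infty}R[f_1|\ldots|f_i]\int_0^{\tau}[f_n^{\infty}|\ldots|f_{i+1}^{\infty}],$$ where $\int_a^b[f_1|\ldots|f_n]=\int_{0\le t_1\le\ldots\le t_n\le1}(\gamma_a^b)^*(f_1(\tau_1)d\tau_1)\cdots(\gamma_a^b)^*(f_n(\tau_n)d\tau_n)$ is the usual iterated integral along the straight line path $\gamma_a^b$ from $a$ to $b$, extended linearly (equal to $1$ for $n=0$); the integral of $R[\cdots]$ up to $i\infty$ is along the vertical ray, as a limit of the whole linear combination, which converges. *)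

(* Defs.v *)
From Stdlib Require Import Reals List ClassicalEpsilon.
From Coquelicot Require Import Coquelicot.
Import ListNotations.
Open Scope C_scope.

(** Functions on the upper half-plane are total functions [C -> C] whose values
    are only ever considered at points of [upper]. *)
Definition upper (tau : C) : Prop := (0 < Im tau)%R.

Definition Cexp (z : C) : C :=
  (exp (Re z) * cos (Im z), exp (Re z) * sin (Im z))%R.

Definition q (tau : C) : C := Cexp (2 * RtoC PI * Ci * tau).

Definition Csum {K : Type} (F : K -> C) (s : list K) : C :=
  fold_right Cplus 0 (map F s).

Definition CSeries (a : nat -> C) : C :=
  (Series (fun n => Re (a n)), Series (fun n => Im (a n))).

(** Limit at +oo of a complex-valued function of a real variable. *)
Definition CLim (f : R -> C) : C :=
  (real (Lim (fun t => Re (f t)) p_infty),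
   real (Lim (fun t => Im (f t)) p_infty)).

(** [bernoulli_upto n j] is B_j for j <= n, computed from
    B_(m+1) = - 1/(m+2) * sum_(i <= m) binom(m+2, i) B_i. *)
Fixpoint bernoulli_upto (n : nat) : nat -> R :=
  match n with
  | O => fun _ => 1%R
  | S m => fun j =>
      if Nat.leb j m then bernoulli_upto m j
      else (- / INR (m + 2) *
            sum_f_R0 (fun i => Binomial.C (m + 2) i * bernoulli_upto m i) m)%R
  end.

Definition bernoulli (n : nat) : R := bernoulli_upto n n.

(** [eisenstein k] is the series of weight 2k; the Lambert series, which starts
    at n = 1, is indexed by n + 1. *)
Definition eisenstein (k : nat) (tau : C) : C :=
  1 - RtoC (4 * INR k / bernoulli (2 * k)) *
      CSeries (fun n => RtoC (INR (S n) ^ (2 * k - 1)) *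
                        (q tau ^ S n / (1 - q tau ^ S n))).

Definition E2 : C -> C := eisenstein 1.
Definition E4 : C -> C := eisenstein 2.
Definition E6 : C -> C := eisenstein 3.

(** The C-algebra of functions on the upper half-plane generated by [gens];
    [alg_ext] makes membership depend only on the restriction to [upper]. *)
Inductive algebra_gen (gens : list (C -> C)) : (C -> C) -> Prop :=
| alg_const (c : C) : algebra_gen gens (fun _ => c)
| alg_gen (f : C -> C) : In f gens -> algebra_gen gens f
| alg_add (f g : C -> C) : algebra_gen gens f -> algebra_gen gens g ->
    algebra_gen gens (fun tau => f tau + g tau)
| alg_mul (f g : C -> C) : algebra_gen gens f -> algebra_gen gens g ->
    algebra_gen gens (fun tau => f tau * g tau)
| alg_ext (f g : C -> C) : algebra_gen gens f ->
    (forall tau, upper tau -> f tau = g tau) -> algebra_gen gens g.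

Definition modular : (C -> C) -> Prop := algebra_gen [E4; E6].
Definition quasimodular : (C -> C) -> Prop := algebra_gen [E2; E4; E6].

Definition CE2_plus_modular (f : C -> C) : Prop :=
  exists (c : C) (g : C -> C),
    modular g /\ forall tau, upper tau -> f tau = c * E2 tau + g tau.

(** f = sum_(n >= 0) a_n q^n, convergent everywhere on the upper half-plane. *)
Definition fourier_series (f : C -> C) (a : nat -> C) : Prop :=
  forall tau, upper tau ->
    is_series (K := C_AbsRing) (V := C_NormedModule)
      (fun n => a n * q tau ^ n) (f tau).

(** The zeroth Fourier coefficient of f; unspecified if f has no expansion. *)
Definition f_infty (f : C -> C) : C :=
  epsilon (inhabits (0 : C))
    (fun a0 => exists a : nat -> C, fourier_series f a /\ a O = a0).

(** The tensor [f_1 | ... | f_n]. *)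
Definition word : Type := list (C -> C).

(** A formal representative of a linear combination of tensors. Words are not
    identified under multilinearity: [iter_int] is multilinear, so its linear
    extension [iter_int_lin] takes the same value on all representatives. *)
Definition lincomb : Type := list (C * word).

(** The list, with multiplicity, of the words indexed by the (r,s)-shuffles. *)
Fixpoint shuffle (u : word) : word -> list word :=
  match u with
  | [] => fun v => [v]
  | a :: u' =>
      fix shuffle_u (v : word) : list word :=
        match v with
        | [] => [u]
        | b :: v' => map (cons a) (shuffle u' v) ++ map (cons b) (shuffle_u v')
        end
  end.

(** [f_n^oo | ... | f_(i+1)^oo], as constant functions. *)
Definition rev_infty (i : nat) (w : word) : word :=
  rev (map (fun f (_ : C) => f_infty f) (skipn i w)).

Definition Rmap (w : word) : lincomb :=
  flat_map
    (fun i => map (fun v => ((- (1)) ^ (length w - i), v))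
                  (shuffle (firstn i w) (rev_infty i w)))
    (seq 0 (S (length w))).

(** Integral over s <= t_1 <= ... <= t_n <= 1 of the pullbacks of
    f_1(tau_1) dtau_1, ..., f_n(tau_n) dtau_n along t |-> a + t (b - a);
    the outermost integration variable is t_1. *)
Fixpoint iter_int_from (a b : C) (w : word) (s : R) : C :=
  match w with
  | [] => 1
  | f :: w' =>
      RInt (V := C_R_CompleteNormedModule)
        (fun t => f (a + RtoC t * (b - a)) * (b - a) * iter_int_from a b w' t)
        s 1
  end.

Definition iter_int (a b : C) (w : word) : C := iter_int_from a b w 0.

Definition iter_int_lin (a b : C) (x : lincomb) : C :=
  Csum (fun cw : C * word => fst cw * iter_int a b (snd cw)) x.

(** The integral from tau to i oo of R[f_1 | ... | f_n]. *)
Definition iter_int_R_ioo (tau : C) (w : word) : C :=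
  CLim (fun T => iter_int_lin tau (tau + RtoC T * Ci) (Rmap w)).

Definition I_reg (w : word) (tau : C) : C :=
  (2 * RtoC PI * Ci) ^ length w *
  Csum (fun i => (- (1)) ^ (length w - i) *
                 iter_int_R_ioo tau (firstn i w) *
                 iter_int 0 tau (rev_infty i w))
       (seq 0 (S (length w))).

Definition lin_indep_C {K : Type} (F : K -> C -> C) : Prop :=
  forall (s : list K) (c : K -> C),
    NoDup s ->
    (forall tau, upper tau -> Csum (fun k => c k * F k tau) s = 0) ->
    forall k, In k s -> c k = 0.

(** Coefficients in Frac(QM) are written g/h with h not identically zero. The
    zeros of such an h are isolated, so an equality of meromorphic functions is
    an equality at the points where no denominator vanishes. *)
Definition lin_indep_FracQM {K : Type} (F : K -> C -> C) : Prop :=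
  forall (s : list K) (g h : K -> C -> C),
    NoDup s ->
    (forall k, In k s -> quasimodular (g k) /\ quasimodular (h k) /\
                         exists tau, upper tau /\ h k tau <> 0) ->
    (forall tau, upper tau -> (forall k, In k s -> h k tau <> 0) ->
       Csum (fun k => g k tau / h k tau * F k tau) s = 0) ->
    forall k, In k s -> forall tau, upper tau -> g k tau = 0.

(* Main.v *)
(** Along words, the regularized integrals satisfy I([]) = 1 and I(f :: w)' = -2 pi i f I(w). Indeed, the
    integrals over constants form the exponential tau |-> sum over words of (prod f_i^oo) tau^n / n!, so that
    regularization replaces the divergent integral up to i oo by the solution of this system whose part
    polynomial in tau is the exponential at -tau, the remainder decaying exponentially at i oo.

    By the argument of Deneufchatel, Duchamp, Minh and Solomon, a nontrivial relation between the I(w) over the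
    quotients of quasimodular forms, taken minimal and normalized at a longest word, must have a trivial
    derivative. So its coefficients at the longest words are constant, and at the words shorter by one letter
    this gives a nonzero linear combination f of the family with 2 pi i f = (u/v)' for quasimodular u and v.

    No such f exists. Comparing the highest powers of tau in the transforms of u, v, f under tau |-> -1/tau
    reduces to homogeneous u, v and f = f_k of weight k. For k = 0, 2 the primitive of f would contain a term
    linear in tau. For k >= 4 let e be the (k-1)-fold primitive of f, an Eichler integral: by Bol's identity the
    primitive of f transforms by a Taylor polynomial of e, and the lowest powers of tau show that e is a
    quotient of modular forms, hence invariant of weight 2 - k < 0. Such an e vanishes, because
    its Fourier coefficients are bounded by averages of it along horizontal lines tending to the real axis.

    The Ramanujan identities follow from a symmetry of the solutions of a x + b y = n in positive integers, the
    transformation law of E4 from the Lipschitz formula in weight 4 and a lattice sum, and the laws of E2 and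
    E6 from the derivatives of that of E4. *)
Require Import Defs.
From Stdlib Require Import Reals List Lra Lia Arith Wf_nat ZArith Permutation ClassicalEpsilon.
From Coquelicot Require Import Coquelicot.
Import ListNotations.
Open Scope R_scope.
Open Scope C_scope.
Bind Scope C_scope with C.
Arguments Cmod x%_C_scope.

(** A function of [W] is a power series in [q], centred at i oo. A nonzero one has no zeros in some
    half-plane [Im tau > Y], and this fact ([W_dichotomy]) plays the part of the identity theorem:
    it makes [W] an integral domain and allows quotients to be formed. Hence the bound [Y] in many
    statements, and the cross-multiplied form of the relations, whose coefficients stay in [W].

    Quasimodular forms are stored as lists of terms, a representation that is far from unique. Their
    invariants are therefore taken from functions: periodicity makes [tau] transcendental over [W]
    ([tau_indep]), so the top and bottom coefficients in [tau] of a transform under tau |-> -1/tau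
    are well defined.

    The obstacle is that f(-1/tau) is in general not in [W], so that a transformation law known for
    large Im tau does not extend by power series. Bol's identity is used to show that the defect of
    the law is a polynomial in [tau], and a polynomial does extend. *)

Lemma Cmod_tri_minus (x y : C) : Cmod x <= Cmod (x - y) + Cmod y.
Proof. replace x with (x - y + y) at 1 by ring. apply Cmod_triangle. Qed.

(** * Complex derivatives *)

Definition cder (f : C -> C) (z l : C) : Prop :=
  is_derive (K := C_AbsRing) (V := AbsRing_NormedModule C_AbsRing) f z l.

Lemma cder_eps (f : C -> C) (z l : C) :
  cder f z l <->
  (forall eps : R, (0 < eps) -> exists d : R, (0 < d) /\
     forall h : C, (Cmod h < d) ->
       (Cmod (f (z + h) - f z - h * l) <= eps * Cmod h)).
Proof.
split.
- intros [_ H] eps Heps.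
  specialize (H z (fun P H => H) (mkposreal eps Heps)).
  destruct H as [d Hd]. exists d. split. apply cond_pos.
  intros h Hh.
  specialize (Hd (z + h)).
  assert (E : @minus (AbsRing_NormedModule C_AbsRing) (Cplus z h) z = h).
  { change ((z + h) + - z = h). ring. }
  assert (Hb : @ball (AbsRing_UniformSpace C_AbsRing) z d (Cplus z h)).
  { change (Cmod (@minus (AbsRing_NormedModule C_AbsRing) (Cplus z h) z) < d).
    rewrite E. exact Hh. }
  specialize (Hd Hb). rewrite E in Hd. exact Hd.
- intros H. split.
  { apply is_linear_scal_l. }
  intros x Hx.
  assert (Ex : z = x).
  { apply (is_filter_lim_locally_unique (V := AbsRing_NormedModule C_AbsRing)). exact Hx. }
  subst x. intros eps.
  destruct (H eps (cond_pos eps)) as [d [Hd H1]].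
  exists (mkposreal d Hd). intros y Hy.
  assert (Hy' : (Cmod (y - z) < d)) by exact Hy.
  specialize (H1 (y - z) Hy').
  assert (E : Cplus z (y - z) = y) by (change C in y; ring).
  rewrite E in H1. exact H1.
Qed.

Lemma cder_const (c z : C) : cder (fun _ => c) z 0.
Proof. apply (is_derive_const (K := C_AbsRing) (V := AbsRing_NormedModule C_AbsRing)). Qed.

Lemma cder_id (z : C) : cder (fun w => w) z 1.
Proof. apply (is_derive_id (K := C_AbsRing)). Qed.

Lemma cder_plus (f g : C -> C) (z a b : C) :
  cder f z a -> cder g z b -> cder (fun w => f w + g w) z (a + b).
Proof. apply (is_derive_plus (K := C_AbsRing) (V := AbsRing_NormedModule C_AbsRing)). Qed.

Lemma cder_mult (f g : C -> C) (z a b : C) :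
  cder f z a -> cder g z b -> cder (fun w => f w * g w) z (a * g z + f z * b).
Proof.
intros Hf Hg. apply (is_derive_mult (K := C_AbsRing)); try assumption.
intros; apply Cmult_comm.
Qed.

Lemma cder_comp (f g : C -> C) (z a b : C) :
  cder f (g z) a -> cder g z b -> cder (fun w => f (g w)) z (a * b).
Proof.
intros Hf Hg. unfold cder. rewrite Cmult_comm.
apply (is_derive_comp (K := C_AbsRing) (V := AbsRing_NormedModule C_AbsRing)); assumption.
Qed.

Lemma cder_unique (f : C -> C) (z a b : C) : cder f z a -> cder f z b -> a = b.
Proof.
rewrite !cder_eps; intros Ha Hb.
destruct (Ceq_dec a b) as [|N]; [assumption|exfalso].
assert (P : (0 < Cmod (a - b))) by (apply Cmod_gt_0, Cminus_eq_contra, N).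
destruct (Ha (Cmod (a - b) / 4)%R) as [d1 [D1 H1]]. lra.
destruct (Hb (Cmod (a - b) / 4)%R) as [d2 [D2 H2]]. lra.
set (d := (Rmin d1 d2 / 2)%R).
assert (Dp : (0 < d)) by (unfold d; apply Rmin_case; lra).
assert (E : Cmod (RtoC d) = d) by (rewrite Cmod_R; apply Rabs_pos_eq; lra).
specialize (H1 (RtoC d)). specialize (H2 (RtoC d)). rewrite E in *.
assert (L1 : (d < d1)) by (unfold d in *; generalize (Rmin_l d1 d2); lra).
assert (L2 : (d < d2)) by (unfold d in *; generalize (Rmin_r d1 d2); lra).
specialize (H1 L1). specialize (H2 L2).
assert (T : (Cmod (RtoC d * (a - b)) <= Cmod (f (z + RtoC d) - f z - RtoC d * b) +
   Cmod (- (f (z + RtoC d) - f z - RtoC d * a)))).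
{ replace (RtoC d * (a - b)) with ((f (z + RtoC d) - f z - RtoC d * b) +
   - (f (z + RtoC d) - f z - RtoC d * a)) by ring. apply Cmod_triangle. }
rewrite Cmod_opp, Cmod_mult, E in T. nra.
Qed.

Lemma cder_ext_loc (f g : C -> C) (z l : C) (d : R) :
  (0 < d) -> (forall h : C, (Cmod h < d) -> f (z + h) = g (z + h)) ->
  cder f z l -> cder g z l.
Proof.
intros Hd E; rewrite !cder_eps; intros H eps Heps.
destruct (H eps Heps) as [d' [Hd' H']].
exists (Rmin d d'); split. apply Rmin_case; assumption.
intros h Hh.
assert (L1 := Rmin_l d d'). assert (L2 := Rmin_r d d').
rewrite <- E by lra.
replace (g z) with (f z). apply H'; lra.
replace z with (z + 0) by ring. apply E. rewrite Cmod_0; assumption.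
Qed.

Lemma cder_opp (f : C -> C) (z a : C) : cder f z a -> cder (fun w => - f w) z (- a).
Proof. apply (is_derive_opp (K := C_AbsRing) (V := AbsRing_NormedModule C_AbsRing)). Qed.

Lemma cder_minus (f g : C -> C) (z a b : C) :
  cder f z a -> cder g z b -> cder (fun w => f w - g w) z (a - b).
Proof. intros; apply cder_plus; [|apply cder_opp]; assumption. Qed.

Lemma cder_scal (c : C) (f : C -> C) (z a : C) :
  cder f z a -> cder (fun w => c * f w) z (c * a).
Proof.
intros H. replace (c * a) with (0 * f z + c * a) by ring.
apply (cder_mult (fun _ => c)); [apply cder_const|assumption].
Qed.

Lemma cder_pow (n : nat) (z : C) : cder (fun w => w ^ n) z (RtoC (INR n) * z ^ (n - 1)).
Proof.
induction n as [|n IH].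
- simpl. replace (0 * 1) with (RtoC 0) by ring. apply cder_const.
- replace (RtoC (INR (S n)) * z ^ (S n - 1)) with
    (1 * z ^ n + z * (RtoC (INR n) * z ^ (n - 1))).
  exact (cder_mult (fun w => w) (fun w => w ^ n) z _ _ (cder_id z) IH).
  rewrite S_INR, RtoC_plus. replace (S n - 1)%nat with n by lia.
  destruct n. simpl; ring.
  replace (S n - 1)%nat with n by lia. simpl Cpow; ring.
Qed.


Lemma cder_inv (z : C) : z <> 0 -> cder (fun w => / w) z (- / (z * z)).
Proof.
intros Hz. rewrite cder_eps. intros eps Heps.
assert (Pz : (0 < Cmod z)) by (apply Cmod_gt_0; assumption).
set (m := Cmod z) in *.
assert (Pm : (0 < eps * (m * m * m) / 2)).
{ apply Rdiv_lt_0_compat; [|lra]. repeat apply Rmult_lt_0_compat; lra. }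
exists (Rmin (m / 2) (eps * (m * m * m) / 2)). split.
{ apply Rmin_case; lra. }
intros h Hh.
assert (L1 := Rmin_l (m / 2) (eps * (m * m * m) / 2)).
assert (L2 := Rmin_r (m / 2) (eps * (m * m * m) / 2)).
assert (Hzh : (m / 2 <= Cmod (z + h))).
{ assert (T : (Cmod z <= Cmod (z + h) + Cmod (- h))).
  { replace z with (z + h + - h) at 1 by ring. apply Cmod_triangle. }
  rewrite Cmod_opp in T. fold m in T. lra. }
assert (N : z + h <> 0).
{ apply Cmod_gt_0. lra. }
replace (/ (z + h) - / z - h * - / (z * z)) with (h * h / ((z + h) * (z * z))) by (field; split; assumption).
assert (N2 : (z + h) * (z * z) <> 0) by (repeat apply Cmult_neq_0; assumption).
rewrite Cmod_div by assumption. rewrite !Cmod_mult. fold m.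
assert (Ph : (0 <= Cmod h)) by apply Cmod_ge_0.
apply Rle_div_l. { repeat apply Rmult_lt_0_compat; lra. }
assert (m * m / 2 * m <= Cmod (z + h) * (m * m)) by nra.
assert (Cmod h <= eps * (Cmod (z+h) * (m*m))) by nra.
nra.
Qed.

Lemma norm_C_R (x : C) : @norm R_AbsRing C_R_NormedModule x = Cmod x.
Proof.
destruct x as [a b]. unfold norm; simpl. unfold prod_norm, Cmod, norm; simpl. unfold abs; simpl.
f_equal. rewrite !Rmult_1_r, <- !Rabs_mult, !Rabs_pos_eq by nra. reflexivity.
Qed.

(** Restriction to a line turns a complex derivative into a derivative in a real variable, with [C]
    as a real normed module; the theorems on constancy and integration are applied there. *)
Lemma cder_line (f : C -> C) (a v l : C) (t : R) :
  cder f (a + RtoC t * v) l ->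
  is_derive (V := C_R_NormedModule) (fun s : R => f (a + RtoC s * v)) t (v * l).
Proof.
rewrite cder_eps. intros H. split.
{ apply is_linear_scal_l. }
intros x Hx.
assert (Ex : t = x) by (apply is_filter_lim_locally_unique; exact Hx).
subst x. intros eps.
assert (Pv : (0 <= Cmod v)) by apply Cmod_ge_0.
destruct (H (eps / (1 + Cmod v))%R) as [d [Hd H1]].
{ apply Rdiv_lt_0_compat; [apply cond_pos|lra]. }
assert (Hp : (0 < d / (1 + Cmod v))) by (apply Rdiv_lt_0_compat; lra).
exists (mkposreal _ Hp). intros y Hy.
assert (Hy' : (Rabs (y - t) < d / (1 + Cmod v))) by exact Hy.
assert (E : Cmod (RtoC (y - t) * v) = (Rabs (y - t) * Cmod v)%R) by (rewrite Cmod_mult, Cmod_R; reflexivity).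
assert (B : (Rabs (y - t) * (1 + Cmod v) < d)).
{ apply Rlt_le_trans with (d / (1 + Cmod v) * (1 + Cmod v))%R.
  apply Rmult_lt_compat_r; lra. right; field; lra. }
assert (Pa : (0 <= Rabs (y - t))) by apply Rabs_pos.
specialize (H1 (RtoC (y - t) * v)). rewrite E in H1.
specialize (H1 ltac:(nra)).
replace (a + RtoC t * v + RtoC (y - t) * v) with (a + RtoC y * v) in H1
  by (rewrite RtoC_minus; ring).
assert (L : (eps / (1 + Cmod v) * (Rabs (y - t) * Cmod v) <= eps * Rabs (y - t))).
{ assert (P := cond_pos eps).
  replace (eps / (1 + Cmod v) * (Rabs (y - t) * Cmod v))%R with
    (eps * Rabs (y - t) * (Cmod v / (1 + Cmod v)))%R by (field; lra).
  rewrite <- (Rmult_1_r (eps * Rabs (y - t))) at 2.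
  apply Rmult_le_compat_l. nra. apply Rle_div_l; lra. }
rewrite norm_C_R.
change (Cmod (f (a + RtoC y * v) + - f (a + RtoC t * v) + - (@scal R_AbsRing C_R_NormedModule (y - t)%R (v * l)))
   <= eps * Rabs (y - t)).
rewrite scal_R_Cmult.
replace (f (a + RtoC y * v) + - f (a + RtoC t * v) + - (RtoC (y - t) * (v * l)))
 with (f (a + RtoC y * v) - f (a + RtoC t * v) - RtoC (y - t) * v * l) by ring.
lra.
Qed.

Lemma upper_seg (Y : R) (z w : C) (t : R) :
  (Y < Im z) -> (Y < Im w) -> (0 <= t <= 1) -> (Y < Im (z + RtoC t * (w - z))).
Proof.
intros Hz Hw Ht. destruct z as [a b], w as [c d]. unfold Im in *; simpl in *.
replace (b + (t * (d + - b) + 0 * (c + - a)))%R with ((1 - t) * b + t * d)%R by ring.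
destruct (Rle_lt_dec t (1/2)); nra.
Qed.

(** A half-plane is convex, so any two of its points are joined by a segment along which the
    derivative is zero. The height [Y] is arbitrary because quotients exist only above the zeros of
    their denominators. *)
Lemma cder_zero_const (f : C -> C) (Y : R) :
  (forall z, (Y < Im z) -> cder f z 0) ->
  forall z w, (Y < Im z) -> (Y < Im w) -> f z = f w.
Proof.
intros H z w Hz Hw.
assert (E := eq_is_derive (V := C_R_NormedModule) (fun s : R => f (z + RtoC s * (w - z))) 0 1).
simpl in E.
replace (z + 0 * (w - z)) with z in E by ring.
replace (z + 1 * (w - z)) with w in E by ring.
apply E. 2: lra.
intros t Ht.
replace (@zero C_R_NormedModule) with ((w - z) * 0) by (rewrite Cmult_0_r; reflexivity).
apply cder_line, H, upper_seg; assumption.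
Qed.

(** * Power series of subexponential growth *)

Fixpoint csum (f : nat -> C) (n : nat) : C :=
  match n with O => 0 | S m => csum f m + f m end.

Fixpoint rsum (f : nat -> R) (n : nat) : R :=
  match n with O => 0%R | S m => (rsum f m + f m)%R end.

Lemma rsum_Sr (f : nat -> R) (n : nat) : rsum f (S n) = (rsum f n + f n)%R.
Proof. reflexivity. Qed.

Lemma csum_ext (f g : nat -> C) (n : nat) :
  (forall i, (i < n)%nat -> f i = g i) -> csum f n = csum g n.
Proof. induction n; simpl; intros H; [reflexivity|]. rewrite IHn, H; auto with arith. Qed.

Lemma csum_plus (f g : nat -> C) (n : nat) :
  csum (fun i => f i + g i) n = csum f n + csum g n.
Proof. induction n; simpl; [ring|]. rewrite IHn; ring. Qed.

Lemma csum_scal (c : C) (f : nat -> C) (n : nat) :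
  csum (fun i => c * f i) n = c * csum f n.
Proof. induction n; simpl; [ring|]. rewrite IHn; ring. Qed.

Lemma csum_minus (f g : nat -> C) (n : nat) :
  csum (fun i => f i - g i) n = csum f n - csum g n.
Proof. induction n; simpl; [ring|]. rewrite IHn; ring. Qed.

Lemma csum_zero (f : nat -> C) (n : nat) :
  (forall i, (i < n)%nat -> f i = 0) -> csum f n = 0.
Proof.
intros H. rewrite (csum_ext f (fun _ => 0)) by assumption.
clear H. induction n; simpl; [|rewrite IHn]; ring.
Qed.

Lemma csum_Sr (f : nat -> C) (n : nat) : csum f (S n) = csum f n + f n.
Proof. reflexivity. Qed.

Lemma csum_S (f : nat -> C) (n : nat) : csum f (S n) = f 0%nat + csum (fun i => f (S i)) n.
Proof. induction n; simpl in *; [ring|]. rewrite IHn; ring. Qed.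

Lemma csum_switch (f : nat -> nat -> C) (n m : nat) :
  csum (fun i => csum (f i) m) n = csum (fun j => csum (fun i => f i j) n) m.
Proof.
induction n; simpl.
- symmetry; apply csum_zero; reflexivity.
- rewrite IHn, <- csum_plus. reflexivity.
Qed.

Lemma csum_split (f : nat -> C) (n m : nat) :
  csum f (n + m) = csum f n + csum (fun i => f (n + i)%nat) m.
Proof.
induction m. rewrite Nat.add_0_r; simpl; ring.
rewrite Nat.add_succ_r; simpl. rewrite IHm. ring.
Qed.

Lemma csum_rev (f : nat -> C) (n : nat) : csum f n = csum (fun i => f (n - 1 - i)%nat) n.
Proof.
revert f; induction n; intros f; [reflexivity|].
rewrite csum_S. simpl csum at 2. rewrite (IHn (fun i => f (S i))).
rewrite Cplus_comm. f_equal.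
- apply csum_ext; intros; f_equal; lia.
- f_equal; lia.
Qed.

Lemma csum_Cmod (f : nat -> C) (n : nat) : Cmod (csum f n) <= rsum (fun i => Cmod (f i)) n.
Proof.
induction n; simpl; [rewrite Cmod_0; lra|].
apply Rle_trans with (1 := Cmod_triangle _ _). lra.
Qed.

Lemma rsum_le (f g : nat -> R) (n : nat) :
  (forall i, (i < n)%nat -> f i <= g i) -> rsum f n <= rsum g n.
Proof.
induction n; simpl; intros H; [lra|].
apply Rplus_le_compat; [apply IHn|apply H]; auto with arith.
Qed.


Lemma rsum_scal (c : R) (f : nat -> R) (n : nat) :
  (rsum (fun i => c * f i) n = c * rsum f n)%R.
Proof. induction n; simpl; [ring|]. rewrite IHn; ring. Qed.

Lemma rsum_const (c : R) (n : nat) : (rsum (fun _ => c) n = INR n * c)%R.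
Proof. induction n. simpl; ring. rewrite S_INR; simpl; rewrite IHn; ring. Qed.

Lemma rsum_nonneg (f : nat -> R) (n : nat) : (forall i, 0 <= f i) -> 0 <= rsum f n.
Proof. intros H; induction n; simpl; [lra|]. generalize (H n); lra. Qed.

Lemma rsum_geom (r : R) (n : nat) : 0 <= r < 1 -> rsum (fun i => (r ^ i)%R) n <= / (1 - r).
Proof.
intros Hr.
assert (E : (rsum (fun i => r ^ i) n = (1 - r ^ n) / (1 - r))%R).
{ induction n; simpl; [field; lra|]. rewrite IHn; field; lra. }
rewrite E. assert (0 <= r ^ n) by (apply pow_le; lra).
unfold Rdiv. rewrite <- (Rmult_1_l (/ (1 - r))) at 2.
apply Rmult_le_compat_r; [|lra]. left; apply Rinv_0_lt_compat; lra.
Qed.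

Lemma Cmod_csum_le (f : nat -> C) (b : nat -> R) (n : nat) :
  (forall i, (i < n)%nat -> Cmod (f i) <= b i) -> Cmod (csum f n) <= rsum b n.
Proof. intros H. eapply Rle_trans; [apply csum_Cmod|apply rsum_le, H]. Qed.

(** * Limits of complex sequences *)

Definition clim (u : nat -> C) (l : C) : Prop :=
  forall eps : R, 0 < eps -> exists N : nat, forall n, (N <= n)%nat -> Cmod (u n - l) < eps.

Lemma clim_unique (u : nat -> C) (a b : C) : clim u a -> clim u b -> a = b.
Proof.
intros Ha Hb. destruct (Ceq_dec a b) as [|N]; [assumption|exfalso].
assert (P : (0 < Cmod (a - b))%R) by (apply Cmod_gt_0, Cminus_eq_contra, N).
destruct (Ha (Cmod (a - b) / 2)%R) as [n1 H1]. lra.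
destruct (Hb (Cmod (a - b) / 2)%R) as [n2 H2]. lra.
specialize (H1 (n1 + n2)%nat ltac:(lia)). specialize (H2 (n1 + n2)%nat ltac:(lia)).
assert (T := Cmod_tri_minus (a - b) (u (n1 + n2)%nat - b)).
replace (a - b - (u (n1 + n2)%nat - b)) with (- (u (n1 + n2)%nat - a)) in T by ring.
rewrite Cmod_opp in T. lra.
Qed.

Lemma clim_ext (u v : nat -> C) (l : C) : (forall n, u n = v n) -> clim u l -> clim v l.
Proof.
intros E H eps He. destruct (H eps He) as [N HN]. exists N; intros; rewrite <- E; auto.
Qed.

Lemma clim_const (c : C) : clim (fun _ => c) c.
Proof.
intros eps He. exists O. intros. replace (c - c) with (RtoC 0) by ring. rewrite Cmod_0; assumption.
Qed.

Lemma clim_plus (u v : nat -> C) (a b : C) :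
  clim u a -> clim v b -> clim (fun n => u n + v n) (a + b).
Proof.
intros Ha Hb eps He.
destruct (Ha (eps / 2)%R) as [n1 H1]. lra. destruct (Hb (eps / 2)%R) as [n2 H2]. lra.
exists (n1 + n2)%nat. intros n Hn.
specialize (H1 n ltac:(lia)). specialize (H2 n ltac:(lia)).
replace (u n + v n - (a + b)) with ((u n - a) + (v n - b)) by ring.
eapply Rle_lt_trans; [apply Cmod_triangle|lra].
Qed.

Lemma clim_bound_zero (u : nat -> C) (b : nat -> R) (l : C) :
  (forall n, Cmod (u n - l) <= b n) -> is_lim_seq b 0 -> clim u l.
Proof.
intros H Hb eps He. apply is_lim_seq_spec in Hb.
destruct (Hb (mkposreal eps He)) as [N HN]. exists N. intros n Hn.
specialize (HN n Hn). simpl in HN.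
generalize (Rabs_def2 _ _ HN) (H n). lra.
Qed.

Lemma clim_mult (u v : nat -> C) (a b : C) :
  clim u a -> clim v b -> clim (fun n => u n * v n) (a * b).
Proof.
intros Ha Hb eps He.
assert (Pa := Cmod_ge_0 a). assert (Pb := Cmod_ge_0 b).
set (d := Rmin 1 (eps / (2 * (1 + Cmod a + Cmod b)))).
assert (Hd : 0 < eps / (2 * (1 + Cmod a + Cmod b))) by (apply Rdiv_lt_0_compat; lra).
assert (D : 0 < d) by (unfold d; apply Rmin_case; lra).
assert (D1 : d <= 1) by apply Rmin_l.
assert (D2 : d * (1 + Cmod a + Cmod b) <= eps / 2).
{ apply Rle_trans with (eps / (2 * (1 + Cmod a + Cmod b)) * (1 + Cmod a + Cmod b))%R.
  apply Rmult_le_compat_r; [lra|apply Rmin_r]. right; field; lra. }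
destruct (Ha d D) as [n1 H1]. destruct (Hb d D) as [n2 H2].
exists (n1 + n2)%nat. intros n Hn.
specialize (H1 n ltac:(lia)). specialize (H2 n ltac:(lia)).
replace (u n * v n - a * b) with ((u n - a) * (v n - b) + (u n - a) * b + a * (v n - b)) by ring.
eapply Rle_lt_trans; [apply Cmod_triangle|].
eapply Rle_lt_trans; [apply Rplus_le_compat_r, Cmod_triangle|].
rewrite !Cmod_mult.
assert (X := Cmod_ge_0 (u n - a)). assert (Z := Cmod_ge_0 (v n - b)).
nra.
Qed.

Lemma clim_scal (c : C) (u : nat -> C) (a : C) : clim u a -> clim (fun n => c * u n) (c * a).
Proof. intros; apply (clim_mult (fun _ => c)); [apply clim_const|assumption]. Qed.

Lemma clim_subseq (u : nat -> C) (l : C) (k : nat -> nat) :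
  (forall n, (n <= k n)%nat) -> clim u l -> clim (fun n => u (k n)) l.
Proof.
intros Hk H eps He. destruct (H eps He) as [N HN]. exists N. intros n Hn.
apply HN. specialize (Hk n). lia.
Qed.

Lemma clim_Cmod_le (u : nat -> C) (l : C) (B : R) :
  clim u l -> (forall n, Cmod (u n) <= B) -> Cmod l <= B.
Proof.
intros H Hu. apply Rnot_lt_le. intros L.
destruct (H (Cmod l - B)%R) as [N HN]. lra.
specialize (HN N (le_n N)).
assert (T := Cmod_tri_minus l (u N)). rewrite <- Cmod_opp in HN.
replace (- (u N - l)) with (l - u N) in HN by ring. generalize (Hu N). lra.
Qed.

Lemma clim_Re (u : nat -> C) (l : C) : clim u l -> is_lim_seq (fun n => Re (u n)) (Re l).
Proof.
intros H. apply is_lim_seq_spec. intros eps.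
destruct (H eps (cond_pos eps)) as [N HN]. exists N. intros n Hn.
specialize (HN n Hn). eapply Rle_lt_trans; [|exact HN].
replace (Re (u n) - Re l)%R with (Re (u n - l)) by reflexivity. apply re_le_Cmod.
Qed.

Lemma Cmod_Re_Im (z : C) : Cmod z <= Rabs (Re z) + Rabs (Im z).
Proof.
destruct z as [a b]. replace (a, b) with (RtoC a + Ci * RtoC b)
 by (unfold Ci, RtoC, Cplus, Cmult; simpl; f_equal; ring).
eapply Rle_trans; [apply Cmod_triangle|].
rewrite Cmod_mult, !Cmod_R, Cmod_Ci. unfold Re, Im; simpl.
replace (a + (0 * b - 1 * 0))%R with a by ring.
replace (0 + (0 * 0 + 1 * b))%R with b by ring. lra.
Qed.

Lemma clim_components (u : nat -> C) (l : C) :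
  is_lim_seq (fun n => Re (u n)) (Re l) -> is_lim_seq (fun n => Im (u n)) (Im l) -> clim u l.
Proof.
intros H1 H2 eps He. apply is_lim_seq_spec in H1. apply is_lim_seq_spec in H2.
assert (He2 : 0 < eps / 2) by lra.
destruct (H1 (mkposreal _ He2)) as [n1 N1]. destruct (H2 (mkposreal _ He2)) as [n2 N2].
exists (n1 + n2)%nat. intros n Hn.
specialize (N1 n ltac:(lia)). specialize (N2 n ltac:(lia)). simpl in N1, N2.
eapply Rle_lt_trans; [apply Cmod_Re_Im|].
change (Re (u n - l)) with (Re (u n) - Re l)%R. change (Im (u n - l)) with (Im (u n) - Im l)%R.
lra.
Qed.

Lemma Re_csum (f : nat -> C) (n : nat) : Re (csum f n) = rsum (fun i => Re (f i)) n.
Proof. induction n; simpl; [reflexivity|]. rewrite <- IHn. reflexivity. Qed.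

Lemma Im_csum (f : nat -> C) (n : nat) : Im (csum f n) = rsum (fun i => Im (f i)) n.
Proof. induction n; simpl; [reflexivity|]. rewrite <- IHn. reflexivity. Qed.

Lemma sum_n_rsum (f : nat -> R) (n : nat) : sum_n f n = rsum f (S n).
Proof.
induction n. rewrite sum_O; simpl; ring.
rewrite sum_Sn, IHn. reflexivity.
Qed.

Lemma is_series_rsum (f : nat -> R) (l : R) : is_series f l -> is_lim_seq (rsum f) l.
Proof.
intros H. apply is_lim_seq_incr_1. eapply is_lim_seq_ext; [|exact H].
intros n. apply sum_n_rsum.
Qed.

(** [CSeries] is a total function, so its value means something only once convergence is known; a
    summable real majorant supplies it. *)
Lemma CSeries_lim (f : nat -> C) (b : nat -> R) :
  (forall n, Cmod (f n) <= b n) -> ex_series b -> clim (csum f) (CSeries f).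
Proof.
intros H Hb. unfold CSeries. apply clim_components.
- apply is_lim_seq_ext with (rsum (fun n => Re (f n))).
  intros; symmetry; apply Re_csum.
  apply is_series_rsum, Series_correct. apply (ex_series_le (V := R_CompleteNormedModule) _ b); [|exact Hb].
  intros n. eapply Rle_trans; [apply re_le_Cmod|apply H].
- apply is_lim_seq_ext with (rsum (fun n => Im (f n))).
  intros; symmetry; apply Im_csum.
  apply is_series_rsum, Series_correct. apply (ex_series_le (V := R_CompleteNormedModule) _ b); [|exact Hb].
  intros n. eapply Rle_trans; [|apply H].
  eapply Rle_trans; [apply Rmax_r|apply Rmax_Cmod].
Qed.

Lemma ex_series_geom_scal (M r : R) : 0 <= r < 1 -> ex_series (fun n => M * r ^ n)%R.
Proof.
intros Hr. apply (ex_series_scal (V := R_NormedModule)), ex_series_geom. rewrite Rabs_pos_eq; lra.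
Qed.

(** Induction on [k] with [s = sqrt r]: of the two factors [s ^ n], one absorbs the power [k] and
    the other, by Bernoulli's inequality, one more factor [n + 1]. *)
Lemma poly_geom (k : nat) : forall r : R, 0 < r < 1 ->
  exists M : R, 0 <= M /\ forall n : nat, (INR n + 1) ^ k * r ^ n <= M.
Proof.
induction k; intros r Hr.
- exists 1%R. split; [lra|]. intros n. simpl. rewrite Rmult_1_l.
  rewrite <- (pow1 n). apply pow_incr; lra.
- set (s := sqrt r).
  assert (Hs : (s * s)%R = r) by (apply sqrt_sqrt; lra).
  assert (S1 : 0 < s) by (apply sqrt_lt_R0; lra).
  assert (S2 : s < 1) by nra.
  destruct (IHk s ltac:(lra)) as [M [HM IH]].
  set (x := (/ s - 1)%R).
  assert (Hx : 0 < x). { unfold x. assert (/ 1 < / s) by (apply Rinv_lt_contravar; nra). rewrite Rinv_1 in *; lra. }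
  assert (B : forall n, (INR n + 1) * s ^ n <= 1 + / x).
  { intros n.
    assert (P := Rpow_mult_distr (1 + x) s n).
    replace ((1 + x) * s)%R with 1%R in P by (unfold x; field; lra). rewrite pow1 in P.
    assert (Q : 1 + INR n * x <= (1 + x) ^ n) by (apply poly; assumption).
    assert (0 < s ^ n) by (apply pow_lt; assumption).
    assert (s ^ n <= 1) by (rewrite <- (pow1 n); apply pow_incr; lra).
    assert (INR n * x * s ^ n <= 1) by nra.
    assert (INR n * s ^ n <= / x).
    { apply Rmult_le_reg_r with x; [assumption|]. rewrite Rinv_l by lra. nra. }
    lra. }
  exists (M * (1 + / x))%R. split.
  { apply Rmult_le_pos; [assumption|]. assert (0 < / x) by (apply Rinv_0_lt_compat; assumption). lra. }
  intros n. rewrite <- Hs, Rpow_mult_distr. simpl.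
  replace ((INR n + 1) * (INR n + 1) ^ k * (s ^ n * s ^ n))%R with
    (((INR n + 1) ^ k * s ^ n) * ((INR n + 1) * s ^ n))%R by ring.
  assert (0 <= INR n) by apply pos_INR.
  assert (0 < s ^ n) by (apply pow_lt; assumption).
  apply Rmult_le_compat; try auto.
  + apply Rmult_le_pos; [apply pow_le|]; lra.
  + apply Rmult_le_pos; lra.
Qed.

(** Says that the power series with coefficients [a] has radius of convergence at least 1, hence
    that the Fourier series converges on the whole upper half-plane. *)
Definition subexp (a : nat -> C) : Prop :=
  forall r : R, 0 < r < 1 -> exists M : R, forall n : nat, Cmod (a n) * r ^ n <= M.

(** Boundedness at the larger radius [(1 + s) / 2] becomes geometric decay at [s]. *)
Lemma subexp_geom (a : nat -> C) (s : R) : subexp a -> 0 < s < 1 ->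
  exists M r : R, 0 <= M /\ 0 < r < 1 /\ forall n, Cmod (a n) * s ^ n <= M * r ^ n.
Proof.
intros H Hs. destruct (H ((1 + s) / 2)%R ltac:(lra)) as [M HM].
set (t := ((1 + s) / 2)%R) in *.
assert (Ht : s < t < 1) by (unfold t; lra).
exists M, (s / t)%R. split; [|split].
- specialize (HM O). simpl in HM. generalize (Cmod_ge_0 (a O)). lra.
- split. apply Rdiv_lt_0_compat; lra. apply Rlt_div_l; lra.
- intros n.
  assert (E : (s ^ n = t ^ n * (s / t) ^ n)%R).
  { rewrite <- Rpow_mult_distr. f_equal. field; lra. }
  rewrite E, <- Rmult_assoc. apply Rmult_le_compat_r; [|apply HM].
  apply pow_le. left; apply Rdiv_lt_0_compat; lra.
Qed.

Lemma subexp_poly (a b : nat -> C) (K : R) (k : nat) :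
  subexp a -> (forall n, Cmod (b n) <= K * (INR n + 1) ^ k * Cmod (a n)) -> subexp b.
Proof.
intros Ha H r Hr.
destruct (subexp_geom a r Ha Hr) as [M [t [HM [Ht B]]]].
destruct (poly_geom k t Ht) as [L [HL BL]].
assert (K0 : 0 <= Rabs K) by apply Rabs_pos.
exists (Rabs K * L * M)%R. intros n.
assert (0 <= r ^ n) by (apply pow_le; lra).
assert (0 <= INR n) by apply pos_INR.
assert (0 <= (INR n + 1) ^ k) by (apply pow_le; lra).
assert (P := Cmod_ge_0 (a n)).
apply Rle_trans with (Rabs K * (INR n + 1) ^ k * Cmod (a n) * r ^ n)%R.
{ apply Rmult_le_compat_r; [assumption|]. eapply Rle_trans; [apply H|].
  apply Rmult_le_compat_r; [assumption|]. apply Rmult_le_compat_r; [assumption|]. apply Rle_abs. }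
replace (Rabs K * (INR n + 1) ^ k * Cmod (a n) * r ^ n)%R with
  (Rabs K * (INR n + 1) ^ k * (Cmod (a n) * r ^ n))%R by ring.
apply Rle_trans with (Rabs K * (INR n + 1) ^ k * (M * t ^ n))%R.
{ apply Rmult_le_compat_l; [apply Rmult_le_pos; assumption|apply B]. }
replace (Rabs K * (INR n + 1) ^ k * (M * t ^ n))%R with (Rabs K * ((INR n + 1) ^ k * t ^ n) * M)%R by ring.
apply Rmult_le_compat_r; [assumption|]. apply Rmult_le_compat_l; [assumption|apply BL].
Qed.

Lemma subexp_bound (b : nat -> C) (K : R) (k : nat) :
  (forall n, Cmod (b n) <= K * (INR n + 1) ^ k) -> subexp b.
Proof.
intros H. apply (subexp_poly (fun _ => 1) b K k).
- intros r Hr. exists 1%R. intros n. rewrite Cmod_1, Rmult_1_l, <- (pow1 n). apply pow_incr; lra.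
- intros n. rewrite Cmod_1, Rmult_1_r. apply H.
Qed.

Lemma subexp_scal (c : C) (a : nat -> C) : subexp a -> subexp (fun n => c * a n).
Proof.
intros H. apply (subexp_poly a _ (Cmod c) 0 H). intros n. rewrite Cmod_mult. simpl. right; ring.
Qed.

Lemma subexp_plus (a b : nat -> C) : subexp a -> subexp b -> subexp (fun n => a n + b n).
Proof.
intros Ha Hb r Hr. destruct (Ha r Hr) as [M HM]. destruct (Hb r Hr) as [L HL].
exists (M + L)%R. intros n. specialize (HM n). specialize (HL n).
assert (0 <= r ^ n) by (apply pow_le; lra).
apply Rle_trans with ((Cmod (a n) + Cmod (b n)) * r ^ n)%R; [|lra].
apply Rmult_le_compat_r; [assumption|apply Cmod_triangle].
Qed.

Lemma subexp_S (a : nat -> C) : subexp a -> subexp (fun n => a (S n)).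
Proof.
intros H r Hr. destruct (H r Hr) as [M HM]. exists (M / r)%R. intros n.
apply Rmult_le_reg_r with r; [lra|]. replace (M / r * r)%R with M by (field; lra).
replace (Cmod (a (S n)) * r ^ n * r)%R with (Cmod (a (S n)) * r ^ (S n))%R by (simpl; ring). apply HM.
Qed.

Definition cauchy_prod (a b : nat -> C) (n : nat) : C := csum (fun i => a i * b (n - i)%nat) (S n).

Lemma subexp_cauchy_prod (a b : nat -> C) : subexp a -> subexp b -> subexp (cauchy_prod a b).
Proof.
intros Ha Hb r Hr.
destruct (subexp_geom a r Ha Hr) as [M [s [HM [Hs Ba]]]].
destruct (subexp_geom b r Hb Hr) as [L [t [HL [Ht Bb]]]].
set (m := Rmax s t).
assert (Hm : 0 < m < 1) by (unfold m; apply Rmax_case; assumption).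
destruct (poly_geom 1 m Hm) as [K [HK BK]].
exists (M * L * K)%R. intros n.
assert (Pr : forall i, 0 < r ^ i) by (intros; apply pow_lt; lra).
assert (Pm : forall i, 0 < m ^ i) by (intros; apply pow_lt; lra).
apply Rle_trans with (rsum (fun _ => M * L * m ^ n) (S n) )%R.
2: { rewrite rsum_const, S_INR. specialize (BK n). simpl in BK. rewrite Rmult_1_r in BK.
  replace ((INR n + 1) * (M * L * m ^ n))%R with (M * L * ((INR n + 1) * m ^ n))%R by ring.
  apply Rmult_le_compat_l; [|assumption]. apply Rmult_le_pos; assumption. }
assert (E : (Cmod (cauchy_prod a b n) * r ^ n)%R = Cmod (csum (fun i => RtoC (r ^ n) * (a i * b (n - i)%nat)) (S n))).
{ rewrite csum_scal, Cmod_mult, Cmod_R, Rabs_pos_eq by (left; apply Pr). rewrite Rmult_comm. reflexivity. }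
rewrite E. apply Cmod_csum_le. intros i Hi.
rewrite !Cmod_mult, Cmod_R, Rabs_pos_eq by (left; apply Pr).
assert (F : (r ^ n = r ^ i * r ^ (n - i))%R) by (rewrite <- pow_add; f_equal; lia).
assert (G : (m ^ n = m ^ i * m ^ (n - i))%R) by (rewrite <- pow_add; f_equal; lia).
rewrite F, G.
replace (r ^ i * r ^ (n - i) * (Cmod (a i) * Cmod (b (n - i)%nat)))%R with
 ((Cmod (a i) * r ^ i) * (Cmod (b (n - i)%nat) * r ^ (n - i)))%R by ring.
replace (M * L * (m ^ i * m ^ (n - i)))%R with ((M * m ^ i) * (L * m ^ (n - i)))%R by ring.
assert (Q : forall u i, 0 < u <= m -> u ^ i <= m ^ i) by (intros; apply pow_incr; lra).
assert (Sm : s <= m) by apply Rmax_l. assert (Tm : t <= m) by apply Rmax_r.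
apply Rmult_le_compat.
- apply Rmult_le_pos; [apply Cmod_ge_0|left; apply Pr].
- apply Rmult_le_pos; [apply Cmod_ge_0|left; apply Pr].
- eapply Rle_trans; [apply Ba|]. apply Rmult_le_compat_l; [assumption|apply Q; lra].
- eapply Rle_trans; [apply Bb|]. apply Rmult_le_compat_l; [assumption|apply Q; lra].
Qed.

(** * Sums of power series, their products and derivatives *)

Definition psum (a : nat -> C) (z : C) : C := CSeries (fun n => a n * z ^ n).

Lemma subexp_term (a : nat -> C) (s : R) : subexp a -> s < 1 ->
  exists M r : R, 0 <= M /\ 0 < r < 1 /\
   forall z, Cmod z <= s -> forall n, Cmod (a n * z ^ n) <= M * r ^ n.
Proof.
intros H Hs. set (t := Rmax s (1/2)).
assert (Ht : 0 < t < 1) by (unfold t; split; [apply Rlt_le_trans with (1/2)%R; [lra|apply Rmax_r]|apply Rmax_case; lra]).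
destruct (subexp_geom a t H Ht) as [M [r [HM [Hr B]]]].
exists M, r. split; [assumption|split; [assumption|]].
intros z Hz n. rewrite Cmod_mult, Cmod_pow. eapply Rle_trans; [|apply B].
apply Rmult_le_compat_l; [apply Cmod_ge_0|]. apply pow_incr. split; [apply Cmod_ge_0|].
apply Rle_trans with s; [assumption|apply Rmax_l].
Qed.

Lemma psum_lim (a : nat -> C) (z : C) : subexp a -> Cmod z < 1 ->
  clim (csum (fun n => a n * z ^ n)) (psum a z).
Proof.
intros H Hz. destruct (subexp_term a _ H Hz) as [M [r [HM [Hr B]]]].
apply (CSeries_lim _ (fun n => M * r ^ n)%R).
intros n; apply B; lra. apply ex_series_geom_scal; lra.
Qed.

Lemma psum_eq (a : nat -> C) (z l : C) : subexp a -> Cmod z < 1 ->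
  clim (csum (fun n => a n * z ^ n)) l -> psum a z = l.
Proof. intros H Hz Hl. apply (clim_unique _ _ _ (psum_lim a z H Hz) Hl). Qed.

Lemma psum_ext (a b : nat -> C) (z : C) : (forall n, a n = b n) -> psum a z = psum b z.
Proof.
intros E. unfold psum, CSeries. f_equal; apply Series_ext; intros n; rewrite E; reflexivity.
Qed.

Lemma psum_plus (a b : nat -> C) (z : C) : subexp a -> subexp b -> Cmod z < 1 ->
  psum (fun n => a n + b n) z = psum a z + psum b z.
Proof.
intros Ha Hb Hz. apply psum_eq; [apply subexp_plus|..]; try assumption.
eapply clim_ext; [|apply clim_plus; [exact (psum_lim a z Ha Hz)|exact (psum_lim b z Hb Hz)]].
intros n; cbv beta. rewrite <- csum_plus. apply csum_ext; intros; ring.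
Qed.

Lemma psum_scal (c : C) (a : nat -> C) (z : C) : subexp a -> Cmod z < 1 ->
  psum (fun n => c * a n) z = c * psum a z.
Proof.
intros Ha Hz. apply psum_eq; [apply subexp_scal|..]; try assumption.
eapply clim_ext; [|apply clim_scal; exact (psum_lim a z Ha Hz)].
intros n; cbv beta. rewrite <- csum_scal. apply csum_ext; intros; ring.
Qed.

Lemma psum_bound (a : nat -> C) (z : C) (b : nat -> R) (B : R) : subexp a -> Cmod z < 1 ->
  (forall n, Cmod (a n * z ^ n) <= b n) -> (forall n, rsum b n <= B) -> Cmod (psum a z) <= B.
Proof.
intros Ha Hz H HB. apply (clim_Cmod_le _ _ _ (psum_lim a z Ha Hz)).
intros n. eapply Rle_trans; [apply Cmod_csum_le; intros; apply H|apply HB].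
Qed.

Lemma psum_S (a : nat -> C) (z : C) : subexp a -> Cmod z < 1 ->
  psum a z = a O + z * psum (fun n => a (S n)) z.
Proof.
intros Ha Hz.
assert (H := psum_lim a z Ha Hz).
apply (clim_unique (fun n => csum (fun n => a n * z ^ n) (S n))).
- apply (clim_subseq _ _ S); [intros; lia|assumption].
- eapply clim_ext; [|apply clim_plus; [apply (clim_const (a O))|apply (clim_scal z); exact (psum_lim _ z (subexp_S a Ha) Hz)]].
  intros n; cbv beta. rewrite csum_S, <- csum_scal. simpl Cpow.
  f_equal; [ring|]. apply csum_ext; intros; ring.
Qed.

Lemma csum_cauchy_prod (a b : nat -> C) (z : C) (n : nat) :
  csum (fun k => cauchy_prod a b k * z ^ k) n =
  csum (fun i => csum (fun j => (a i * z ^ i) * (b j * z ^ j)) (n - i)) n.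
Proof.
induction n; [reflexivity|].
rewrite !(csum_Sr _ n), IHn. rewrite Nat.sub_succ_l by lia. rewrite Nat.sub_diag.
assert (E : csum (fun i => csum (fun j => a i * z ^ i * (b j * z ^ j)) (S n - i)) n =
  csum (fun i => csum (fun j => a i * z ^ i * (b j * z ^ j)) (n - i)) n +
  csum (fun i => a i * b (n - i)%nat * z ^ n) n).
{ rewrite <- csum_plus. apply csum_ext. intros i Hi.
  rewrite Nat.sub_succ_l by lia. simpl. f_equal.
  replace (z ^ n) with (z ^ i * z ^ (n - i)) by (rewrite <- Cpow_add_r; f_equal; lia). ring. }
unfold cauchy_prod. rewrite E, csum_Sr, Nat.sub_diag.
rewrite (csum_ext (fun i => a i * b (n - i)%nat * z ^ n) (fun i => z ^ n * (a i * b (n - i)%nat))) by (intros; ring).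
rewrite csum_scal. simpl. ring.
Qed.

Lemma psum_cauchy_prod (a b : nat -> C) (z : C) : subexp a -> subexp b -> Cmod z < 1 ->
  psum (cauchy_prod a b) z = psum a z * psum b z.
Proof.
intros Ha Hb Hz. apply psum_eq; [apply subexp_cauchy_prod|..]; try assumption.
assert (H := clim_mult _ _ _ _ (psum_lim a z Ha Hz) (psum_lim b z Hb Hz)).
destruct (subexp_term a _ Ha Hz) as [M [s [HM [Hs Ba]]]].
destruct (subexp_term b _ Hb Hz) as [L [t [HL [Ht Bb]]]].
set (m := Rmax s t).
assert (Hm : 0 < m < 1) by (unfold m; apply Rmax_case; assumption).
assert (Pm : forall i, 0 < m ^ i) by (intros; apply pow_lt; lra).
assert (Q : forall u i, 0 < u <= m -> u ^ i <= m ^ i) by (intros; apply pow_incr; lra).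
assert (Sm : s <= m) by apply Rmax_l. assert (Tm : t <= m) by apply Rmax_r.
(* Minus the products of terms with indices below [n] whose sum is at least [n]: at most [n^2] of
   them, each bounded by [M L m^n]. *)
set (d := fun n => csum (fun k => cauchy_prod a b k * z ^ k) n -
   csum (fun k => a k * z ^ k) n * csum (fun k => b k * z ^ k) n).
assert (D : forall n, Cmod (d n) <= M * L * (INR n * (INR n * m ^ n))).
{ intros n.
  assert (E : d n = - csum (fun i => csum (fun j => (a i * z ^ i) * (b (n - i + j)%nat * z ^ (n - i + j))) i) n).
  { unfold d. rewrite csum_cauchy_prod.
    rewrite (Cmult_comm (csum (fun k => a k * z ^ k) n)), <- csum_scal.
    replace (- csum (fun i => csum (fun j => (a i * z ^ i) * (b (n - i + j)%nat * z ^ (n - i + j))) i) n)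
     with (- (1) * csum (fun i => csum (fun j => (a i * z ^ i) * (b (n - i + j)%nat * z ^ (n - i + j))) i) n) by ring.
    rewrite <- csum_scal.
    match goal with |- ?x - ?y = _ => replace (x - y) with (x + - (1) * y) by ring end.
    rewrite <- csum_scal, <- csum_plus.
    apply csum_ext. intros i Hi.
    rewrite !csum_scal.
    replace (csum (fun k => b k * z ^ k) n) with (csum (fun k => b k * z ^ k) (n - i + i)) by (f_equal; lia).
    rewrite csum_split. ring. }
  rewrite E, Cmod_opp.
  apply Rle_trans with (rsum (fun _ => INR n * (M * L * m ^ n)) n)%R.
  2: rewrite rsum_const; right; ring.
  apply Cmod_csum_le. intros i Hi.
  apply Rle_trans with (rsum (fun _ => M * L * m ^ n) i)%R.
  2: { rewrite rsum_const. apply Rmult_le_compat_r.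
    apply Rmult_le_pos; [apply Rmult_le_pos; assumption|left; apply Pm].
    apply le_INR; lia. }
  apply Cmod_csum_le. intros j Hj. rewrite Cmod_mult.
  apply Rle_trans with ((M * m ^ i) * (L * m ^ (n - i + j)))%R.
  - apply Rmult_le_compat; try apply Cmod_ge_0.
    + eapply Rle_trans; [apply Ba; lra|]. apply Rmult_le_compat_l; [assumption|apply Q; lra].
    + eapply Rle_trans; [apply Bb; lra|]. apply Rmult_le_compat_l; [assumption|apply Q; lra].
  - replace (M * m ^ i * (L * m ^ (n - i + j)))%R with (M * L * (m ^ i * m ^ (n - i + j)))%R by ring.
    apply Rmult_le_compat_l; [apply Rmult_le_pos; assumption|].
    rewrite <- pow_add. replace (i + (n - i + j))%nat with (n + j)%nat by lia.
    rewrite pow_add. rewrite <- (Rmult_1_r (m ^ n)) at 2. apply Rmult_le_compat_l; [left; apply Pm|].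
    rewrite <- (pow1 j). apply pow_incr; lra. }
assert (Dl : clim d 0).
{ apply (clim_bound_zero d (fun n => M * L * (INR n * (INR n * m ^ n)))%R).
  intros n. replace (d n - 0) with (d n) by ring. apply D.
  set (w := sqrt m).
  assert (Hw : (w * w)%R = m) by (apply sqrt_sqrt; lra).
  assert (W1 : 0 < w) by (apply sqrt_lt_R0; lra).
  assert (W2 : w < 1) by nra.
  destruct (poly_geom 2 w ltac:(lra)) as [K [HK BK]].
  apply (is_lim_seq_le_le (fun _ => 0%R) _ (fun n => M * L * K * w ^ n)%R).
  - intros n. assert (0 <= INR n) by apply pos_INR.
    assert (0 < w ^ n) by (apply pow_lt; lra).
    split.
    + repeat apply Rmult_le_pos; try assumption. left; apply Pm.
    + rewrite <- Hw, Rpow_mult_distr. specialize (BK n). simpl in BK.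
      replace (M * L * (INR n * (INR n * (w ^ n * w ^ n))))%R with (M * L * ((INR n * INR n * w ^ n) * w ^ n))%R by ring.
      rewrite (Rmult_assoc (M * L)). apply Rmult_le_compat_l; [apply Rmult_le_pos; assumption|].
      apply Rmult_le_compat_r; [lra|]. eapply Rle_trans; [|exact BK].
      apply Rmult_le_compat_r; [lra|nra].
  - apply is_lim_seq_const.
  - replace (Finite 0) with (Rbar_mult (M * L * K)%R 0%R) by (simpl; f_equal; ring).
    apply is_lim_seq_scal_l, is_lim_seq_geom. rewrite Rabs_pos_eq; lra. }
replace (psum a z * psum b z) with (0 + psum a z * psum b z) by ring.
eapply clim_ext; [|apply clim_plus; [exact Dl|exact H]].
intros n; unfold d; cbv beta; ring.
Qed.

Definition pder (a : nat -> C) (n : nat) : C := RtoC (INR (S n)) * a (S n).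

Lemma subexp_pder (a : nat -> C) : subexp a -> subexp (pder a).
Proof.
intros H. apply subexp_S in H. apply (subexp_poly _ _ 1%R 1 H). intros n. unfold pder.
rewrite Cmod_mult, Cmod_R, S_INR. assert (0 <= INR n) by apply pos_INR.
rewrite Rabs_pos_eq by lra. simpl. right; ring.
Qed.

(** The remainder of second order is at most [n^2 |h|^2 s^(n-2)]; both sides are multiplied by [s^2]
    so that no exponent [n - 2] has to be formed for [n < 2]. *)
Lemma pow_taylor_bound (z h : C) (s : R) (n : nat) : 0 < s -> Cmod z <= s -> Cmod (z + h) <= s ->
  s * s * Cmod ((z + h) ^ n - z ^ n - h * (RtoC (INR n) * z ^ (n - 1))) <= (INR n) ^ 2 * (Cmod h) ^ 2 * s ^ n.
Proof.
intros Hs Hz Hzh. induction n.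
- simpl. replace (1 - 1 - h * (0 * 1)) with (RtoC 0) by ring. rewrite Cmod_0. simpl; lra.
- assert (E : (z + h) ^ S n - z ^ S n - h * (RtoC (INR (S n)) * z ^ (S n - 1)) =
    (z + h) * ((z + h) ^ n - z ^ n - h * (RtoC (INR n) * z ^ (n - 1))) + RtoC (INR n) * (h * h) * z ^ (n - 1)).
  { rewrite S_INR, RtoC_plus. replace (S n - 1)%nat with n by lia.
    destruct n. simpl; ring. replace (S n - 1)%nat with n by lia. simpl Cpow. ring. }
  rewrite E. clear E.
  set (e := (z + h) ^ n - z ^ n - h * (RtoC (INR n) * z ^ (n - 1))) in *.
  assert (P0 := pos_INR n). assert (P1 := Cmod_ge_0 h). assert (P2 := Cmod_ge_0 e).
  assert (P3 : 0 < s ^ n) by (apply pow_lt; assumption).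
  assert (T : Cmod ((z + h) * e + RtoC (INR n) * (h * h) * z ^ (n - 1)) <= s * Cmod e + INR n * (Cmod h * Cmod h) * s ^ (n - 1)).
  { eapply Rle_trans; [apply Cmod_triangle|]. rewrite !Cmod_mult, Cmod_pow, Cmod_R, Rabs_pos_eq by assumption.
    apply Rplus_le_compat. apply Rmult_le_compat_r; assumption.
    apply Rmult_le_compat_l. { apply Rmult_le_pos; [assumption|apply Rmult_le_pos; assumption]. }
    apply pow_incr; split; [apply Cmod_ge_0|assumption]. }
  assert (F : INR n * (s * s * s ^ (n - 1)) <= INR n * (s * s ^ n)).
  { destruct n. simpl; lra. replace (S n - 1)%nat with n by lia. simpl pow. right; ring. }
  rewrite S_INR. simpl pow in *.
  apply Rle_trans with (s * s * (s * Cmod e + INR n * (Cmod h * Cmod h) * s ^ (n - 1)))%R.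
  { apply Rmult_le_compat_l; [nra|assumption]. }
  set (H2 := (Cmod h * Cmod h)%R) in *.
  assert (PH : 0 <= H2) by (unfold H2; nra).
  assert (s * (s * s * Cmod e) <= s * (INR n * (INR n * 1) * (Cmod h * (Cmod h * 1)) * s ^ n)) by (apply Rmult_le_compat_l; lra).
  assert (H2 * (INR n * (s * s * s ^ (n - 1))) <= H2 * (INR n * (s * s ^ n))) by (apply Rmult_le_compat_l; assumption).
  replace (Cmod h * (Cmod h * 1))%R with H2 in * by (unfold H2; ring).
  assert (0 <= INR n * (H2 * (s * s ^ n))) by (repeat apply Rmult_le_pos; lra).
  assert (0 <= H2 * (s * s ^ n)) by (repeat apply Rmult_le_pos; lra).
  nra.
Qed.

(** Termwise differentiation: at a radius [s] between [|z|] and 1 the remainders of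
    [pow_taylor_bound] add up to at most [K |h|^2], with [K] obtained from the geometric decay of
    [n^2 a_n s^n]. *)
Lemma psum_cder (a : nat -> C) (z : C) : subexp a -> Cmod z < 1 -> cder (psum a) z (psum (pder a) z).
Proof.
intros Ha Hz. rewrite cder_eps.
set (s := ((1 + Cmod z) / 2)%R). assert (P := Cmod_ge_0 z).
assert (Hs : Cmod z < s < 1 /\ 0 < s) by (unfold s; lra).
set (b := fun n => RtoC ((INR n) ^ 2) * a n).
assert (Hb : subexp b).
{ apply (subexp_poly a b 1%R 2 Ha). intros n. unfold b. rewrite Cmod_mult, Cmod_R.
  assert (0 <= INR n) by apply pos_INR. rewrite Rabs_pos_eq by (apply pow_le; assumption).
  apply Rmult_le_compat_r; [apply Cmod_ge_0|]. rewrite Rmult_1_l. apply pow_incr; lra. }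
destruct (subexp_geom b s Hb ltac:(lra)) as [M [r [HM [Hr B]]]].
set (K := (M / (1 - r) / (s * s))%R).
assert (HK : 0 <= K).
{ unfold K. apply Rle_div_r; [nra|]. rewrite Rmult_0_l. apply Rle_div_r; lra. }
intros eps Heps.
set (d := Rmin (s - Cmod z) (eps / (1 + K))).
assert (Hp : 0 < eps / (1 + K)) by (apply Rdiv_lt_0_compat; lra).
exists d. split. { unfold d; apply Rmin_case; lra. }
intros h Hh.
assert (L1 : d <= s - Cmod z) by apply Rmin_l. assert (L2 : d <= eps / (1 + K)) by apply Rmin_r.
assert (P1 := Cmod_ge_0 h).
assert (Hzh : Cmod (z + h) <= s).
{ eapply Rle_trans; [apply Cmod_triangle|]. lra. }
assert (L : clim (csum (fun n => a n * ((z + h) ^ n - z ^ n - h * (RtoC (INR n) * z ^ (n - 1)))))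
   (psum a (z + h) - psum a z - h * psum (pder a) z)).
{ assert (Hpd : clim (csum (fun n => a n * (RtoC (INR n) * z ^ (n - 1)))) (psum (pder a) z)).
  { intros e He. destruct (psum_lim _ z (subexp_pder a Ha) Hz e He) as [N HN].
    exists (S N). intros n Hn. destruct n; [lia|].
    rewrite csum_S. simpl INR at 1.
    replace (a O * (RtoC 0 * z ^ (0 - 1))) with (RtoC 0) by ring. rewrite Cplus_0_l.
    rewrite (csum_ext _ (fun k => pder a k * z ^ k)).
    2: { intros i Hi. unfold pder. replace (S i - 1)%nat with i by lia. ring. }
    apply HN. lia. }
  assert (A1 := psum_lim a (z + h) Ha ltac:(lra)). assert (A2 := psum_lim a z Ha Hz).
  replace (psum a (z + h) - psum a z - h * psum (pder a) z) with
    (psum a (z + h) + (- (1) * psum a z + (- h) * psum (pder a) z)) by ring.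
  eapply clim_ext; [|apply clim_plus; [exact A1|apply clim_plus; [apply (clim_scal (- (1))); exact A2|apply (clim_scal (- h)); exact Hpd]]].
  intros n; cbv beta. rewrite <- !csum_scal, <- !csum_plus. apply csum_ext; intros; ring. }
assert (Bd : Cmod (psum a (z + h) - psum a z - h * psum (pder a) z) <= K * (Cmod h) ^ 2).
{ apply (clim_Cmod_le _ _ _ L). intros n.
  apply Rle_trans with (rsum (fun n => (Cmod h ^ 2 / (s * s) * M) * r ^ n) n)%R.
  - apply Cmod_csum_le. intros i _. rewrite Cmod_mult.
    assert (T := pow_taylor_bound z h s i ltac:(lra) ltac:(lra) Hzh).
    set (e := Cmod ((z + h) ^ i - z ^ i - h * (RtoC (INR i) * z ^ (i - 1)))) in *.
    specialize (B i). unfold b in B. rewrite Cmod_mult, Cmod_R, Rabs_pos_eq in B by (apply pow_le, pos_INR).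
    assert (A0 := Cmod_ge_0 (a i)).
    apply Rmult_le_reg_r with (s * s)%R; [nra|].
    replace (Cmod h ^ 2 / (s * s) * M * r ^ i * (s * s))%R with (Cmod h ^ 2 * (M * r ^ i))%R by (field; lra).
    replace (Cmod (a i) * e * (s * s))%R with (Cmod (a i) * (s * s * e))%R by ring.
    apply Rle_trans with (Cmod (a i) * (INR i ^ 2 * Cmod h ^ 2 * s ^ i))%R.
    { apply Rmult_le_compat_l; assumption. }
    replace (Cmod (a i) * (INR i ^ 2 * Cmod h ^ 2 * s ^ i))%R with (Cmod h ^ 2 * (INR i ^ 2 * Cmod (a i) * s ^ i))%R by ring.
    apply Rmult_le_compat_l; [apply pow_le; assumption|assumption].
  - rewrite rsum_scal. unfold K.
    assert (G := rsum_geom r n ltac:(lra)).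
    replace (M / (1 - r) / (s * s) * Cmod h ^ 2)%R with (Cmod h ^ 2 / (s * s) * M * / (1 - r))%R by (field; lra).
    apply Rmult_le_compat_l; [|assumption]. apply Rmult_le_pos; [|assumption].
    apply Rle_div_r; [nra|]. rewrite Rmult_0_l. apply pow_le; assumption. }
eapply Rle_trans; [exact Bd|].
assert (K * Cmod h <= eps).
{ apply Rle_trans with ((1 + K) * (eps / (1 + K)))%R; [|right; field; lra].
  apply Rmult_le_compat; lra. }
simpl. nra.
Qed.

(** * The exponential and the nome *)

Lemma Rabs_sin_le (x : R) : Rabs (sin x) <= Rabs x.
Proof.
assert (K : forall x, 0 < x -> Rabs (sin x) <= x).
{ intros y Hy. apply Rabs_le. split; [|left; apply sin_lt_x; assumption].
  destruct (Rle_lt_dec y PI).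
  - assert (0 <= sin y) by (apply sin_ge_0; lra). lra.
  - generalize (SIN_bound y), PI2_3_2. unfold PI2. lra. }
destruct (Rtotal_order x 0) as [H|[H|H]].
- rewrite <- (Rabs_Ropp (sin x)), <- sin_neg, <- (Rabs_Ropp x), (Rabs_pos_eq (- x)) by lra.
  apply K; lra.
- subst. rewrite sin_0. lra.
- rewrite (Rabs_pos_eq x) by lra. apply K; lra.
Qed.

Lemma Rabs_cos_sub (x : R) : Rabs (1 - cos x) <= x * x / 2.
Proof.
assert (E : cos x = (1 - 2 * sin (x / 2) * sin (x / 2))%R).
{ rewrite <- cos_2a_sin. f_equal; field. }
rewrite E. assert (S := Rabs_sin_le (x / 2)).
replace (1 - (1 - 2 * sin (x / 2) * sin (x / 2)))%R with (2 * (sin (x / 2) * sin (x / 2)))%R by ring.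
assert (T : (sin (x / 2) * sin (x / 2) = Rabs (sin (x / 2)) * Rabs (sin (x / 2)))%R).
{ rewrite <- Rabs_mult, Rabs_pos_eq by nra. reflexivity. }
rewrite Rabs_pos_eq by nra. rewrite T.
assert (U : (Rabs (x / 2) * Rabs (x / 2) = x / 2 * (x / 2))%R).
{ rewrite <- Rabs_mult, Rabs_pos_eq by nra. reflexivity. }
assert (0 <= Rabs (sin (x / 2))) by apply Rabs_pos. nra.
Qed.

Lemma Rabs_sin_sub (x : R) : Rabs (sin x - x) <= Rabs x * (x * x / 2).
Proof.
assert (K : forall x, 0 < x -> Rabs (sin x - x) <= x * (x * x / 2)).
{ intros y Hy. destruct (MVT_cor2 sin cos 0 y Hy) as [c [E Hc]].
  { intros; apply derivable_pt_lim_sin. }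
  rewrite sin_0, !Rminus_0_r in E. rewrite E.
  replace (cos c * y - y)%R with (- (y * (1 - cos c)))%R by ring.
  rewrite Rabs_Ropp, Rabs_mult, (Rabs_pos_eq y) by lra.
  apply Rmult_le_compat_l; [lra|]. generalize (Rabs_cos_sub c). nra. }
destruct (Rtotal_order x 0) as [H|[H|H]].
- rewrite <- (Rabs_Ropp x), (Rabs_pos_eq (- x)) by lra.
  replace (sin x - x)%R with (- (sin (- x) - - x))%R by (rewrite sin_neg; ring).
  rewrite Rabs_Ropp. replace (x * x)%R with (- x * - x)%R by ring. apply K; lra.
- subst. rewrite sin_0, Rminus_0_r, Rabs_R0. lra.
- rewrite (Rabs_pos_eq x) by lra. apply K; lra.
Qed.

Lemma Rabs_exp_sub (x : R) : Rabs x <= 1 / 2 -> Rabs (exp x - 1 - x) <= 2 * (x * x).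
Proof.
intros H. assert (H' := Rabs_le_between x (1/2)). destruct H' as [H' _]. specialize (H' H).
assert (L := exp_ineq1_le x). assert (L' := exp_ineq1_le (- x)).
rewrite exp_Ropp in L'.
assert (P := exp_pos x).
rewrite Rabs_pos_eq by lra.
assert (exp x * (1 - x) <= 1).
{ apply Rmult_le_reg_l with (/ exp x)%R; [apply Rinv_0_lt_compat; assumption|].
  rewrite <- Rmult_assoc, Rinv_l by lra. lra. }
nra.
Qed.

Lemma Cexp_plus (z w : C) : Cexp (z + w) = Cexp z * Cexp w.
Proof.
destruct z as [a b], w as [c d]. unfold Cexp, Cplus, Cmult; simpl.
rewrite exp_plus, cos_plus, sin_plus. f_equal; ring.
Qed.

Lemma Cexp_0 : Cexp 0 = 1.
Proof. unfold Cexp; simpl. rewrite exp_0, cos_0, sin_0. unfold RtoC; f_equal; ring. Qed.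

Lemma Cexp_nz (z : C) : Cexp z <> 0.
Proof.
intros E. assert (F := Cexp_plus z (- z)). rewrite E, Cplus_opp_r, Cexp_0, Cmult_0_l in F.
apply C1_nz; assumption.
Qed.

Lemma Cmod_Cexp (z : C) : Cmod (Cexp z) = exp (Re z).
Proof.
destruct z as [a b]. unfold Cexp, Cmod; simpl.
replace (exp a * cos b * (exp a * cos b * 1) + exp a * sin b * (exp a * sin b * 1))%R
 with (exp a * exp a * (Rsqr (sin b) + Rsqr (cos b)))%R by (unfold Rsqr; ring).
rewrite sin2_cos2, Rmult_1_r. apply sqrt_square. left; apply exp_pos.
Qed.

Lemma Cexp_pow (z : C) (n : nat) : Cexp z ^ n = Cexp (RtoC (INR n) * z).
Proof.
induction n.
- simpl. rewrite Cmult_0_l, Cexp_0. reflexivity.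
- rewrite S_INR, RtoC_plus. simpl Cpow. rewrite IHn, <- Cexp_plus. f_equal. ring.
Qed.

(** As [Cexp] is given through real functions, real estimates for exp, cos and sin are combined: the
    real and imaginary parts of the remainder are each at most [3 |h|^2], and [6 / 10 < 1] explains
    the radius [eps / 10]. *)
Lemma cder_Cexp_0 : cder Cexp 0 1.
Proof.
rewrite cder_eps. intros eps Heps.
exists (Rmin (1 / 2) (eps / 10)). split. { apply Rmin_case; lra. }
intros h Hh. assert (L1 := Rmin_l (1/2) (eps / 10)). assert (L2 := Rmin_r (1/2) (eps / 10)).
rewrite Cexp_0, Cplus_0_l, Cmult_1_r.
eapply Rle_trans; [apply Cmod_Re_Im|].
assert (Rm := Rmax_Cmod h). assert (P := Cmod_ge_0 h).
assert (M1 := Rmax_l (Rabs (fst h)) (Rabs (snd h))). assert (M2 := Rmax_r (Rabs (fst h)) (Rabs (snd h))).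
destruct h as [x y]. simpl in M1, M2, Rm.
set (m := Cmod (x, y)) in *.
assert (Hx : Rabs x <= m) by lra. assert (Hy : Rabs y <= m) by lra.
change (Re (Cexp (x, y) - 1 - (x, y))) with (exp x * cos y - 1 - x)%R.
replace (Im (Cexp (x, y) - 1 - (x, y))) with (exp x * sin y - y)%R by (unfold Im; simpl; ring).
assert (E1 := Rabs_exp_sub x ltac:(lra)).
assert (C1 := Rabs_cos_sub y). assert (S1 := Rabs_sin_sub y).
assert (X2 : x * x <= m * m).
{ replace (x * x)%R with (Rabs x * Rabs x)%R by (rewrite <- Rabs_mult, Rabs_pos_eq by nra; reflexivity).
  generalize (Rabs_pos x). nra. }
assert (Y2 : y * y <= m * m).
{ replace (y * y)%R with (Rabs y * Rabs y)%R by (rewrite <- Rabs_mult, Rabs_pos_eq by nra; reflexivity).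
  generalize (Rabs_pos y). nra. }
assert (Ex : 0 < exp x <= 2).
{ split; [apply exp_pos|]. apply Rabs_le_between in E1. apply Rabs_le_between in Hx. nra. }
assert (Ax : Rabs (exp x - 1) <= 2 * m).
{ replace (exp x - 1)%R with ((exp x - 1 - x) + x)%R by ring.
  eapply Rle_trans; [apply Rabs_triang|]. nra. }
assert (T1 : Rabs (exp x * cos y - 1 - x) <= 3 * (m * m)).
{ replace (exp x * cos y - 1 - x)%R with ((exp x - 1 - x) + - (exp x * (1 - cos y)))%R by ring.
  eapply Rle_trans; [apply Rabs_triang|]. rewrite Rabs_Ropp, Rabs_mult, (Rabs_pos_eq (exp x)) by lra.
  assert (exp x * Rabs (1 - cos y) <= 2 * (m * m / 2)).
  { apply Rmult_le_compat; [lra|apply Rabs_pos|lra|lra]. }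
  lra. }
assert (T2 : Rabs (exp x * sin y - y) <= 3 * (m * m)).
{ replace (exp x * sin y - y)%R with (exp x * (sin y - y) + (exp x - 1) * y)%R by ring.
  eapply Rle_trans; [apply Rabs_triang|]. rewrite !Rabs_mult, (Rabs_pos_eq (exp x)) by lra.
  assert (exp x * Rabs (sin y - y) <= 2 * (m * m / 2)).
  { apply Rmult_le_compat; [lra|apply Rabs_pos|lra|].
    eapply Rle_trans; [exact S1|].
    apply Rle_trans with (1 * (m * m / 2))%R; [|lra].
    apply Rmult_le_compat; [apply Rabs_pos|nra|lra|lra]. }
  assert (Rabs (exp x - 1) * Rabs y <= 2 * m * m).
  { apply Rmult_le_compat; try apply Rabs_pos; assumption. }
  lra. }
nra.
Qed.

Lemma cder_Cexp (z : C) : cder Cexp z (Cexp z).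
Proof.
assert (H := cder_Cexp_0). rewrite cder_eps in H |- *. intros eps Heps.
assert (P : 0 < Cmod (Cexp z)) by (apply Cmod_gt_0, Cexp_nz).
destruct (H (eps / Cmod (Cexp z))%R) as [d [Hd H1]]. { apply Rdiv_lt_0_compat; assumption. }
exists d. split; [assumption|]. intros h Hh. specialize (H1 h Hh).
rewrite Cplus_0_l, Cexp_0 in H1.
replace (Cexp (z + h) - Cexp z - h * Cexp z) with (Cexp z * (Cexp h - 1 - h * 1)) by (rewrite Cexp_plus; ring).
rewrite Cmod_mult.
apply Rle_trans with (Cmod (Cexp z) * (eps / Cmod (Cexp z) * Cmod h))%R.
apply Rmult_le_compat_l; lra. right; field; lra.
Qed.

Definition tpi : C := 2 * RtoC PI * Ci.

Lemma tpi_nz : tpi <> 0.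
Proof.
unfold tpi. generalize PI_RGT_0; intros. repeat apply Cmult_neq_0; try apply Ci_nz; intros E; apply RtoC_inj in E; lra.
Qed.

Lemma cder_q (z : C) : cder q z (tpi * q z).
Proof.
unfold q. rewrite (Cmult_comm tpi).
apply (cder_comp Cexp (fun tau => 2 * RtoC PI * Ci * tau)). apply cder_Cexp.
replace tpi with (tpi * 1) by ring. apply cder_scal, cder_id.
Qed.

Lemma Re_tpi (z : C) : Re (2 * RtoC PI * Ci * z) = (- (2 * PI * Im z))%R.
Proof. destruct z; unfold Re, Im; simpl. ring. Qed.

Lemma Cmod_q (z : C) : Cmod (q z) = exp (- (2 * PI * Im z)).
Proof. unfold q. rewrite Cmod_Cexp, Re_tpi. reflexivity. Qed.

Lemma q_nz (z : C) : q z <> 0.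
Proof. apply Cexp_nz. Qed.

Lemma Cmod_q_lt (z : C) : upper z -> Cmod (q z) < 1.
Proof.
intros H. rewrite Cmod_q, <- exp_0. apply exp_increasing.
unfold upper in H. generalize PI_RGT_0. nra.
Qed.

Lemma q_plus (z w : C) : q (z + w) = q z * q w.
Proof. unfold q. rewrite <- Cexp_plus. f_equal. ring. Qed.

Lemma q_1 : q 1 = 1.
Proof.
unfold q. replace (2 * RtoC PI * Ci * 1) with (0, 2 * PI)%R by (unfold RtoC, Ci, Cmult; simpl; f_equal; ring).
unfold Cexp; simpl. rewrite exp_0, cos_2PI, sin_2PI. unfold RtoC; f_equal; ring.
Qed.

Lemma q_period (z : C) : q (z + 1) = q z.
Proof. rewrite q_plus, q_1. ring. Qed.

(** * Functions with an everywhere convergent Fourier series *)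

(** Equivalent to [fourier_series] (see [fourier_series_Wf]), with the convergence of every series
    replaced by a growth condition on the coefficients, which is easier to carry through products
    and derivatives. *)
Definition Wf (a : nat -> C) (f : C -> C) : Prop :=
  subexp a /\ forall tau, upper tau -> f tau = psum a (q tau).

Definition W (f : C -> C) : Prop := exists a, Wf a f.

Lemma Wf_ext (a b : nat -> C) (f g : C -> C) : Wf a f -> (forall n, b n = a n) ->
  (forall tau, upper tau -> g tau = f tau) -> Wf b g.
Proof.
intros [Ha Hf] E F. split.
- intros r Hr. destruct (Ha r Hr) as [M HM]. exists M. intros n; rewrite E; apply HM.
- intros tau Ht. rewrite F, Hf by assumption. symmetry; apply psum_ext; assumption.
Qed.

Lemma W_ext (f g : C -> C) : W f -> (forall tau, upper tau -> g tau = f tau) -> W g.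
Proof. intros [a Ha] E. exists a. apply (Wf_ext a a f g Ha); auto. Qed.

Lemma Wf_plus (a b : nat -> C) (f g : C -> C) : Wf a f -> Wf b g ->
  Wf (fun n => a n + b n) (fun tau => f tau + g tau).
Proof.
intros [Ha Hf] [Hb Hg]. split. apply subexp_plus; assumption.
intros tau Ht. rewrite Hf, Hg, psum_plus; auto using Cmod_q_lt.
Qed.

Lemma Wf_scal (c : C) (a : nat -> C) (f : C -> C) : Wf a f ->
  Wf (fun n => c * a n) (fun tau => c * f tau).
Proof.
intros [Ha Hf]. split. apply subexp_scal; assumption.
intros tau Ht. rewrite Hf, psum_scal; auto using Cmod_q_lt.
Qed.

Lemma Wf_mult (a b : nat -> C) (f g : C -> C) : Wf a f -> Wf b g ->
  Wf (cauchy_prod a b) (fun tau => f tau * g tau).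
Proof.
intros [Ha Hf] [Hb Hg]. split. apply subexp_cauchy_prod; assumption.
intros tau Ht. rewrite Hf, Hg, psum_cauchy_prod; auto using Cmod_q_lt.
Qed.

Definition cseq (c : C) (n : nat) : C := match n with O => c | S _ => 0 end.


Lemma psum_zero (z : C) : psum (fun _ => 0) z = 0.
Proof.
unfold psum, CSeries.
assert (E : Series (fun _ => 0%R) = 0%R).
{ rewrite (Series_ext _ (fun n => 0 * 1)%R) by (intros; ring). rewrite Series_scal_l. ring. }
change (RtoC 0) with (0%R, 0%R).
f_equal; (transitivity (Series (fun _ => 0%R)); [apply Series_ext; intros n; rewrite Cmult_0_l; reflexivity|exact E]).
Qed.

Lemma subexp_cseq (c : C) : subexp (cseq c).
Proof.
apply (subexp_bound _ (Cmod c) 0). intros n. simpl. rewrite Rmult_1_r.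
destruct n; simpl; [lra|]. rewrite Cmod_0. apply Cmod_ge_0.
Qed.

Lemma psum_cseq (c z : C) : Cmod z < 1 -> psum (cseq c) z = c.
Proof.
intros Hz. rewrite psum_S by (try apply subexp_cseq; assumption). simpl.
rewrite psum_zero. ring.
Qed.

Lemma Wf_const (c : C) : Wf (cseq c) (fun _ => c).
Proof.
split. apply subexp_cseq.
intros tau Ht. symmetry; apply psum_cseq, Cmod_q_lt; assumption.
Qed.

Lemma W_const (c : C) : W (fun _ => c).
Proof. eexists; apply Wf_const. Qed.

Lemma W_plus (f g : C -> C) : W f -> W g -> W (fun tau => f tau + g tau).
Proof. intros [a Ha] [b Hb]. eexists; apply Wf_plus; eassumption. Qed.

Lemma W_scal (c : C) (f : C -> C) : W f -> W (fun tau => c * f tau).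
Proof. intros [a Ha]. eexists; apply Wf_scal; eassumption. Qed.

Lemma W_mult (f g : C -> C) : W f -> W g -> W (fun tau => f tau * g tau).
Proof. intros [a Ha] [b Hb]. eexists; apply Wf_mult; eassumption. Qed.

Lemma W_opp (f : C -> C) : W f -> W (fun tau => - f tau).
Proof. intros H. apply (W_ext _ _ (W_scal (- (1)) f H)). intros; ring. Qed.

Lemma W_minus (f g : C -> C) : W f -> W g -> W (fun tau => f tau - g tau).
Proof. intros H1 H2. apply W_plus; [|apply W_opp]; assumption. Qed.

Lemma W_pow (f : C -> C) (n : nat) : W f -> W (fun tau => f tau ^ n).
Proof. intros H; induction n; simpl. apply W_const. apply W_mult; assumption. Qed.


Lemma W_period (f : C -> C) (tau : C) : W f -> upper tau -> f (tau + 1) = f tau.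
Proof.
intros [a [_ Hf]] Ht. rewrite !Hf, q_period; try assumption. reflexivity.
unfold upper in *. destruct tau; simpl in *; lra.
Qed.

Lemma upper_nbhd (tau : C) : upper tau -> forall h : C, Cmod h < Im tau -> upper (tau + h).
Proof.
unfold upper. intros Ht h Hh.
assert (Rm := Rmax_Cmod h). assert (M := Rmax_r (Rabs (fst h)) (Rabs (snd h))).
destruct h as [x y], tau as [u v]. simpl in *.
assert (Rabs y < v) by lra. apply Rabs_def2 in H. lra.
Qed.

Lemma cder_ext_upper (f g : C -> C) (tau l : C) : upper tau ->
  (forall z, upper z -> f z = g z) -> cder f tau l -> cder g tau l.
Proof.
intros Ht E. apply (cder_ext_loc f g tau l (Im tau)). exact Ht.
intros h Hh. apply E, upper_nbhd; assumption.
Qed.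

Lemma Wf_cder (a : nat -> C) (f : C -> C) (tau : C) : Wf a f -> upper tau ->
  cder f tau (tpi * psum (fun n => RtoC (INR n) * a n) (q tau)).
Proof.
intros [Ha Hf] Ht.
apply (cder_ext_upper (fun z => psum a (q z))). assumption. { intros; symmetry; auto. }
assert (Hq := Cmod_q_lt tau Ht).
assert (Sn : subexp (fun n => RtoC (INR n) * a n)).
{ apply (subexp_poly a _ 1%R 1 Ha). intros n. rewrite Cmod_mult, Cmod_R. assert (P := pos_INR n).
  rewrite Rabs_pos_eq by assumption. simpl. rewrite Rmult_1_r, Rmult_1_l.
  apply Rmult_le_compat_r; [apply Cmod_ge_0|lra]. }
replace (tpi * psum (fun n => RtoC (INR n) * a n) (q tau)) with (psum (pder a) (q tau) * (tpi * q tau)).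
apply (cder_comp (psum a) q). apply psum_cder; assumption. apply cder_q.
rewrite (psum_S _ _ Sn Hq). simpl INR at 1. change (fun n => RtoC (INR (S n)) * a (S n)) with (pder a). ring.
Qed.

Lemma Wf_D (a : nat -> C) (f : C -> C) : Wf a f ->
  exists g, Wf (fun n => RtoC (INR n) * a n) g /\ forall tau, upper tau -> cder f tau (tpi * g tau).
Proof.
intros H. exists (fun tau => psum (fun n => RtoC (INR n) * a n) (q tau)). split.
- split; [|reflexivity]. destruct H as [Ha _].
  apply (subexp_poly a _ 1%R 1 Ha). intros n. rewrite Cmod_mult, Cmod_R. assert (P := pos_INR n).
  rewrite Rabs_pos_eq by assumption. simpl. rewrite Rmult_1_r, Rmult_1_l.
  apply Rmult_le_compat_r; [apply Cmod_ge_0|lra].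
- intros; apply Wf_cder; assumption.
Qed.

Lemma psum_near_0 (a : nat -> C) : subexp a -> exists K : R, 0 <= K /\
  forall z, Cmod z <= 1 / 2 -> Cmod (psum a z - a O) <= K * Cmod z.
Proof.
intros Ha. assert (H1 := subexp_S a Ha).
destruct (subexp_term _ (1/2) H1 ltac:(lra)) as [M [r [HM [Hr B]]]].
exists (M / (1 - r))%R. split. { apply Rle_div_r; lra. }
intros z Hz. rewrite psum_S by (try assumption; lra).
replace (a O + z * psum (fun n => a (S n)) z - a O) with (z * psum (fun n => a (S n)) z) by ring.
rewrite Cmod_mult, Rmult_comm. apply Rmult_le_compat_r; [apply Cmod_ge_0|].
apply (psum_bound _ z (fun n => M * r ^ n)%R). assumption. lra. intros; apply B; assumption.
intros n. rewrite rsum_scal. apply Rmult_le_compat_l; [assumption|apply rsum_geom; lra].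
Qed.

Lemma psum_drop (a : nat -> C) (n : nat) : (forall i, (i < n)%nat -> a i = 0) ->
  forall z, subexp a -> Cmod z < 1 -> psum a z = z ^ n * psum (fun k => a (n + k)%nat) z.
Proof.
revert a. induction n; intros a H z Ha Hz.
- simpl. rewrite Cmult_1_l. apply psum_ext. reflexivity.
- rewrite psum_S by assumption. rewrite (H O) by lia.
  rewrite (IHn (fun n => a (S n))); [|intros; apply H; lia|apply subexp_S; assumption|assumption].
  simpl Cpow. change (fun k => a (S n + k)%nat) with (fun k => a (S (n + k))). ring.
Qed.

Lemma subexp_shift (a : nat -> C) (n : nat) : subexp a -> subexp (fun k => a (n + k)%nat).
Proof.
induction n; intros Ha; [exact Ha|].
apply (subexp_S (fun k => a (n + k)%nat)) in IHn; [|assumption].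
intros r Hr. destruct (IHn r Hr) as [M HM]. exists M. intros k. specialize (HM k).
replace (S n + k)%nat with (n + S k)%nat by lia. exact HM.
Qed.

(** Zeros of a nonzero power series do not accumulate at 0: once the lowest power with nonzero
    coefficient is split off, the other factor stays close to that coefficient. *)
Lemma psum_nonzero (a : nat -> C) : subexp a -> (forall n, a n = 0) \/
  exists d : R, 0 < d /\ forall z : C, z <> 0 -> Cmod z < d -> Cmod z < 1 -> psum a z <> 0.
Proof.
intros Ha.
destruct (excluded_middle_informative (exists n, a n <> 0)) as [H|H].
2: { left. intros n. destruct (Ceq_dec (a n) 0); [assumption|]. exfalso; apply H; exists n; assumption. }
right.
assert (Hm : exists n, a n <> 0 /\ forall i, (i < n)%nat -> a i = 0).
{ destruct H as [n Hn]. revert Hn. induction n as [n IH] using lt_wf_ind. intros Hn.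
  destruct (excluded_middle_informative (exists i, (i < n)%nat /\ a i <> 0)) as [[i [Hi Hi']]|N].
  - apply (IH i); assumption.
  - exists n. split; [assumption|]. intros i Hi. destruct (Ceq_dec (a i) 0); [assumption|].
    exfalso; apply N; exists i; split; assumption. }
destruct Hm as [n [Hn Hlow]].
assert (Hb := subexp_shift a n Ha).
destruct (psum_near_0 _ Hb) as [K [HK B]].
assert (P : 0 < Cmod (a n)) by (apply Cmod_gt_0; assumption).
assert (P2 : 0 < Cmod (a n) / (1 + K)) by (apply Rdiv_lt_0_compat; lra).
exists (Rmin (1/2) (Cmod (a n) / (1 + K))). split. { apply Rmin_case; lra. }
intros z Hz Hzd Hz1 E.
assert (L1 := Rmin_l (1/2) (Cmod (a n) / (1 + K))). assert (L2 := Rmin_r (1/2) (Cmod (a n) / (1 + K))).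
rewrite (psum_drop a n Hlow z Ha Hz1) in E.
assert (E2 : psum (fun k => a (n + k)%nat) z = 0).
{ destruct (Ceq_dec (psum (fun k => a (n + k)%nat) z) 0); [assumption|].
  exfalso. revert E. apply Cmult_neq_0; [apply Cpow_nz|]; assumption. }
specialize (B z ltac:(lra)). rewrite E2, Nat.add_0_r in B.
replace (0 - a n) with (- a n) in B by ring. rewrite Cmod_opp in B.
assert (Cmod (a n) < Cmod (a n)); [|lra].
apply Rle_lt_trans with (1 := B).
assert (Pz := Cmod_ge_0 z).
apply Rle_lt_trans with ((1 + K) * Cmod z)%R. nra.
apply Rlt_le_trans with ((1 + K) * (Cmod (a n) / (1 + K)))%R; [|right; field; lra].
apply Rmult_lt_compat_l; lra.
Qed.

Lemma q_small (d : R) : 0 < d -> exists Y : R, 0 < Y /\ forall tau, Y < Im tau -> Cmod (q tau) < d.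
Proof.
intros Hd. assert (P := PI_RGT_0).
exists (1 + Rabs (ln d))%R. split. { generalize (Rabs_pos (ln d)); lra. }
intros tau H. rewrite Cmod_q. rewrite <- (exp_ln d Hd) at 1. apply exp_increasing.
assert (A := Rabs_pos (ln d)). assert (B := Rle_abs (- ln d)). rewrite Rabs_Ropp in B.
assert (3 < 2 * PI) by (generalize PI2_3_2; unfold PI2; lra). nra.
Qed.

(** A punctured disc around [q = 0] pulls back to a half-plane. An element of [W] is thus determined
    near i oo, and one that is not the zero function may serve as a denominator for large
    [Im tau]. *)
Lemma W_dichotomy (f : C -> C) : W f -> (forall tau, upper tau -> f tau = 0) \/
  exists Y : R, 0 < Y /\ forall tau, Y < Im tau -> f tau <> 0.
Proof.
intros [a [Ha Hf]]. destruct (psum_nonzero a Ha) as [H|[d [Hd H]]].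
- left. intros tau Ht. rewrite Hf by assumption. rewrite (psum_ext _ (fun _ => 0)) by assumption. apply psum_zero.
- right. destruct (q_small d Hd) as [Y [HY HYd]]. exists Y. split; [assumption|].
  intros tau Ht. assert (U : upper tau) by (unfold upper; lra).
  rewrite Hf by assumption. apply H; auto using q_nz, Cmod_q_lt.
Qed.

Lemma W_zero_large (f : C -> C) (Y : R) : W f -> (forall tau, Y < Im tau -> upper tau -> f tau = 0) ->
  forall tau, upper tau -> f tau = 0.
Proof.
intros Hf H. destruct (W_dichotomy f Hf) as [|[Z [HZ N]]]; [assumption|exfalso].
set (t := (0, 1 + Rabs Y + Z)%R : C).
assert (0 <= Rabs Y) by apply Rabs_pos. assert (Y <= Rabs Y) by apply Rle_abs.
apply (N t). unfold t; simpl; lra. apply H; unfold upper, t; simpl; lra.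
Qed.

Lemma W_integral (f g : C -> C) (Y : R) : W f -> W g ->
  (forall tau, Y < Im tau -> upper tau -> f tau * g tau = 0) ->
  (forall tau, upper tau -> f tau = 0) \/ (forall tau, upper tau -> g tau = 0).
Proof.
intros Hf Hg H. destruct (W_dichotomy f Hf) as [|[Z [HZ N]]]; [left; assumption|right].
apply (W_zero_large g (Rmax Y Z) Hg). intros tau Ht Hu.
assert (L1 := Rmax_l Y Z). assert (L2 := Rmax_r Y Z).
destruct (Ceq_dec (g tau) 0); [assumption|]. exfalso.
assert (f tau * g tau <> 0) by (apply Cmult_neq_0; [apply N; lra|assumption]).
apply H0, H; [lra|assumption].
Qed.

Lemma Wf_unique (a b : nat -> C) (f : C -> C) : Wf a f -> Wf b f -> forall n, a n = b n.
Proof.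
intros [Ha Hf] [Hb Hg].
assert (Hd : subexp (fun n => a n + - (1) * b n)) by (apply subexp_plus, subexp_scal; assumption).
destruct (psum_nonzero _ Hd) as [H|[d [Hdp H]]].
- intros n. specialize (H n). apply Ceq_minus. rewrite <- H. ring.
- exfalso. destruct (q_small d Hdp) as [Y [HY HYd]].
  set (t := (0, 1 + Y)%R : C).
  assert (U : upper t) by (unfold upper, t; simpl; lra).
  apply (H (q t)). apply q_nz. apply HYd; unfold t; simpl; lra. apply Cmod_q_lt; assumption.
  rewrite psum_plus, psum_scal; auto using Cmod_q_lt, subexp_scal.
  rewrite <- Hf, <- Hg by assumption. ring.
Qed.

(** The nth coefficient is divided by [n]. The constant term is subtracted beforehand because its
    primitive is linear in [tau] and leaves [W]. *)
Lemma Wf_prim (a : nat -> C) (f : C -> C) : Wf a f ->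
  exists b G, Wf b G /\ b O = 0 /\ forall tau, upper tau -> cder G tau (tpi * (f tau - a O)).
Proof.
intros [Ha Hf].
set (b := (fun n : nat => match n with O => RtoC 0 | S _ => / RtoC (INR n) * a n end) : nat -> C).
assert (Hb : subexp b).
{ apply (subexp_poly a b 1%R 0 Ha). intros [|n]; unfold b.
  - rewrite Cmod_0. generalize (Cmod_ge_0 (a O)). simpl; lra.
  - assert (P := pos_INR n).
    rewrite Cmod_mult, Cmod_inv, Cmod_R by (intros E; apply RtoC_inj in E; rewrite S_INR in E; lra).
    rewrite S_INR, Rabs_pos_eq by lra. simpl. rewrite !Rmult_1_l.
    rewrite <- (Rmult_1_l (Cmod (a (S n)))) at 2. apply Rmult_le_compat_r; [apply Cmod_ge_0|].
    rewrite <- Rinv_1. apply Rinv_le_contravar; lra. }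
exists b, (fun tau => psum b (q tau)). split; [split; [assumption|reflexivity]|]. split; [reflexivity|].
intros tau Ht.
replace (f tau - a O) with (psum (fun n => RtoC (INR n) * b n) (q tau)).
apply Wf_cder; [split; [assumption|reflexivity]|assumption].
rewrite Hf by assumption.
replace (psum a (q tau) - a O) with (psum a (q tau) + psum (cseq (- a O)) (q tau))
 by (rewrite psum_cseq by (apply Cmod_q_lt; assumption); ring).
rewrite <- psum_plus; try assumption; [|apply subexp_cseq|apply Cmod_q_lt; assumption].
apply psum_ext. intros [|n]; unfold b; simpl cseq.
- simpl. ring.
- field. intros E; apply RtoC_inj in E; rewrite S_INR in E. generalize (pos_INR n); lra.
Qed.

(** * Polynomials in tau over W *)

Lemma Cmod_nat_shift (z : C) (l : nat) : INR l - Cmod z <= Cmod (z + RtoC (INR l)).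
Proof.
assert (T := Cmod_tri_minus (RtoC (INR l)) (z + RtoC (INR l))).
replace (RtoC (INR l) - (z + RtoC (INR l))) with (- z) in T by ring.
rewrite Cmod_opp, Cmod_R, Rabs_pos_eq in T by apply pos_INR. lra.
Qed.

(** The evaluation points [z + l] are those at which periodic coefficients keep their value. For [l]
    so large that [|z + l|] exceeds [1 + K / |c_n|], the top term outweighs all the others. *)
Lemma poly_zero (n : nat) (c : nat -> C) (z : C) :
  (forall l : nat, csum (fun j => (z + RtoC (INR l)) ^ j * c j) n = 0) ->
  forall j, (j < n)%nat -> c j = 0.
Proof.
induction n; intros H; [intros; lia|].
assert (E : c n = 0).
{ destruct (Ceq_dec (c n) 0) as [|N]; [assumption|exfalso].
  apply Cmod_gt_0 in N.
  set (K := rsum (fun j => Cmod (c j)) n).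
  assert (HK : 0 <= K) by (apply rsum_nonneg; intros; apply Cmod_ge_0).
  destruct (INR_unbounded (Cmod z + 1 + K / Cmod (c n))%R) as [l Hl].
  specialize (H l). rewrite csum_Sr in H.
  set (w := z + RtoC (INR l)) in *.
  assert (L := Cmod_nat_shift z l). fold w in L.
  assert (Hk : 0 <= K / Cmod (c n)) by (apply Rle_div_r; lra).
  assert (Hw : 1 + K / Cmod (c n) < Cmod w) by lra.
  destruct n.
  { simpl in H. assert (Cmod (c O) = 0%R). { replace (c O) with (0 + 1 * c O) by ring. rewrite H. apply Cmod_0. } lra. }
  assert (T : Cmod (w ^ S n * c (S n)) <= K * Cmod w ^ n).
  { replace (w ^ S n * c (S n)) with (- csum (fun j => w ^ j * c j) (S n)).
    2: { rewrite <- (Cplus_0_l (w ^ S n * c (S n))). rewrite <- (Cplus_opp_r (csum (fun j => w ^ j * c j) (S n))).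
      rewrite (Cplus_comm (csum _ _)). rewrite <- Cplus_assoc, H. ring. }
    rewrite Cmod_opp. unfold K. rewrite Rmult_comm, <- rsum_scal.
    apply Cmod_csum_le. intros i Hi. rewrite Cmod_mult, Cmod_pow.
    apply Rmult_le_compat_r; [apply Cmod_ge_0|]. apply Rle_pow; [lra|lia]. }
  rewrite Cmod_mult, Cmod_pow in T. simpl pow in T.
  assert (P : 0 < Cmod w ^ n) by (apply pow_lt; lra).
  assert (T2 : Cmod w * Cmod (c (S n)) <= K).
  { apply Rmult_le_reg_r with (Cmod w ^ n)%R; [assumption|]. lra. }
  assert (T3 : (1 + K / Cmod (c (S n))) * Cmod (c (S n)) < Cmod w * Cmod (c (S n))) by (apply Rmult_lt_compat_r; assumption).
  replace ((1 + K / Cmod (c (S n))) * Cmod (c (S n)))%R with (Cmod (c (S n)) + K)%R in T3 by (field; lra).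
  lra. }
assert (IH : forall j, (j < n)%nat -> c j = 0).
{ apply IHn. intros l. specialize (H l). rewrite csum_Sr, E in H. rewrite <- H. ring. }
intros j Hj. destruct (Nat.eq_dec j n); [subst; assumption|apply IH; lia].
Qed.

Lemma W_period_nat (f : C -> C) (tau : C) (l : nat) : W f -> upper tau -> f (tau + RtoC (INR l)) = f tau.
Proof.
intros Hf Ht. induction l.
- simpl. f_equal; ring.
- rewrite S_INR, RtoC_plus, Cplus_assoc, W_period, IHl; try assumption. reflexivity.
  unfold upper in *. destruct tau; simpl in *; lra.
Qed.

Lemma tau_indep (n : nat) (phi : nat -> C -> C) (Y : R) :
  (forall j, (j < n)%nat -> W (phi j)) ->
  (forall tau, Y < Im tau -> upper tau -> csum (fun j => tau ^ j * phi j tau) n = 0) ->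
  forall j, (j < n)%nat -> forall tau, upper tau -> phi j tau = 0.
Proof.
intros HW H j Hj. apply (W_zero_large _ Y); [auto|].
intros tau HY Ht. apply (poly_zero n (fun j => phi j tau) tau); [|assumption].
intros l. rewrite <- (H (tau + RtoC (INR l))).
- apply csum_ext. intros i Hi. rewrite W_period_nat; auto.
- destruct tau; simpl in *; lra.
- unfold upper in *. destruct tau; simpl in *; lra.
Qed.

(** Polynomials in [tau] over [W]; [n] is a strict bound for the degree, so [WT 0] contains only
    zero. *)
Definition WT (n : nat) (F : C -> C) : Prop :=
  exists phi : nat -> C -> C, (forall j, W (phi j)) /\
    forall tau, upper tau -> F tau = csum (fun j => tau ^ j * phi j tau) n.

Lemma WT_ext (n : nat) (F G : C -> C) : WT n F -> (forall tau, upper tau -> G tau = F tau) -> WT n G.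
Proof. intros [phi [Hw H]] E. exists phi. split; [assumption|]. intros; rewrite E; auto. Qed.

Lemma WT_zero (n : nat) : WT n (fun _ => 0).
Proof.
exists (fun _ _ => RtoC 0). split; [intros; apply W_const|].
intros. symmetry; apply csum_zero. intros; ring.
Qed.

Lemma WT_le (n m : nat) (F : C -> C) : (n <= m)%nat -> WT n F -> WT m F.
Proof.
intros L [phi [Hw H]].
exists (fun j tau => if lt_dec j n then phi j tau else RtoC 0). split.
- intros j. destruct (lt_dec j n); [apply Hw|apply W_const].
- intros tau Ht. rewrite H by assumption. replace m with (n + (m - n))%nat by lia.
  rewrite csum_split, (csum_zero _ (m - n)).
  + rewrite Cplus_0_r. apply csum_ext. intros i Hi. destruct (lt_dec i n); [reflexivity|lia].
  + intros i _. destruct (lt_dec (n + i) n); [lia|ring].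
Qed.

Lemma WT_plus (n : nat) (F G : C -> C) : WT n F -> WT n G -> WT n (fun tau => F tau + G tau).
Proof.
intros [p [Hp H]] [r [Hr K]]. exists (fun j tau => p j tau + r j tau). split.
- intros; apply W_plus; auto.
- intros tau Ht. rewrite H, K, <- csum_plus by assumption. apply csum_ext; intros; ring.
Qed.

Lemma WT_scalW (n : nat) (f F : C -> C) : W f -> WT n F -> WT n (fun tau => f tau * F tau).
Proof.
intros Hf [p [Hp H]]. exists (fun j tau => f tau * p j tau). split.
- intros; apply W_mult; auto.
- intros tau Ht. rewrite H, <- csum_scal by assumption. apply csum_ext; intros; ring.
Qed.

Lemma WT_tau (n : nat) (F : C -> C) : WT n F -> WT (S n) (fun tau => tau * F tau).
Proof.
intros [p [Hp H]]. exists (fun j => match j with O => fun _ => RtoC 0 | S i => p i end). split.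
- intros [|j]; [apply W_const|apply Hp].
- intros tau Ht. rewrite H, csum_S, <- csum_scal by assumption. simpl Cpow. rewrite Cmult_0_r, Cplus_0_l.
  apply csum_ext; intros; ring.
Qed.

Lemma WT_tau_pow (k n : nat) (F : C -> C) : WT n F -> WT (k + n) (fun tau => tau ^ k * F tau).
Proof.
intros H. induction k.
- apply (WT_ext _ _ _ H). intros; simpl; ring.
- apply (WT_ext _ _ _ (WT_tau _ _ IHk)). intros; simpl; ring.
Qed.

Lemma WT_W (f : C -> C) : W f -> WT 1 f.
Proof.
intros H. exists (fun _ => f). split; [auto|]. intros; simpl; ring.
Qed.

Lemma WT_monomial (k : nat) (f : C -> C) : W f -> WT (S k) (fun tau => tau ^ k * f tau).
Proof. intros H. rewrite <- Nat.add_1_r. apply WT_tau_pow, WT_W, H. Qed.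

Lemma WT_csum (n m : nat) (F : nat -> C -> C) : (forall i, (i < m)%nat -> WT n (F i)) ->
  WT n (fun tau => csum (fun i => F i tau) m).
Proof.
induction m; intros H; simpl. apply WT_zero.
apply WT_plus; [apply IHm; auto|apply H; lia].
Qed.

Lemma WT_opp (n : nat) (F : C -> C) : WT n F -> WT n (fun tau => - F tau).
Proof.
intros H. apply (WT_ext _ _ _ (WT_scalW n _ F (W_const (- (1))) H)). intros; ring.
Qed.

Lemma WT_mult (n m : nat) (F G : C -> C) : WT n F -> WT (S m) G -> WT (n + m) (fun tau => F tau * G tau).
Proof.
intros [p [Hp H]] HG.
apply WT_ext with (fun tau => csum (fun j => tau ^ j * (p j tau * G tau)) n).
- apply WT_csum. intros i Hi. apply (WT_le (i + S m)); [lia|].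
  apply WT_tau_pow, WT_scalW; auto.
- intros tau Ht. rewrite H by assumption. rewrite Cmult_comm, <- csum_scal. apply csum_ext; intros; ring.
Qed.

(** * Top and bottom coefficients in tau *)

Definition leading (n : nat) (phi F : C -> C) : Prop :=
  W phi /\ exists G, WT n G /\ forall tau, upper tau -> F tau = tau ^ n * phi tau + G tau.

Lemma leading_WT (n : nat) (phi F : C -> C) : leading n phi F -> WT (S n) F.
Proof.
intros [Hp [G [HG E]]]. apply (WT_ext _ (fun tau => tau ^ n * phi tau + G tau)); [|assumption].
apply WT_plus. apply WT_monomial, Hp. apply (WT_le n); [lia|assumption].
Qed.

Lemma leading_zero (n : nat) (phi F : C -> C) (Y : R) : leading n phi F -> WT n F \/ 
  (forall tau, Y < Im tau -> upper tau -> F tau = 0) -> forall tau, upper tau -> phi tau = 0.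
Proof.
intros [Hp [G [HG E]]] H.
assert (HF : exists F', WT n F' /\ forall tau, Y < Im tau -> upper tau -> tau ^ n * phi tau + F' tau = 0).
{ destruct H as [H|H].
  - exists (fun tau => G tau + - F tau). split. apply WT_plus; [|apply WT_opp]; assumption.
    intros. rewrite E by assumption. ring.
  - exists G. split; [assumption|]. intros. rewrite <- E by assumption. auto. }
destruct HF as [F' [[p [Hw K]] Z]].
set (ps := fun j => if Nat.eq_dec j n then phi else p j).
intros tau Ht. assert (E' : phi tau = ps n tau) by (unfold ps; destruct (Nat.eq_dec n n); [reflexivity|lia]).
rewrite E'. apply (tau_indep (S n) ps Y); [| |lia|assumption].
- intros j _. unfold ps. destruct (Nat.eq_dec j n); auto.
- intros t Y1 U. rewrite csum_Sr. unfold ps at 2. destruct (Nat.eq_dec n n); [|lia].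
  rewrite <- (Z t Y1 U), (K t U), Cplus_comm. f_equal. apply csum_ext. intros i Hi. unfold ps.
  destruct (Nat.eq_dec i n); [lia|reflexivity].
Qed.

Lemma leading_ext (n : nat) (phi F phi' F' : C -> C) : leading n phi F ->
  (forall tau, upper tau -> phi' tau = phi tau) -> (forall tau, upper tau -> F' tau = F tau) -> leading n phi' F'.
Proof.
intros [Hp [G [HG E]]] E1 E2. split. apply (W_ext phi); assumption.
exists G. split; [assumption|]. intros. rewrite E1, E2, E by assumption. reflexivity.
Qed.

Lemma leading_plus_low (n : nat) (phi F G : C -> C) : leading n phi F -> WT n G -> leading n phi (fun tau => F tau + G tau).
Proof.
intros [Hp [K [HK E]]] HG. split; [assumption|]. exists (fun tau => K tau + G tau). split.
apply WT_plus; assumption. intros; rewrite E by assumption; ring.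
Qed.

Lemma leading_plus (n : nat) (phi psi F G : C -> C) : leading n phi F -> leading n psi G ->
  leading n (fun tau => phi tau + psi tau) (fun tau => F tau + G tau).
Proof.
intros [Hp [K [HK E]]] [Hs [L [HL E']]]. split; [apply W_plus; assumption|].
exists (fun tau => K tau + L tau). split.
apply WT_plus; assumption. intros; rewrite E, E' by assumption; ring.
Qed.

Lemma leading_scalW (n : nat) (f phi F : C -> C) : W f -> leading n phi F ->
  leading n (fun tau => f tau * phi tau) (fun tau => f tau * F tau).
Proof.
intros Hf [Hp [K [HK E]]]. split; [apply W_mult; assumption|].
exists (fun tau => f tau * K tau). split. apply WT_scalW; assumption.
intros; rewrite E by assumption; ring.
Qed.

Lemma leading_mult (n m : nat) (phi psi F G : C -> C) : leading n phi F -> leading m psi G ->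
  leading (n + m) (fun tau => phi tau * psi tau) (fun tau => F tau * G tau).
Proof.
intros [Hp [K [HK E]]] HG. split; [apply W_mult; [assumption|apply HG]|].
assert (HG' := leading_WT _ _ _ HG). destruct HG as [Hs [L [HL E']]].
exists (fun tau => tau ^ n * (phi tau * L tau) + K tau * G tau). split.
- apply WT_plus. apply WT_tau_pow, WT_scalW; assumption. apply WT_mult; assumption.
- intros tau Ht. rewrite E, E', Cpow_add_r by assumption. ring.
Qed.

Lemma leading_tau_pow (k n : nat) (phi F : C -> C) : leading n phi F -> leading (k + n) phi (fun tau => tau ^ k * F tau).
Proof.
intros [Hp [K [HK E]]]. split; [assumption|]. exists (fun tau => tau ^ k * K tau). split.
apply WT_tau_pow; assumption. intros; rewrite E, Cpow_add_r by assumption; ring.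
Qed.

(** [leading] lets its coefficient vanish, so degree and coefficient become unique only under the
    two nonvanishing conditions. Agreement for large [Im tau] suffices, by [tau_indep]. *)
Lemma leading_unique (n m : nat) (phi psi F G : C -> C) (Y : R) : leading n phi F -> leading m psi G ->
  (forall tau, Y < Im tau -> upper tau -> F tau = G tau) ->
  (exists t, upper t /\ phi t <> 0) -> (exists t, upper t /\ psi t <> 0) ->
  n = m /\ forall tau, upper tau -> phi tau = psi tau.
Proof.
intros HF HG E [t [Ut Nt]] [s [Us Ns]].
assert (D : forall a b f g F G, leading a f F -> leading b g G -> (forall tau, Y < Im tau -> upper tau -> F tau = G tau) ->
   (b < a)%nat -> forall tau, upper tau -> f tau = 0).
{ intros a b f g F' G' H1 H2 E' L.
  apply (leading_zero a f (fun tau => F' tau + - G' tau) Y).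
  - apply leading_plus_low; [assumption|]. apply WT_opp, (WT_le (S b)); [lia|]. apply (leading_WT b g); assumption.
  - right. intros. rewrite E' by assumption. ring. }
destruct (lt_eq_lt_dec n m) as [[L|L]|L].
- exfalso. apply Ns. apply (D m n psi phi G F); auto. intros; symmetry; auto.
- split; [assumption|]. subst m. intros tau Ht. apply Ceq_minus.
  replace (phi tau - psi tau) with (phi tau + (fun _ => - (1)) tau * psi tau) by (cbv beta; ring).
  apply (leading_zero n (fun tau => phi tau + (fun _ => - (1)) tau * psi tau) (fun tau => F tau + (fun _ => - (1)) tau * G tau) Y); [|right|assumption].
  + apply leading_plus; [assumption|]. apply leading_scalW; [apply W_const|assumption].
  + intros; rewrite E by assumption; ring.
- exfalso. apply Nt. apply (D n m phi psi F G); auto.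
Qed.

Definition trailing (n : nat) (phi F : C -> C) : Prop :=
  W phi /\ exists k G, WT k G /\ forall tau, upper tau -> F tau = tau ^ n * (phi tau + tau * G tau).

Lemma upper_nz (tau : C) : upper tau -> tau <> 0.
Proof. intros H E. rewrite E in H. unfold upper in H; simpl in H; lra. Qed.

Lemma trailing_zero (n k : nat) (phi G : C -> C) (Y : R) : W phi -> WT k G ->
  (forall tau, Y < Im tau -> upper tau -> tau ^ n * (phi tau + tau * G tau) = 0) -> forall tau, upper tau -> phi tau = 0.
Proof.
intros Hp [p [Hw K]] H tau Ht.
set (ps := fun j => match j with O => phi | S i => p i end).
change (ps O tau = 0). apply (tau_indep (S k) ps Y); [| |lia|assumption].
- intros [|j] _; simpl; auto.
- intros t Y1 U. rewrite csum_S. simpl. 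
  destruct (Ceq_dec (phi t + t * G t) 0) as [Z|Z].
  + rewrite <- Z, (K t U), <- csum_scal, Cmult_1_l. f_equal. apply csum_ext; intros; ring.
  + exfalso. revert Z. intros Z. apply (Cmult_neq_0 (t ^ n) _ (Cpow_nz t n (upper_nz t U)) Z). auto.
Qed.

Lemma trailing_unique (n m : nat) (phi psi F G : C -> C) (Y : R) : trailing n phi F -> trailing m psi G ->
  (forall tau, Y < Im tau -> upper tau -> F tau = G tau) ->
  (exists t, upper t /\ phi t <> 0) -> (exists t, upper t /\ psi t <> 0) ->
  n = m /\ forall tau, upper tau -> phi tau = psi tau.
Proof.
intros HF HG E [t [Ut Nt]] [s [Us Ns]].
assert (D : forall a b f g F G, trailing a f F -> trailing b g G -> (forall tau, Y < Im tau -> upper tau -> F tau = G tau) ->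
   (a < b)%nat -> forall tau, upper tau -> f tau = 0).
{ intros a b f g F' G' [Hf [k [K [HK EK]]]] [Hg [l [L [HL EL]]]] E' Lt.
  assert (HLm : exists d, WT d (fun tau => tau ^ (b - a - 1) * (g tau + tau * L tau))).
  { exists (b - a - 1 + S (1 + l))%nat. apply WT_tau_pow, WT_plus.
    apply (WT_le 1); [lia|apply WT_W; assumption]. apply WT_tau, (WT_le l); [lia|assumption]. }
  destruct HLm as [d Hd].
  apply (trailing_zero a (k + d) f (fun tau => K tau + - (tau ^ (b - a - 1) * (g tau + tau * L tau))) Y Hf).
  - apply WT_plus. apply (WT_le k); [lia|assumption]. apply WT_opp, (WT_le d); [lia|assumption].
  - intros tau Y1 U. apply (Ceq_minus (F' tau) (G' tau)) in E' as E2; [|assumption..].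
    rewrite EK, EL in E2 by assumption. rewrite <- E2.
    replace (tau ^ b) with (tau ^ a * (tau * tau ^ (b - a - 1))).
    2: { change (tau * tau ^ (b - a - 1)) with (tau ^ S (b - a - 1)). rewrite <- Cpow_add_r. f_equal; lia. }
    ring. }
destruct (lt_eq_lt_dec n m) as [[L|L]|L].
- exfalso. apply Nt. apply (D n m phi psi F G); auto.
- split; [assumption|]. subst m. intros tau Ht. apply Ceq_minus.
  destruct HF as [Hf [k [K [HK EK]]]]. destruct HG as [Hg [l [L [HL EL]]]].
  apply (trailing_zero n (k + l) (fun tau => phi tau - psi tau) (fun tau => K tau + - L tau) Y); [| | |assumption].
  + apply W_minus; assumption.
  + apply WT_plus. apply (WT_le k); [lia|assumption]. apply WT_opp, (WT_le l); [lia|assumption].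
  + intros t0 Y1 U. apply (Ceq_minus (F t0) (G t0)) in E as E2; [|assumption..].
    rewrite EK, EL in E2 by assumption. rewrite <- E2. ring.
- exfalso. apply Ns. apply (D m n psi phi G F); auto. intros; symmetry; auto.
Qed.

Lemma W_der (f : C -> C) : W f -> exists f', W f' /\ forall tau, upper tau -> cder f tau (f' tau).
Proof.
intros [a Ha]. destruct (Wf_D a f Ha) as [g [Hg E]].
exists (fun tau => tpi * g tau). split; [|assumption]. apply W_scal. eexists; exact Hg.
Qed.

Lemma cder_monomial (j : nat) (f : C -> C) (tau l : C) : cder f tau l ->
  cder (fun t => t ^ j * f t) tau (RtoC (INR j) * tau ^ (j - 1) * f tau + tau ^ j * l).
Proof. intros H. apply (cder_mult (fun t => t ^ j)); [apply cder_pow|assumption]. Qed.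

Lemma WT_mono_der (j : nat) (f : C -> C) : W f -> WT (S j) (fun tau => RtoC (INR j) * tau ^ (j - 1) * f tau).
Proof.
intros H. apply (WT_ext _ (fun tau => tau ^ (j - 1) * (RtoC (INR j) * f tau))); [|intros; ring].
apply (WT_le (S (j - 1))); [lia|]. apply WT_monomial, W_scal, H.
Qed.

Lemma cder_csum (F F' : nat -> C -> C) (tau : C) (n : nat) :
  (forall i, (i < n)%nat -> cder (F i) tau (F' i tau)) ->
  cder (fun t => csum (fun i => F i t) n) tau (csum (fun i => F' i tau) n).
Proof.
induction n; intros H; simpl. apply cder_const.
apply cder_plus; [apply IHn; auto|apply H; lia].
Qed.

Lemma WT_der (n : nat) (F : C -> C) : WT n F -> exists F', WT n F' /\ forall tau, upper tau -> cder F tau (F' tau).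
Proof.
intros [p [Hp H]].
assert (Hd : forall j, exists p', W p' /\ forall tau, upper tau -> cder (p j) tau (p' tau)) by (intros; apply W_der, Hp).
set (d := fun j => proj1_sig (constructive_indefinite_description _ (Hd j))).
assert (Dd : forall j, W (d j) /\ forall tau, upper tau -> cder (p j) tau (d j tau)).
{ intros j. unfold d. destruct (constructive_indefinite_description _ (Hd j)); assumption. }
exists (fun tau => csum (fun j => RtoC (INR j) * tau ^ (j - 1) * p j tau + tau ^ j * d j tau) n). split.
- apply WT_csum. intros i Hi. apply (WT_le (S i)); [lia|]. apply WT_plus.
  apply WT_mono_der, Hp. apply WT_monomial, Dd.
- intros tau Ht. apply (cder_ext_upper (fun t => csum (fun j => t ^ j * p j t) n)); [assumption| |].
  { intros; symmetry; auto. }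
  apply (cder_csum (fun j t => t ^ j * p j t) (fun j t => RtoC (INR j) * t ^ (j - 1) * p j t + t ^ j * d j t)).
  intros i Hi. apply cder_monomial, Dd; assumption.
Qed.

Lemma leading_der (n : nat) (phi phi' F : C -> C) : leading n phi F -> W phi' ->
  (forall tau, upper tau -> cder phi tau (phi' tau)) ->
  exists F', leading n phi' F' /\ forall tau, upper tau -> cder F tau (F' tau).
Proof.
intros [Hp [G [HG E]]] Hp' Hd. destruct (WT_der n G HG) as [G' [HG' D]].
exists (fun tau => tau ^ n * phi' tau + (RtoC (INR n) * tau ^ (n - 1) * phi tau + G' tau)). split.
- split; [assumption|]. eexists; split; [|intros; reflexivity].
  apply WT_plus; [|assumption].
  destruct n. { apply (WT_ext _ _ _ (WT_zero 0)). intros; simpl; ring. }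
  apply (WT_ext _ (fun tau => tau ^ (S n - 1) * (RtoC (INR (S n)) * phi tau))); [|intros; ring].
  replace (S n - 1)%nat with n by lia. apply WT_monomial, W_scal, Hp.
- intros tau Ht. apply (cder_ext_upper (fun t => t ^ n * phi t + G t)); [assumption| |].
  { intros; symmetry; auto. }
  replace (tau ^ n * phi' tau + (RtoC (INR n) * tau ^ (n - 1) * phi tau + G' tau)) with
   ((RtoC (INR n) * tau ^ (n - 1) * phi tau + tau ^ n * phi' tau) + G' tau) by ring.
  apply cder_plus; [apply cder_monomial|]; auto.
Qed.

(** * Divisor sums *)

Lemma Csum_app {K : Type} (F : K -> C) (l m : list K) : Csum F (l ++ m) = Csum F l + Csum F m.
Proof. unfold Csum. induction l; simpl; [ring|]. rewrite IHl; ring. Qed.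

Lemma Csum_cons {K : Type} (F : K -> C) (x : K) (l : list K) : Csum F (x :: l) = F x + Csum F l.
Proof. reflexivity. Qed.

Lemma Csum_ext {K : Type} (F G : K -> C) (l : list K) : (forall x, In x l -> F x = G x) -> Csum F l = Csum G l.
Proof.
induction l; intros H; [reflexivity|]. rewrite !Csum_cons, IHl, H; simpl; auto. intros; apply H; simpl; auto.
Qed.

Lemma Csum_plus {K : Type} (F G : K -> C) (l : list K) : Csum (fun x => F x + G x) l = Csum F l + Csum G l.
Proof. induction l; [unfold Csum; simpl; ring|]. rewrite !Csum_cons, IHl; ring. Qed.

Lemma Csum_scal {K : Type} (c : C) (F : K -> C) (l : list K) : Csum (fun x => c * F x) l = c * Csum F l.
Proof. induction l; [unfold Csum; simpl; ring|]. rewrite !Csum_cons, IHl; ring. Qed.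

Lemma Csum_map {K L : Type} (h : K -> L) (F : L -> C) (l : list K) : Csum F (map h l) = Csum (fun x => F (h x)) l.
Proof. unfold Csum. rewrite map_map. reflexivity. Qed.

Lemma Csum_flat_map {K L : Type} (h : K -> list L) (F : L -> C) (l : list K) :
  Csum F (flat_map h l) = Csum (fun x => Csum F (h x)) l.
Proof. induction l; [reflexivity|]. simpl. rewrite Csum_app, Csum_cons, IHl. reflexivity. Qed.

Lemma Csum_perm {K : Type} (F : K -> C) (l m : list K) : Permutation l m -> Csum F l = Csum F m.
Proof.
induction 1; rewrite ?Csum_cons; try reflexivity.
- rewrite IHPermutation; reflexivity.
- ring.
- congruence.
Qed.

Lemma Csum_seq (F : nat -> C) (n : nat) : Csum F (seq 0 n) = csum F n.
Proof.
induction n; [reflexivity|]. rewrite seq_S, Csum_app, IHn. unfold Csum; simpl. ring.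
Qed.

Lemma Csum_seq_S (F : nat -> C) (k n : nat) : Csum F (seq k n) = csum (fun i => F (k + i)%nat) n.
Proof.
induction n; [reflexivity|]. rewrite seq_S, Csum_app, IHn. unfold Csum; simpl. ring.
Qed.

Lemma Csum_filter {K : Type} (c : K -> bool) (F : K -> C) (l : list K) :
  Csum F l = Csum F (filter c l) + Csum F (filter (fun x => negb (c x)) l).
Proof.
induction l; [unfold Csum; simpl; ring|]. simpl. destruct (c a); simpl; rewrite !Csum_cons, IHl; ring.
Qed.

Lemma Csum_Cmod {K : Type} (F : K -> C) (B : R) (l : list K) : (forall x, In x l -> Cmod (F x) <= B) ->
  Cmod (Csum F l) <= INR (length l) * B.
Proof.
induction l; intros H. { unfold Csum; simpl. rewrite Cmod_0. lra. }
rewrite Csum_cons. simpl length. rewrite S_INR.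
assert (Cmod (F a) <= B) by (apply H; simpl; auto).
assert (Cmod (Csum F l) <= INR (length l) * B) by (apply IHl; intros; apply H; simpl; auto).
assert (T := Cmod_triangle (F a) (Csum F l)). lra.
Qed.

Lemma NoDup_map_on {K L : Type} (h : K -> L) (l : list K) : NoDup l ->
  (forall x y, In x l -> In y l -> h x = h y -> x = y) -> NoDup (map h l).
Proof.
induction l; intros N H; simpl; [constructor|]. inversion N; subst. constructor.
- intros I. apply in_map_iff in I. destruct I as [y [E I]].
  assert (y = a) by (apply H; simpl; auto). subst; contradiction.
- apply IHl; [assumption|]. intros; apply H; simpl; auto.
Qed.

Lemma NoDup_app_disj {K : Type} (l m : list K) : NoDup l -> NoDup m ->
  (forall x, In x l -> In x m -> False) -> NoDup (l ++ m).
Proof.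
induction l; intros Nl Nm H; simpl; [assumption|]. inversion Nl; subst. constructor.
- intros I. apply in_app_iff in I. destruct I; [contradiction|]. apply (H a); simpl; auto.
- apply IHl; auto. intros x I1 I2; apply (H x); simpl; auto.
Qed.

Lemma NoDup_flat_map {K L : Type} (h : K -> list L) (l : list K) : NoDup l ->
  (forall x, In x l -> NoDup (h x)) ->
  (forall x y z, In x l -> In y l -> In z (h x) -> In z (h y) -> x = y) -> NoDup (flat_map h l).
Proof.
induction l; intros N H1 H2; simpl; [constructor|]. inversion N; subst.
apply NoDup_app_disj.
- apply H1; simpl; auto.
- apply IHl; auto. intros; apply H1; simpl; auto. intros; apply (H2 x y z); simpl; auto.
- intros x I1 I2. apply in_flat_map in I2. destruct I2 as [y [I2 I3]].
  assert (a = y) by (apply (H2 a y x); simpl; auto). subst; contradiction.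
Qed.

Lemma NoDup_list_prod {K L : Type} (l : list K) (m : list L) : NoDup l -> NoDup m -> NoDup (list_prod l m).
Proof.
intros Hl Hm. rewrite list_prod_as_flat_map. apply NoDup_flat_map; [assumption|..].
- intros x _. apply NoDup_map_on; [assumption|]. intros y z _ _ E; congruence.
- intros x y z _ _ I1 I2. apply in_map_iff in I1. apply in_map_iff in I2.
  destruct I1 as [u [E1 _]], I2 as [v [E2 _]]. congruence.
Qed.

Lemma Csum_bij {K L : Type} (F : K -> C) (G : L -> C) (h : K -> L) (l : list K) (m : list L) :
  NoDup l -> NoDup m ->
  (forall x, In x l -> In (h x) m /\ F x = G (h x)) ->
  (forall x y, In x l -> In y l -> h x = h y -> x = y) ->
  (forall y, In y m -> exists x, In x l /\ h x = y) -> Csum F l = Csum G m.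
Proof.
intros Nl Nm H1 H2 H3.
rewrite (Csum_ext F (fun x => G (h x))) by (intros; apply H1; assumption).
rewrite <- Csum_map. apply Csum_perm, NoDup_Permutation; [apply NoDup_map_on; assumption|assumption|].
intros y. rewrite in_map_iff. split.
- intros [x [E I]]. subst. apply H1; assumption.
- intros I. destruct (H3 y I) as [x [I' E]]. exists x; split; assumption.
Qed.

Definition divpairs (n : nat) : list (nat * nat) :=
  filter (fun p => Nat.eqb (fst p * snd p) n) (list_prod (seq 1 n) (seq 1 n)).

Lemma in_divpairs (n a x : nat) : In (a, x) (divpairs n) <-> (1 <= a /\ 1 <= x /\ a * x = n)%nat.
Proof.
unfold divpairs. rewrite filter_In, in_prod_iff, !in_seq, Nat.eqb_eq. simpl. split; [lia|].
intros [H1 [H2 H3]]. repeat split; try lia; nia.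
Qed.

Lemma NoDup_divpairs (n : nat) : NoDup (divpairs n).
Proof. apply NoDup_filter, NoDup_list_prod; apply seq_NoDup. Qed.

Definition nC (n : nat) : C := RtoC (INR n).


Lemma nC_mult (n m : nat) : nC (n * m) = nC n * nC m.
Proof. unfold nC. rewrite mult_INR, RtoC_mult. reflexivity. Qed.

Lemma nC_S (n : nat) : nC (S n) = nC n + 1.
Proof. unfold nC. rewrite S_INR, RtoC_plus. reflexivity. Qed.

Lemma nC_minus (n m : nat) : (m <= n)%nat -> nC (n - m) = nC n - nC m.
Proof. intros. unfold nC. rewrite minus_INR, RtoC_minus by assumption. reflexivity. Qed.

Lemma nC_neq_0 (n : nat) : n <> O -> nC n <> 0.
Proof. intros H E. apply RtoC_inj in E. apply (not_0_INR n H E). Qed.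

Lemma Cmod_nC (n : nat) : Cmod (nC n) = INR n.
Proof. unfold nC. rewrite Cmod_R, Rabs_pos_eq by apply pos_INR. reflexivity. Qed.

(** The divisor power sum sigma_r(n). It is 0 at [n = 0]; the constant term of an Eisenstein series
    is supplied separately by [cseq]. *)
Definition divsum (r n : nat) : C := Csum (fun p => nC (fst p) ^ r) (divpairs n).

Lemma divsum_0 (r : nat) : divsum r 0 = 0.
Proof. reflexivity. Qed.

Lemma subexp_divsum (r : nat) : subexp (divsum r).
Proof.
apply (subexp_bound _ 1%R (2 + r)). intros n. rewrite Rmult_1_l.
assert (P := pos_INR n).
apply Rle_trans with (INR (length (divpairs n)) * INR n ^ r)%R.
- apply Csum_Cmod. intros [a x] I. apply in_divpairs in I. simpl. rewrite Cmod_pow, Cmod_nC.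
  apply pow_incr. split; [apply pos_INR|]. apply le_INR. nia.
- rewrite pow_add. apply Rmult_le_compat; try apply pos_INR; [apply pow_le; assumption| |apply pow_incr; lra].
  apply Rle_trans with (INR (n * n)).
  + apply le_INR. unfold divpairs. eapply Nat.le_trans; [apply filter_length_le|].
    rewrite length_prod, !length_seq. lia.
  + rewrite mult_INR. simpl. nra.
Qed.

(** * Sums over the positive solutions of a x + b y = n *)

Definition quad : Type := ((nat * nat) * (nat * nat))%type.

Definition quads (n : nat) : list quad :=
  filter (fun t => let '((a, b), (x, y)) := t in Nat.eqb (a * x + b * y) n)
    (list_prod (list_prod (seq 1 n) (seq 1 n)) (list_prod (seq 1 n) (seq 1 n))).

Lemma in_quads (n a b x y : nat) : In ((a, b), (x, y)) (quads n) <->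
  (1 <= a /\ 1 <= b /\ 1 <= x /\ 1 <= y /\ a * x + b * y = n)%nat.
Proof.
unfold quads. rewrite filter_In, !in_prod_iff, !in_seq, Nat.eqb_eq. split; [lia|].
intros [H1 [H2 [H3 [H4 H5]]]]. repeat split; try lia; nia.
Qed.

Lemma NoDup_quads (n : nat) : NoDup (quads n).
Proof. apply NoDup_filter, NoDup_list_prod; apply NoDup_list_prod; apply seq_NoDup. Qed.

Definition q_ab (F : nat -> nat -> C) (t : quad) : C := let '((a, b), _) := t in F a b.

Lemma conv_quads (r s n : nat) :
  cauchy_prod (divsum r) (divsum s) n = Csum (q_ab (fun a b => nC a ^ r * nC b ^ s)) (quads n).
Proof.
unfold cauchy_prod. rewrite <- Csum_seq.
rewrite (Csum_ext _ (fun i => Csum (fun pp => nC (fst (fst pp)) ^ r * nC (fst (snd pp)) ^ s)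
   (list_prod (divpairs i) (divpairs (n - i))))).
2: { intros i _. rewrite list_prod_as_flat_map, Csum_flat_map. unfold divsum.
  rewrite Cmult_comm, <- Csum_scal. apply Csum_ext. intros p _. rewrite Csum_map. cbn [fst snd].
  rewrite Csum_scal. apply Cmult_comm. }
rewrite <- Csum_flat_map.
apply (Csum_bij _ _ (fun pp => ((fst (fst pp), fst (snd pp)), (snd (fst pp), snd (snd pp))))).
- apply NoDup_flat_map; [apply seq_NoDup|..].
  + intros; apply NoDup_list_prod; apply NoDup_divpairs.
  + intros i j [[a x] [b y]] _ _ I1 I2. rewrite in_prod_iff, !in_divpairs in I1, I2. lia.
- apply NoDup_quads.
- intros [[a x] [b y]] I. split; [|reflexivity]. apply in_flat_map in I. destruct I as [i [I1 I2]].
  rewrite in_prod_iff, !in_divpairs in I2. apply in_seq in I1. simpl. apply in_quads. lia.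
- intros [[a x] [b y]] [[a' x'] [b' y']] _ _ E. simpl in E. congruence.
- intros [[a b] [x y]] I. apply in_quads in I. exists ((a, x), (b, y)). split; [|reflexivity].
  apply in_flat_map. exists (a * x)%nat. rewrite in_seq, in_prod_iff, !in_divpairs. lia.
Qed.

Definition q_lt (t : quad) : bool := let '((a, b), _) := t in Nat.ltb b a.
Definition q_eq (t : quad) : bool := let '((a, b), _) := t in Nat.eqb a b.
Definition q_lt' (t : quad) : bool := let '(_, (x, y)) := t in Nat.ltb x y.
Definition q_eq' (t : quad) : bool := let '(_, (x, y)) := t in Nat.eqb x y.

Ltac qfil := repeat match goal with
  | H : In _ (filter _ _) |- _ => apply filter_In in H; destruct H
  | H : In _ (quads _) |- _ => apply in_quads in H
  | |- In _ (filter _ _) => apply filter_In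
  | |- In _ (quads _) => apply in_quads
  | |- _ /\ _ => split
  | H : (_ <? _)%nat = true |- _ => apply Nat.ltb_lt in H
  | H : negb _ = true |- _ => apply Bool.negb_true_iff in H
  | H : (_ <? _)%nat = false |- _ => apply Nat.ltb_ge in H
  | H : (_ =? _)%nat = true |- _ => apply Nat.eqb_eq in H
  | H : (_ =? _)%nat = false |- _ => apply Nat.eqb_neq in H
  | |- (_ <? _)%nat = true => apply Nat.ltb_lt
  | |- (_ =? _)%nat = true => apply Nat.eqb_eq
  | |- negb _ = true => apply Bool.negb_true_iff
  | |- (_ <? _)%nat = false => apply Nat.ltb_ge
  | |- (_ =? _)%nat = false => apply Nat.eqb_neq
  end.

Lemma NoDup_fq (c : quad -> bool) (n : nat) : NoDup (filter c (quads n)).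
Proof. apply NoDup_filter, NoDup_quads. Qed.

Lemma NoDup_ffq (c d : quad -> bool) (n : nat) : NoDup (filter d (filter c (quads n))).
Proof. apply NoDup_filter, NoDup_fq. Qed.

Lemma quads_split_ab (F : nat -> nat -> C) (n : nat) : (forall a b, F a b = F b a) ->
  Csum (q_ab F) (quads n) = 2 * Csum (q_ab F) (filter q_lt (quads n)) + Csum (q_ab F) (filter q_eq (quads n)).
Proof.
intros S. rewrite (Csum_filter q_lt), (Csum_filter q_eq (q_ab F) (filter (fun x => negb (q_lt x)) (quads n))).
assert (E1 : Csum (q_ab F) (filter q_eq (filter (fun x => negb (q_lt x)) (quads n))) = Csum (q_ab F) (filter q_eq (quads n))).
{ apply (Csum_bij _ _ (fun t => t)); auto using NoDup_fq, NoDup_ffq.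
  - intros [[a b] [x y]] I. split; [|reflexivity]. unfold q_eq, q_lt in *. qfil; lia.
  - intros [[a b] [x y]] I. exists ((a, b), (x, y)). split; [|reflexivity]. unfold q_eq, q_lt in *. qfil; lia. }
assert (E2 : Csum (q_ab F) (filter (fun x => negb (q_eq x)) (filter (fun x => negb (q_lt x)) (quads n))) = Csum (q_ab F) (filter q_lt (quads n))).
{ apply (Csum_bij _ _ (fun t : quad => let '((a, b), (x, y)) := t in ((b, a), (y, x)))); auto using NoDup_fq, NoDup_ffq.
  - intros [[a b] [x y]] I. split; [|apply S]. unfold q_eq, q_lt in *. qfil; lia.
  - intros [[a b] [x y]] [[a' b'] [x' y']] _ _ E. congruence.
  - intros [[a b] [x y]] I. exists ((b, a), (y, x)). split; [|reflexivity]. unfold q_eq, q_lt in *. qfil; lia. }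
rewrite E1, E2. ring.
Qed.

Lemma quads_split_xy (F : nat -> nat -> C) (n : nat) : (forall a b, F a b = F b a) ->
  Csum (q_ab F) (quads n) = 2 * Csum (q_ab F) (filter q_lt' (quads n)) + Csum (q_ab F) (filter q_eq' (quads n)).
Proof.
intros S. rewrite (Csum_filter q_lt'), (Csum_filter q_eq' (q_ab F) (filter (fun x => negb (q_lt' x)) (quads n))).
assert (E1 : Csum (q_ab F) (filter q_eq' (filter (fun x => negb (q_lt' x)) (quads n))) = Csum (q_ab F) (filter q_eq' (quads n))).
{ apply (Csum_bij _ _ (fun t => t)); auto using NoDup_fq, NoDup_ffq.
  - intros [[a b] [x y]] I. split; [|reflexivity]. unfold q_eq', q_lt' in *. qfil; lia.
  - intros [[a b] [x y]] I. exists ((a, b), (x, y)). split; [|reflexivity]. unfold q_eq', q_lt' in *. qfil; lia. }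
assert (E2 : Csum (q_ab F) (filter (fun x => negb (q_eq' x)) (filter (fun x => negb (q_lt' x)) (quads n))) = Csum (q_ab F) (filter q_lt' (quads n))).
{ apply (Csum_bij _ _ (fun t : quad => let '((a, b), (x, y)) := t in ((b, a), (y, x)))); auto using NoDup_fq, NoDup_ffq.
  - intros [[a b] [x y]] I. split; [|apply S]. unfold q_eq', q_lt' in *. qfil; lia.
  - intros [[a b] [x y]] [[a' b'] [x' y']] _ _ E. congruence.
  - intros [[a b] [x y]] I. exists ((b, a), (y, x)). split; [|reflexivity]. unfold q_eq', q_lt' in *. qfil; lia. }
rewrite E1, E2. ring.
Qed.

(** Since [a x + b y = (a - b) x + b (x + y)], the map [(a, b, x, y) |-> (a - b, b, x, x + y)] is a
    bijection from the quadruples with [a > b] to those with [x < y]. *)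
Lemma quads_shear (F : nat -> nat -> C) (n : nat) :
  Csum (q_ab (fun a b => F (a - b)%nat b)) (filter q_lt (quads n)) = Csum (q_ab F) (filter q_lt' (quads n)).
Proof.
apply (Csum_bij _ _ (fun t : quad => let '((a, b), (x, y)) := t in ((a - b, b), (x, x + y))%nat)); auto using NoDup_fq.
- intros [[a b] [x y]] I. split; [|reflexivity]. unfold q_lt, q_lt' in *. qfil; lia.
- intros [[a b] [x y]] [[a' b'] [x' y']] I J E. unfold q_lt in *. qfil. injection E; intros.
  assert (a = a') by lia. assert (y = y') by lia. congruence.
- intros [[a b] [x y]] I. exists ((a + b, b), (x, y - x))%nat. unfold q_lt, q_lt' in *. split.
  + qfil; lia.
  + qfil. repeat f_equal; lia.
Qed.

(** For [a > b] the hypothesis and the shear express the sum of [g] as the sum of [F] over [a > b]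
    minus the sum of [F] over [x < y]. Splitting the full sum of [F] once by comparing [a] with [b]
    and once by comparing [x] with [y] shows that this difference comes from the two diagonals. *)
Lemma quads_identity (F g : nat -> nat -> C) (n : nat) :
  (forall a b, F a b = F b a) -> (forall a b, g a b = g b a) ->
  (forall a b, (b < a)%nat -> g a b = F a b - F (a - b)%nat b) ->
  Csum (q_ab g) (quads n) =
  Csum (q_ab F) (filter q_eq' (quads n)) + Csum (q_ab (fun a b => g a b - F a b)) (filter q_eq (quads n)).
Proof.
intros SF Sg H.
rewrite (quads_split_ab g n Sg).
assert (E : Csum (q_ab g) (filter q_lt (quads n)) = Csum (q_ab F) (filter q_lt (quads n)) - Csum (q_ab F) (filter q_lt' (quads n))).
{ rewrite <- quads_shear.
  rewrite (Csum_ext (q_ab g) (fun t => q_ab F t + - (1) * q_ab (fun a b => F (a - b)%nat b) t)).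
  rewrite Csum_plus, Csum_scal; ring.
  intros [[a b] [x y]] I. unfold q_lt in I. qfil. simpl. rewrite H by assumption. ring. }
assert (E1 := quads_split_ab F n SF). rewrite (quads_split_xy F n SF) in E1.
assert (E2 : Csum (q_ab (fun a b => g a b - F a b)) (filter q_eq (quads n)) =
  Csum (q_ab g) (filter q_eq (quads n)) - Csum (q_ab F) (filter q_eq (quads n))).
{ rewrite (Csum_ext _ (fun t => q_ab g t + - (1) * q_ab F t)).
  rewrite Csum_plus, Csum_scal; ring. intros [[a b] [x y]] _. simpl; ring. }
rewrite E, E2.
replace (Csum (q_ab F) (filter q_eq' (quads n))) with (2 * Csum (q_ab F) (filter q_lt (quads n))
  + Csum (q_ab F) (filter q_eq (quads n)) - 2 * Csum (q_ab F) (filter q_lt' (quads n))) by (rewrite <- E1; ring).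
ring.
Qed.

(** On the diagonal [x = y] the equation reads [(a + b) x = n], so [d = a + b] runs over the
    divisors and [a] over [1, ..., d - 1]. *)
Lemma quads_xy (F : nat -> nat -> C) (n : nat) :
  Csum (q_ab F) (filter q_eq' (quads n)) = Csum (fun p => csum (fun i => F (S i) (fst p - S i)%nat) (fst p - 1)) (divpairs n).
Proof.
rewrite (Csum_ext _ (fun p => Csum (fun ap => F (fst ap) (fst (snd ap) - fst ap)%nat) (map (fun a => (a, p)) (seq 1 (fst p - 1)))) (divpairs n)).
2: { intros p _. rewrite Csum_map, Csum_seq_S. reflexivity. }
rewrite <- Csum_flat_map. symmetry.
apply (Csum_bij _ _ (fun ap : nat * (nat * nat) => let '(a, (d, x)) := ap in ((a, d - a), (x, x))%nat)); auto using NoDup_fq.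
- apply NoDup_flat_map; [apply NoDup_divpairs|..].
  + intros p _. apply NoDup_map_on; [apply seq_NoDup|]. intros; congruence.
  + intros p p' z _ _ I1 I2. apply in_map_iff in I1. apply in_map_iff in I2.
    destruct I1 as [u [E1 _]], I2 as [v [E2 _]]. congruence.
- intros [a [d x]] I. apply in_flat_map in I. destruct I as [[d' x'] [I1 I2]].
  apply in_map_iff in I2. destruct I2 as [a' [E I2]]. injection E; intros; subst.
  apply in_divpairs in I1. apply in_seq in I2. simpl in I2. split; [|reflexivity].
  unfold q_eq'. qfil; lia.
- intros [a [d x]] [a' [d' x']] I I' E.
  apply in_flat_map in I. destruct I as [[u v] [I1 I2]].
  apply in_map_iff in I2. destruct I2 as [w [E2 I2]]. injection E2; intros; subst.
  apply in_flat_map in I'. destruct I' as [[u v] [I3 I4]].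
  apply in_map_iff in I4. destruct I4 as [w [E4 I4]]. injection E4; intros; subst.
  apply in_divpairs in I1. apply in_seq in I2. apply in_divpairs in I3. apply in_seq in I4. simpl in I2, I4.
  injection E; intros. assert (d = d') by lia. congruence.
- intros [[a b] [x y]] I. unfold q_eq' in I. qfil. subst y. exists (a, (a + b, x))%nat. split.
  + apply in_flat_map. exists (a + b, x)%nat. rewrite in_divpairs. split; [lia|].
    apply in_map_iff. exists a. split; [reflexivity|]. apply in_seq. simpl. lia.
  + repeat f_equal; lia.
Qed.

(** On the diagonal [a = b] the equation reads [a (x + y) = n], and a cofactor [m = x + y] splits in
    [m - 1] ways. *)
Lemma quads_ab_eq (F : nat -> nat -> C) (n : nat) :
  Csum (q_ab F) (filter q_eq (quads n)) = Csum (fun p => nC (snd p - 1) * F (fst p) (fst p)) (divpairs n).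
Proof.
rewrite (Csum_ext _ (fun p => Csum (fun ap => F (fst (snd ap)) (fst (snd ap))) (map (fun a : nat => (a, p)) (seq 1 (snd p - 1)))) (divpairs n)).
2: { intros p _. rewrite Csum_map, Csum_seq_S. cbn [fst snd].
  induction (snd p - 1)%nat as [|k IH]; simpl csum. unfold nC; simpl; ring. rewrite <- IH, nC_S; ring. }
rewrite <- Csum_flat_map. symmetry.
apply (Csum_bij _ _ (fun ap : nat * (nat * nat) => let '(x, (a, m)) := ap in ((a, a), (x, m - x))%nat)); auto using NoDup_fq.
- apply NoDup_flat_map; [apply NoDup_divpairs|..].
  + intros p _. apply NoDup_map_on; [apply seq_NoDup|]. intros; congruence.
  + intros p p' z _ _ I1 I2. apply in_map_iff in I1. apply in_map_iff in I2.
    destruct I1 as [u [E1 _]], I2 as [v [E2 _]]. congruence.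
- intros [x [a m]] I. apply in_flat_map in I. destruct I as [[d' x'] [I1 I2]].
  apply in_map_iff in I2. destruct I2 as [a' [E I2]]. injection E; intros; subst.
  apply in_divpairs in I1. apply in_seq in I2. simpl in I2. split; [|reflexivity].
  unfold q_eq. qfil; lia.
- intros [x [a m]] [x' [a' m']] I I' E.
  apply in_flat_map in I. destruct I as [[u v] [I1 I2]].
  apply in_map_iff in I2. destruct I2 as [w [E2 I2]]. injection E2; intros; subst.
  apply in_flat_map in I'. destruct I' as [[u v] [I3 I4]].
  apply in_map_iff in I4. destruct I4 as [w [E4 I4]]. injection E4; intros; subst.
  apply in_divpairs in I1. apply in_seq in I2. apply in_divpairs in I3. apply in_seq in I4. simpl in I2, I4.
  injection E; intros. assert (m = m') by lia. congruence.
- intros [[a b] [x y]] I. unfold q_eq in I. qfil. subst b. exists (x, (a, x + y))%nat. split.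
  + apply in_flat_map. exists (a, x + y)%nat. rewrite in_divpairs. split; [lia|].
    apply in_map_iff. exists x. split; [reflexivity|]. apply in_seq. simpl. lia.
  + repeat f_equal; lia.
Qed.

Lemma csum_closed (G P : nat -> C) (m : nat) : P O = 0 -> (forall i, (i < m)%nat -> P (S i) = P i + G i) -> csum G m = P m.
Proof.
intros H0 HS. induction m; simpl; [symmetry; assumption|]. rewrite IHm, HS; auto with arith.
Qed.

Lemma conv_general (F g : nat -> nat -> C) (P : C -> C) (n : nat) :
  (forall a b, F a b = F b a) -> (forall a b, g a b = g b a) ->
  (forall a b, (b < a)%nat -> g a b = F a b - F (a - b)%nat b) ->
  (forall d, (1 <= d)%nat -> csum (fun i => F (S i) (d - S i)%nat) (d - 1) = P (nC d)) ->
  Csum (q_ab g) (quads n) =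
  Csum (fun p => P (nC (fst p)) + (nC (snd p) - 1) * (g (fst p) (fst p) - F (fst p) (fst p))) (divpairs n).
Proof.
intros SF Sg H HP. rewrite (quads_identity F g n SF Sg H), quads_xy, quads_ab_eq, <- Csum_plus.
apply Csum_ext. intros [d x] I. apply in_divpairs in I. simpl fst; simpl snd.
rewrite HP by lia. rewrite nC_minus by lia. reflexivity.
Qed.

Lemma RtoC_neq (x : R) : x <> 0%R -> RtoC x <> 0.
Proof. intros H E. apply RtoC_inj in E. contradiction. Qed.

Ltac rtoc := repeat split; repeat (apply Cmult_neq_0); try (apply RtoC_neq; lra).


(** Under [a |-> a - b] the form [a^2 + a b + b^2] drops by [2 a b], its square by
    [4 (a^3 b + a b^3)] and its cube by [6 (a^5 b + a b^5) + 14 a^3 b^3]. These three choices of [F]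
    produce the convolutions of sigma_1 with sigma_1, sigma_3 and sigma_5. *)
Lemma quad2_sum (n : nat) :
  Csum (q_ab (fun a b => 2 * (nC a ^ 1 * nC b ^ 1))) (quads n) =
  Csum (fun p => (fun d => ((1)*d ^ 1 + (-6)*d ^ 2 + (5)*d ^ 3) / 6) (nC (fst p)) + (nC (snd p) - 1) *
    ((fun a b => 2 * (nC a ^ 1 * nC b ^ 1)) (fst p) (fst p) - (fun a b => nC a ^ 2 + nC a * nC b + nC b ^ 2) (fst p) (fst p))) (divpairs n).
Proof.
apply (conv_general (fun a b => nC a ^ 2 + nC a * nC b + nC b ^ 2) (fun a b => 2 * (nC a ^ 1 * nC b ^ 1)) (fun d => ((1)*d ^ 1 + (-6)*d ^ 2 + (5)*d ^ 3) / 6)).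
- intros; ring.
- intros; ring.
- intros a b Hab. rewrite nC_minus by lia. ring.
- intros d Hd.
  (* The sum of [F (i + 1) (d - i - 1)] over [i < m] as a polynomial in [m] and [d], verified
     through its difference in [m]; [m = d - 1] gives the stated polynomial in [d]. *)
  rewrite (csum_closed _ (fun m => ((1)*nC m^1*nC d^0 + (-3)*nC m^1*nC d^1 + (6)*nC m^1*nC d^2 + (3)*nC m^2*nC d^0 + (-3)*nC m^2*nC d^1 + (2)*nC m^3*nC d^0) / 6)).
  + rewrite nC_minus by lia. change (nC 1) with (RtoC 1). field; rtoc.
  + change (nC 0) with (RtoC 0). field; rtoc.
  + intros m Hm. rewrite nC_minus, !nC_S by lia. field; rtoc.
Qed.

Lemma quad4_sum (n : nat) :
  Csum (q_ab (fun a b => 4 * (nC a ^ 3 * nC b ^ 1 + nC a ^ 1 * nC b ^ 3))) (quads n) =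
  Csum (fun p => (fun d => ((-1)*d ^ 1 + (10)*d ^ 3 + (-30)*d ^ 4 + (21)*d ^ 5) / 30) (nC (fst p)) + (nC (snd p) - 1) *
    ((fun a b => 4 * (nC a ^ 3 * nC b ^ 1 + nC a ^ 1 * nC b ^ 3)) (fst p) (fst p) - (fun a b => (nC a ^ 2 + nC a * nC b + nC b ^ 2) ^ 2) (fst p) (fst p))) (divpairs n).
Proof.
apply (conv_general (fun a b => (nC a ^ 2 + nC a * nC b + nC b ^ 2) ^ 2) (fun a b => 4 * (nC a ^ 3 * nC b ^ 1 + nC a ^ 1 * nC b ^ 3)) (fun d => ((-1)*d ^ 1 + (10)*d ^ 3 + (-30)*d ^ 4 + (21)*d ^ 5) / 30)).
- intros; ring.
- intros; ring.
- intros a b Hab. rewrite nC_minus by lia. ring.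
- intros d Hd.
  rewrite (csum_closed _ (fun m => ((-1)*nC m^1*nC d^0 + (15)*nC m^1*nC d^2 + (-30)*nC m^1*nC d^3 + (30)*nC m^1*nC d^4 + (-15)*nC m^2*nC d^1 + (45)*nC m^2*nC d^2 + (-30)*nC m^2*nC d^3 + (10)*nC m^3*nC d^0 + (-30)*nC m^3*nC d^1 + (30)*nC m^3*nC d^2 + (15)*nC m^4*nC d^0 + (-15)*nC m^4*nC d^1 + (6)*nC m^5*nC d^0) / 30)).
  + rewrite nC_minus by lia. change (nC 1) with (RtoC 1). field; rtoc.
  + change (nC 0) with (RtoC 0). field; rtoc.
  + intros m Hm. rewrite nC_minus, !nC_S by lia. field; rtoc.
Qed.

Lemma quad6_sum (n : nat) :
  Csum (q_ab (fun a b => 6 * (nC a ^ 5 * nC b ^ 1 + nC a ^ 1 * nC b ^ 5) + 14 * (nC a ^ 3 * nC b ^ 3))) (quads n) =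
  Csum (fun p => (fun d => ((10)*d ^ 1 + (-49)*d ^ 3 + (210)*d ^ 5 + (-420)*d ^ 6 + (249)*d ^ 7) / 420) (nC (fst p)) + (nC (snd p) - 1) *
    ((fun a b => 6 * (nC a ^ 5 * nC b ^ 1 + nC a ^ 1 * nC b ^ 5) + 14 * (nC a ^ 3 * nC b ^ 3)) (fst p) (fst p) - (fun a b => (nC a ^ 2 + nC a * nC b + nC b ^ 2) ^ 3) (fst p) (fst p))) (divpairs n).
Proof.
apply (conv_general (fun a b => (nC a ^ 2 + nC a * nC b + nC b ^ 2) ^ 3) (fun a b => 6 * (nC a ^ 5 * nC b ^ 1 + nC a ^ 1 * nC b ^ 5) + 14 * (nC a ^ 3 * nC b ^ 3)) (fun d => ((10)*d ^ 1 + (-49)*d ^ 3 + (210)*d ^ 5 + (-420)*d ^ 6 + (249)*d ^ 7) / 420)).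
- intros; ring.
- intros; ring.
- intros a b Hab. rewrite nC_minus by lia. ring.
- intros d Hd.
  rewrite (csum_closed _ (fun m => ((10)*nC m^1*nC d^0 + (-84)*nC m^1*nC d^2 + (420)*nC m^1*nC d^4 + (-630)*nC m^1*nC d^5 + (420)*nC m^1*nC d^6 + (105)*nC m^2*nC d^1 + (-735)*nC m^2*nC d^3 + (1260)*nC m^2*nC d^4 + (-630)*nC m^2*nC d^5 + (-70)*nC m^3*nC d^0 + (840)*nC m^3*nC d^2 + (-1470)*nC m^3*nC d^3 + (840)*nC m^3*nC d^4 + (-525)*nC m^4*nC d^1 + (1260)*nC m^4*nC d^2 + (-735)*nC m^4*nC d^3 + (210)*nC m^5*nC d^0 + (-630)*nC m^5*nC d^1 + (504)*nC m^5*nC d^2 + (210)*nC m^6*nC d^0 + (-210)*nC m^6*nC d^1 + (60)*nC m^7*nC d^0) / 420)).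
  + rewrite nC_minus by lia. change (nC 1) with (RtoC 1). field; rtoc.
  + change (nC 0) with (RtoC 0). field; rtoc.
  + intros m Hm. rewrite nC_minus, !nC_S by lia. field; rtoc.
Qed.

(** Here [a^2 b^2 (a + b)^2] turns into [a^2 b^2 (a - b)^2], and the difference [4 a^3 b^3] isolates
    the convolution of sigma_3 with itself. *)
Lemma quad6'_sum (n : nat) :
  Csum (q_ab (fun a b => 4 * (nC a ^ 3 * nC b ^ 3))) (quads n) =
  Csum (fun p => (fun d => ((-1)*d ^ 3 + (1)*d ^ 7) / 30) (nC (fst p)) + (nC (snd p) - 1) *
    ((fun a b => 4 * (nC a ^ 3 * nC b ^ 3)) (fst p) (fst p) - (fun a b => nC a ^ 2 * nC b ^ 2 * (nC a + nC b) ^ 2) (fst p) (fst p))) (divpairs n).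
Proof.
apply (conv_general (fun a b => nC a ^ 2 * nC b ^ 2 * (nC a + nC b) ^ 2) (fun a b => 4 * (nC a ^ 3 * nC b ^ 3)) (fun d => ((-1)*d ^ 3 + (1)*d ^ 7) / 30)).
- intros; ring.
- intros; ring.
- intros a b Hab. rewrite nC_minus by lia. ring.
- intros d Hd.
  rewrite (csum_closed _ (fun m => ((-1)*nC m^1*nC d^2 + (5)*nC m^1*nC d^4 + (-15)*nC m^2*nC d^3 + (15)*nC m^2*nC d^4 + (10)*nC m^3*nC d^2 + (-30)*nC m^3*nC d^3 + (10)*nC m^3*nC d^4 + (15)*nC m^4*nC d^2 + (-15)*nC m^4*nC d^3 + (6)*nC m^5*nC d^2) / 30)).
  + rewrite nC_minus by lia. change (nC 1) with (RtoC 1). field; rtoc.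
  + change (nC 0) with (RtoC 0). field; rtoc.
  + intros m Hm. rewrite nC_minus, !nC_S by lia. field; rtoc.
Qed.

(** The coefficients in [l] may involve [n]: since [d x = n], a factor [x d^(r+1)] is [n d^r]. This
    is where the terms [n sigma_r(n)], that is the derivatives, come from. *)
Lemma divsum_ext_sum (n : nat) (F : nat -> nat -> C) (l : list (C * nat)) :
  (forall d x, (1 <= d)%nat -> (1 <= x)%nat -> (d * x = n)%nat ->
     F d x = fold_right (fun cr acc => fst cr * nC d ^ snd cr + acc) 0 l) ->
  Csum (fun p => F (fst p) (snd p)) (divpairs n) = fold_right (fun cr acc => fst cr * divsum (snd cr) n + acc) 0 l.
Proof.
intros H. rewrite (Csum_ext _ (fun p => fold_right (fun cr acc => fst cr * nC (fst p) ^ snd cr + acc) 0 l)).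
2: { intros [d x] I. apply in_divpairs in I. apply (H d x); lia. }
clear H. induction l as [|[c r] l IH]; simpl.
- induction (divpairs n); [reflexivity|]. rewrite Csum_cons, IHl. ring.
- rewrite Csum_plus, Csum_scal, IH. reflexivity.
Qed.

Lemma conv_1_1 (n : nat) :
  12 * cauchy_prod (divsum 1) (divsum 1) n = 5 * divsum 3 n + divsum 1 n - 6 * nC n * divsum 1 n.
Proof.
assert (H := quad2_sum n).
rewrite (Csum_ext _ (fun t => 2 * q_ab (fun a b => nC a ^ 1 * nC b ^ 1) t)) in H by (intros [[a b] [x y]] _; reflexivity).
rewrite Csum_scal, <- conv_quads in H.
rewrite (divsum_ext_sum n (fun d x => ((1) * nC d ^ 1 + (-6) * nC d ^ 2 + (5) * nC d ^ 3) / 6 + (nC x - 1) *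
  (2 * (nC d ^ 1 * nC d ^ 1) - (nC d ^ 2 + nC d * nC d + nC d ^ 2)))
  [(1 / 6 - nC n, 1%nat); (RtoC 5 / 6, 3%nat)]) in H.
- simpl in H. replace (12 * cauchy_prod (divsum 1) (divsum 1) n) with (6 * (2 * cauchy_prod (divsum 1) (divsum 1) n)) by ring.
  rewrite H. field; rtoc.
- intros d x _ _ E. subst n. rewrite nC_mult. simpl. field; rtoc.
Qed.

Lemma conv_1_3 (n : nat) :
  240 * cauchy_prod (divsum 1) (divsum 3) n = 21 * divsum 5 n + 10 * divsum 3 n - divsum 1 n - 30 * nC n * divsum 3 n.
Proof.
assert (H := quad4_sum n).
rewrite (Csum_ext _ (fun t => 4 * (q_ab (fun a b => nC a ^ 3 * nC b ^ 1) t + q_ab (fun a b => nC a ^ 1 * nC b ^ 3) t))) in H by (intros [[a b] [x y]] _; reflexivity).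
rewrite Csum_scal, Csum_plus, <- !conv_quads in H.
assert (Sw : cauchy_prod (divsum 3) (divsum 1) n = cauchy_prod (divsum 1) (divsum 3) n).
{ unfold cauchy_prod. rewrite csum_rev. apply csum_ext. intros i Hi. rewrite Cmult_comm. f_equal; f_equal; lia. }
rewrite Sw in H.
rewrite (divsum_ext_sum n (fun d x => ((-1) * nC d ^ 1 + (10) * nC d ^ 3 + (-30) * nC d ^ 4 + (21) * nC d ^ 5) / 30 + (nC x - 1) *
  (4 * (nC d ^ 3 * nC d ^ 1 + nC d ^ 1 * nC d ^ 3) - (nC d ^ 2 + nC d * nC d + nC d ^ 2) ^ 2))
  [(-1 / 30, 1%nat); (1 / 3 - nC n, 3%nat); (RtoC 21 / 30, 5%nat)]) in H.
- simpl in H. replace (240 * cauchy_prod (divsum 1) (divsum 3) n) with (30 * (4 * (cauchy_prod (divsum 1) (divsum 3) n + cauchy_prod (divsum 1) (divsum 3) n))) by ring.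
  rewrite H. field; rtoc.
- intros d x _ _ E. subst n. rewrite nC_mult. simpl. field; rtoc.
Qed.

(** The identity [E4^2 = E8] on Fourier coefficients; it serves to eliminate sigma_7 in the
    derivative of [E6]. *)
Lemma conv_3_3 (n : nat) : 120 * cauchy_prod (divsum 3) (divsum 3) n = divsum 7 n - divsum 3 n.
Proof.
assert (H := quad6'_sum n).
rewrite (Csum_ext _ (fun t => 4 * q_ab (fun a b => nC a ^ 3 * nC b ^ 3) t)) in H by (intros [[a b] [x y]] _; reflexivity).
rewrite Csum_scal, <- conv_quads in H.
rewrite (divsum_ext_sum n (fun d x => ((-1) * nC d ^ 3 + (1) * nC d ^ 7) / 30 + (nC x - 1) *
  (4 * (nC d ^ 3 * nC d ^ 3) - (nC d ^ 2 * nC d ^ 2 * (nC d + nC d) ^ 2)))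
  [(-1 / 30, 3%nat); (RtoC 1 / 30, 7%nat)]) in H.
- simpl in H. replace (120 * cauchy_prod (divsum 3) (divsum 3) n) with (30 * (4 * cauchy_prod (divsum 3) (divsum 3) n)) by ring.
  rewrite H. field; rtoc.
- intros d x _ _ E. subst n. simpl. field; rtoc.
Qed.

Lemma conv_1_5 (n : nat) :
  504 * cauchy_prod (divsum 1) (divsum 5) n = 20 * divsum 7 n - 42 * nC n * divsum 5 n + 21 * divsum 5 n + divsum 1 n.
Proof.
assert (H := quad6_sum n).
rewrite (Csum_ext _ (fun t => 6 * (q_ab (fun a b => nC a ^ 5 * nC b ^ 1) t + q_ab (fun a b => nC a ^ 1 * nC b ^ 5) t)
   + 14 * q_ab (fun a b => nC a ^ 3 * nC b ^ 3) t)) in H by (intros [[a b] [x y]] _; reflexivity).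
rewrite Csum_plus, !Csum_scal, Csum_plus, <- !conv_quads in H.
assert (Sw : cauchy_prod (divsum 5) (divsum 1) n = cauchy_prod (divsum 1) (divsum 5) n).
{ unfold cauchy_prod. rewrite csum_rev. apply csum_ext. intros i Hi. rewrite Cmult_comm. f_equal; f_equal; lia. }
rewrite Sw in H.
rewrite (divsum_ext_sum n (fun d x => ((10) * nC d ^ 1 + (-49) * nC d ^ 3 + (210) * nC d ^ 5 + (-420) * nC d ^ 6 + (249) * nC d ^ 7) / 420 + (nC x - 1) *
  (6 * (nC d ^ 5 * nC d ^ 1 + nC d ^ 1 * nC d ^ 5) + 14 * (nC d ^ 3 * nC d ^ 3) - (nC d ^ 2 + nC d * nC d + nC d ^ 2) ^ 3))
  [(10 / 420, 1%nat); (-49 / 420, 3%nat); (1 / 2 - nC n, 5%nat); (RtoC 249 / 420, 7%nat)]) in H.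
- simpl in H.
  (* The identity for the cube also contains the convolution of sigma_3 with itself, with total
     factor [42 14 = 588]; [conv_3_3] removes it. *)
  replace (504 * cauchy_prod (divsum 1) (divsum 5) n) with
   (42 * (6 * (cauchy_prod (divsum 1) (divsum 5) n + cauchy_prod (divsum 1) (divsum 5) n) + 14 * cauchy_prod (divsum 3) (divsum 3) n)
     - 588 / 120 * (120 * cauchy_prod (divsum 3) (divsum 3) n)) by (field; rtoc).
  rewrite H, conv_3_3. field; rtoc.
- intros d x _ _ E. subst n. rewrite nC_mult. simpl. field; rtoc.
Qed.

(** * Eisenstein series *)

Lemma CSeries_unique (f : nat -> C) (l : C) : clim (csum f) l -> CSeries f = l.
Proof.
intros H. assert (K : forall (g : nat -> R) x, is_lim_seq (rsum g) x -> Series g = real x).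
{ intros g x L. unfold Series. apply f_equal. apply is_lim_seq_unique.
  apply is_lim_seq_ext with (fun n => rsum g (S n)). intros; symmetry; apply sum_n_rsum.
  apply (is_lim_seq_incr_1 (rsum g)). exact L. }
unfold CSeries. destruct l as [a b]. f_equal.
- apply (K _ (Finite a)). eapply is_lim_seq_ext; [|exact (clim_Re _ _ H)]. intros; apply Re_csum.
- apply (K _ (Finite b)). assert (H' := clim_Re _ _ (clim_scal (- Ci) _ _ H)).
  assert (E : forall z : C, Re (- Ci * z) = Im z) by (intros [u v]; unfold Re, Im; simpl; ring).
  rewrite E in H'. eapply is_lim_seq_ext; [|exact H'].
  intros; cbv beta. rewrite E. apply Im_csum.
Qed.

(** The lattice points under the hyperbola [n m = M], listed column by column. Regrouped by the
    value of the product they give a partial sum of the series of divisor sums. *)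
Definition hyp_pairs (M : nat) : list (nat * nat) :=
  flat_map (fun n => map (fun m => (n, m)) (seq 1 (M / n))) (seq 1 M).

Lemma in_hyp_pairs (M n m : nat) : In (n, m) (hyp_pairs M) <-> (1 <= n /\ 1 <= m /\ n * m <= M)%nat.
Proof.
unfold hyp_pairs. rewrite in_flat_map. split.
- intros [n' [I1 I2]]. apply in_map_iff in I2. destruct I2 as [m' [E I2]]. injection E; intros; subst.
  apply in_seq in I1. apply in_seq in I2.
  assert (n * (M / n) <= M)%nat by (apply Nat.Div0.mul_div_le). nia.
- intros [H1 [H2 H3]]. exists n. split; [apply in_seq; nia|].
  apply in_map_iff. exists m. split; [reflexivity|]. apply in_seq. split; [lia|].
  assert (m <= M / n)%nat; [|lia]. apply Nat.div_le_lower_bound; lia.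
Qed.

Lemma NoDup_hyp_pairs (M : nat) : NoDup (hyp_pairs M).
Proof.
apply NoDup_flat_map; [apply seq_NoDup|..].
- intros n _. apply NoDup_map_on; [apply seq_NoDup|]. intros; congruence.
- intros n n' p _ _ I1 I2. apply in_map_iff in I1. apply in_map_iff in I2.
  destruct I1 as [u [E1 _]], I2 as [v [E2 _]]. congruence.
Qed.

Lemma hyp_pairs_divsum (r M : nat) (z : C) :
  Csum (fun p => nC (fst p) ^ r * z ^ (fst p * snd p)) (hyp_pairs M) = csum (fun n => divsum r n * z ^ n) (S M).
Proof.
rewrite csum_S, divsum_0, Cmult_0_l, Cplus_0_l.
replace (csum (fun i => divsum r (S i) * z ^ S i) M) with (Csum (fun n => divsum r n * z ^ n) (seq 1 M))
  by (rewrite Csum_seq_S; reflexivity).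
rewrite (Csum_ext (fun n => divsum r n * z ^ n) (fun n => Csum (fun p => nC (fst p) ^ r * z ^ (fst p * snd p)) (divpairs n))).
2: { intros n _. unfold divsum. rewrite Cmult_comm, <- Csum_scal. apply Csum_ext. intros [d x] I.
  apply in_divpairs in I. simpl fst; simpl snd. replace (d * x)%nat with n by lia. ring. }
rewrite <- Csum_flat_map.
apply (Csum_bij _ _ (fun p => p)); try (intros; assumption).
- apply NoDup_hyp_pairs.
- apply NoDup_flat_map; [apply seq_NoDup|..].
  + intros; apply NoDup_divpairs.
  + intros n n' [d x] _ _ I1 I2. apply in_divpairs in I1. apply in_divpairs in I2. lia.
- intros [n m] I. split; [|reflexivity]. apply in_hyp_pairs in I.
  apply in_flat_map. exists (n * m)%nat. rewrite in_seq, in_divpairs. nia.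
- intros [n m] I. exists (n, m). split; [|reflexivity]. apply in_flat_map in I.
  destruct I as [N [I1 I2]]. apply in_seq in I1. apply in_divpairs in I2. apply in_hyp_pairs. lia.
Qed.

Lemma geom_csum (w : C) (n : nat) : w <> 1 -> csum (fun i => w ^ S i) n = (w - w ^ S n) / (1 - w).
Proof.
intros H. assert (N : 1 - w <> 0). { intros E. apply H. apply Ceq_minus. rewrite <- (Copp_0), <- E. ring. }
induction n. simpl; field; assumption.
rewrite csum_Sr, IHn. simpl. field; assumption.
Qed.

Lemma one_minus_nz (z : C) : Cmod z < 1 -> 1 - z <> 0.
Proof.
intros H E. assert (z = 1). { apply Ceq_minus. rewrite <- (Copp_0), <- E. ring. }
subst. rewrite Cmod_1 in H. lra.
Qed.

Lemma Cmod_one_minus (z : C) : 1 - Cmod z <= Cmod (1 - z).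
Proof. assert (T := Cmod_tri_minus 1 z). rewrite Cmod_1 in T. lra. Qed.

Lemma Cmod_pow_le (z : C) (n m : nat) : Cmod z < 1 -> (m <= n)%nat -> Cmod (z ^ n) <= Cmod z ^ m.
Proof.
intros H L. rewrite Cmod_pow. replace n with (m + (n - m))%nat by lia. rewrite pow_add.
assert (P := Cmod_ge_0 z). rewrite <- (Rmult_1_r (Cmod z ^ m)) at 2.
apply Rmult_le_compat_l; [apply pow_le; assumption|]. rewrite <- (pow1 (n - m)). apply pow_incr; lra.
Qed.

Lemma lim_poly_geom (K : R) (k : nat) (r : R) : 0 <= r < 1 -> is_lim_seq (fun n => K * ((INR n + 1) ^ k * r ^ n))%R 0.
Proof.
intros Hr. replace (Finite 0) with (Rbar_mult K 0%R) by (simpl; f_equal; ring).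
apply is_lim_seq_scal_l.
set (s := ((1 + r) / 2)%R). set (w := sqrt s).
assert (Hs : 0 < s < 1 /\ r < s) by (unfold s; lra).
assert (Hw : (w * w)%R = s) by (apply sqrt_sqrt; lra).
assert (W1 : 0 < w) by (apply sqrt_lt_R0; lra).
assert (W2 : w < 1) by nra.
destruct (poly_geom k w ltac:(lra)) as [M [HM B]].
apply (is_lim_seq_le_le (fun _ => 0%R) _ (fun n => M * w ^ n)%R).
- intros n. assert (P := pos_INR n). assert (0 <= (INR n + 1) ^ k) by (apply pow_le; lra).
  assert (0 < w ^ n) by (apply pow_lt; assumption).
  assert (0 <= r ^ n) by (apply pow_le; lra).
  split; [apply Rmult_le_pos; lra|].
  apply Rle_trans with ((INR n + 1) ^ k * (w ^ n * w ^ n))%R.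
  + apply Rmult_le_compat_l; [assumption|]. rewrite <- Rpow_mult_distr, Hw. apply pow_incr; lra.
  + rewrite <- Rmult_assoc. apply Rmult_le_compat_r; [lra|apply B].
- apply is_lim_seq_const.
- replace (Finite 0) with (Rbar_mult M 0%R) by (simpl; f_equal; ring).
  apply is_lim_seq_scal_l, is_lim_seq_geom. rewrite Rabs_pos_eq; lra.
Qed.

(** Each geometric column, cut at the hyperbola, lacks only powers of [z] with exponent larger than
    [M]. The total error over [M] columns is a polynomial in [M] times [|z|^M]. *)
Lemma lambert (r : nat) (z : C) : Cmod z < 1 ->
  clim (csum (fun n => nC (S n) ^ r * (z ^ S n / (1 - z ^ S n)))) (psum (divsum r) z).
Proof.
intros Hz. assert (Pz := Cmod_ge_0 z).
set (d := fun M => csum (fun n => nC (S n) ^ r * (z ^ S n / (1 - z ^ S n))) M - csum (fun n => divsum r n * z ^ n) (S M)).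
assert (Hd : clim d 0).
{ apply (clim_bound_zero _ (fun M => / (1 - Cmod z) * ((INR M + 1) ^ (S r) * Cmod z ^ M))%R).
  2: apply lim_poly_geom; lra.
  intros M. replace (d M - 0) with (d M) by ring. unfold d. rewrite <- hyp_pairs_divsum.
  unfold hyp_pairs. rewrite Csum_flat_map, Csum_seq_S.
  rewrite <- csum_minus.
  apply Rle_trans with (rsum (fun _ => (INR M + 1) ^ r * (Cmod z ^ M * / (1 - Cmod z))) M)%R.
  - apply Cmod_csum_le. intros i Hi. rewrite Csum_map, Csum_seq_S. cbn [fst snd].
    change (1 + i)%nat with (S i).
    rewrite (csum_ext _ (fun k => nC (S i) ^ r * (z ^ S i) ^ S k)).
    2: { intros k _. rewrite <- Cpow_mult_r. reflexivity. }
    rewrite csum_scal, geom_csum.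
    2: { intros E. apply (one_minus_nz (z ^ S i)). 
      eapply Rle_lt_trans; [apply (Cmod_pow_le z (S i) 1 Hz); lia|]. simpl; lra. rewrite E; ring. }
    assert (Hw : Cmod (z ^ S i) <= Cmod z). { eapply Rle_trans; [apply (Cmod_pow_le z (S i) 1 Hz); lia|]. simpl; lra. }
    assert (N : 1 - z ^ S i <> 0) by (apply one_minus_nz; lra).
    match goal with |- Cmod ?A <= _ => replace A with (nC (S i) ^ r * ((z ^ S i) ^ S (M / S i) / (1 - z ^ S i))) by (field; assumption) end.
    rewrite Cmod_mult, Cmod_pow, Cmod_nC, Cmod_div by assumption.
    assert (L := Cmod_one_minus (z ^ S i)).
    apply Rmult_le_compat.
    + apply pow_le, pos_INR.
    + apply Rle_div_r; [lra|]. rewrite Rmult_0_l. apply Cmod_ge_0.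
    + apply pow_incr. split; [apply pos_INR|]. rewrite S_INR. apply Rplus_le_compat_r, le_INR; lia.
    + unfold Rdiv. apply Rmult_le_compat; [apply Cmod_ge_0|left; apply Rinv_0_lt_compat; lra| |apply Rinv_le_contravar; lra].
      rewrite <- Cpow_mult_r. apply Cmod_pow_le; [assumption|].
      assert (M < S i * S (M / S i))%nat by (apply Nat.mul_succ_div_gt; lia). lia.
  - rewrite rsum_const. assert (P := pos_INR M).
    assert (Q : 0 < / (1 - Cmod z)) by (apply Rinv_0_lt_compat; lra).
    assert (0 <= Cmod z ^ M) by (apply pow_le; assumption).
    assert (0 <= (INR M + 1) ^ r) by (apply pow_le; lra).
    replace (/ (1 - Cmod z) * ((INR M + 1) ^ S r * Cmod z ^ M))%R with
     ((INR M + 1) * ((INR M + 1) ^ r * (Cmod z ^ M * / (1 - Cmod z))))%R by (simpl; ring).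
    apply Rmult_le_compat_r; [|lra]. repeat apply Rmult_le_pos; lra. }
replace (psum (divsum r) z) with (0 + psum (divsum r) z) by ring.
eapply clim_ext; [|apply clim_plus; [exact Hd|apply (clim_subseq (csum (fun n => divsum r n * z ^ n)) _ S); [intros; lia|exact (psum_lim _ z (subexp_divsum r) Hz)]]].
intros M. unfold d. ring.
Qed.

Definition eis_seq (c : C) (r : nat) (n : nat) : C := cseq 1 n + c * divsum r n.

Lemma Wf_eisenstein (k : nat) : (1 <= k)%nat ->
  Wf (eis_seq (- RtoC (4 * INR k / bernoulli (2 * k))) (2 * k - 1)) (eisenstein k).
Proof.
intros Hk. split; [apply subexp_plus; [apply subexp_cseq|apply subexp_scal, subexp_divsum]|].
intros tau Ht. assert (Hq := Cmod_q_lt tau Ht).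
unfold eis_seq. rewrite psum_plus, psum_scal, psum_cseq; auto using subexp_cseq, subexp_scal, subexp_divsum.
unfold eisenstein.
rewrite (CSeries_unique _ (psum (divsum (2 * k - 1)) (q tau))). ring.
eapply clim_ext; [|apply lambert; exact Hq].
intros n. apply csum_ext. intros i _. unfold nC. rewrite <- RtoC_pow. reflexivity.
Qed.

(** Puts the factorials in a form that evaluates to integer literals, on which [field] can compute
    the Bernoulli numbers. *)
Lemma binomial_IZR (n k : nat) : (Binomial.C n k =
  IZR (Z.of_nat (fact n)) / (IZR (Z.of_nat (fact k)) * IZR (Z.of_nat (fact (n - k)))))%R.
Proof. unfold Binomial.C. rewrite !INR_IZR_INZ. reflexivity. Qed.

Ltac bernoulli_tac :=
  unfold bernoulli; cbn [bernoulli_upto Nat.leb sum_f_R0 Nat.add]; rewrite !binomial_IZR, !INR_IZR_INZ;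
  repeat match goal with |- context [Z.of_nat ?x] => let y := eval vm_compute in (Z.of_nat x) in
    change (Z.of_nat x) with y end; field.

Lemma bernoulli_2 : bernoulli 2 = (1 / 6)%R.
Proof. bernoulli_tac. Qed.

Lemma bernoulli_4 : bernoulli 4 = (- 1 / 30)%R.
Proof. bernoulli_tac. Qed.

Lemma bernoulli_6 : bernoulli 6 = (1 / 42)%R.
Proof. bernoulli_tac. Qed.

Lemma Wf_E2 : Wf (eis_seq (-24) 1) E2.
Proof.
assert (H := Wf_eisenstein 1 ltac:(lia)). simpl in H.
apply (Wf_ext _ _ _ _ H); [|reflexivity]. intros n. unfold eis_seq. f_equal. f_equal.
rewrite bernoulli_2, <- RtoC_opp. f_equal. field.
Qed.

Lemma Wf_E4 : Wf (eis_seq 240 3) E4.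
Proof.
assert (H := Wf_eisenstein 2 ltac:(lia)). simpl in H.
apply (Wf_ext _ _ _ _ H); [|reflexivity]. intros n. unfold eis_seq. f_equal. f_equal.
rewrite bernoulli_4, <- RtoC_opp. f_equal. field.
Qed.

Lemma Wf_E6 : Wf (eis_seq (-504) 5) E6.
Proof.
assert (H := Wf_eisenstein 3 ltac:(lia)). simpl in H.
apply (Wf_ext _ _ _ _ H); [|reflexivity]. intros n. unfold eis_seq. f_equal. f_equal.
rewrite bernoulli_6, <- RtoC_opp. f_equal. field.
Qed.

Lemma cauchy_eis (c d : C) (r s n : nat) :
  cauchy_prod (eis_seq c r) (eis_seq d s) n =
  cseq 1 n + c * divsum r n + d * divsum s n + c * d * cauchy_prod (divsum r) (divsum s) n.
Proof.
assert (K1 : forall b, cauchy_prod (cseq 1) b n = b n).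
{ intros b. unfold cauchy_prod. rewrite csum_S, csum_zero. simpl. rewrite Nat.sub_0_r. ring.
  intros i Hi; simpl; ring. }
assert (K2 : forall b, cauchy_prod b (cseq 1) n = b n).
{ intros b. transitivity (cauchy_prod (cseq 1) b n); [|apply K1]. unfold cauchy_prod. rewrite csum_rev. apply csum_ext. intros i Hi.
  rewrite Cmult_comm. f_equal; f_equal; lia. }
rewrite <- (K2 (divsum r)) at 1. rewrite <- (K1 (divsum s)) at 1. rewrite <- (K1 (cseq 1)) at 1.
unfold cauchy_prod, eis_seq. rewrite <- !csum_scal, <- !csum_plus. apply csum_ext. intros; ring.
Qed.

Lemma cseq_nC (n : nat) : nC n * cseq 1 n = 0.
Proof. destruct n; unfold nC; simpl; ring. Qed.

(** Derivation multiplies the nth coefficient by [n], which reduces each Ramanujan identity to a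
    convolution identity between divisor sums. *)
Lemma Wf_cder_eq (a b : nat -> C) (f g : C -> C) (tau : C) : Wf a f -> Wf b g -> upper tau ->
  (forall n, nC n * a n = b n) -> cder f tau (tpi * g tau).
Proof.
intros Ha [Hb Hg] Ht E. rewrite Hg by assumption.
rewrite (psum_ext b (fun n => RtoC (INR n) * a n)) by (intros; rewrite <- E; reflexivity).
apply (Wf_cder a f); assumption.
Qed.

Lemma cder_E2 (tau : C) : upper tau -> cder E2 tau (tpi * ((E2 tau * E2 tau - E4 tau) / 12)).
Proof.
intros Ht.
assert (H := Wf_scal (/ 12) _ _ (Wf_plus _ _ _ _ (Wf_mult _ _ _ _ Wf_E2 Wf_E2) (Wf_scal (- (1)) _ _ Wf_E4))).
replace ((E2 tau * E2 tau - E4 tau) / 12) with (/ 12 * (E2 tau * E2 tau + - (1) * E4 tau)) by (unfold Cdiv; ring).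
apply (Wf_cder_eq _ _ _ (fun tau => / 12 * (E2 tau * E2 tau + - (1) * E4 tau)) tau Wf_E2 H Ht).
intros n. cbv beta. rewrite cauchy_eis. unfold eis_seq.
replace (-24 * -24 * cauchy_prod (divsum 1) (divsum 1) n) with (48 * (12 * cauchy_prod (divsum 1) (divsum 1) n)) by ring.
rewrite conv_1_1, Cmult_plus_distr_l, cseq_nC. field; rtoc.
Qed.

Lemma cder_E4 (tau : C) : upper tau -> cder E4 tau (tpi * ((E2 tau * E4 tau - E6 tau) / 3)).
Proof.
intros Ht.
assert (H := Wf_scal (/ 3) _ _ (Wf_plus _ _ _ _ (Wf_mult _ _ _ _ Wf_E2 Wf_E4) (Wf_scal (- (1)) _ _ Wf_E6))).
replace ((E2 tau * E4 tau - E6 tau) / 3) with (/ 3 * (E2 tau * E4 tau + - (1) * E6 tau)) by (unfold Cdiv; ring).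
apply (Wf_cder_eq _ _ _ (fun tau => / 3 * (E2 tau * E4 tau + - (1) * E6 tau)) tau Wf_E4 H Ht).
intros n. cbv beta. rewrite cauchy_eis. unfold eis_seq.
replace (-24 * 240 * cauchy_prod (divsum 1) (divsum 3) n) with (-24 * (240 * cauchy_prod (divsum 1) (divsum 3) n)) by ring.
rewrite conv_1_3, Cmult_plus_distr_l, cseq_nC. field; rtoc.
Qed.

Lemma cder_E6 (tau : C) : upper tau -> cder E6 tau (tpi * ((E2 tau * E6 tau - E4 tau * E4 tau) / 2)).
Proof.
intros Ht.
assert (H := Wf_scal (/ 2) _ _ (Wf_plus _ _ _ _ (Wf_mult _ _ _ _ Wf_E2 Wf_E6) (Wf_scal (- (1)) _ _ (Wf_mult _ _ _ _ Wf_E4 Wf_E4)))).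
replace ((E2 tau * E6 tau - E4 tau * E4 tau) / 2) with (/ 2 * (E2 tau * E6 tau + - (1) * (E4 tau * E4 tau))) by (unfold Cdiv; ring).
apply (Wf_cder_eq _ _ _ (fun tau => / 2 * (E2 tau * E6 tau + - (1) * (E4 tau * E4 tau))) tau Wf_E6 H Ht).
intros n. cbv beta. rewrite !cauchy_eis. unfold eis_seq.
replace (-24 * -504 * cauchy_prod (divsum 1) (divsum 5) n) with (24 * (504 * cauchy_prod (divsum 1) (divsum 5) n)) by ring.
replace (240 * 240 * cauchy_prod (divsum 3) (divsum 3) n) with (480 * (120 * cauchy_prod (divsum 3) (divsum 3) n)) by ring.
rewrite conv_1_5, conv_3_3, Cmult_plus_distr_l, cseq_nC. field; rtoc.
Qed.

(** * The Lipschitz formula in weight 4 *)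

Definition csin (w : C) : C := (sin (Re w) * cosh (Im w), cos (Re w) * sinh (Im w))%R.

Lemma csin_Cexp (w : C) : 2 * Ci * csin w = Cexp (Ci * w) - Cexp (- (Ci * w)).
Proof.
destruct w as [x y]. unfold csin, Cexp, cosh, sinh, Cminus, Cplus, Copp, Cmult, Ci, RtoC; simpl.
replace (0 * x - 1 * y)%R with (- y)%R by ring. replace (0 * y + 1 * x)%R with x by ring.
rewrite Ropp_involutive, cos_neg, sin_neg. f_equal; field.
Qed.

Lemma csin_sq (w : C) : 4 * Cexp (2 * Ci * w) * (csin w * csin w) = - ((1 - Cexp (2 * Ci * w)) * (1 - Cexp (2 * Ci * w))).
Proof.
assert (E1 : Cexp (2 * Ci * w) = Cexp (Ci * w) * Cexp (Ci * w)) by (rewrite <- Cexp_plus; f_equal; ring).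
assert (E2 : Cexp (Ci * w) * Cexp (- (Ci * w)) = 1) by (rewrite <- Cexp_plus, <- Cexp_0; f_equal; ring).
assert (H := csin_Cexp w).
assert (I2 : Ci * Ci = - (1)) by (unfold Ci, Cmult, Copp, RtoC; simpl; f_equal; ring).
replace (4 * Cexp (2 * Ci * w) * (csin w * csin w)) with
  (- (Cexp (2 * Ci * w) * ((2 * Ci * csin w) * (2 * Ci * csin w)))).
2: { replace (2 * Ci * csin w * (2 * Ci * csin w)) with (4 * (Ci * Ci) * (csin w * csin w)) by ring. rewrite I2. ring. }
rewrite H, E1. 
replace (Cexp (Ci * w) * Cexp (Ci * w) * ((Cexp (Ci * w) - Cexp (- (Ci * w))) * (Cexp (Ci * w) - Cexp (- (Ci * w)))))
 with ((Cexp (Ci * w) * Cexp (Ci * w) - Cexp (Ci * w) * Cexp (- (Ci * w))) * (Cexp (Ci * w) * Cexp (Ci * w) - Cexp (Ci * w) * Cexp (- (Ci * w)))) by ring.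
rewrite E2. ring.
Qed.

Lemma cosh_bounds (y : R) : 1 <= cosh y /\ (Rabs y <= 1 / 2 -> cosh y <= 1 + 2 * (y * y)).
Proof.
unfold cosh. split.
- generalize (exp_ineq1_le y), (exp_ineq1_le (- y)). lra.
- intros H. assert (A := Rabs_exp_sub y H).
  assert (B := Rabs_exp_sub (- y)). rewrite Rabs_Ropp in B. specialize (B H).
  apply Rabs_le_between in A. apply Rabs_le_between in B. lra.
Qed.

Lemma sinh_bounds (y : R) : Rabs y <= Rabs (sinh y) /\
  (Rabs y <= 1 / 2 -> Rabs (sinh y - y) <= 2 * (y * y) * Rabs y).
Proof.
assert (K : forall y, 0 < y -> y <= sinh y /\ (y <= 1 / 2 -> Rabs (sinh y - y) <= 2 * (y * y) * y)).
{ intros t Ht. destruct (MVT_cor2 sinh cosh 0 t Ht) as [c [E Hc]].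
  { intros; apply derivable_pt_lim_sinh. }
  rewrite sinh_0, !Rminus_0_r in E. rewrite E. destruct (cosh_bounds c) as [C1 C2].
  split; [nra|]. intros H. specialize (C2 ltac:(rewrite Rabs_pos_eq; lra)).
  rewrite Rabs_pos_eq by nra. replace (cosh c * t - t)%R with ((cosh c - 1) * t)%R by ring.
  apply Rmult_le_compat_r; nra. }
assert (O : sinh (- y) = (- sinh y)%R) by (unfold sinh; rewrite Ropp_involutive; field).
destruct (Rtotal_order y 0) as [H|[H|H]].
- destruct (K (- y)%R ltac:(lra)) as [K1 K2]. rewrite O in K1, K2.
  rewrite (Rabs_left y), (Rabs_left (sinh y)) by lra. split; [lra|]. intros L. specialize (K2 L).
  replace (sinh y - y)%R with (- (- sinh y - - y))%R by ring. rewrite Rabs_Ropp. nra.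
- subst. rewrite sinh_0, Rminus_0_r, Rabs_R0. split; intros; lra.
- destruct (K y H) as [K1 K2]. rewrite (Rabs_pos_eq y), (Rabs_pos_eq (sinh y)) by lra. split; auto.
Qed.

Lemma sin_lower (x : R) : Rabs x <= 2 -> 1 / 4 * Rabs x <= Rabs (sin x).
Proof.
intros H. replace x with (2 * (x / 2))%R at 2 by field. rewrite sin_2a.
assert (S := Rabs_sin_sub (x / 2)). assert (K := Rabs_cos_sub (x / 2)).
assert (Q : x / 2 * (x / 2) <= 1).
{ replace (x / 2 * (x / 2))%R with (Rabs (x / 2) * Rabs (x / 2))%R by (rewrite <- Rabs_mult, Rabs_pos_eq by nra; reflexivity).
  assert (E : Rabs (x / 2) = (Rabs x / 2)%R) by (unfold Rdiv; rewrite Rabs_mult, (Rabs_pos_eq (/ 2)) by lra; reflexivity).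
  rewrite E. generalize (Rabs_pos x). nra. }
rewrite !Rabs_mult, (Rabs_pos_eq 2) by lra.
apply Rabs_le_between in K.
assert (Kc : 1 / 2 <= Rabs (cos (x / 2))) by (rewrite Rabs_pos_eq; lra).
assert (E : Rabs (x / 2) = (Rabs x / 2)%R) by (unfold Rdiv; rewrite Rabs_mult, (Rabs_pos_eq (/ 2)) by lra; reflexivity).
assert (T := Rabs_triang (sin (x / 2)) (x / 2 - sin (x / 2))).
replace (sin (x / 2) + (x / 2 - sin (x / 2)))%R with (x / 2)%R in T by ring.
rewrite Rabs_minus_sym in S. rewrite E in *.
assert (P := Rabs_pos x).
assert (S2 : 1 / 4 * Rabs x <= Rabs (sin (x / 2))) by nra.
nra.
Qed.

(** From [|sin w|^2 = sin^2 x + sinh^2 y], where both summands have lower bounds in terms of [x] and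
    [y]. *)
Lemma csin_lower (w : C) : Rabs (Re w) <= 2 -> 1 / 4 * Cmod w <= Cmod (csin w).
Proof.
destruct w as [x y]. simpl. intros H. unfold Cmod, csin; simpl.
assert (S := sin_lower x H). destruct (sinh_bounds y) as [S' _].
assert (E : (cosh y * cosh y = 1 + sinh y * sinh y)%R).
{ unfold cosh, sinh. replace (exp (- y)) with (/ exp y)%R by (symmetry; apply exp_Ropp). field. apply Rgt_not_eq, exp_pos. }
replace (sin x * cosh y * (sin x * cosh y * 1) + cos x * sinh y * (cos x * sinh y * 1))%R with
  (sin x * sin x * (cosh y * cosh y) + (cos x * cos x) * (sinh y * sinh y))%R by ring.
assert (F : (cos x * cos x = 1 - sin x * sin x)%R) by (generalize (sin2_cos2 x); unfold Rsqr; lra).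
rewrite E, F.
replace (1 / 4)%R with (sqrt (1 / 4 * (1 / 4))) by (apply sqrt_square; lra).
rewrite <- sqrt_mult_alt by lra. apply sqrt_le_1_alt.
assert (A : forall u v, 1 / 4 * Rabs u <= Rabs v -> 1 / 4 * (1 / 4) * (u * u) <= v * v).
{ intros u v L. replace (u * u)%R with (Rabs u * Rabs u)%R by (rewrite <- Rabs_mult, Rabs_pos_eq by nra; reflexivity).
  replace (v * v)%R with (Rabs v * Rabs v)%R by (rewrite <- Rabs_mult, Rabs_pos_eq by nra; reflexivity).
  generalize (Rabs_pos u). nra. }
assert (A1 := A x (sin x) S).
assert (A2 := A y (sinh y) ltac:(generalize (Rabs_pos y); lra)). nra.
Qed.

Lemma csin_upper (w : C) : Cmod w <= 1 / 2 -> Cmod (csin w - w) <= 6 * Cmod w ^ 3.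
Proof.
intros H. eapply Rle_trans; [apply Cmod_Re_Im|].
assert (Rm := Rmax_Cmod w). assert (M1 := Rmax_l (Rabs (fst w)) (Rabs (snd w))).
assert (M2 := Rmax_r (Rabs (fst w)) (Rabs (snd w))).
destruct w as [x y]. simpl fst in *; simpl snd in *. set (m := Cmod (x, y)) in *.
change (Re (csin (x, y) - (x, y))) with (sin x * cosh y - x)%R.
change (Im (csin (x, y) - (x, y))) with (cos x * sinh y - y)%R.
assert (Hx : Rabs x <= m) by lra. assert (Hy : Rabs y <= m) by lra.
assert (Px := Rabs_pos x). assert (Py := Rabs_pos y).
assert (X2 : x * x <= m * m).
{ replace (x * x)%R with (Rabs x * Rabs x)%R by (rewrite <- Rabs_mult, Rabs_pos_eq by nra; reflexivity). nra. }
assert (Y2 : y * y <= m * m).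
{ replace (y * y)%R with (Rabs y * Rabs y)%R by (rewrite <- Rabs_mult, Rabs_pos_eq by nra; reflexivity). nra. }
assert (X0 : 0 <= x * x) by nra. assert (Y0 : 0 <= y * y) by nra.
destruct (cosh_bounds y) as [C1 C2]. specialize (C2 ltac:(lra)).
destruct (sinh_bounds y) as [_ S2]. specialize (S2 ltac:(lra)).
assert (Sx := Rabs_sin_sub x). assert (Cx := Rabs_cos_sub x).
assert (m0 : 0 <= m) by lra. assert (mm : m * m <= 1 / 4) by nra.
assert (m3 : 0 <= m * (m * m)) by nra.
assert (B1 : Rabs (sin x - x) <= m * (m * m) / 2).
{ eapply Rle_trans; [exact Sx|]. apply Rle_trans with (m * (m * m / 2))%R; [|lra]. apply Rmult_le_compat; lra. }
assert (B2 : Rabs (sinh y - y) <= 2 * (m * (m * m))).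
{ eapply Rle_trans; [exact S2|]. apply Rle_trans with (2 * (m * m) * m)%R; [|lra]. apply Rmult_le_compat; lra. }
assert (B3 : Rabs (sinh y) <= 2 * m).
{ replace (sinh y) with ((sinh y - y) + y)%R by ring. eapply Rle_trans; [apply Rabs_triang|]. nra. }
assert (T1 : Rabs (sin x * cosh y - x) <= 3 * (m * (m * m))).
{ replace (sin x * cosh y - x)%R with ((sin x - x) * cosh y + x * (cosh y - 1))%R by ring.
  eapply Rle_trans; [apply Rabs_triang|]. rewrite !Rabs_mult, (Rabs_pos_eq (cosh y)), (Rabs_pos_eq (cosh y - 1)) by lra.
  assert (Rabs (sin x - x) * cosh y <= m * (m * m) / 2 * (3 / 2)) by (apply Rmult_le_compat; try apply Rabs_pos; lra).
  assert (Rabs x * (cosh y - 1) <= m * (2 * (m * m))) by (apply Rmult_le_compat; lra). lra. }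
assert (T2 : Rabs (cos x * sinh y - y) <= 3 * (m * (m * m))).
{ replace (cos x * sinh y - y)%R with (- ((1 - cos x) * sinh y) + (sinh y - y))%R by ring.
  eapply Rle_trans; [apply Rabs_triang|]. rewrite Rabs_Ropp, Rabs_mult.
  assert (Rabs (1 - cos x) * Rabs (sinh y) <= m * m / 2 * (2 * m)) by (apply Rmult_le_compat; try apply Rabs_pos; lra). lra. }
simpl. lra.
Qed.

(** For [x = q z] this is [pi^4 (1 / sin^4 - 2 / (3 sin^2))] at [pi z], see [Aq_csin], the closed
    form of the sum of [(z + n)^-4] over all integers [n]. The prefactor is [(2 pi i)^4 / 3!] and
    the fraction generates the cubes. *)
Definition Aq (x : C) : C := 8 * RtoC PI ^ 4 / 3 * (x * (1 + 4 * x + x * x) / (1 - x) ^ 4).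

Lemma Aq_csin (x s : C) : s <> 0 -> x <> 0 -> 4 * x * (s * s) = - ((1 - x) * (1 - x)) ->
  1 - x <> 0 /\ Aq x = RtoC PI ^ 4 * (/ (s * s * (s * s)) - RtoC 2 / 3 * / (s * s)).
Proof.
intros Hs Hx E.
assert (N : 1 - x <> 0).
{ intros Z. rewrite Z in E. apply (Cmult_neq_0 (4 * x) (s * s)); [|apply Cmult_neq_0; assumption|rewrite E; ring].
  apply Cmult_neq_0; [|assumption]. apply RtoC_neq; lra. }
split; [assumption|].
assert (E2 : s * s = - ((1 - x) * (1 - x)) / (4 * x)) by (rewrite <- E; field; assumption).
rewrite E2. unfold Aq. field. repeat split; try assumption.
Qed.

(** Only the quartic pole at 0 is subtracted; the remaining error of order [|z|^-2] is one that the
    duplication argument tolerates. All constants are crude. *)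
Lemma lipschitz_pole : exists K : R, 0 <= K /\ forall z : C, z <> 0 -> Rabs (Re z) <= 1 / 2 ->
  1 - q z <> 0 /\ Cmod (Aq (q z) - / z ^ 4) <= K * (1 + / (Cmod z ^ 2)).
Proof.
assert (P1 := PI_RGT_0). assert (P4 := PI_4).
assert (P3 : 3 < PI) by (generalize PI2_3_2; unfold PI2; lra).
exists (4 ^ 4 * 100000)%R. split; [simpl; lra|]. intros z Hz HR.
set (w := RtoC PI * z).
assert (Hw : w <> 0). { apply Cmult_neq_0; [|assumption]. intros E; apply RtoC_inj in E; lra. }
assert (Ew : Cmod w = (PI * Cmod z)%R) by (unfold w; rewrite Cmod_mult, Cmod_R, Rabs_pos_eq by lra; reflexivity).
assert (Rw : Rabs (Re w) <= 2).
{ unfold w. rewrite re_scal_l, Rabs_mult, (Rabs_pos_eq PI) by lra.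
  assert (0 <= Rabs (Re z)) by apply Rabs_pos. nra. }
assert (L := csin_lower w Rw). set (s := csin w) in *.
assert (Pz : 0 < Cmod z) by (apply Cmod_gt_0; assumption).
assert (Pw : 0 < Cmod w) by (apply Cmod_gt_0; assumption).
assert (Hs : s <> 0). { apply Cmod_gt_0. lra. }
assert (Eq : q z = Cexp (2 * Ci * w)) by (unfold q, w; f_equal; ring).
destruct (Aq_csin (q z) s Hs (q_nz z)) as [N EA]. { rewrite Eq. apply csin_sq. }
split; [assumption|]. rewrite EA.
assert (Ez : / z ^ 4 = RtoC PI ^ 4 * / (w * w * (w * w))).
{ unfold w. field. repeat split; try assumption. intros E; apply RtoC_inj in E; lra. }
rewrite Ez.
replace (RtoC PI ^ 4 * (/ (s * s * (s * s)) - RtoC 2 / 3 * / (s * s)) - RtoC PI ^ 4 * / (w * w * (w * w))) with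
  (RtoC PI ^ 4 * ((/ (s * s * (s * s)) - / (w * w * (w * w))) + - (RtoC 2 / 3 * / (s * s)))) by ring.
rewrite Cmod_mult, Cmod_pow, Cmod_R, Rabs_pos_eq by lra.
set (t := Cmod w) in *. set (m := Cmod s) in *.
assert (m0 : 0 < m) by lra.
assert (m2 : 1 / 16 * (t * t) <= m * m) by nra.
assert (t20 : 0 < t * t) by nra.
assert (t40 : 0 < t * t * (t * t)) by nra.
assert (m4 : 1 / 256 * (t * t * (t * t)) <= m * m * (m * m)) by nra.
assert (B2 : Cmod (- (RtoC 2 / 3 * / (s * s))) <= 11 * / (t * t)).
{ rewrite Cmod_opp, Cmod_mult, Cmod_inv, Cmod_mult by (auto using Cmult_neq_0). fold m.
  rewrite <- RtoC_div, Cmod_R, Rabs_pos_eq by lra.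
  apply Rmult_le_reg_r with (m * m * (t * t))%R; [nra|].
  replace (2 / 3 * / (m * m) * (m * m * (t * t)))%R with (2 / 3 * (t * t))%R by (field; lra).
  replace (11 * / (t * t) * (m * m * (t * t)))%R with (11 * (m * m))%R by (field; lra). lra. }
assert (B1 : Cmod (/ (s * s * (s * s)) - / (w * w * (w * w))) <= 50000 * (1 + / (t * t))).
{ assert (Pi : 0 < / (t * t)) by (apply Rinv_0_lt_compat; assumption).
  (* Near 0 the factor [w - s] of the difference of fourth powers is of third order; away from 0 the
     two quartic terms are bounded one by one. *)
  destruct (Rle_lt_dec t (1 / 2)) as [Ht|Ht].
  - replace (/ (s * s * (s * s)) - / (w * w * (w * w))) with ((w - s) * (w + s) * (w * w + s * s) / (s * s * (s * s) * (w * w * (w * w)))) by (field; split; assumption).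
    assert (U := csin_upper w Ht). fold s t in U.
    rewrite Cmod_div by (auto 7 using Cmult_neq_0). rewrite !Cmod_mult. fold t m.
    assert (U1 : Cmod (w - s) <= 6 * t ^ 3). { replace (w - s) with (- (s - w)) by ring. rewrite Cmod_opp. assumption. }
    assert (t3 : t ^ 3 <= t / 4) by (simpl; nra).
    assert (Us : m <= 5 / 2 * t).
    { assert (T := Cmod_tri_minus s w). fold m t in T. lra. }
    assert (U2 : Cmod (w + s) <= 7 / 2 * t). { eapply Rle_trans; [apply Cmod_triangle|]. fold t m. lra. }
    assert (U3 : Cmod (w * w + s * s) <= 8 * (t * t)).
    { eapply Rle_trans; [apply Cmod_triangle|]. rewrite !Cmod_mult. fold t m. nra. }
    assert (U4 : Cmod (w - s) * Cmod (w + s) * Cmod (w * w + s * s) <= 168 * (t ^ 3 * t * (t * t))).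
    { apply Rle_trans with (6 * t ^ 3 * (7 / 2 * t) * (8 * (t * t)))%R; [|right; field].
      apply Rmult_le_compat; try assumption; try apply Cmod_ge_0.
      apply Rmult_le_pos; apply Cmod_ge_0. apply Rmult_le_compat; try assumption; apply Cmod_ge_0. }
    apply Rle_trans with (50000 * / (t * t))%R; [|lra].
    apply Rle_div_l. { repeat apply Rmult_lt_0_compat; lra. }
    eapply Rle_trans; [exact U4|].
    replace (50000 * / (t * t) * (m * m * (m * m) * (t * t * (t * t))))%R with (50000 * (m * m * (m * m)) * (t * t))%R by (field; lra).
    replace (168 * (t ^ 3 * t * (t * t)))%R with (168 * (t * t * (t * t)) * (t * t))%R by ring.
    apply Rmult_le_compat_r; lra.
  - eapply Rle_trans; [apply Cmod_triangle|]. rewrite Cmod_opp, !Cmod_inv, !Cmod_mult by (auto 7 using Cmult_neq_0).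
    fold m t. assert (t2 : 1 / 4 <= t * t) by nra. assert (t4 : 1 / 16 <= t * t * (t * t)) by nra.
    assert (/ (m * m * (m * m)) <= / (1 / 4096)) by (apply Rinv_le_contravar; lra).
    assert (/ (t * t * (t * t)) <= / (1 / 16)) by (apply Rinv_le_contravar; lra).
    replace (/ (1 / 4096))%R with 4096%R in * by field. replace (/ (1 / 16))%R with 16%R in * by field. lra. }
assert (Pi : / (t * t) <= / (Cmod z ^ 2)).
{ apply Rinv_le_contravar; [simpl; nra|]. rewrite Ew. simpl.
  rewrite Rmult_1_r. apply Rmult_le_compat; nra. }
assert (Pi0 : 0 < / (t * t)) by (apply Rinv_0_lt_compat; assumption).
assert (Q : PI ^ 4 <= 4 ^ 4) by (apply pow_incr; lra).
rewrite Rmult_assoc. apply Rmult_le_compat; [apply pow_le; lra|apply Cmod_ge_0|assumption|].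
eapply Rle_trans; [apply Cmod_triangle|]. lra.
Qed.

(** The shifts run over the unsymmetric range [-N, ..., N - 1], which duplication reproduces
    exactly: the points [z / 2] and [(z + 1) / 2] contribute the even and odd shifts from [-2 N] to
    [2 N - 1]. *)
Definition Sym4 (N : nat) (z : C) : C := csum (fun d => / (z + nC d) ^ 4 + / (z - nC (S d)) ^ 4) N.

Definition Sym2 (N : nat) (z : C) : R :=
  rsum (fun d => / Cmod (z + nC d) ^ 2 + / Cmod (z - nC (S d)) ^ 2)%R N.

Definition nonint (z : C) : Prop := forall k : Z, z <> RtoC (IZR k).

Lemma nC_IZR (n : nat) : nC n = RtoC (IZR (Z.of_nat n)).
Proof. unfold nC. rewrite INR_IZR_INZ. reflexivity. Qed.

Lemma nonint_plus (z : C) (n : nat) : nonint z -> z + nC n <> 0.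
Proof.
intros H E. apply (H (- Z.of_nat n)%Z). rewrite opp_IZR, RtoC_opp, <- nC_IZR.
apply Ceq_minus. rewrite <- E. ring.
Qed.

Lemma nonint_minus (z : C) (n : nat) : nonint z -> z - nC n <> 0.
Proof. intros H E. apply (H (Z.of_nat n)). rewrite <- nC_IZR. apply Ceq_minus, E. Qed.

Lemma nonint_half (z : C) (j : nat) : nonint z -> nonint ((z + nC j) / 2).
Proof.
intros H k E. apply (H (2 * k - Z.of_nat j)%Z). rewrite minus_IZR, mult_IZR, RtoC_minus, RtoC_mult, <- E, <- nC_IZR.
field.
Qed.

Lemma nonint_Im (z : C) : Im z <> 0%R -> nonint z.
Proof. intros H k E. apply H. rewrite E. reflexivity. Qed.

Lemma nC_2 (N : nat) : nC (2 * N) = 2 * nC N.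
Proof. rewrite nC_mult. reflexivity. Qed.

Lemma Sym4_double (N : nat) (z : C) : nonint z ->
  Sym4 N ((z + nC 0) / 2) + Sym4 N ((z + nC 1) / 2) = 16 * Sym4 (2 * N) z.
Proof.
intros H. induction N. { unfold Sym4; simpl. ring. }
replace (2 * S N)%nat with (S (S (2 * N))) by lia.
unfold Sym4 in *. rewrite !csum_Sr.
match goal with |- ?a + ?b + (?c + ?d) = _ => replace (a + b + (c + d)) with ((a + c) + (b + d)) by ring end.
rewrite IHN. rewrite !nC_S, nC_2. change (nC 0) with (RtoC 0). 
assert (A1 := nonint_plus z (2 * N) H). assert (A2 := nonint_plus z (S (2 * N)) H).
assert (A3 := nonint_minus z (S (2 * N)) H). assert (A4 := nonint_minus z (S (S (2 * N))) H).
rewrite ?nC_S, nC_2 in *.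
replace ((z + 0) / 2 + nC N) with ((z + 2 * nC N) / 2) by field.
replace ((z + 0) / 2 - (nC N + 1)) with ((z - (2 * nC N + 1 + 1)) / 2) by field.
replace ((z + (0 + 1)) / 2 + nC N) with ((z + (2 * nC N + 1)) / 2) by field.
replace ((z + (0 + 1)) / 2 - (nC N + 1)) with ((z - (2 * nC N + 1)) / 2) by field.
assert (F : forall u : C, u <> 0 -> / (u / 2) ^ 4 = 16 * / u ^ 4) by (intros; field; assumption).
rewrite !F by assumption. ring.
Qed.

Lemma Sym2_double (N : nat) (z : C) : nonint z ->
  (Sym2 N ((z + nC 0) / 2) + Sym2 N ((z + nC 1) / 2) = 4 * Sym2 (2 * N) z)%R.
Proof.
intros H. induction N. { unfold Sym2; simpl. ring. }
replace (2 * S N)%nat with (S (S (2 * N))) by lia.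
unfold Sym2 in *.
rewrite !rsum_Sr.
match goal with |- (?a + ?b + (?c + ?d))%R = _ => replace (a + b + (c + d))%R with ((a + c) + (b + d))%R by ring end.
rewrite IHN. rewrite !nC_S, nC_2. change (nC 0) with (RtoC 0). 
assert (A1 := nonint_plus z (2 * N) H). assert (A2 := nonint_plus z (S (2 * N)) H).
assert (A3 := nonint_minus z (S (2 * N)) H). assert (A4 := nonint_minus z (S (S (2 * N))) H).
rewrite ?nC_S, nC_2 in *.
replace ((z + 0) / 2 + nC N) with ((z + 2 * nC N) / 2) by field.
replace ((z + 0) / 2 - (nC N + 1)) with ((z - (2 * nC N + 1 + 1)) / 2) by field.
replace ((z + (0 + 1)) / 2 + nC N) with ((z + (2 * nC N + 1)) / 2) by field.
replace ((z + (0 + 1)) / 2 - (nC N + 1)) with ((z - (2 * nC N + 1)) / 2) by field.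
assert (F : forall u : C, u <> 0 -> (/ Cmod (u / 2) ^ 2 = 4 * / Cmod u ^ 2)%R).
{ intros u Hu. rewrite Cmod_div, Cmod_R, Rabs_pos_eq by (try apply RtoC_neq; lra).
  apply Cmod_gt_0 in Hu. field. lra. }
rewrite !F by assumption. ring.
Qed.

(** With [u = q (z / 2)] the other half-point [(z + 1) / 2] gives [- u], so this is the counterpart
    of [Sym4_double] for the closed form. *)
Lemma Aq_double (u : C) : 1 - u * u <> 0 -> Aq u + Aq (- u) = 16 * Aq (u * u).
Proof.
intros H. unfold Aq.
assert (1 - u <> 0) by (intros E; apply H; replace (1 - u * u) with ((1 - u) * (1 + u)) by ring; rewrite E; ring).
assert (1 + u <> 0) by (intros E; apply H; replace (1 - u * u) with ((1 - u) * (1 + u)) by ring; rewrite E; ring).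
field. repeat split; try assumption. replace (1 - - u) with (1 + u) by ring. assumption.
Qed.

Lemma q_half : q (1 / 2) = - (1).
Proof.
unfold q. replace (2 * RtoC PI * Ci * (1 / 2)) with (0, PI)%R.
2: { replace (2 * RtoC PI * Ci * (1 / 2)) with (RtoC PI * Ci) by field. unfold RtoC, Ci, Cmult; simpl; f_equal; ring. }
unfold Cexp; simpl. rewrite exp_0, cos_PI, sin_PI. unfold RtoC, Copp; simpl; f_equal; ring.
Qed.

Lemma csum_one_off (f : nat -> C) (t : C) (b : nat -> R) (i N : nat) : (i < N)%nat ->
  (forall j, 0 <= b j) -> (forall j, j <> i -> Cmod (f j) <= b j) -> Cmod (f i - t) <= b i ->
  Cmod (csum f N - t) <= rsum b N.
Proof.
intros Hi Hb Hj Ht. induction N; [lia|]. rewrite csum_Sr. simpl rsum.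
destruct (Nat.eq_dec i N).
- subst. replace (csum f N + f N - t) with (csum f N + (f N - t)) by ring.
  eapply Rle_trans; [apply Cmod_triangle|]. apply Rplus_le_compat; [|assumption].
  apply Cmod_csum_le. intros j L. apply Hj. lia.
- replace (csum f N + f N - t) with ((csum f N - t) + f N) by ring.
  eapply Rle_trans; [apply Cmod_triangle|]. apply Rplus_le_compat; [apply IHN; lia|apply Hj; auto].
Qed.

Lemma pow4_le_pow2 (u : C) : 1 / 2 <= Cmod u -> Cmod (/ u ^ 4) <= 4 * / Cmod u ^ 2.
Proof.
intros H. assert (Hu : u <> 0) by (apply Cmod_gt_0; lra).
rewrite Cmod_inv, Cmod_pow by (apply Cpow_nz; assumption).
set (t := Cmod u) in *. assert (0 < t * t) by nra.
replace (/ t ^ 4)%R with (/ (t * t) * / t ^ 2)%R by (field; lra).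
apply Rmult_le_compat_r. { left; apply Rinv_0_lt_compat; simpl; nra. }
replace 4%R with (/ (1 / 4))%R by field. apply Rinv_le_contravar; nra.
Qed.

Lemma Re_le_Cmod_shift (z : C) (k : Z) (x : R) : Rabs (Re z - IZR k) <= 1 / 2 -> 1 <= Rabs (IZR k + x) -> 
  1 / 2 <= Cmod (z + RtoC x).
Proof.
intros H1 H2. eapply Rle_trans; [|apply re_le_Cmod].
replace (Re (z + RtoC x)) with (Re z + x)%R by reflexivity.
assert (T := Rabs_triang (Re z + x) (IZR k - Re z)).
replace (Re z + x + (IZR k - Re z))%R with (IZR k + x)%R in T by ring.
rewrite Rabs_minus_sym in H1. lra.
Qed.

Lemma Rabs_IZR_ge1 (k : Z) : k <> 0%Z -> 1 <= Rabs (IZR k).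
Proof. intros H. rewrite <- abs_IZR. apply IZR_le. lia. Qed.

Lemma q_period_Z (z : C) (k : Z) : q (z - RtoC (IZR k)) = q z.
Proof.
assert (P : forall (n : nat) w, q (w + nC n) = q w).
{ intros n w. induction n. f_equal; unfold nC; simpl; ring.
  rewrite nC_S, Cplus_assoc, q_period, IHn. reflexivity. }
destruct (Z_le_gt_dec 0 k).
- rewrite <- (P (Z.to_nat k) (z - RtoC (IZR k))). rewrite nC_IZR, Z2Nat.id by lia. f_equal; ring.
- rewrite <- (P (Z.to_nat (- k)) z), nC_IZR, Z2Nat.id, opp_IZR, RtoC_opp by lia. reflexivity.
Qed.

(** Let [k] be the integer nearest to [Re z]; the bound on [Re z] ensures that the shift by [-k]
    occurs in [Sym4 N], and its term cancels the pole of [Aq]. At every other shift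
    [|z + n| >= 1/2], so the inverse fourth power is at most 4 times the inverse square. *)
Lemma herglotz_base : exists M : R, 0 <= M /\ forall (N : nat) (z : C), nonint z -> Rabs (Re z) <= INR N - 1 ->
  1 - q z <> 0 /\ Cmod (Sym4 N z - Aq (q z)) <= M * (1 + Sym2 N z).
Proof.
destruct lipschitz_pole as [K [HK B]]. exists (4 + K)%R. split; [lra|].
intros N z Hz HN.
set (k := Int_part (Re z + 1 / 2)).
assert (Hk : Rabs (Re z - IZR k) <= 1 / 2).
{ destruct (base_Int_part (Re z + 1 / 2)). fold k in H, H0. apply Rabs_le. lra. }
assert (Hkn : - INR N < IZR k < INR N).
{ apply Rabs_le_between in Hk. apply Rabs_le_between in HN. lra. }
assert (kN : (- Z.of_nat N < k < Z.of_nat N)%Z).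
{ rewrite INR_IZR_INZ, <- opp_IZR in Hkn. split; apply lt_IZR; lra. }
set (ze := z - RtoC (IZR k)).
assert (Hze : ze <> 0). { intros E. apply (Hz k). apply Ceq_minus, E. }
destruct (B ze Hze) as [N1 Bz]. { change (Re ze) with (Re z - IZR k)%R. assumption. }
unfold ze in N1, Bz at 1. rewrite q_period_Z in N1, Bz. split; [assumption|].
set (b := fun d => (4 * (/ Cmod (z + nC d) ^ 2 + / Cmod (z - nC (S d)) ^ 2))%R).
assert (Inv : forall u : C, u <> 0 -> 0 < / Cmod u ^ 2).
{ intros u Hu. apply Rinv_0_lt_compat, pow_lt, Cmod_gt_0, Hu. }
assert (Ip : forall d, 0 < / Cmod (z + nC d) ^ 2) by (intros; apply Inv, nonint_plus, Hz).
assert (Im : forall d, 0 < / Cmod (z - nC (S d)) ^ 2) by (intros; apply Inv, nonint_minus, Hz).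
assert (Bp : forall d, (k + Z.of_nat d <> 0)%Z -> Cmod (/ (z + nC d) ^ 4) <= 4 * / Cmod (z + nC d) ^ 2).
{ intros d Hd. apply pow4_le_pow2. rewrite nC_IZR. apply (Re_le_Cmod_shift z k); [assumption|].
  rewrite <- plus_IZR. apply Rabs_IZR_ge1, Hd. }
assert (Bm : forall d, (k - Z.of_nat (S d) <> 0)%Z -> Cmod (/ (z - nC (S d)) ^ 4) <= 4 * / Cmod (z - nC (S d)) ^ 2).
{ intros d Hd. apply pow4_le_pow2.
  replace (z - nC (S d)) with (z + RtoC (- IZR (Z.of_nat (S d)))) by (rewrite RtoC_opp, <- nC_IZR; ring).
  apply (Re_le_Cmod_shift z k); [assumption|].
  rewrite <- opp_IZR, <- plus_IZR. apply Rabs_IZR_ge1. lia. }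
assert (E2 : rsum b N = (4 * Sym2 N z)%R) by (unfold b; rewrite rsum_scal; reflexivity).
assert (b0 : forall j, 0 <= b j) by (intros j; unfold b; generalize (Ip j) (Im j); lra).
assert (S2 : forall d, (d < N)%nat -> / Cmod (z + nC d) ^ 2 <= Sym2 N z /\ / Cmod (z - nC (S d)) ^ 2 <= Sym2 N z).
{ intros d Hd. unfold Sym2. 
  assert (G : forall n, (d < n)%nat -> (/ Cmod (z + nC d) ^ 2 + / Cmod (z - nC (S d)) ^ 2)%R <= rsum (fun d => / Cmod (z + nC d) ^ 2 + / Cmod (z - nC (S d)) ^ 2)%R n).
  { induction n; intros L; [lia|]. rewrite rsum_Sr.
    assert (0 <= rsum (fun d => / Cmod (z + nC d) ^ 2 + / Cmod (z - nC (S d)) ^ 2)%R n).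
    { apply rsum_nonneg. intros i. generalize (Ip i) (Im i); lra. }
    destruct (Nat.eq_dec d n); [subst; lra|]. specialize (IHn ltac:(lia)). generalize (Ip n) (Im n). lra. }
  specialize (G N Hd). generalize (Ip d) (Im d). lra. }
assert (Main : Cmod (Sym4 N z - / ze ^ 4) <= 4 * Sym2 N z /\ / Cmod ze ^ 2 <= Sym2 N z).
{ destruct (Z_le_gt_dec k 0) as [Hk0|Hk0].
  - set (i := Z.to_nat (- k)).
    assert (Ei : ze = z + nC i). { unfold ze, i. rewrite nC_IZR, Z2Nat.id, opp_IZR, RtoC_opp by lia. reflexivity. }
    rewrite <- E2, Ei. split; [|apply S2; lia].
    apply (csum_one_off _ _ _ i); [lia|assumption|..]; unfold b.
    + intros j Hj. eapply Rle_trans; [apply Cmod_triangle|].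
      generalize (Bp j ltac:(lia)) (Bm j ltac:(lia)). lra.
    + match goal with |- Cmod (?x + ?y - ?x) <= _ => replace (x + y - x) with y by ring end.
      generalize (Bm i ltac:(lia)) (Ip i). lra.
  - set (i := Z.to_nat (k - 1)).
    assert (Ei : ze = z - nC (S i)). { unfold ze, i. rewrite nC_IZR, Nat2Z.inj_succ, Z2Nat.id by lia. do 3 f_equal. lia. }
    rewrite <- E2, Ei. split; [|apply S2; lia].
    apply (csum_one_off _ _ _ i); [lia|assumption|..]; unfold b.
    + intros j Hj. eapply Rle_trans; [apply Cmod_triangle|].
      generalize (Bp j ltac:(lia)) (Bm j ltac:(lia)). lra.
    + match goal with |- Cmod (?x + ?y - ?y) <= _ => replace (x + y - y) with x by ring end.
      generalize (Bp i ltac:(lia)) (Im i). lra. }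
destruct Main as [M1 M2].
replace (Sym4 N z - Aq (q z)) with ((Sym4 N z - / ze ^ 4) + - (Aq (q z) - / ze ^ 4)) by ring.
eapply Rle_trans; [apply Cmod_triangle|]. rewrite Cmod_opp.
assert (0 <= Sym2 N z).
{ unfold Sym2. apply rsum_nonneg. intros i. generalize (Ip i) (Im i); lra. }
nra.
Qed.

(** Herglotz' trick: both sides satisfy the duplication formula with factor 16, while the bound for
    their difference is only multiplied by 4. *)
Lemma lipschitz (N0 : nat) (z : C) (d : R) : nonint z -> (2 <= N0)%nat -> Rabs (Re z) <= INR N0 - 1 ->
  0 < d -> (forall k, d <= Cmod (z + nC k)) -> (forall k, d <= Cmod (z - nC (S k))) ->
  clim (fun k => Sym4 (2 ^ k * N0) z) (Aq (q z)).
Proof.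
intros Hz HN0 HR Hd D1 D2. destruct herglotz_base as [M [HM B]].
assert (H : forall (k : nat) (z : C), nonint z -> Rabs (Re z) <= INR N0 - 1 ->
  Cmod (Sym4 (2 ^ k * N0) z - Aq (q z)) <= M * / 4 ^ k * (1 + Sym2 (2 ^ k * N0) z)).
{ induction k; intros w Hw Rw.
  - simpl pow. rewrite Rinv_1, Rmult_1_r, Nat.pow_0_r, Nat.mul_1_l. apply B; assumption.
  - assert (N2 : 2 <= INR N0) by (change 2%R with (INR 2); apply le_INR; assumption).
    (* [N0 >= 2] makes the strip stable under both maps [w |-> (w + j) / 2]. *)
    assert (Rj : forall j, (j <= 1)%nat -> Rabs (Re ((w + nC j) / 2)) <= INR N0 - 1).
    { intros j Hj. replace (Re ((w + nC j) / 2)) with ((Re w + INR j) / 2)%R.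
      2: { unfold Cdiv. rewrite <- RtoC_inv by lra. rewrite re_scal_r. reflexivity. }
      apply Rabs_le_between in Rw. assert (0 <= INR j <= 1) by (split; [apply pos_INR|change 1%R with (INR 1); apply le_INR; lia]).
      apply Rabs_le. lra. }
    assert (H0 := IHk _ (nonint_half w 0 Hw) (Rj 0%nat ltac:(lia))).
    assert (H1 := IHk _ (nonint_half w 1 Hw) (Rj 1%nat ltac:(lia))).
    assert (Eq0 : q ((w + nC 0) / 2) * q ((w + nC 0) / 2) = q w).
    { rewrite <- q_plus. f_equal. unfold nC; simpl. field. }
    assert (Eq1 : q ((w + nC 1) / 2) = - q ((w + nC 0) / 2)).
    { replace ((w + nC 1) / 2) with ((w + nC 0) / 2 + 1 / 2) by (unfold nC; simpl; field). rewrite q_plus, q_half. ring. }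
    set (N := (2 ^ k * N0)%nat) in *.
    replace (2 ^ S k * N0)%nat with (2 * N)%nat by (unfold N; simpl; lia).
    destruct (B N0 w Hw Rw) as [Nq _]. rewrite <- Eq0 in Nq.
    assert (EA := Aq_double _ Nq). rewrite <- Eq1, Eq0 in EA.
    assert (ES := Sym4_double N w Hw). assert (ES2 := Sym2_double N w Hw).
    assert (T : 16 * Cmod (Sym4 (2 * N) w - Aq (q w)) <= M * / 4 ^ k * (2 + 4 * Sym2 (2 * N) w)).
    { replace (16 * Cmod (Sym4 (2 * N) w - Aq (q w)))%R with (Cmod (16 * Sym4 (2 * N) w - 16 * Aq (q w))).
      2: { replace (16 * Sym4 (2 * N) w - 16 * Aq (q w)) with (16 * (Sym4 (2 * N) w - Aq (q w))) by ring.
        rewrite Cmod_mult, Cmod_R, Rabs_pos_eq by lra. reflexivity. }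
      rewrite <- ES, <- EA.
      match goal with |- Cmod (?a + ?b - (?c + ?d)) <= _ => replace (a + b - (c + d)) with ((a - c) + (b - d)) by ring end.
      eapply Rle_trans; [apply Cmod_triangle|]. rewrite <- ES2. nra. }
    assert (P4 : 0 < / 4 ^ k) by (apply Rinv_0_lt_compat, pow_lt; lra).
    replace (/ 4 ^ S k)%R with (/ 4 * / 4 ^ k)%R by (simpl; field; apply pow_nonzero; lra).
    assert (0 <= M * / 4 ^ k) by nra. nra. }
(* The number of terms of [Sym2] grows like [2 ^ k] and each is bounded through [d], so against the
   factor [/ 4 ^ k] the bound still decays like [/ 2 ^ k]. *)
apply (clim_bound_zero _ (fun k => M * (/ 4) ^ k + M * (2 * INR N0 * / (d * d)) * (/ 2) ^ k)%R).
- intros k. eapply Rle_trans; [apply H; assumption|].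
  assert (S2 : Sym2 (2 ^ k * N0) z <= 2 ^ k * INR N0 * (2 * / (d * d))).
  { replace (2 ^ k * INR N0)%R with (INR (2 ^ k * N0)) by (rewrite mult_INR, pow_INR; reflexivity).
    rewrite <- rsum_const. apply rsum_le. intros i _.
    assert (G : forall u, d <= u -> / u ^ 2 <= / (d * d)) by (intros; apply Rinv_le_contravar; simpl; nra).
    generalize (G _ (D1 i)) (G _ (D2 i)). lra. }
  assert (P4 : 0 < / 4 ^ k) by (apply Rinv_0_lt_compat, pow_lt; lra).
  rewrite !pow_inv.
  replace (M * / 4 ^ k + M * (2 * INR N0 * / (d * d)) * / 2 ^ k)%R with (M * / 4 ^ k * (1 + 2 ^ k * INR N0 * (2 * / (d * d))))%R.
  + apply Rmult_le_compat_l; [nra|lra].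
  + replace (4 ^ k)%R with (2 ^ k * 2 ^ k)%R by (rewrite <- Rpow_mult_distr; f_equal; ring).
    assert (N2k : (2 ^ k <> 0)%R) by (apply pow_nonzero; lra). field. repeat split; try assumption; lra.
- replace (Finite 0) with (Rbar_plus (Rbar_mult M 0%R) (Rbar_mult (M * (2 * INR N0 * / (d * d)))%R 0%R)) by (simpl; f_equal; ring).
  apply is_lim_seq_plus'; [apply (is_lim_seq_scal_l _ M 0%R)|apply (is_lim_seq_scal_l _ (M * (2 * INR N0 * / (d * d)))%R 0%R)];
  apply is_lim_seq_geom; rewrite Rabs_pos_eq; lra.
Qed.

(** * The transformation law of E4 *)

Definition cube_gen (x : C) : C := x * (1 + 4 * x + x * x) / (1 - x) ^ 4.

(** The numerator of the tail: the sum of [(n + m)^3 x^m] over [m >= 0] equals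
    [cube_rem n x / (1 - x)^4]. *)
Definition cube_rem (n x : C) : C :=
  n ^ 3 * (1 - x) ^ 3 + 3 * n ^ 2 * x * (1 - x) ^ 2 + 3 * n * x * (1 + x) * (1 - x) + x * (1 + 4 * x + x * x).

Lemma cube_csum (x : C) (n : nat) : 1 - x <> 0 ->
  cube_gen x - csum (fun m => nC (S m) ^ 3 * x ^ S m) n = x ^ S n * cube_rem (nC (S n)) x / (x * (1 - x) ^ 4) * x.
Proof.
intros H. destruct (Ceq_dec x 0) as [E|N].
{ subst. rewrite (csum_zero _ n) by (intros; simpl; ring). unfold cube_gen. simpl. unfold Cdiv. ring. }
induction n.
- simpl csum. unfold cube_gen, cube_rem. change (nC 1) with (RtoC 1). simpl Cpow. field. split; assumption.
- rewrite csum_Sr.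
  match goal with |- ?a - (?b + ?c) = _ => replace (a - (b + c)) with ((a - b) - c) by ring end.
  rewrite IHn. unfold cube_rem. rewrite (nC_S (S n)). simpl Cpow. field. split; assumption.
Qed.

Lemma cube_rem_bound (n : nat) (x : C) : Cmod x < 1 -> (1 <= n)%nat -> Cmod (cube_rem (nC n) x) <= 50 * (INR n) ^ 3.
Proof.
intros Hx Hn. assert (P := Cmod_ge_0 x).
assert (N1 : 1 <= INR n) by (change 1%R with (INR 1); apply le_INR; assumption).
assert (M1 : Cmod (1 - x) <= 2).
{ unfold Cminus. eapply Rle_trans; [apply Cmod_triangle|]. rewrite Cmod_opp, Cmod_1. lra. }
assert (M2 : Cmod (1 + x) <= 2). { eapply Rle_trans; [apply Cmod_triangle|]. rewrite Cmod_1. lra. }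
assert (M3 : Cmod (1 + 4 * x + x * x) <= 6).
{ eapply Rle_trans; [apply Cmod_triangle|]. rewrite Cmod_mult.
  assert (T := Cmod_triangle 1 (4 * x)). rewrite Cmod_1, Cmod_mult, Cmod_R, Rabs_pos_eq in T by lra. nra. }
set (N := INR n) in *. assert (N3 : 1 <= N ^ 3) by (simpl; nra). assert (N32 : N ^ 2 <= N ^ 3) by (simpl; nra). assert (N31 : N <= N ^ 3) by (simpl; nra).
assert (Q1 := Cmod_ge_0 (1 - x)). assert (Q2 := Cmod_ge_0 (1 + x)). assert (Q3 := Cmod_ge_0 (1 + 4 * x + x * x)).
assert (P2 : Cmod (1 - x) ^ 2 <= 4) by (simpl; nra).
assert (P3 : Cmod (1 - x) ^ 3 <= 8) by (simpl; nra).
assert (P20 : 0 <= Cmod (1 - x) ^ 2) by (apply pow_le; assumption).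
assert (P30 : 0 <= Cmod (1 - x) ^ 3) by (apply pow_le; assumption).
unfold cube_rem.
eapply Rle_trans; [apply Cmod_triangle|]. eapply Rle_trans; [apply Rplus_le_compat_r, Cmod_triangle|].
eapply Rle_trans; [apply Rplus_le_compat_r, Rplus_le_compat_r, Cmod_triangle|].
rewrite !Cmod_mult, !Cmod_pow, !Cmod_R, Cmod_nC, (Rabs_pos_eq 3) by lra. fold N.
assert (T1 : N ^ 3 * Cmod (1 - x) ^ 3 <= N ^ 3 * 8) by (apply Rmult_le_compat_l; lra).
assert (T2 : 3 * N ^ 2 * Cmod x * Cmod (1 - x) ^ 2 <= 3 * N ^ 3 * 1 * 4).
{ apply Rmult_le_compat; try lra. apply Rmult_le_pos; [nra|lra]. apply Rmult_le_compat; try lra; nra. }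
assert (T3 : 3 * N * Cmod x * Cmod (1 + x) * Cmod (1 - x) <= 3 * N ^ 3 * 1 * 2 * 2).
{ apply Rmult_le_compat; try lra. repeat apply Rmult_le_pos; lra. apply Rmult_le_compat; try lra. repeat apply Rmult_le_pos; lra.
  apply Rmult_le_compat; lra. }
assert (T4 : Cmod x * Cmod (1 + 4 * x + x * x) <= 1 * 6) by (apply Rmult_le_compat; lra).
lra.
Qed.

(** The companion of [lambert] with the cube on the inner summation variable, as it comes out of the
    Lipschitz formula applied to each row [c tau] of the lattice. *)
Lemma lambert_cube (z : C) : Cmod z < 1 -> clim (csum (fun c => cube_gen (z ^ S c))) (psum (divsum 3) z).
Proof.
intros Hz. assert (Pz := Cmod_ge_0 z).
set (d := fun M => csum (fun c => cube_gen (z ^ S c)) M - csum (fun n => divsum 3 n * z ^ n) (S M)).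
set (K := (/ (1 - Cmod z) ^ 4)%R).
assert (HK : 0 < K) by (apply Rinv_0_lt_compat, pow_lt; lra).
assert (Hd : clim d 0).
{ apply (clim_bound_zero _ (fun M => 50 * K * ((INR M + 1) ^ 4 * Cmod z ^ M))%R).
  2: apply lim_poly_geom; lra.
  intros M. replace (d M - 0) with (d M) by ring. unfold d. rewrite <- hyp_pairs_divsum.
  (* The region under the hyperbola is symmetric, so the cube can be moved to the other factor. *)
  rewrite (Csum_bij _ (fun p => nC (snd p) ^ 3 * z ^ (fst p * snd p)) (fun p => (snd p, fst p)) (hyp_pairs M) (hyp_pairs M) (NoDup_hyp_pairs M) (NoDup_hyp_pairs M)).
  2: { intros [n m] I. apply in_hyp_pairs in I. simpl. split; [apply in_hyp_pairs; lia|]. rewrite Nat.mul_comm; reflexivity. }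
  2: { intros [n m] [n' m'] _ _ E. simpl in E. congruence. }
  2: { intros [n m] I. exists (m, n). apply in_hyp_pairs in I. split; [apply in_hyp_pairs; lia|reflexivity]. }
  unfold hyp_pairs. rewrite Csum_flat_map, Csum_seq_S.
  rewrite <- csum_minus.
  apply Rle_trans with (rsum (fun _ => 50 * K * ((INR M + 1) ^ 3 * Cmod z ^ M)) M)%R.
  2: { rewrite rsum_const. assert (P := pos_INR M). assert (0 <= Cmod z ^ M) by (apply pow_le; assumption).
    assert (0 <= (INR M + 1) ^ 3) by (apply pow_le; lra).
    replace (50 * K * ((INR M + 1) ^ 4 * Cmod z ^ M))%R with ((INR M + 1) * (50 * K * ((INR M + 1) ^ 3 * Cmod z ^ M)))%R by (simpl; ring).
    apply Rmult_le_compat_r; [|lra]. repeat apply Rmult_le_pos; lra. }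
  apply Cmod_csum_le. intros i Hi. rewrite Csum_map, Csum_seq_S. cbn [fst snd].
  change (1 + i)%nat with (S i).
  assert (Hw : Cmod (z ^ S i) <= Cmod z). { eapply Rle_trans; [apply (Cmod_pow_le z (S i) 1 Hz); lia|]. simpl; lra. }
  assert (N : 1 - z ^ S i <> 0) by (apply one_minus_nz; lra).
  rewrite (csum_ext _ (fun k => nC (S k) ^ 3 * (z ^ S i) ^ S k)).
  2: { intros k _. rewrite <- Cpow_mult_r. reflexivity. }
  rewrite cube_csum by assumption.
  set (w := z ^ S i) in *. set (k := (M / S i)%nat).
  destruct (Ceq_dec w 0) as [E|Nw].
  { rewrite E, Cmult_0_r, Cmod_0. apply Rmult_le_pos; [lra|]. apply Rmult_le_pos; apply pow_le; [generalize (pos_INR M); lra|assumption]. }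
  replace (w ^ S k * cube_rem (nC (S k)) w / (w * (1 - w) ^ 4) * w) with (w ^ S k * cube_rem (nC (S k)) w * / (1 - w) ^ 4)
    by (field; split; assumption).
  assert (L := Cmod_one_minus w).
  rewrite !Cmod_mult, Cmod_inv, (Cmod_pow (1 - w)) by (apply Cpow_nz; assumption).
  assert (R1 : Cmod (w ^ S k) <= Cmod z ^ M).
  { unfold w. rewrite <- Cpow_mult_r. apply Cmod_pow_le; [assumption|].
    assert (M < S i * S (M / S i))%nat by (apply Nat.mul_succ_div_gt; lia). unfold k. lia. }
  assert (R2 : Cmod (cube_rem (nC (S k)) w) <= 50 * (INR M + 1) ^ 3).
  { eapply Rle_trans; [apply cube_rem_bound; [lra|lia]|]. apply Rmult_le_compat_l; [lra|].
    apply pow_incr. split; [apply pos_INR|]. rewrite S_INR. apply Rplus_le_compat_r, le_INR.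
    unfold k. apply Nat.Div0.div_le_upper_bound. nia. }
  assert (R3 : / Cmod (1 - w) ^ 4 <= K).
  { apply Rinv_le_contravar. apply pow_lt; lra. apply pow_incr; lra. }
  replace (50 * K * ((INR M + 1) ^ 3 * Cmod z ^ M))%R with (Cmod z ^ M * (50 * (INR M + 1) ^ 3) * K)%R by ring.
  apply Rmult_le_compat; [apply Rmult_le_pos; apply Cmod_ge_0| |apply Rmult_le_compat; try apply Cmod_ge_0; assumption|assumption].
  left; apply Rinv_0_lt_compat, pow_lt; lra. }
replace (psum (divsum 3) z) with (0 + psum (divsum 3) z) by ring.
eapply clim_ext; [|apply clim_plus; [exact Hd|apply (clim_subseq (csum (fun n => divsum 3 n * z ^ n)) _ S); [intros; lia|exact (psum_lim _ z (subexp_divsum 3) Hz)]]].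
intros M. unfold d. ring.
Qed.

(** * Lattice sums of weight 4 *)

Definition Z4 (N : nat) : C := csum (fun d => / nC (S d) ^ 4) N.

(** The sum of [(c tau + d)^-4] over the nonzero [(c, d)] with [|c|, |d| <= N], taken up to sign.
    The square truncation is preserved by the exchange of [c] and [d], so the law under tau |->
    -1/tau holds exactly for each [N]. *)
Definition Lat4 (N : nat) (tau : C) : C := Z4 N + Z4 N * / tau ^ 4 +
  csum (fun c => csum (fun d => / (nC (S c) * tau + nC (S d)) ^ 4 + / (nC (S c) * tau - nC (S d)) ^ 4) N) N.

Lemma upper_lin_nz (tau x : C) (c : nat) : upper tau -> Im x = 0%R -> nC (S c) * tau + x <> 0.
Proof.
intros H Hx E. assert (I : Im (nC (S c) * tau + x) = (INR (S c) * Im tau)%R).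
{ unfold nC. destruct tau as [u v], x as [s t]; simpl in *. subst. unfold Im; simpl. ring. }
rewrite E in I. unfold upper in H. assert (0 < INR (S c)) by (apply lt_0_INR; lia). simpl Im in I. nra.
Qed.

Lemma Lat4_S (N : nat) (tau : C) : upper tau -> Lat4 N (- / tau) = tau ^ 4 * Lat4 N tau.
Proof.
intros H. assert (N0 := upper_nz tau H). unfold Lat4.
assert (E : csum (fun c => csum (fun d => / (nC (S c) * - / tau + nC (S d)) ^ 4 + / (nC (S c) * - / tau - nC (S d)) ^ 4) N) N =
  tau ^ 4 * csum (fun c => csum (fun d => / (nC (S c) * tau + nC (S d)) ^ 4 + / (nC (S c) * tau - nC (S d)) ^ 4) N) N).
{ rewrite csum_switch, <- csum_scal. apply csum_ext. intros c _. rewrite <- csum_scal. apply csum_ext. intros d _.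
  assert (N1 := upper_lin_nz tau (nC (S d)) c H (eq_refl _)).
  assert (N2 := upper_lin_nz tau (- nC (S d)) c H ltac:(simpl; ring)). fold (nC (S c) * tau - nC (S d)) in N2.
  replace (nC (S d) * - / tau + nC (S c)) with ((nC (S c) * tau - nC (S d)) / tau) by (field; assumption).
  replace (nC (S d) * - / tau - nC (S c)) with (- (nC (S c) * tau + nC (S d)) / tau) by (field; assumption).
  field. repeat split; assumption. }
rewrite E. field. assumption.
Qed.

(** The one missing shift [+N] turns the range of [Sym4] into the symmetric range of the square. *)
Lemma Sym4_sym (N : nat) (z : C) : Sym4 N z + / (z + nC N) ^ 4 =
  / z ^ 4 + csum (fun d => / (z + nC (S d)) ^ 4 + / (z - nC (S d)) ^ 4) N.
Proof.
induction N. { unfold Sym4; simpl csum. change (nC 0) with (RtoC 0). rewrite Cplus_0_r. ring. }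
rewrite csum_Sr, Cplus_assoc, <- IHN. unfold Sym4. rewrite csum_Sr. ring.
Qed.

Lemma Lat4_Sym4 (N : nat) (tau : C) : upper tau ->
  Lat4 N tau = Z4 N + csum (fun c => Sym4 N (nC (S c) * tau) + / (nC (S c) * tau + nC N) ^ 4) N.
Proof.
intros H. unfold Lat4. rewrite (csum_ext (fun c => Sym4 N (nC (S c) * tau) + _) _ N (fun c _ => Sym4_sym N (nC (S c) * tau))).
rewrite csum_plus, <- Cplus_assoc. do 2 f_equal.
unfold Z4. rewrite Cmult_comm, <- csum_scal. apply csum_ext. intros c _. field.
split; [apply upper_nz; assumption|apply nC_neq_0; lia].
Qed.

(** Comparison with the telescoping differences [1/x - 1/(x+1)]; two of the four powers are
    estimated by [N]. *)
Lemma quartic_tail (N m : nat) : (1 <= N)%nat -> rsum (fun i => / INR (N + i) ^ 4)%R m <= 2 * / INR N ^ 3.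
Proof.
intros HN. assert (N1 : 1 <= INR N) by (change 1%R with (INR 1); apply le_INR; assumption).
assert (G : rsum (fun i => / INR (N + i) ^ 4)%R m <= 2 * / INR N ^ 2 * (/ INR N - / INR (N + m))).
{ induction m. { simpl. rewrite Nat.add_0_r. right; ring. }
  rewrite rsum_Sr, Nat.add_succ_r, S_INR.
  assert (M1 : INR N <= INR (N + m)) by (apply le_INR; lia).
  set (x := INR (N + m)) in *. set (n := INR N) in *.
  assert (/ x ^ 4 <= 2 * / n ^ 2 * (/ x - / (x + 1))); [|lra].
  replace (2 * / n ^ 2 * (/ x - / (x + 1)))%R with (2 * / (n ^ 2 * (x * (x + 1))))%R by (field; lra).
  assert (n * n <= x * x) by nra. assert (0 < n * n) by nra. assert (0 < x * (x + 1)) by nra.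
  replace (2 * / (n ^ 2 * (x * (x + 1))))%R with (/ (n ^ 2 * (x * (x + 1)) / 2))%R by (field; simpl; repeat split; nra).
  apply Rinv_le_contravar; [simpl; nra|].
  apply Rle_trans with (x ^ 2 * (x * (x + 1)) / 2)%R; simpl; nra. }
eapply Rle_trans; [exact G|].
assert (0 < / INR (N + m)) by (apply Rinv_0_lt_compat, lt_0_INR; lia).
assert (0 < / INR N ^ 2) by (apply Rinv_0_lt_compat, pow_lt; lra).
replace (2 * / INR N ^ 3)%R with (2 * / INR N ^ 2 * / INR N)%R by (field; lra). nra.
Qed.

Lemma Sym4_tail (N M : nat) (z : C) (k : R) : (1 <= N)%nat -> (N <= M)%nat -> 0 < k ->
  (forall d, (1 <= d)%nat -> k * INR d <= Cmod (z + nC d) /\ k * INR d <= Cmod (z - nC d)) ->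
  Cmod (Sym4 M z - Sym4 N z) <= 4 * / k ^ 4 * / INR N ^ 3.
Proof.
intros HN HM Hk H. replace M with (N + (M - N))%nat by lia. unfold Sym4. rewrite csum_split.
match goal with |- Cmod (?a + ?b - ?a) <= _ => replace (a + b - a) with b by ring end.
assert (k4 : 0 < / k ^ 4) by (apply Rinv_0_lt_compat, pow_lt; assumption).
apply Rle_trans with (rsum (fun i => 2 * / k ^ 4 * / INR (N + i) ^ 4)%R (M - N)).
2: { rewrite rsum_scal. assert (T := quartic_tail N (M - N) HN). nra. }
assert (G : forall u n, (1 <= n)%nat -> k * INR n <= Cmod u -> Cmod (/ u ^ 4) <= / k ^ 4 * / INR n ^ 4).
{ intros u n Hn L. assert (0 < INR n) by (apply lt_0_INR; lia). assert (0 < k * INR n) by nra.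
  assert (u <> 0) by (apply Cmod_gt_0; lra).
  rewrite Cmod_inv, Cmod_pow by (apply Cpow_nz; assumption).
  rewrite <- Rinv_mult, <- Rpow_mult_distr. apply Rinv_le_contravar; [apply pow_lt; assumption|apply pow_incr; lra]. }
apply Cmod_csum_le. intros i _. eapply Rle_trans; [apply Cmod_triangle|].
assert (B1 := G _ (N + i)%nat ltac:(lia) (proj1 (H (N + i)%nat ltac:(lia)))).
assert (B2 : Cmod (/ (z - nC (S (N + i))) ^ 4) <= / k ^ 4 * / INR (N + i) ^ 4).
{ apply G; [lia|]. eapply Rle_trans; [|apply H; lia]. rewrite S_INR. nra. }
lra.
Qed.

Lemma pow2_ge (k : nat) : (k <= 2 ^ k)%nat.
Proof. apply Nat.lt_le_incl, Nat.pow_gt_lin_r. lia. Qed.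

(** The imaginary part of [c tau + d] times the conjugate of [tau] is [- d Im tau]. The bound is
    independent of [c], which makes the row estimates uniform. *)
Lemma Cmod_lattice (tau : C) (c d : R) : upper tau -> Im tau / Cmod tau * Rabs d <= Cmod (RtoC c * tau + RtoC d).
Proof.
intros H. assert (Nz := upper_nz tau H). assert (P := proj1 (Cmod_gt_0 tau) Nz). unfold upper in H.
apply Rmult_le_reg_r with (Cmod tau); [assumption|].
replace (Im tau / Cmod tau * Rabs d * Cmod tau)%R with (Im tau * Rabs d)%R by (field; lra).
rewrite <- (Cmod_conj tau), <- Cmod_mult.
eapply Rle_trans; [|apply Rmax_Cmod]. eapply Rle_trans; [|apply Rmax_r].
destruct tau as [x y]. simpl in *. replace ((c * x - 0 * y + d) * - y + (c * y + 0 * x + 0) * x)%R with (- (y * d))%R by ring.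
rewrite Rabs_Ropp, Rabs_mult, (Rabs_pos_eq y) by lra. lra.
Qed.

(** The limit in [lipschitz] runs through [2 ^ j N0] with [N0 >= N]; comparing with [Sym4 N] before
    passing to the limit gives an error of order [N^-3] uniformly in [c], which can be summed over
    [N] rows. *)
Lemma lipschitz_tail (tau : C) (c N : nat) : upper tau -> (1 <= N)%nat ->
  Cmod (Sym4 N (nC (S c) * tau) - Aq (q (nC (S c) * tau))) <= 4 * / (Im tau / Cmod tau) ^ 4 * / INR N ^ 3.
Proof.
intros H HN. set (z := nC (S c) * tau). set (k := (Im tau / Cmod tau)%R).
assert (Nz := upper_nz tau H).
assert (Hk : 0 < k) by (apply Rdiv_lt_0_compat; [exact H|apply Cmod_gt_0; assumption]).
assert (Iz : Im z = (INR (S c) * Im tau)%R) by (unfold z, nC; apply im_scal_l).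
assert (c1 : 1 <= INR (S c)) by (change 1%R with (INR 1); apply le_INR; lia).
assert (Hi : 0 < Im z) by (rewrite Iz; unfold upper in H; nra).
destruct (INR_unbounded (Rabs (Re z) + 1)) as [n Hn].
set (N0 := (N + n + 2)%nat).
assert (L := lipschitz N0 z (Im z) (nonint_Im z ltac:(lra)) ltac:(unfold N0; lia)).
assert (Ic : forall w, Im w = Im z -> Im z <= Cmod w).
{ intros w E. rewrite <- E. eapply Rle_trans; [apply Rle_abs|]. eapply Rle_trans; [apply Rmax_r|apply Rmax_Cmod]. }
assert (HN0 : Rabs (Re z) <= INR N0 - 1).
{ unfold N0. rewrite !plus_INR. change (INR 2) with 2%R. generalize (pos_INR N). lra. }
specialize (L HN0 Hi).
specialize (L ltac:(intros; apply Ic; unfold nC; simpl; ring) ltac:(intros; apply Ic; unfold nC; simpl; ring)).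
replace (Sym4 N z - Aq (q z)) with (- (Aq (q z) + - Sym4 N z)) by ring. rewrite Cmod_opp.
apply (clim_Cmod_le _ _ _ (clim_plus _ _ _ _ L (clim_const (- Sym4 N z)))).
intros j. apply (Sym4_tail N _ z k HN); [|assumption|].
- unfold N0. assert (J := pow2_ge j). assert (1 <= 2 ^ j)%nat by (clear; induction j; simpl; lia). nia.
- intros d Hd. unfold z, k. split.
  + assert (T := Cmod_lattice tau (INR (S c)) (INR d) H). rewrite Rabs_pos_eq in T by apply pos_INR. exact T.
  + assert (T := Cmod_lattice tau (INR (S c)) (- INR d) H). rewrite Rabs_Ropp, Rabs_pos_eq, RtoC_opp in T by apply pos_INR. exact T.
Qed.

Lemma q_nC_mult (n : nat) (tau : C) : q (nC n * tau) = q tau ^ n.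
Proof. unfold q. rewrite Cexp_pow. f_equal. unfold nC. ring. Qed.

Lemma Aq_cube (x : C) : Aq x = 8 * RtoC PI ^ 4 / 3 * cube_gen x.
Proof. reflexivity. Qed.

Lemma lim_inv_S (K : R) : is_lim_seq (fun n => K * / (INR n + 1))%R 0.
Proof.
replace (Finite 0) with (Rbar_mult K 0%R) by (simpl; f_equal; ring). apply is_lim_seq_scal_l.
apply is_lim_seq_spec. intros eps. destruct (INR_unbounded (/ eps)) as [N HN]. exists N. intros n Hn.
assert (P := cond_pos eps). assert (Pn := pos_INR n). apply le_INR in Hn. rewrite Rminus_0_r.
rewrite Rabs_pos_eq by (left; apply Rinv_0_lt_compat; lra).
rewrite <- (Rinv_inv eps). apply Rinv_lt_contravar; [|lra].
apply Rmult_lt_0_compat; [apply Rinv_0_lt_compat; assumption|lra].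
Qed.

Lemma Lat4_lim (tau : C) : upper tau -> clim (fun N => Lat4 N tau - Z4 N) (8 * RtoC PI ^ 4 / 3 * psum (divsum 3) (q tau)).
Proof.
intros H. set (k := (Im tau / Cmod tau)%R). assert (Nz := upper_nz tau H).
assert (Hk : 0 < k) by (apply Rdiv_lt_0_compat; [exact H|apply Cmod_gt_0; assumption]).
assert (k4 : 0 < / k ^ 4) by (apply Rinv_0_lt_compat, pow_lt; assumption).
set (d := fun N => Lat4 N tau - Z4 N - csum (fun c => Aq (q (nC (S c) * tau))) N).
assert (Hd : clim d 0).
{ apply (clim_bound_zero _ (fun N => 10 * / k ^ 4 * / (INR N + 1))%R); [|apply lim_inv_S].
  intros N. replace (d N - 0) with (d N) by ring. unfold d. rewrite Lat4_Sym4 by assumption.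
  match goal with |- Cmod (?z + ?a - ?z - ?b) <= _ => replace (z + a - z - b) with (a - b) by ring end.
  rewrite <- csum_minus.
  destruct N. { simpl csum. rewrite Cmod_0. change (INR 0) with 0%R. rewrite Rplus_0_l, Rinv_1. lra. }
  assert (N1 : 1 <= INR (S N)) by (change 1%R with (INR 1); apply le_INR; lia).
  apply Rle_trans with (rsum (fun _ => 5 * / k ^ 4 * / INR (S N) ^ 3)%R (S N)).
  - apply Cmod_csum_le. intros c _.
    match goal with |- Cmod (?a + ?b - ?e) <= _ => replace (a + b - e) with ((a - e) + b) by ring end.
    eapply Rle_trans; [apply Cmod_triangle|].
    assert (T := lipschitz_tail tau c (S N) H ltac:(lia)). fold k in T.
    assert (T2 : Cmod (/ (nC (S c) * tau + nC (S N)) ^ 4) <= / k ^ 4 * / INR (S N) ^ 3).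
    { assert (Hn := upper_lin_nz tau (nC (S N)) c H (eq_refl _)).
      rewrite Cmod_inv, Cmod_pow by (apply Cpow_nz; assumption).
      rewrite <- Rinv_mult. apply Rinv_le_contravar. { apply Rmult_lt_0_compat; apply pow_lt; lra. }
      assert (L := Cmod_lattice tau (INR (S c)) (INR (S N)) H). rewrite Rabs_pos_eq in L by apply pos_INR. fold k in L.
      apply Rle_trans with ((k * INR (S N)) ^ 4)%R; [|apply pow_incr; split; [nra|exact L]].
      rewrite Rpow_mult_distr. apply Rmult_le_compat_l; [apply pow_le; lra|]. apply Rle_pow; [assumption|lia]. }
    lra.
  - rewrite rsum_const.
    replace (INR (S N) * (5 * / k ^ 4 * / INR (S N) ^ 3))%R with (5 * / k ^ 4 * (/ INR (S N) ^ 2))%R by (field; split; lra).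
    rewrite (Rmult_comm 10), (Rmult_comm 5), !Rmult_assoc. apply Rmult_le_compat_l; [lra|].
    set (n := INR (S N)) in *. replace (10 * / (n + 1))%R with (5 * / ((n + 1) / 2))%R by (field; lra).
    apply Rmult_le_compat_l; [lra|]. apply Rinv_le_contravar; [lra|]. simpl. nra. }
assert (L := lambert_cube (q tau) (Cmod_q_lt tau H)).
replace (8 * RtoC PI ^ 4 / 3 * psum (divsum 3) (q tau)) with (0 + 8 * RtoC PI ^ 4 / 3 * psum (divsum 3) (q tau)) by ring.
eapply clim_ext; [|apply clim_plus; [exact Hd|apply (clim_scal (8 * RtoC PI ^ 4 / 3)); exact L]].
intros N; cbv beta. unfold d. rewrite <- csum_scal.
rewrite (csum_ext (fun c => Aq (q (nC (S c) * tau))) (fun i => 8 * RtoC PI ^ 4 / 3 * cube_gen (q tau ^ S i))).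
ring. intros i _. rewrite Aq_cube, q_nC_mult. reflexivity.
Qed.

Lemma clim_contraction (u v : nat -> C) : (forall k, u (S k) = v k + u k / 16) -> clim v 0 -> clim u 0.
Proof.
intros H Hv eps He. destruct (Hv (eps / 4)%R ltac:(lra)) as [K HK].
assert (G : forall j, Cmod (u (K + j)%nat) <= Cmod (u K) * (/ 16) ^ j + eps / 2).
{ induction j. { rewrite Nat.add_0_r. simpl. lra. }
  rewrite Nat.add_succ_r, H. eapply Rle_trans; [apply Cmod_triangle|].
  specialize (HK (K + j)%nat ltac:(lia)). replace (v (K + j)%nat - 0) with (v (K + j)%nat) in HK by ring.
  rewrite Cmod_div, Cmod_R, Rabs_pos_eq by (try apply RtoC_neq; lra). simpl pow. lra. }
assert (L : is_lim_seq (fun j => Cmod (u K) * (/ 16) ^ j)%R 0).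
{ replace (Finite 0) with (Rbar_mult (Cmod (u K)) 0%R) by (simpl; f_equal; ring).
  apply is_lim_seq_scal_l, is_lim_seq_geom. rewrite Rabs_pos_eq; lra. }
apply is_lim_seq_spec in L. assert (He4 : 0 < eps / 4) by lra. destruct (L (mkposreal _ He4)) as [J HJ].
exists (K + J)%nat. intros n Hn. replace (u n - 0) with (u (K + (n - K))%nat) by (replace (K + (n - K))%nat with n by lia; ring).
specialize (G (n - K)%nat). specialize (HJ (n - K)%nat ltac:(lia)). simpl in HJ. apply Rabs_def2 in HJ. lra.
Qed.

(** Even denominators give [Z4 N / 16]; odd ones are the half-integers, each met twice in
    [Sym4 N (1/2)]. Thus zeta(4) is also obtained from the Lipschitz formula, at the point 1/2. *)
Lemma Z4_double (N : nat) : Z4 (2 * N) = Sym4 N (1 / 2) / 32 + Z4 N / 16.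
Proof.
induction N. { unfold Z4, Sym4; simpl. field. }
replace (2 * S N)%nat with (S (S (2 * N))) by lia. unfold Z4, Sym4 in *. rewrite !csum_Sr, IHN.
assert (A1 := nC_neq_0 (S (2 * N)) ltac:(lia)). assert (A2 := nC_neq_0 (S (S (2 * N))) ltac:(lia)).
assert (A3 := nC_neq_0 (S N) ltac:(lia)).
rewrite !nC_S, nC_2 in *.
replace (1 / 2 + nC N) with ((2 * nC N + 1) / 2) by field.
replace (1 / 2 - (nC N + 1)) with (- ((2 * nC N + 1) / 2)) by field.
replace (2 * nC N + 1 + 1) with (2 * (nC N + 1)) in * by ring.
field. repeat split; assumption.
Qed.

Lemma Z4_lim : clim (fun k => Z4 (2 ^ k * 2)) (RtoC PI ^ 4 / 90).
Proof.
assert (Hn : nonint (1 / 2)).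
{ intros k E. assert (E2 : IZR (2 * k) = 1%R). { apply RtoC_inj. rewrite mult_IZR, RtoC_mult, <- E. field. }
  apply eq_IZR in E2. lia. }
assert (L := lipschitz 2 (1 / 2) (1 / 2)%R Hn (le_n 2)).
assert (Ere : forall x : R, Re (1 / 2 + RtoC x) = (1 / 2 + x)%R) by (intros; rewrite <- RtoC_div, <- RtoC_plus by lra; reflexivity).
specialize (L ltac:(rewrite <- (Cplus_0_r (1 / 2)), Ere, Rabs_pos_eq; simpl; lra) ltac:(lra)).
assert (D1 : forall k, 1 / 2 <= Cmod (1 / 2 + nC k)).
{ intros k. eapply Rle_trans; [|apply re_le_Cmod]. unfold nC. rewrite Ere. generalize (pos_INR k). intros. rewrite Rabs_pos_eq; lra. }
assert (D2 : forall k, 1 / 2 <= Cmod (1 / 2 - nC (S k))).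
{ intros k. eapply Rle_trans; [|apply re_le_Cmod]. unfold Cminus, nC. rewrite <- RtoC_opp, Ere. rewrite S_INR. generalize (pos_INR k). intros. rewrite Rabs_left; lra. }
specialize (L D1 D2).
assert (EA : Aq (q (1 / 2)) = RtoC PI ^ 4 / 3).
{ rewrite q_half. unfold Aq. field. }
rewrite EA in L.
(* The odd denominators contribute [pi^4 / 96], and [pi^4 / 90] is the fixed point of
   [x = pi^4 / 96 + x / 16]. *)
assert (U := clim_contraction (fun k => Z4 (2 ^ k * 2) + - (RtoC PI ^ 4 / 90)) (fun k => / 32 * Sym4 (2 ^ k * 2) (1 / 2) + - (RtoC PI ^ 4 / 96))).
cbv beta in U.
assert (U' := clim_plus _ _ _ _ (U ltac:(intros k; replace (2 ^ S k * 2)%nat with (2 * (2 ^ k * 2))%nat by (simpl; lia); rewrite Z4_double; field)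
  ltac:(replace (RtoC 0) with (/ 32 * (RtoC PI ^ 4 / 3) + - (RtoC PI ^ 4 / 96)) by field; apply clim_plus; [apply clim_scal; exact L|apply clim_const]))
  (clim_const (RtoC PI ^ 4 / 90))).
rewrite Cplus_0_l in U'. eapply clim_ext; [|exact U']. intros; cbv beta; ring.
Qed.

(** The subsequence [2 ^ k 2] is the one along which the limit of [Z4] is known; it is enough to
    pass the law of [Lat4] to the limit. *)
Lemma E4_Lat4 (tau : C) : upper tau -> clim (fun k => Lat4 (2 ^ k * 2) tau) (RtoC PI ^ 4 / 90 * E4 tau).
Proof.
intros H.
assert (L := clim_subseq _ _ (fun k => 2 ^ k * 2)%nat ltac:(intros n; generalize (pow2_ge n); lia) (Lat4_lim tau H)).
assert (E : E4 tau = 1 + 240 * psum (divsum 3) (q tau)).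
{ rewrite (proj2 Wf_E4) by assumption. unfold eis_seq.
  rewrite psum_plus, psum_scal, psum_cseq; auto using subexp_cseq, subexp_scal, subexp_divsum, Cmod_q_lt. }
rewrite E. replace (RtoC PI ^ 4 / 90 * (1 + 240 * psum (divsum 3) (q tau))) with
  (8 * RtoC PI ^ 4 / 3 * psum (divsum 3) (q tau) + RtoC PI ^ 4 / 90) by field.
eapply clim_ext; [|apply clim_plus; [exact L|exact Z4_lim]]. intros; cbv beta; ring.
Qed.

Lemma upper_S (tau : C) : upper tau -> upper (- / tau).
Proof.
unfold upper. intros H. destruct tau as [x y]. simpl in *.
assert (0 < x * x + y * y) by nra.
replace (- (- y / (x * (x * 1) + y * (y * 1))))%R with (y / (x * x + y * y))%R by (field; lra).
apply Rdiv_lt_0_compat; assumption.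
Qed.

Lemma E4_S (tau : C) : upper tau -> E4 (- / tau) = tau ^ 4 * E4 tau.
Proof.
intros H. assert (HS := upper_S tau H).
assert (L1 := E4_Lat4 _ HS). assert (L2 := clim_scal (tau ^ 4) _ _ (E4_Lat4 tau H)).
assert (E := clim_unique _ _ _ (clim_ext _ _ _ (fun k => Lat4_S (2 ^ k * 2) tau H) L1) L2).
assert (N : RtoC PI ^ 4 / 90 <> 0).
{ apply Cmult_neq_0. apply Cpow_nz, RtoC_neq. generalize PI_RGT_0; lra.
  rewrite <- RtoC_inv by lra. apply RtoC_neq. lra. }
replace (E4 (- / tau)) with ((RtoC PI ^ 4 / 90 * E4 (- / tau)) / (RtoC PI ^ 4 / 90)).
rewrite E. all: field; apply RtoC_neq; generalize PI_RGT_0; lra.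
Qed.

(** * The transformation laws of E2 and E6 *)

(** 1728 times the usual discriminant. *)
Definition Delta (tau : C) : C := E4 tau ^ 3 - E6 tau ^ 2.

Lemma W_E2 : W E2. Proof. eexists; exact Wf_E2. Qed.
Lemma W_E4 : W E4. Proof. eexists; exact Wf_E4. Qed.
Lemma W_E6 : W E6. Proof. eexists; exact Wf_E6. Qed.

Lemma cder_eq (f : C -> C) (z a b : C) : cder f z a -> a = b -> cder f z b.
Proof. intros H E; rewrite <- E; exact H. Qed.

Lemma cder_Delta (tau : C) : upper tau -> cder Delta tau (tpi * (E2 tau * Delta tau)).
Proof.
intros H. assert (H4 := cder_E4 tau H). assert (H6 := cder_E6 tau H).
apply (cder_eq _ _ _ _ (cder_minus _ _ _ _ _ (cder_mult _ _ _ _ _ H4 (cder_mult _ _ _ _ _ H4 (cder_mult _ _ _ _ _ H4 (cder_const 1 tau))))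
  (cder_mult _ _ _ _ _ H6 (cder_mult _ _ _ _ _ H6 (cder_const 1 tau))))).
unfold Delta. field; rtoc.
Qed.

Lemma Delta_not_zero : exists tau, upper tau /\ Delta tau <> 0.
Proof.
destruct (excluded_middle_informative (exists tau, upper tau /\ Delta tau <> 0)) as [|N]; [assumption|exfalso].
assert (Z : forall tau, upper tau -> Delta tau = 0).
{ intros tau H. destruct (Ceq_dec (Delta tau) 0); [assumption|exfalso; apply N; exists tau; split; assumption]. }
assert (H := Wf_plus _ _ _ _ (Wf_mult _ _ _ _ Wf_E4 (Wf_mult _ _ _ _ Wf_E4 Wf_E4)) (Wf_scal (- (1)) _ _ (Wf_mult _ _ _ _ Wf_E6 Wf_E6))).
assert (K := Wf_ext _ _ _ (fun _ => RtoC 0) H (fun n => eq_refl)).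
(* The coefficient of [q] is compared: it is [3 240 + 2 504 = 1728]. *)
assert (E := Wf_unique _ _ _ (K ltac:(intros tau Ht; cbv beta; rewrite <- (Z tau Ht); unfold Delta; ring)) (Wf_const 0) 1%nat).
assert (S : forall r, divsum r 1 = 1) by (intros r; unfold divsum, Csum; simpl; change (nC 1) with (RtoC 1); rewrite Cpow_1_l; ring).
unfold cauchy_prod, eis_seq in E. simpl in E. rewrite !S, !divsum_0 in E.
apply (RtoC_neq 1728); [lra|]. rewrite <- E. ring.
Qed.

(** The logarithmic derivative of [Delta] is [tpi E2], so [Delta] divided by the exponential of a
    primitive of [tpi E2] is constant, and one zero would make [Delta] vanish everywhere. The
    summand [tpi t] is the primitive of the constant term 1 of [E2]. *)
Lemma Delta_nz (tau : C) : upper tau -> Delta tau <> 0.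
Proof.
intros H Z. destruct (Wf_prim _ _ Wf_E2) as [b [G [_ [_ HG]]]].
assert (D : forall z, 0 < Im z -> cder (fun t => Delta t * Cexp (- (1) * (G t + tpi * t))) z 0).
{ intros z Hz. assert (H1 := cder_Delta z Hz). assert (H2 := HG z Hz).
  assert (H3 := cder_comp _ _ _ _ _ (cder_Cexp _) (cder_scal (- (1)) _ _ _ (cder_plus _ _ _ _ _ H2 (cder_scal tpi _ _ _ (cder_id z))))).
  apply (cder_eq _ _ _ _ (cder_mult _ _ _ _ _ H1 H3)). 
  unfold eis_seq. simpl cseq. rewrite divsum_0. ring. }
destruct Delta_not_zero as [t [Ht Nt]].
assert (E := cder_zero_const _ 0%R D tau t H Ht). cbv beta in E. rewrite Z, Cmult_0_l in E.
symmetry in E. revert E. apply Cmult_neq_0; [assumption|apply Cexp_nz].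
Qed.

(** The coefficient of the anomalous term in the law of [E2]. *)
Definition kappa : C := 12 / tpi.

Lemma cder_S (f : C -> C) (tau l : C) : upper tau -> cder f (- / tau) l ->
  cder (fun t => f (- / t)) tau (l * / (tau * tau)).
Proof.
intros H Hf. apply (cder_comp f (fun t => - / t)); [assumption|].
apply (cder_eq _ _ _ _ (cder_opp _ _ _ (cder_inv tau (upper_nz tau H)))). ring.
Qed.

Lemma cder_unique_upper (f g : C -> C) (tau a b : C) : upper tau ->
  (forall z, upper z -> f z = g z) -> cder f tau a -> cder g tau b -> a = b.
Proof. intros H E Hf Hg. apply (cder_unique g tau); [|assumption]. apply (cder_ext_upper f); assumption. Qed.

(** The first three derivatives of the transformation law of E4 determine E2 and E6 at [-1/tau] up to
    the possibility [Delta tau = 0], which is excluded. *)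
Lemma E2_E6_S (tau : C) : upper tau ->
  E2 (- / tau) = tau ^ 2 * E2 tau + kappa * tau /\ E6 (- / tau) = tau ^ 6 * E6 tau.
Proof.
assert (tp := tpi_nz).
(* With D the derivative divided by [tpi], [X] is [3 D E4], and [X1], [X2] are [D X] and [D^2 X]
   expanded by the Ramanujan identities. *)
set (X := fun t => E2 t * E4 t - E6 t).
set (X1 := fun t => 5 / 12 * (E2 t * E2 t * E4 t - 2 * (E2 t * E6 t) + E4 t * E4 t)).
set (X2 := fun t => 5 / 12 * (2 * E2 t * ((E2 t * E2 t - E4 t) / 12) * E4 t + E2 t * E2 t * ((E2 t * E4 t - E6 t) / 3)
   - 2 * ((E2 t * E2 t - E4 t) / 12 * E6 t + E2 t * ((E2 t * E6 t - E4 t * E4 t) / 2)) + 2 * E4 t * ((E2 t * E4 t - E6 t) / 3))).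
assert (DX : forall t, upper t -> cder X t (tpi * X1 t)).
{ intros t H. assert (H2 := cder_E2 t H). assert (H4 := cder_E4 t H). assert (H6 := cder_E6 t H).
  apply (cder_eq _ _ _ _ (cder_minus _ _ _ _ _ (cder_mult _ _ _ _ _ H2 H4) H6)). unfold X1. field; rtoc. }
assert (DX1 : forall t, upper t -> cder X1 t (tpi * X2 t)).
{ intros t H. assert (H2 := cder_E2 t H). assert (H4 := cder_E4 t H). assert (H6 := cder_E6 t H).
  apply (cder_eq _ _ _ _ (cder_scal (5 / 12) _ _ _ (cder_plus _ _ _ _ _ (cder_minus _ _ _ _ _ (cder_mult _ _ _ _ _ (cder_mult _ _ _ _ _ H2 H2) H4)
    (cder_scal 2 _ _ _ (cder_mult _ _ _ _ _ H2 H6))) (cder_mult _ _ _ _ _ H4 H4)))). unfold X2. field; rtoc. }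
assert (L2 : forall t, upper t -> X (- / t) = kappa * t ^ 5 * E4 t + t ^ 6 * X t).
{ intros t H. assert (N := upper_nz t H). assert (HS := upper_S t H).
  assert (E := cder_unique_upper _ _ t _ _ H (fun z Hz => E4_S z Hz) (cder_S E4 t _ H (cder_E4 _ HS)) (cder_mult _ _ _ _ _ (cder_pow 4 t) (cder_E4 t H))).
  change (nC 4) with (RtoC 4) in E. simpl INR in E.
  replace (X (- / t)) with (3 * (t * t) / tpi * (tpi * ((E2 (- / t) * E4 (- / t) - E6 (- / t)) / 3) * / (t * t))) by (unfold X; field; split; assumption).
  rewrite E. replace (RtoC (1 + 1 + 1 + 1)) with (RtoC 4) by (f_equal; ring). unfold kappa, X. simpl Nat.sub. field. assumption. }
assert (L3 : forall t, upper t -> X1 (- / t) = t ^ 2 / tpi * (5 * kappa * t ^ 4 * E4 t + 6 * t ^ 5 * X t) + kappa * t ^ 7 * (X t / 3) + t ^ 8 * X1 t).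
{ intros t H. assert (N := upper_nz t H). assert (HS := upper_S t H).
  assert (E := cder_unique_upper _ _ t _ _ H L2 (cder_S X t _ H (DX _ HS))
    (cder_plus _ _ _ _ _ (cder_mult _ _ _ _ _ (cder_scal kappa _ _ _ (cder_pow 5 t)) (cder_E4 t H)) (cder_mult _ _ _ _ _ (cder_pow 6 t) (DX t H)))).
  simpl INR in E. 
  replace (X1 (- / t)) with (t * t / tpi * (tpi * X1 (- / t) * / (t * t))) by (field; split; assumption).
  rewrite E. replace (RtoC (1 + 1 + 1 + 1 + 1)) with (RtoC 5) by (f_equal; ring). replace (RtoC (1 + 1 + 1 + 1 + 1 + 1)) with (RtoC 6) by (f_equal; ring).
  unfold X. simpl Nat.sub. field. assumption. }
assert (L4 : forall t, upper t -> X2 (- / t) = t ^ 2 / tpi * (/ tpi * (30 * kappa * t ^ 5 * E4 t + 42 * t ^ 6 * X t)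
   + 5 * kappa * t ^ 6 * (X t / 3) + 6 * t ^ 7 * X1 t + 7 * kappa * t ^ 6 * (X t / 3) + 8 * t ^ 7 * X1 t) + kappa * t ^ 9 * (X1 t / 3) + t ^ 10 * X2 t).
{ intros t H. assert (N := upper_nz t H). assert (HS := upper_S t H).
  assert (E := cder_unique_upper (fun t => X1 (- / t)) (fun t => / tpi * 5 * kappa * t ^ 6 * E4 t + / tpi * 6 * t ^ 7 * X t + kappa * / 3 * t ^ 7 * X t + t ^ 8 * X1 t) t _ _ H
    ltac:(intros z Hz; cbv beta; rewrite (L3 z Hz); field; assumption)
    (cder_S X1 t _ H (DX1 _ HS))
    (cder_plus _ _ _ _ _ (cder_plus _ _ _ _ _ (cder_plus _ _ _ _ _ (cder_mult _ _ _ _ _ (cder_scal (/ tpi * 5 * kappa) _ _ _ (cder_pow 6 t)) (cder_E4 t H))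
      (cder_mult _ _ _ _ _ (cder_scal (/ tpi * 6) _ _ _ (cder_pow 7 t)) (DX t H))) (cder_mult _ _ _ _ _ (cder_scal (kappa * / 3) _ _ _ (cder_pow 7 t)) (DX t H)))
       (cder_mult _ _ _ _ _ (cder_pow 8 t) (DX1 t H)))).
  simpl INR in E.
  replace (X2 (- / t)) with (t * t / tpi * (tpi * X2 (- / t) * / (t * t))) by (field; split; assumption).
  rewrite E. replace (RtoC (1 + 1 + 1 + 1 + 1 + 1)) with (RtoC 6) by (f_equal; ring).
  replace (RtoC (1 + 1 + 1 + 1 + 1 + 1 + 1)) with (RtoC 7) by (f_equal; ring). replace (RtoC (1 + 1 + 1 + 1 + 1 + 1 + 1 + 1)) with (RtoC 8) by (f_equal; ring).
  unfold X. simpl Nat.sub. field. assumption. }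
intros H. assert (N := upper_nz tau H). specialize (L2 tau H). specialize (L3 tau H). specialize (L4 tau H).
assert (Dn := Delta_nz tau H). unfold Delta in Dn. assert (L1 := E4_S tau H).
unfold X2, X1, X in *. rewrite L1 in L2, L3, L4.
set (P' := E2 (- / tau)) in *. set (R' := E6 (- / tau)) in *.
set (P := E2 tau) in *. set (Q := E4 tau) in *. set (R := E6 tau) in *.
(* [p] measures the failure of the expected law of [E2]. The law of [X] then shows that [E6]
   deviates by [p Q], so everything reduces to [p = 0]. *)
set (p := (P' - kappa * tau) / tau ^ 2 - P).
assert (EP : P' = tau ^ 2 * (P + p) + kappa * tau) by (unfold p; field; assumption).
assert (ER : R' = tau ^ 6 * (R + p * Q)).
{ replace R' with (P' * (tau ^ 4 * Q) - (P' * (tau ^ 4 * Q) - R')) by ring. rewrite L2, EP. ring. }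
clearbody p. clear L2. rewrite EP, ER in L3, L4.
(* The laws of [X1] and [X2] hold for [p = 0]; what remains of them for general [p] are the two
   equations [F3] and [F4]. *)
assert (F3 : p * (p * Q + 2 * R) = 0).
{ apply Ceq_minus in L3. 
  match type of L3 with ?A = RtoC 0 => replace (p * (p * Q + 2 * R)) with (- (RtoC 12 / 5) / tau ^ 8 * A) end.
  rewrite L3; ring. unfold kappa. field; repeat split; assumption. }
assert (F4 : p * (Q * Q) - 3 / 2 * (P * (p * (p * Q + 2 * R))) - 3 / 2 * p * p * R - p * p * p * Q = 0).
{ apply Ceq_minus in L4.
  match type of L4 with ?A = RtoC 0 => match goal with |- ?B = RtoC 0 => replace B with (RtoC 12 / 5 / tau ^ 10 * A + 3 / 2 * kappa / tau * (p * (p * Q + 2 * R))) end end.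
  rewrite L4, F3; ring. unfold kappa. field; repeat split; assumption. }
destruct (Ceq_dec p 0) as [Z|Np].
- rewrite EP, ER, Z. split; ring.
- exfalso. apply Dn.
  (* For [p <> 0], [F3] gives [p Q = - 2 R], and inserting this in [Q] times [F4] leaves
     [p (Q^3 - R^2) = 0]. *)
  assert (G1 : p * Q + 2 * R = 0).
  { destruct (Ceq_dec (p * Q + 2 * R) 0); [assumption|exfalso]. revert F3. apply Cmult_neq_0; assumption. }
  assert (G2 : p * (Q ^ 3 - R ^ 2) = 0).
  { replace (p * (Q ^ 3 - R ^ 2)) with (Q * (p * (Q * Q) - 3 / 2 * (P * (p * (p * Q + 2 * R))) - 3 / 2 * p * p * R - p * p * p * Q)
      + p * (p * Q + 2 * R) * (3 / 2 * P * Q) + p * (p * Q + 2 * R) * (p * Q - R / 2)) by field.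
    rewrite F4, G1. ring. }
  destruct (Ceq_dec (Q ^ 3 - R ^ 2) 0); [assumption|exfalso]. revert G2. apply Cmult_neq_0; assumption.
Qed.

(** * Vanishing in negative weight *)

Lemma W_bound (a : nat -> C) (f : C -> C) : Wf a f ->
  exists B : R, 0 <= B /\ forall tau, 1 / 2 <= Im tau -> Cmod (f tau) <= B.
Proof.
intros [Ha Hf].
assert (Hs : exp (- PI) < 1) by (rewrite <- exp_0; apply exp_increasing; generalize PI_RGT_0; lra).
destruct (subexp_term a _ Ha Hs) as [M [r [HM [Hr B]]]].
exists (M * / (1 - r))%R. split.
{ apply Rmult_le_pos; [assumption|]. left; apply Rinv_0_lt_compat; lra. }
intros tau Ht. assert (U : upper tau) by (unfold upper; lra).
rewrite Hf by assumption. apply (psum_bound a _ (fun n => M * r ^ n)%R); [assumption|apply Cmod_q_lt; assumption|..].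
- intros n. apply B. rewrite Cmod_q. destruct Ht as [Ht|Ht].
  + left. apply exp_increasing. generalize PI_RGT_0. nra.
  + rewrite <- Ht. right; f_equal; field.
- intros n. rewrite rsum_scal. apply Rmult_le_compat_l; [assumption|apply rsum_geom; lra].
Qed.

Lemma W_period_Z (f : C -> C) (tau : C) (k : Z) : W f -> upper tau -> f (tau - RtoC (IZR k)) = f tau.
Proof.
intros [a [_ Hf]] Ht. rewrite !Hf, q_period_Z; try assumption. reflexivity.
unfold upper in *. destruct tau; simpl in *; lra.
Qed.

(** The function [|f|^2 / Im^N] is invariant under tau |-> -1/tau. Below height 1/2, a translation
    to [|Re| <= 1/2] gives [|tau|^2 <= 1/2], so inversion at least doubles the height; after
    finitely many steps the bound for [Im >= 1/2] applies. Squares avoid the exponent [N / 2]. *)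
Lemma neg_weight_bound (f : C -> C) (N : nat) : W f ->
  (forall tau, upper tau -> f tau = tau ^ N * f (- / tau)) ->
  exists B : R, 0 <= B /\ forall tau, upper tau -> Cmod (f tau) ^ 2 <= B * Im tau ^ N.
Proof.
intros Hf HS. assert (Hf' := Hf). destruct Hf' as [a Ha]. destruct (W_bound a f Ha) as [B [HB HBd]].
exists (B ^ 2 * 2 ^ N)%R. split. { apply Rmult_le_pos; apply pow_le; lra. }
assert (G : forall n tau, upper tau -> / 2 ^ (S n) <= Im tau -> Cmod (f tau) ^ 2 <= B ^ 2 * 2 ^ N * Im tau ^ N).
{ induction n; intros tau Ht Hn.
  - simpl in Hn. rewrite Rmult_assoc, <- Rpow_mult_distr.
    rewrite <- (Rmult_1_r (Cmod (f tau) ^ 2)). apply Rmult_le_compat; [apply pow_le, Cmod_ge_0|lra| |].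
    + apply pow_incr. split; [apply Cmod_ge_0|apply HBd; lra].
    + rewrite <- (pow1 N). apply pow_incr. lra.
  - destruct (Rle_lt_dec (1 / 2) (Im tau)) as [L|L].
    { apply IHn; [assumption|]. simpl. assert (1 <= 2 ^ n) by (apply pow_R1_Rle; lra).
      assert (/ (2 * 2 ^ n) <= / 2) by (apply Rinv_le_contravar; lra). lra. }
    set (k := Int_part (Re tau + 1 / 2)). set (t := tau - RtoC (IZR k)).
    assert (Hr : - (1 / 2) <= Re t <= 1 / 2).
    { unfold t. change (Re (tau - RtoC (IZR k))) with (Re tau - IZR k)%R.
      destruct (base_Int_part (Re tau + 1 / 2)) as [I1 I2]. fold k in I1, I2. lra. }
    assert (Hi : Im t = Im tau) by (unfold t; destruct tau; simpl; ring).
    assert (Ut : upper t) by (unfold upper in *; rewrite Hi; assumption).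
    rewrite <- (W_period_Z f tau k Hf Ht). fold t. rewrite <- Hi in Hn, L |- *. clearbody t.
    unfold upper in Ut.
    set (m := (Cmod t ^ 2)%R).
    assert (Em : m = (Re t ^ 2 + Im t ^ 2)%R) by apply Cmod2_alt.
    assert (m0 : 0 < m) by (rewrite Em; nra). assert (m1 : m <= 1 / 2) by (rewrite Em; nra).
    assert (It : Im (- / t) = (Im t / m)%R).
    { rewrite Em. destruct t as [x y]. simpl in *. field. nra. }
    rewrite HS by exact Ut. rewrite Cmod_mult, Rpow_mult_distr, Cmod_pow, <- Nat.mul_1_r with (n := N) at 1.
    replace ((Cmod t ^ (N * 1)) ^ 2)%R with (m ^ N)%R by (unfold m; rewrite Nat.mul_1_r, <- !pow_mult; f_equal; lia).
    assert (I := IHn (- / t) (upper_S t Ut)). rewrite It in I.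
    assert (Hq : / 2 ^ S n <= Im t / m).
    { apply Rle_div_r; [assumption|]. assert (0 < / 2 ^ S n) by (apply Rinv_0_lt_compat, pow_lt; lra).
      replace (/ 2 ^ S (S n))%R with (/ 2 ^ S n * / 2)%R in Hn by (simpl; field; apply pow_nonzero; lra). nra. }
    specialize (I Hq).
    apply Rle_trans with (m ^ N * (B ^ 2 * 2 ^ N * (Im t / m) ^ N))%R.
    + apply Rmult_le_compat_l; [apply pow_le; lra|assumption].
    + right. replace (m ^ N * (B ^ 2 * 2 ^ N * (Im t / m) ^ N))%R with (B ^ 2 * 2 ^ N * (m ^ N * (Im t / m) ^ N))%R by ring.
      rewrite <- Rpow_mult_distr. do 2 f_equal. field. lra. }
intros tau Ht. unfold upper in Ht. destruct (INR_unbounded (/ Im tau)) as [n Hn].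
apply (G n); [exact Ht|]. rewrite <- (Rinv_inv (Im tau)). assert (P : 0 < / Im tau) by (apply Rinv_0_lt_compat; assumption).
apply Rinv_le_contravar; [assumption|]. assert (T := pow2_ge (S n)). apply le_INR in T. rewrite pow_INR in T.
change (INR 2) with 2%R in T. rewrite S_INR in T. lra.
Qed.

Lemma clim_csum (u : nat -> nat -> C) (v : nat -> C) (m : nat) :
  (forall l, clim (fun K => u K l) (v l)) -> clim (fun K => csum (u K) m) (csum v m).
Proof. intros H. induction m; simpl; [exact (clim_const 0)|apply clim_plus; auto]. Qed.

Lemma csum_single (f : nat -> C) (i N : nat) : (i < N)%nat ->
  (forall j, (j < N)%nat -> j <> i -> f j = 0) -> csum f N = f i.
Proof.
intros Hi H. induction N; [lia|]. rewrite csum_Sr. destruct (Nat.eq_dec i N).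
- subst. rewrite csum_zero; [ring|]. intros j Hj. apply H; lia.
- rewrite IHN, (H N); [ring|lia|lia|lia|]. intros; apply H; lia.
Qed.

Lemma q_real_neq_1 (x : R) : x <> 0%R -> -1 < x < 1 -> 1 - q (RtoC x) <> 0.
Proof.
intros Nx Hx. destruct lipschitz_pole as [K0 [_ L]].
assert (K : forall y : R, y <> 0%R -> - (1 / 2) <= y <= 1 / 2 -> 1 - q (RtoC y) <> 0).
{ intros y Ny Hy. apply L. intros E; apply RtoC_inj in E; contradiction. simpl. apply Rabs_le; lra. }
destruct (Rlt_le_dec x (- (1 / 2))).
- rewrite <- (q_period_Z (RtoC x) (-1)), <- RtoC_minus. apply K; lra.
- destruct (Rlt_le_dec (1 / 2) x).
  + rewrite <- (q_period_Z (RtoC x) 1), <- RtoC_minus. apply K; lra.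
  + apply K; [assumption|lra].
Qed.

(** Orthogonality of the characters of Z/m: a full geometric sum of a nontrivial mth root of unity
    vanishes. *)
Lemma root_average (m k n : nat) : (k < m)%nat -> (n < m)%nat -> k <> n ->
  csum (fun l => q (RtoC (INR k / INR m)) ^ l * q (RtoC (- INR n / INR m)) ^ l) m = 0.
Proof.
intros Hk Hn Hkn. assert (m0 : 0 < INR m) by (apply lt_0_INR; lia).
set (x := ((INR k - INR n) / INR m)%R).
assert (E : q (RtoC (INR k / INR m)) * q (RtoC (- INR n / INR m)) = q (RtoC x)).
{ rewrite <- q_plus, <- RtoC_plus. f_equal. f_equal. unfold x. field. lra. }
rewrite (csum_ext _ (fun l => q (RtoC x) ^ l)) by (intros; rewrite <- Cpow_mult_l, E; reflexivity).
apply lt_INR in Hk, Hn. assert (Pk := pos_INR k). assert (Pn := pos_INR n).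
assert (N : 1 - q (RtoC x) <> 0).
{ apply q_real_neq_1.
  - unfold x. intros Z. apply Hkn, INR_eq. apply Rmult_eq_reg_r with (/ INR m)%R; [|apply Rinv_neq_0_compat; lra].
    unfold Rdiv in Z. lra.
  - unfold x. split; [apply Rlt_div_r; lra|apply Rlt_div_l; lra]. }
assert (P : q (RtoC x) ^ m = 1).
{ rewrite <- q_nC_mult. replace (nC m * RtoC x) with (RtoC (IZR (Z.of_nat k - Z.of_nat n))).
  2: { unfold nC, x. rewrite <- RtoC_mult, minus_IZR, <- !INR_IZR_INZ. f_equal. field. lra. }
  replace (RtoC (IZR (Z.of_nat k - Z.of_nat n))) with (0 - RtoC (IZR (- (Z.of_nat k - Z.of_nat n)))) by (rewrite opp_IZR, RtoC_opp; ring).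
  rewrite q_period_Z. unfold q. rewrite Cmult_0_r. apply Cexp_0. }
assert (G : forall j, (1 - q (RtoC x)) * csum (fun l => q (RtoC x) ^ l) j = 1 - q (RtoC x) ^ j).
{ induction j; [simpl; ring|]. rewrite csum_Sr, Cmult_plus_distr_l, IHj. simpl. ring. }
specialize (G m). rewrite P in G. replace (1 - 1) with (RtoC 0) in G by ring.
destruct (Ceq_dec (csum (fun l => q (RtoC x) ^ l) m) 0) as [|Z]; [assumption|exfalso].
revert G. apply Cmult_neq_0; assumption.
Qed.

(** In place of a Fourier integral, [f] is averaged over [m] equidistant points of the horizontal
    line against the conjugate character. This yields the nth term up to the frequencies [k >= m],
    whose contribution tends to 0 with growing [m]. *)
Lemma fourier_coeff_bound (a : nat -> C) (f : C -> C) (n : nat) (y B : R) : Wf a f -> 0 < y ->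
  (forall x : R, Cmod (f (x, y)) <= B) -> Cmod (a n) * Cmod (q (0, y)%R) ^ n <= B.
Proof.
intros [Ha Hf] Hy HB. set (z := q (0, y)%R).
assert (U : forall x : R, upper (x, y)) by (intros; exact Hy).
assert (Hz : Cmod z < 1) by (apply Cmod_q_lt, U).
destruct (subexp_term a _ Ha Hz) as [M [r [HM [Hr Bt]]]]. specialize (Bt z (Rle_refl _)).
apply le_epsilon. intros eps Heps.
assert (Hl : is_lim_seq (fun m => M * / (1 - r) * r ^ m)%R 0).
{ replace (Finite 0) with (Rbar_mult (M * / (1 - r))%R 0%R) by (simpl; f_equal; ring).
  apply is_lim_seq_scal_l, is_lim_seq_geom. rewrite Rabs_pos_eq; lra. }
apply is_lim_seq_spec in Hl. destruct (Hl (mkposreal _ Heps)) as [m0 Hm0]. simpl in Hm0.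
(* [m > n] makes [n] the only frequency below [m] that survives the average; [m >= m0] makes the
   contribution of the others smaller than [eps]. *)
set (m := (m0 + n + 1)%nat). specialize (Hm0 m ltac:(unfold m; lia)). apply Rabs_def2 in Hm0.
assert (mp : 0 < INR m) by (apply lt_0_INR; unfold m; lia).
set (om := q (RtoC (1 / INR m))). set (oi := q (RtoC (- INR n / INR m))).
assert (Co : forall x : R, Cmod (q (RtoC x)) = 1%R).
{ intros x. rewrite Cmod_q. simpl. rewrite Rmult_0_r, Ropp_0. apply exp_0. }
assert (Ef : forall l : nat, f (INR l / INR m, y)%R = psum a (z * om ^ l)).
{ intros l. rewrite Hf by apply U. f_equal. unfold z, om. rewrite <- q_nC_mult, <- q_plus. f_equal.
  unfold nC, Cplus, Cmult, RtoC; simpl. f_equal; field; lra. }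
assert (Hzl : forall l, Cmod (z * om ^ l) = Cmod z).
{ intros l. rewrite Cmod_mult, Cmod_pow. unfold om. rewrite Co, pow1. ring. }
assert (Om : forall k l, (om ^ l) ^ k = q (RtoC (INR k / INR m)) ^ l).
{ intros k l. rewrite <- Cpow_mult_r, Nat.mul_comm, Cpow_mult_r. f_equal. unfold om. rewrite <- q_nC_mult. f_equal.
  unfold nC. rewrite <- RtoC_mult. f_equal. field. lra. }
assert (Lim : clim (fun K => csum (fun l => oi ^ l * csum (fun k => a k * (z * om ^ l) ^ k) K) m) (csum (fun l => oi ^ l * f (INR l / INR m, y)%R) m)).
{ apply (clim_csum (fun K l => oi ^ l * csum (fun k => a k * (z * om ^ l) ^ k) K)). intros l.
  apply clim_scal. rewrite Ef. apply psum_lim; [assumption|rewrite Hzl; assumption]. }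
set (c := fun k => csum (fun l => q (RtoC (INR k / INR m)) ^ l * oi ^ l) m).
assert (Cn : c n = nC m).
{ unfold c, oi. rewrite (csum_ext _ (fun _ => 1)).
  - clear. induction m; simpl; [reflexivity|]. rewrite IHm, nC_S. reflexivity.
  - intros l _. rewrite <- Cpow_mult_l, <- q_plus, <- RtoC_plus. replace (INR n / INR m + - INR n / INR m)%R with 0%R by (field; lra).
    unfold q. rewrite Cmult_0_r, Cexp_0. apply Cpow_1_l. }
assert (Cb : forall k, Cmod (c k) <= INR m).
{ intros k. unfold c. eapply Rle_trans; [apply (Cmod_csum_le _ (fun _ => 1%R))|rewrite rsum_const; lra].
  intros l _. unfold oi. rewrite Cmod_mult, !Cmod_pow, !Co, pow1. lra. }
assert (Sw : forall K, csum (fun l => oi ^ l * csum (fun k => a k * (z * om ^ l) ^ k) K) m = csum (fun k => a k * z ^ k * c k) K).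
{ intros K. rewrite (csum_ext _ (fun l => csum (fun k => a k * z ^ k * (q (RtoC (INR k / INR m)) ^ l * oi ^ l)) K)).
  - rewrite csum_switch. apply csum_ext. intros k _. rewrite csum_scal. reflexivity.
  - intros l _. rewrite <- csum_scal. apply csum_ext. intros k _. rewrite Cpow_mult_l, Om. ring. }
assert (Key : Cmod (csum (fun l => oi ^ l * f (INR l / INR m, y)%R) m - nC m * (a n * z ^ n)) <= INR m * (M * / (1 - r) * r ^ m)).
{ apply (clim_Cmod_le (fun K => csum (fun k => a k * z ^ k * c k) (m + K) + - (nC m * (a n * z ^ n)))).
  - apply clim_plus; [|apply clim_const].
    apply (clim_subseq (fun K => csum (fun k => a k * z ^ k * c k) K) _ (fun K => (m + K)%nat)); [intros; lia|].
    eapply clim_ext; [|exact Lim]. exact Sw.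
  - intros K. rewrite csum_split.
    rewrite (csum_single _ n m); [|unfold m; lia|].
    2: { intros k Hk Hkn. unfold c, oi. rewrite root_average; [ring|assumption|unfold m; lia|assumption]. }
    rewrite Cn. match goal with |- Cmod (?x + ?y + - ?w) <= _ => replace (x + y + - w) with y by ring end.
    apply Rle_trans with (rsum (fun i => INR m * M * r ^ m * r ^ i)%R K).
    + apply Cmod_csum_le. intros i _. rewrite Cmod_mult.
      replace (INR m * M * r ^ m * r ^ i)%R with (M * r ^ (m + i) * INR m)%R by (rewrite pow_add; ring).
      apply Rmult_le_compat; try apply Cmod_ge_0; auto.
    + rewrite rsum_scal. assert (G := rsum_geom r K ltac:(lra)).
      replace (INR m * (M * / (1 - r) * r ^ m))%R with (INR m * M * r ^ m * / (1 - r))%R by ring.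
      apply Rmult_le_compat_l; [|assumption]. repeat apply Rmult_le_pos; try lra. apply pow_le; lra. }
assert (Up : Cmod (csum (fun l => oi ^ l * f (INR l / INR m, y)%R) m) <= INR m * B).
{ rewrite <- rsum_const. apply Cmod_csum_le. intros l _. unfold oi. rewrite Cmod_mult, Cmod_pow, Co, pow1, Rmult_1_l. apply HB. }
assert (T := Cmod_tri_minus (nC m * (a n * z ^ n)) (nC m * (a n * z ^ n) - csum (fun l => oi ^ l * f (INR l / INR m, y)%R) m)).
match type of T with _ <= Cmod ?x + Cmod ?w => replace x with (csum (fun l => oi ^ l * f (INR l / INR m, y)%R) m) in T by ring;
  rewrite <- (Cmod_opp w) in T; replace (- w) with (csum (fun l => oi ^ l * f (INR l / INR m, y)%R) m - nC m * (a n * z ^ n)) in T by ring end.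
rewrite !Cmod_mult, Cmod_pow, Cmod_nC in T. apply Rmult_le_reg_l with (INR m); [assumption|]. nra.
Qed.

Lemma neg_weight_zero (f : C -> C) (N : nat) : W f -> (1 <= N)%nat ->
  (forall tau, upper tau -> f tau = tau ^ N * f (- / tau)) -> forall tau, upper tau -> f tau = 0.
Proof.
intros [a Ha] HN HS. destruct (neg_weight_bound f N ltac:(exists a; exact Ha) HS) as [B [HB Bd]].
assert (Z : forall n, a n = 0).
{ intros n. destruct (Ceq_dec (a n) 0) as [|Nz]; [assumption|exfalso]. apply Cmod_gt_0 in Nz.
  (* For [y <= 1] the factor [|q|^n] is at least [exp(- 2 pi)^n], independently of [y], while the
     bound for [f] at height [y] tends to 0 with [y]; this is where [N >= 1] enters. *)
  assert (G : forall y, 0 < y <= 1 -> (Cmod (a n) * exp (- (2 * PI)) ^ n) ^ 2 <= B * y).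
  { intros y Hy.
    assert (Bx : forall x : R, Cmod (f (x, y)) <= sqrt (B * y ^ N)).
    { intros x. rewrite <- (sqrt_pow2 (Cmod (f (x, y)))) by apply Cmod_ge_0. apply sqrt_le_1_alt. apply Bd. unfold upper; simpl; lra. }
    assert (F := fourier_coeff_bound a f n y _ Ha ltac:(lra) Bx).
    assert (E : Cmod (a n) * exp (- (2 * PI)) ^ n <= sqrt (B * y ^ N)).
    { eapply Rle_trans; [|exact F]. apply Rmult_le_compat_l; [lra|]. apply pow_incr. split; [left; apply exp_pos|].
      rewrite Cmod_q. simpl. destruct (Req_dec y 1) as [E1|E1]; [rewrite E1, Rmult_1_r; lra|].
      left. apply exp_increasing. generalize PI_RGT_0. nra. }
    assert (yN : y ^ N <= y).
    { destruct N; [lia|]. simpl. rewrite <- (Rmult_1_r y) at 3. apply Rmult_le_compat_l; [lra|]. rewrite <- (pow1 N). apply pow_incr; lra. }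
    assert (yp : 0 <= y ^ N) by (apply pow_le; lra).
    apply Rle_trans with (sqrt (B * y ^ N) ^ 2)%R.
    - apply pow_incr. split; [|assumption]. apply Rmult_le_pos; [lra|]. apply pow_le. left; apply exp_pos.
    - rewrite pow2_sqrt by (apply Rmult_le_pos; assumption). apply Rmult_le_compat_l; assumption. }
  set (A := ((Cmod (a n) * exp (- (2 * PI)) ^ n) ^ 2)%R) in *.
  assert (HA : 0 < A). { unfold A. apply pow_lt, Rmult_lt_0_compat; [assumption|]. apply pow_lt, exp_pos. }
  assert (Hy : 0 < Rmin 1 (A / (2 * (1 + B))) <= 1).
  { split; [|apply Rmin_l]. apply Rmin_case; [lra|]. apply Rdiv_lt_0_compat; lra. }
  specialize (G _ Hy). assert (R := Rmin_r 1 (A / (2 * (1 + B)))).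
  assert (B * (A / (2 * (1 + B))) <= A / 2).
  { replace (A / 2)%R with ((1 + B) * (A / (2 * (1 + B))))%R by (field; lra). apply Rmult_le_compat_r; [|lra].
    left. apply Rdiv_lt_0_compat; lra. }
  nra. }
intros tau Ht. rewrite (proj2 Ha) by assumption. rewrite (psum_ext _ (fun _ => 0) _ Z). apply psum_zero.
Qed.

(** * Taylor polynomials and Bol's identity *)

Definition dpow (x : C) (j : nat) : C := x ^ j / nC (fact j).

Lemma nC_fact_nz (j : nat) : nC (fact j) <> 0.
Proof. apply nC_neq_0, fact_neq_0. Qed.

Lemma dpow_cder (g : C -> C) (tau l : C) (j : nat) : cder g tau l ->
  cder (fun t => dpow (g t) j) tau (match j with O => 0 | S i => l * dpow (g tau) i end).
Proof.
intros H. unfold dpow.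
apply (cder_ext_loc (fun t => / nC (fact j) * g t ^ j) _ _ _ 1%R); [lra|intros; unfold Cdiv; ring|].
apply (cder_eq _ _ _ _ (cder_scal (/ nC (fact j)) _ _ _ (cder_comp (fun w => w ^ j) g _ _ _ (cder_pow j _) H))).
destruct j. { simpl. ring. }
assert (N1 := nC_fact_nz j). assert (N2 := nC_neq_0 (S j) ltac:(lia)).
change (fact (S j)) with (S j * fact j)%nat. rewrite nC_mult. change (RtoC (INR (S j))) with (nC (S j)).
replace (S j - 1)%nat with j by lia. field. split; assumption.
Qed.

Definition taylor (E : nat -> C -> C) (N : nat) (x tau : C) : C := csum (fun j => E j tau * dpow (x - tau) j) (S N).

(** Differentiation is in the base point [tau], with the evaluation point [x] fixed: the terms
    telescope and only the last one is left. *)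
Lemma taylor_cder (E : nat -> C -> C) (N : nat) (x tau : C) :
  (forall j, cder (E j) tau (E (S j) tau)) -> cder (taylor E N x) tau (E (S N) tau * dpow (x - tau) N).
Proof.
intros H. unfold taylor.
assert (D : forall j, cder (fun t => dpow (x - t) j) tau (match j with O => 0 | S i => - (1) * dpow (x - tau) i end)).
{ intros j. apply (dpow_cder (fun t => x - t)). apply (cder_eq _ _ _ _ (cder_minus _ _ _ _ _ (cder_const x tau) (cder_id tau))). ring. }
induction N.
- simpl. apply (cder_eq _ _ _ _ (cder_plus _ _ _ _ _ (cder_const 0 tau) (cder_mult _ _ _ _ _ (H O) (D O)))). ring.
- apply (cder_eq _ _ _ _ (cder_plus _ _ _ _ _ IHN (cder_mult _ _ _ _ _ (H (S N)) (D (S N))))). ring.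
Qed.

Lemma WT_zero_large (n : nat) (F : C -> C) (Y : R) : WT n F -> (forall tau, Y < Im tau -> upper tau -> F tau = 0) ->
  forall tau, upper tau -> F tau = 0.
Proof.
intros [p [Hp H]] Z tau Ht. rewrite H by assumption. apply csum_zero. intros i Hi.
rewrite (tau_indep n p Y); auto; [ring|]. intros t Y1 U. rewrite <- H by assumption. auto.
Qed.

Lemma WT_lin_pow (c d : C) (j : nat) : WT (S j) (fun x => (c * x + d) ^ j).
Proof.
induction j.
- apply (WT_ext _ _ _ (WT_W _ (W_const 1))). reflexivity.
- simpl Cpow. assert (L : WT 2 (fun x => c * x + d)).
  { apply WT_plus. apply (WT_ext _ _ _ (WT_monomial 1 _ (W_const c))). intros; simpl; ring.
    apply (WT_le 1); [lia|]. apply WT_W, W_const. }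
  exact (WT_mult 2 j _ _ L IHj).
Qed.

(** [U x t] compares the Taylor polynomials based at [-1/t] and at [t]. Since [E (S N)] has weight
    [N + 2], it does not depend on [t]. For [t = x] it is the defect [x^N E0(-1/x) - E0(x)] of the
    law, for a fixed base point [t0] it is a polynomial in [x]; so the defect vanishes everywhere
    once it vanishes for large [Im x]. *)
Lemma bol_extend (E : nat -> C -> C) (N : nat) (Y : R) :
  (forall j tau, upper tau -> cder (E j) tau (E (S j) tau)) ->
  (forall tau, upper tau -> E (S N) (- / tau) = tau ^ (N + 2) * E (S N) tau) ->
  (forall tau, Y < Im tau -> upper tau -> E 0%nat tau = tau ^ N * E 0%nat (- / tau)) ->
  forall tau, upper tau -> E 0%nat tau = tau ^ N * E 0%nat (- / tau).
Proof.
intros HE HS HY.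
assert (T0 : forall t, taylor E N t t = E 0%nat t).
{ intros t. unfold taylor. rewrite csum_S, csum_zero.
  - unfold dpow. simpl. change (nC 1) with (RtoC 1). field.
  - intros i _. unfold dpow. replace (t - t) with (RtoC 0) by ring. simpl. unfold Cdiv. ring. }
set (U := fun x t => taylor E N (- / x) (- / t) * x ^ N - taylor E N x t).
assert (UC : forall x s t : C, x <> 0 -> upper s -> upper t -> U x s = U x t).
{ intros x s t Nx Hs Ht. apply (cder_zero_const (U x) 0%R); [|assumption..].
  intros z Hz. assert (Nz := upper_nz z Hz).
  assert (D1 := cder_S (taylor E N (- / x)) z _ Hz (taylor_cder E N (- / x) (- / z) (fun j => HE j _ (upper_S z Hz)))).
  assert (D2 := taylor_cder E N x z (fun j => HE j z Hz)).
  apply (cder_eq _ _ _ _ (cder_minus _ _ _ _ _ (cder_mult _ _ _ _ _ D1 (cder_const (x ^ N) z)) D2)).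
  rewrite HS by assumption.
  replace (- / x - - / z) with ((x - z) / (x * z)) by (field; split; assumption).
  unfold dpow. rewrite Cpow_add_r.
  replace (((x - z) / (x * z)) ^ N) with ((x - z) ^ N / (x ^ N * z ^ N)).
  - assert (A := Cpow_nz x N Nx). assert (B := Cpow_nz z N Nz). assert (F := nC_fact_nz N). field. repeat split; assumption.
  - unfold Cdiv. rewrite Cpow_mult_l, Cpow_inv, Cpow_mult_l by (apply Cmult_neq_0; assumption). reflexivity. }
assert (UD : forall t, U t t = t ^ N * E 0%nat (- / t) - E 0%nat t) by (intros t; unfold U; rewrite !T0; ring).
intros tau Ht. symmetry. apply Ceq_minus. rewrite <- UD.
set (t0 := Ci). assert (H0 : upper t0) by (unfold upper, t0; simpl; lra).
rewrite (UC tau tau t0 (upper_nz tau Ht) Ht H0).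
apply (WT_zero_large (S N) (fun x => U x t0) Y); [| |assumption].
- apply (WT_ext _ (fun x => csum (fun j => (E j (- / t0) / nC (fact j)) * (x ^ (N - j) * (/ t0 * x + - (1)) ^ j)) (S N)
     + csum (fun j => (- E j t0 / nC (fact j)) * (1 * x + - t0) ^ j) (S N))).
  + apply WT_plus; apply WT_csum; intros j Hj.
    * apply (WT_scalW _ (fun _ => E j (- / t0) / nC (fact j))); [apply W_const|].
      apply (WT_le (N - j + S j)); [lia|]. apply WT_tau_pow, WT_lin_pow.
    * apply (WT_scalW _ (fun _ => - E j t0 / nC (fact j))); [apply W_const|].
      apply (WT_le (S j)); [lia|]. apply WT_lin_pow.
  + intros x Hx. assert (Nx := upper_nz x Hx). assert (Nt := upper_nz t0 H0). unfold U, taylor.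
    rewrite Cmult_comm, <- csum_scal, <- csum_minus, <- csum_plus. apply csum_ext. intros j Hj.
    assert (F := nC_fact_nz j). unfold dpow.
    replace (x ^ N) with (x ^ (N - j) * x ^ j) by (rewrite <- Cpow_add_r; f_equal; lia).
    replace (/ t0 * x + - (1)) with (x * (- / x - - / t0)) by (field; split; assumption).
    rewrite Cpow_mult_l. replace (1 * x + - t0) with (x - t0) by ring. field. assumption.
- intros t Y1 Hu. rewrite <- (UC t t t0 (upper_nz t Hu) Hu H0), UD, <- HY by assumption. ring.
Qed.

(** * Graded quasimodular forms and their primitives *)

(** Invariance under translation and holomorphy at i oo are contained in [W c], so only the law
    under tau |-> -1/tau is stated. *)
Definition modular_wt (k : nat) (c : C -> C) : Prop := W c /\ forall tau, upper tau -> c (- / tau) = tau ^ k * c tau.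

(** The term [(k, i, c)] stands for the function [c E2^i] with [c] modular of weight [k]. *)
Definition qterm : Type := (nat * nat * (C -> C))%type.
Definition qval (t : qterm) (tau : C) : C := let '(k, i, c) := t in c tau * E2 tau ^ i.
Definition qeval (l : list qterm) (tau : C) : C := Csum (fun t => qval t tau) l.
Definition qwt (t : qterm) : nat := let '(k, i, c) := t in (k + 2 * i)%nat.
Definition qdeg (t : qterm) : nat := let '(k, i, c) := t in i.
Definition modular_term (t : qterm) : Prop := let '(k, i, c) := t in modular_wt k c.
Definition qcoef (t : qterm) : C -> C := let '(k, i, c) := t in c.
Definition keyeq (key : qterm -> nat) (m : nat) (l : list qterm) : list qterm := filter (fun t => Nat.eqb (key t) m) l.

Lemma modular_wt_mult (k j : nat) (c d : C -> C) : modular_wt k c -> modular_wt j d -> modular_wt (k + j) (fun tau => c tau * d tau).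
Proof.
intros [Wc Hc] [Wd Hd]. split; [apply W_mult; assumption|].
intros tau H. rewrite Hc, Hd, Cpow_add_r by assumption. ring.
Qed.

Lemma modular_wt_const (c : C) : modular_wt 0 (fun _ => c).
Proof. split; [apply W_const|]. intros. simpl. ring. Qed.

Lemma modular_wt_E4 : modular_wt 4 E4. Proof. split; [exact W_E4|exact E4_S]. Qed.

Lemma modular_wt_E6 : modular_wt 6 E6. Proof. split; [exact W_E6|]. intros; apply E2_E6_S; assumption. Qed.

Lemma qeval_app (l m : list qterm) (tau : C) : qeval (l ++ m) tau = qeval l tau + qeval m tau.
Proof. apply Csum_app. Qed.

(** The list is merely one expansion as a polynomial in [E2] with modular coefficients; terms of
    equal weight and degree are not collected and may cancel. *)
Lemma quasimodular_rep (f : C -> C) : quasimodular f ->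
  exists l, List.Forall modular_term l /\ forall tau, upper tau -> f tau = qeval l tau.
Proof.
unfold quasimodular. induction 1 as [c|f H|f g _ [l [L E]] _ [m [M E']]|f g _ [l [L E]] _ [m [M E']]|f g _ [l [L E]] E'].
- exists [(0%nat, 0%nat, fun _ => c)]. split; [repeat constructor; apply modular_wt_const|].
  intros; unfold qeval, Csum; simpl; ring.
- destruct H as [H|[H|[H|[]]]]; subst.
  + exists [(0%nat, 1%nat, fun _ => RtoC 1)]. split; [repeat constructor; apply modular_wt_const|]. intros; unfold qeval, Csum; simpl; ring.
  + exists [(4%nat, 0%nat, E4)]. split; [constructor; [apply modular_wt_E4|constructor]|]. intros; unfold qeval, Csum; simpl; ring.
  + exists [(6%nat, 0%nat, E6)]. split; [constructor; [apply modular_wt_E6|constructor]|]. intros; unfold qeval, Csum; simpl; ring.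
- exists (l ++ m). split; [apply Forall_app; split; assumption|]. intros; rewrite qeval_app, E, E' by assumption; reflexivity.
- exists (flat_map (fun t => map (fun s : qterm => let '(k, i, c) := t in let '(k', i', c') := s in
    ((k + k')%nat, (i + i')%nat, fun tau => c tau * c' tau)) m) l). split.
  + apply Forall_flat_map. apply Forall_forall. intros [[k i] c] It. apply Forall_map, Forall_forall. intros [[k' i'] c'] Is.
    rewrite Forall_forall in L, M. apply modular_wt_mult; [apply (L _ It)|apply (M _ Is)].
  + intros tau Ht. rewrite E, E' by assumption. unfold qeval. rewrite Csum_flat_map, Cmult_comm, <- Csum_scal.
    apply Csum_ext. intros [[k i] c] _. rewrite Csum_map, Cmult_comm, <- Csum_scal. apply Csum_ext. intros [[k' i'] c'] _.
    simpl. rewrite Cpow_add_r. ring.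
- exists l. split; [assumption|]. intros. rewrite <- E' by assumption. auto.
Qed.

Lemma quasimodular_der (f : C -> C) : quasimodular f ->
  exists g, quasimodular g /\ forall tau, upper tau -> cder f tau (tpi * g tau).
Proof.
assert (Q2 : quasimodular E2) by (apply alg_gen; simpl; auto).
assert (Q4 : quasimodular E4) by (apply alg_gen; simpl; auto).
assert (Q6 : quasimodular E6) by (apply alg_gen; simpl; auto).
assert (Qs : forall c f, quasimodular f -> quasimodular (fun tau => c * f tau)) by (intros; apply (alg_mul _ (fun _ => c)); [apply alg_const|assumption]).
unfold quasimodular at 1. induction 1 as [c|f H|f g Hf [f' [Qf Df]] Hg [g' [Qg Dg]]|f g Hf [f' [Qf Df]] Hg [g' [Qg Dg]]|f g Hf [f' [Qf Df]] E'].
- exists (fun _ => RtoC 0). split; [apply alg_const|]. intros. rewrite Cmult_0_r. apply cder_const.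
- destruct H as [H|[H|[H|[]]]]; subst.
  + exists (fun tau => / 12 * (E2 tau * E2 tau + - (1) * E4 tau)). split.
    * apply Qs. apply alg_add; [apply alg_mul; assumption|apply Qs; assumption].
    * intros tau Ht. apply (cder_eq _ _ _ _ (cder_E2 tau Ht)). field.
  + exists (fun tau => / 3 * (E2 tau * E4 tau + - (1) * E6 tau)). split.
    * apply Qs. apply alg_add; [apply alg_mul; assumption|apply Qs; assumption].
    * intros tau Ht. apply (cder_eq _ _ _ _ (cder_E4 tau Ht)). field.
  + exists (fun tau => / 2 * (E2 tau * E6 tau + - (1) * (E4 tau * E4 tau))). split.
    * apply Qs. apply alg_add; [apply alg_mul; assumption|apply Qs, alg_mul; assumption].
    * intros tau Ht. apply (cder_eq _ _ _ _ (cder_E6 tau Ht)). field.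
- exists (fun tau => f' tau + g' tau). split; [apply alg_add; assumption|].
  intros tau Ht. apply (cder_eq _ _ _ _ (cder_plus _ _ _ _ _ (Df tau Ht) (Dg tau Ht))). ring.
- exists (fun tau => f' tau * g tau + f tau * g' tau). split; [apply alg_add; apply alg_mul; assumption|].
  intros tau Ht. apply (cder_eq _ _ _ _ (cder_mult _ _ _ _ _ (Df tau Ht) (Dg tau Ht))). ring.
- exists f'. split; [assumption|]. intros tau Ht. apply (cder_ext_upper f); auto.
Qed.

Lemma W_Csum {K : Type} (F : K -> C -> C) (l : list K) : (forall x, In x l -> W (F x)) -> W (fun tau => Csum (fun x => F x tau) l).
Proof.
induction l as [|x l IH]; intros H; [exact (W_const 0)|].
apply (W_plus (F x)); [apply H; simpl; auto|]. apply IH. intros; apply H; simpl; auto.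
Qed.

Lemma W_qval (t : qterm) : modular_term t -> W (qval t).
Proof. destruct t as [[k i] c]. intros [H _]. apply W_mult; [assumption|]. apply W_pow, W_E2. Qed.

Lemma W_qeval (l : list qterm) : List.Forall modular_term l -> W (qeval l).
Proof. intros H. apply (W_Csum qval). intros t I. rewrite Forall_forall in H. apply W_qval, H, I. Qed.

Lemma quasimodular_W (f : C -> C) : quasimodular f -> W f.
Proof.
intros H. destruct (quasimodular_rep f H) as [l [L E]]. apply (W_ext _ _ (W_qeval l L) E).
Qed.

Lemma qeval_split (p : qterm -> bool) (l : list qterm) (tau : C) :
  qeval l tau = qeval (filter p l) tau + qeval (filter (fun t => negb (p t)) l) tau.
Proof. apply Csum_filter. Qed.

Definition not_zero (f : C -> C) : Prop := exists tau, upper tau /\ f tau <> 0.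

Lemma not_zero_dec (f : C -> C) : not_zero f \/ forall tau, upper tau -> f tau = 0.
Proof.
destruct (excluded_middle_informative (not_zero f)) as [|N]; [left; assumption|right].
intros tau H. destruct (Ceq_dec (f tau) 0); [assumption|]. exfalso; apply N; exists tau; split; assumption.
Qed.

Lemma not_zero_mult (f g : C -> C) : W f -> W g -> not_zero f -> not_zero g -> not_zero (fun tau => f tau * g tau).
Proof.
intros Wf Wg [t [Ut Nt]] [s [Us Ns]]. destruct (not_zero_dec (fun tau => f tau * g tau)) as [|Z]; [assumption|exfalso].
destruct (W_integral f g 0%R Wf Wg (fun tau _ H => Z tau H)) as [Zf|Zg]; auto.
Qed.

Lemma W_cancel (f g : C -> C) : W f -> W g -> not_zero f -> (forall tau, upper tau -> f tau * g tau = 0) ->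
  forall tau, upper tau -> g tau = 0.
Proof.
intros Wf Wg [t [Ut Nt]] Z. destruct (W_integral f g 0%R Wf Wg (fun tau _ H => Z tau H)) as [Zf|Zg]; [|assumption].
exfalso. auto.
Qed.

Lemma W_nonzero_large (f : C -> C) : W f -> not_zero f -> exists Y : R, 0 < Y /\ forall tau, Y < Im tau -> f tau <> 0.
Proof.
intros Hf [t [Ut Nt]]. destruct (W_dichotomy f Hf) as [Z|]; [|assumption]. exfalso; auto.
Qed.

(** Since terms may cancel, the highest key in a list carries no information. Top components that
    are zero as functions are discarded until a nonzero one appears; the key is the weight or the
    degree in [E2]. *)
Lemma qeval_trim (key : qterm -> nat) (l : list qterm) (m : nat) : (forall t, In t l -> (key t <= m)%nat) ->
  (forall tau, upper tau -> qeval l tau = 0) \/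
  exists m' l', (m' <= m)%nat /\ incl l' l /\ (forall t, In t l' -> (key t <= m')%nat) /\
    (forall tau, upper tau -> qeval l' tau = qeval l tau) /\ not_zero (qeval (keyeq key m' l')).
Proof.
revert l. induction m; intros l Hl.
- destruct (not_zero_dec (qeval (keyeq key 0 l))) as [N|Z].
  + right. exists 0%nat, l. repeat split; auto. apply incl_refl.
  + left. intros tau Ht. rewrite (qeval_split (fun t => Nat.eqb (key t) 0)). unfold keyeq in Z. rewrite Z by assumption.
    replace (filter (fun t => negb (Nat.eqb (key t) 0)) l) with (@nil qterm).
    * unfold qeval, Csum; simpl; ring.
    * clear Z. induction l as [|t l IH]; [reflexivity|]. simpl.
      assert (K : key t = 0%nat) by (specialize (Hl t (or_introl eq_refl)); lia). rewrite K. simpl. apply IH. intros; apply Hl; simpl; auto.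
- destruct (not_zero_dec (qeval (keyeq key (S m) l))) as [N|Z].
  + right. exists (S m), l. repeat split; auto. apply incl_refl.
  + set (l1 := filter (fun t => negb (Nat.eqb (key t) (S m))) l).
    assert (E : forall tau, upper tau -> qeval l1 tau = qeval l tau).
    { intros tau Ht. rewrite (qeval_split (fun t => Nat.eqb (key t) (S m)) l). unfold keyeq in Z. rewrite Z by assumption.
      unfold l1. ring. }
    destruct (IHm l1) as [Z1|[m' [l' [L1 [L2 [L3 [L4 L5]]]]]]].
    * intros t It. apply filter_In in It. destruct It as [It Kt]. specialize (Hl t It).
      apply Bool.negb_true_iff, Nat.eqb_neq in Kt. lia.
    * left. intros; rewrite <- E; auto.
    * right. exists m', l'. repeat split; auto.
      -- intros t It. specialize (L2 t It). apply filter_In in L2. apply L2.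
      -- intros; rewrite L4, E; auto.
Qed.

Lemma keyeq_incl (key : qterm -> nat) (m : nat) (l : list qterm) : incl (keyeq key m l) l.
Proof. intros t I. apply filter_In in I. apply I. Qed.

Lemma keyeq_key (key : qterm -> nat) (m : nat) (l : list qterm) (t : qterm) : In t (keyeq key m l) -> key t = m.
Proof. intros I. apply filter_In in I. apply Nat.eqb_eq, I. Qed.

Lemma Forall_incl {T : Type} (P : T -> Prop) (l l' : list T) : incl l' l -> List.Forall P l -> List.Forall P l'.
Proof. rewrite !Forall_forall. auto. Qed.

Lemma max_key (key : qterm -> nat) (l : list qterm) : exists m, forall t, In t l -> (key t <= m)%nat.
Proof.
induction l as [|t l [m Hm]]; [exists O; intros t []|]. exists (key t + m)%nat.
intros s [E|I]; [subst; lia|]. specialize (Hm s I). lia.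
Qed.

Lemma W_qcoef (t : qterm) : modular_term t -> W (qcoef t).
Proof. destruct t as [[k i] c]. intros [H _]; assumption. Qed.

(** * Transforms of graded forms under tau |-> -1/tau *)

Lemma qval_S (t : qterm) (tau : C) : modular_term t -> upper tau ->
  qval t (- / tau) = tau ^ (qwt t - qdeg t) * (qcoef t tau * (tau * E2 tau + kappa) ^ qdeg t).
Proof.
destruct t as [[k i] c]. intros [_ H] Ht. simpl. rewrite H by assumption. rewrite (proj1 (E2_E6_S tau Ht)).
replace (k + (i + (i + 0)) - i)%nat with (k + i)%nat by lia.
replace (tau ^ 2 * E2 tau + kappa * tau) with (tau * (tau * E2 tau + kappa)) by ring.
rewrite Cpow_mult_l, Cpow_add_r. ring.
Qed.

Lemma leading_lin_pow (i : nat) : leading i (fun tau => E2 tau ^ i) (fun tau => (tau * E2 tau + kappa) ^ i).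
Proof.
assert (T1 : leading 1 E2 (fun tau => tau * E2 tau + kappa)).
{ split; [exact W_E2|]. exists (fun _ => kappa). split; [apply WT_W, W_const|]. intros; simpl; ring. }
induction i.
- split; [exact (W_const 1)|]. exists (fun _ => RtoC 0). split; [apply WT_zero|]. intros; simpl; ring.
- exact (leading_mult 1 i _ _ _ _ T1 IHi).
Qed.

(** Each factor [E2] becomes [tau (tau E2 + kappa)] and so contributes two powers of [tau] at the
    top: the weight is the degree in [tau] of the transform. *)
Lemma leading_qval (t : qterm) : modular_term t -> leading (qwt t) (qval t) (fun tau => qval t (- / tau)).
Proof.
intros H. assert (Hw : (qwt t = (qwt t - qdeg t) + qdeg t)%nat) by (destruct t as [[k i] c]; simpl; lia).
rewrite Hw at 1.
apply (leading_ext _ _ _ _ _ (leading_tau_pow (qwt t - qdeg t) _ _ _ (leading_scalW _ _ _ _ (W_qcoef t H) (leading_lin_pow (qdeg t))))).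
- intros tau _. destruct t as [[k i] c]. reflexivity.
- intros tau Ht. apply qval_S; assumption.
Qed.

Lemma WT_qeval_S (l : list qterm) (m : nat) : List.Forall modular_term l -> (forall t, In t l -> (qwt t < m)%nat) ->
  WT m (fun tau => qeval l (- / tau)).
Proof.
induction 1 as [|t l Ht _ IH]; intros Hm; [exact (WT_zero m)|].
apply (WT_plus m (fun tau => qval t (- / tau)) (fun tau => qeval l (- / tau))).
- apply (WT_le (S (qwt t))); [apply Hm; simpl; auto|]. apply (leading_WT _ _ _ (leading_qval t Ht)).
- apply IH. intros; apply Hm; simpl; auto.
Qed.

Lemma leading_homogeneous (l : list qterm) (m : nat) : List.Forall modular_term l -> (forall t, In t l -> qwt t = m) ->
  leading m (qeval l) (fun tau => qeval l (- / tau)).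
Proof.
induction 1 as [|t l Ht _ IH]; intros Hm.
- split; [exact (W_const 0)|]. exists (fun _ => RtoC 0). split; [apply WT_zero|]. intros; unfold qeval, Csum; simpl; ring.
- apply (leading_plus m (qval t) (qeval l) (fun tau => qval t (- / tau)) (fun tau => qeval l (- / tau))).
  + rewrite <- (Hm t (or_introl eq_refl)). apply leading_qval; assumption.
  + apply IH. intros; apply Hm; simpl; auto.
Qed.

Lemma leading_qeval (l : list qterm) (m : nat) : List.Forall modular_term l -> (forall t, In t l -> (qwt t <= m)%nat) ->
  leading m (qeval (keyeq qwt m l)) (fun tau => qeval l (- / tau)).
Proof.
intros H Hm.
apply (leading_ext m (qeval (keyeq qwt m l)) (fun tau => qeval (keyeq qwt m l) (- / tau) + qeval (filter (fun t => negb (Nat.eqb (qwt t) m)) l) (- / tau))).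
- apply leading_plus_low.
  + apply leading_homogeneous; [apply (Forall_incl _ l); [apply keyeq_incl|assumption]|]. intros; eapply keyeq_key; eassumption.
  + apply WT_qeval_S; [apply (Forall_incl _ l); [intros t I; apply filter_In in I; apply I|assumption]|].
    intros t I. apply filter_In in I. destruct I as [I K]. apply Bool.negb_true_iff, Nat.eqb_neq in K. specialize (Hm t I). lia.
- reflexivity.
- intros. apply (qeval_split (fun t => Nat.eqb (qwt t) m)).
Qed.

Lemma trailing_ext (n : nat) (phi F phi' F' : C -> C) : trailing n phi F ->
  (forall tau, upper tau -> phi' tau = phi tau) -> (forall tau, upper tau -> F' tau = F tau) -> trailing n phi' F'.
Proof.
intros [Hp [k [G [HG E]]]] E1 E2. split; [apply (W_ext phi); assumption|].
exists k, G. split; [assumption|]. intros. rewrite E1, E2, E by assumption. reflexivity.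
Qed.

Lemma trailing_mult (n m : nat) (phi psi F G : C -> C) : trailing n phi F -> trailing m psi G ->
  trailing (n + m) (fun tau => phi tau * psi tau) (fun tau => F tau * G tau).
Proof.
intros [Hp [k [K [HK EK]]]] [Hs [l [L [HL EL]]]]. split; [apply W_mult; assumption|].
exists (k + S l)%nat, (fun tau => phi tau * L tau + (psi tau * K tau + tau * (K tau * L tau))). split.
- apply WT_plus; [apply WT_scalW; [assumption|apply (WT_le l); [lia|assumption]]|].
  apply WT_plus; [apply WT_scalW; [assumption|apply (WT_le k); [lia|assumption]]|].
  rewrite Nat.add_succ_r. apply WT_tau, WT_mult; [assumption|apply (WT_le l); [lia|assumption]].
- intros tau Ht. rewrite EK, EL, Cpow_add_r by assumption. ring.
Qed.

Lemma trailing_plus (n : nat) (phi psi F G : C -> C) : trailing n phi F -> trailing n psi G ->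
  trailing n (fun tau => phi tau + psi tau) (fun tau => F tau + G tau).
Proof.
intros [Hp [k [K [HK EK]]]] [Hs [l [L [HL EL]]]]. split; [apply W_plus; assumption|].
exists (k + l)%nat, (fun tau => K tau + L tau). split.
- apply WT_plus; [apply (WT_le k)|apply (WT_le l)]; try assumption; lia.
- intros tau Ht. rewrite EK, EL by assumption. ring.
Qed.

Lemma trailing_W (f : C -> C) : W f -> trailing 0 f f.
Proof. intros H. split; [assumption|]. exists 0%nat, (fun _ => 0). split; [apply WT_zero|]. intros; simpl; ring. Qed.

Lemma trailing_lin_pow (i : nat) : trailing 0 (fun _ => kappa ^ i) (fun tau => (tau * E2 tau + kappa) ^ i).
Proof.
assert (L1 : trailing 0 (fun _ => kappa) (fun tau => tau * E2 tau + kappa)).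
{ split; [apply W_const|]. exists 1%nat, E2. split; [apply WT_W, W_E2|]. intros; simpl; ring. }
induction i.
- exact (trailing_W _ (W_const 1)).
- exact (trailing_mult 0 0 _ _ _ _ L1 IHi).
Qed.

Lemma trailing_tau_pow (k n : nat) (phi F : C -> C) : trailing n phi F -> trailing (k + n) phi (fun tau => tau ^ k * F tau).
Proof.
intros [Hp [j [G [HG E]]]]. split; [assumption|]. exists j, G. split; [assumption|].
intros. rewrite E, Cpow_add_r by assumption. ring.
Qed.

(** The lowest power of tau in the transform of a homogeneous quasimodular form carries the leading
    coefficient with respect to E2, which is modular. *)
Lemma trailing_homogeneous (l : list qterm) (n : nat) : List.Forall modular_term l -> (forall t, In t l -> qwt t = n) -> not_zero (qeval l) ->
  exists d c, (d <= n)%nat /\ W c /\ not_zero c /\ (forall tau, upper tau -> tau ^ (2 * d) * c (- / tau) = tau ^ n * c tau) /\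
    trailing (n - d) (fun tau => kappa ^ d * c tau) (fun tau => qeval l (- / tau)).
Proof.
intros Hok Hn [t0 [Ut0 Nt0]]. destruct (max_key qdeg l) as [m Hm].
destruct (qeval_trim qdeg l m Hm) as [Z|[d [l' [_ [L2 [L3 [L4 L5]]]]]]]; [exfalso; auto|].
assert (Hok' := Forall_incl _ _ _ L2 Hok).
set (c := fun tau => Csum (fun t => qcoef t tau) (keyeq qdeg d l')).
assert (Hd : (d <= n)%nat).
{ destruct L5 as [t1 [_ N1]]. destruct (keyeq qdeg d l') as [|t r] eqn:E; [exfalso; apply N1; reflexivity|].
  assert (I : In t (keyeq qdeg d l')) by (rewrite E; simpl; auto).
  assert (K := keyeq_key _ _ _ _ I). assert (Wt := Hn t (L2 t (keyeq_incl _ _ _ _ I))). destruct t as [[k i] c0]. simpl in *. lia. }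
assert (Wc : W c).
{ apply (W_Csum qcoef). intros t I. apply W_qcoef. rewrite Forall_forall in Hok'. apply Hok', (keyeq_incl _ _ _ _ I). }
assert (Ec : forall tau, qeval (keyeq qdeg d l') tau = c tau * E2 tau ^ d).
{ intros tau. unfold c, qeval. rewrite Cmult_comm, <- Csum_scal. apply Csum_ext. intros t I. rewrite <- (keyeq_key _ _ _ _ I).
  destruct t as [[k i] c0]. simpl. ring. }
exists d, c. split; [assumption|]. split; [assumption|]. split; [|split].
- destruct L5 as [t1 [U1 N1]]. exists t1. split; [assumption|]. intros Z. apply N1. rewrite Ec, Z. ring.
- intros tau Ht. unfold c. rewrite <- !Csum_scal. apply Csum_ext. intros t I.
  assert (K := keyeq_key _ _ _ _ I). assert (I2 := keyeq_incl _ _ _ _ I). assert (Wt := Hn t (L2 t I2)).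
  rewrite Forall_forall in Hok'. specialize (Hok' t I2). destruct t as [[k i] c0].
  unfold modular_term in Hok'. destruct Hok' as [_ Hk]. unfold qcoef. unfold qdeg in K. unfold qwt in Wt.
  rewrite Hk, <- Wt, <- K, Cpow_add_r by assumption. ring.
- apply (trailing_ext _ (fun tau => kappa ^ d * c tau) (fun tau => qeval l' (- / tau))); [|reflexivity|intros tau Ht; symmetry; apply L4, upper_S, Ht].
  assert (G : forall r, incl r l' -> trailing (n - d) (fun tau => kappa ^ d * Csum (fun t => qcoef t tau) (keyeq qdeg d r)) (fun tau => qeval r (- / tau))).
  { induction r as [|t r IH]; intros Hr.
    - split; [apply W_scal; exact (W_const 0)|]. exists 0%nat, (fun _ => 0). split; [apply WT_zero|].
      intros; unfold qeval, Csum; simpl; ring.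
    - assert (It : In t l') by (apply Hr; simpl; auto). specialize (IH ltac:(intros s Is; apply Hr; simpl; auto)).
      assert (Wt := Hn t (L2 t It)). specialize (L3 t It). rewrite Forall_forall in Hok'. specialize (Hok' t It).
      assert (Hi : (qdeg t <= n)%nat) by (destruct t as [[k i] c0]; simpl in *; lia).
      assert (LT := trailing_tau_pow (n - qdeg t) 0 _ _ (trailing_mult 0 0 _ _ _ _ (trailing_W _ (W_qcoef t Hok')) (trailing_lin_pow (qdeg t)))).
      assert (F : forall tau, upper tau -> qeval (t :: r) (- / tau) = tau ^ (n - qdeg t) * (qcoef t tau * (tau * E2 tau + kappa) ^ qdeg t) + qeval r (- / tau)).
      { intros tau Ht. unfold qeval at 1. rewrite Csum_cons, qval_S, Wt by assumption. reflexivity. }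
      destruct (Nat.eq_dec (qdeg t) d) as [Ed|Ed].
      + rewrite Ed, Nat.add_0_r in LT.
        apply (trailing_ext _ _ _ _ _ (trailing_plus _ _ _ _ _ LT IH)).
        * intros tau _. unfold keyeq at 1. simpl filter. rewrite (proj2 (Nat.eqb_eq _ _) Ed), Csum_cons. unfold keyeq. ring.
        * intros tau Ht. rewrite F, Ed by assumption. reflexivity.
      (* A term of degree below [d] in [E2] starts only at the power [n - qdeg t], above [n - d],
         and does not reach the bottom coefficient. *)
      + assert (LZ : trailing (n - d) (fun _ => 0) (fun tau => tau ^ (n - qdeg t) * (qcoef t tau * (tau * E2 tau + kappa) ^ qdeg t))).
        { split; [apply W_const|].
          exists (d - qdeg t - 1 + S (qdeg t))%nat, (fun tau => tau ^ (d - qdeg t - 1) * (qcoef t tau * (tau * E2 tau + kappa) ^ qdeg t)). split.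
          - apply WT_tau_pow, WT_scalW; [apply W_qcoef; assumption|]. apply (leading_WT _ _ _ (leading_lin_pow (qdeg t))).
          - intros tau _. replace (n - qdeg t)%nat with ((n - d) + (1 + (d - qdeg t - 1)))%nat by lia. rewrite !Cpow_add_r. simpl. ring. }
        apply (trailing_ext _ _ _ _ _ (trailing_plus _ _ _ _ _ LZ IH)).
        * intros tau _. unfold keyeq at 1. simpl filter. rewrite (proj2 (Nat.eqb_neq _ _) Ed). unfold keyeq. ring.
        * intros tau Ht. apply F; assumption. }
  exact (G l' (incl_refl l')).
Qed.

(** Where [v] has no zeros, [u / v] is the periodic primitive plus [tpi a_0 tau] plus a constant.
    Multiplied by [v] this is a relation of degree 1 in [tau] over [W], so [tau_indep] gives
    [a_0 = 0] and [u = v G] on all of the upper half-plane. *)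
Lemma const_primitive (u v u' v' f : C -> C) (a : nat -> C) : W u -> W v -> Wf a f -> not_zero v ->
  (forall tau, upper tau -> cder u tau (u' tau)) -> (forall tau, upper tau -> cder v tau (v' tau)) ->
  (forall tau, upper tau -> u' tau * v tau - u tau * v' tau = tpi * f tau * (v tau * v tau)) ->
  a O = 0 /\ exists g G, Wf g G /\ (forall tau, upper tau -> u tau = v tau * G tau) /\
    forall tau, upper tau -> cder G tau (tpi * f tau).
Proof.
intros Wu Wv Hf Nv Du Dv E.
destruct (Wf_prim a f Hf) as [b [G0 [HG0 [_ DG0]]]].
destruct (W_nonzero_large v Wv Nv) as [Y [HY NY]].
set (F := fun t => u t * / v t - (G0 t + tpi * a O * t)).
assert (DF : forall z, Y < Im z -> cder F z 0).
{ intros z Hz. assert (Uz : upper z) by (unfold upper; lra). assert (Nz := NY z Hz).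
  apply (cder_eq _ _ _ _ (cder_minus _ _ _ _ _ (cder_mult _ _ _ _ _ (Du z Uz) (cder_comp Cinv v _ _ _ (cder_inv _ Nz) (Dv z Uz)))
     (cder_plus _ _ _ _ _ (DG0 z Uz) (cder_scal (tpi * a O) _ _ _ (cder_id z))))).
  replace (u' z * / v z + u z * (- / (v z * v z) * v' z)) with ((u' z * v z - u z * v' z) / (v z * v z)) by (field; assumption).
  rewrite E by assumption. field. assumption. }
set (t0 := (0, Y + 1)%R : C).
assert (Ht0 : Y < Im t0) by (unfold t0; simpl; lra).
set (C0 := F t0).
assert (EF : forall z, Y < Im z -> u z - v z * (G0 z + C0) + z * (- (tpi * a O) * v z) = 0).
{ intros z Hz. assert (K := cder_zero_const F Y DF z t0 Hz Ht0). fold C0 in K. rewrite <- K. unfold F. field. apply NY; assumption. }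
set (p := fun j => match j with O => fun z => u z - v z * (G0 z + C0) | S _ => fun z => - (tpi * a O) * v z end).
assert (WG : Wf (fun n => b n + cseq C0 n) (fun z => G0 z + C0)) by (apply Wf_plus; [exact HG0|apply Wf_const]).
assert (Wp : forall j, (j < 2)%nat -> W (p j)).
{ intros [|j] _; simpl.
  - apply W_minus; [assumption|]. apply W_mult; [assumption|]. eexists; exact WG.
  - apply W_scal; assumption. }
assert (Z := tau_indep 2 p Y Wp ltac:(intros z Hz _; rewrite <- (EF z Hz); simpl; ring)).
split.
- destruct Nv as [s [Us Ns]]. assert (Z1 := Z 1%nat ltac:(lia) s Us). simpl in Z1.
  destruct (Ceq_dec (a O) 0) as [|N]; [assumption|exfalso]. revert Z1. 
  replace (- (tpi * a O) * v s) with (- (1) * (tpi * (a O * v s))) by ring.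
  apply Cmult_neq_0; [rewrite <- RtoC_opp; apply RtoC_neq; lra|]. apply Cmult_neq_0; [apply tpi_nz|apply Cmult_neq_0; assumption].
- assert (a0 : a O = 0).
  { destruct Nv as [s [Us Ns]]. assert (Z1 := Z 1%nat ltac:(lia) s Us). simpl in Z1.
    destruct (Ceq_dec (a O) 0) as [|N]; [assumption|exfalso]. revert Z1. 
    replace (- (tpi * a O) * v s) with (- (1) * (tpi * (a O * v s))) by ring.
    apply Cmult_neq_0; [rewrite <- RtoC_opp; apply RtoC_neq; lra|]. apply Cmult_neq_0; [apply tpi_nz|apply Cmult_neq_0; assumption]. }
  eexists; exists (fun z => G0 z + C0). split; [exact WG|]. split.
  + intros z Hz. assert (Z0 := Z 0%nat ltac:(lia) z Hz). simpl in Z0. apply Ceq_minus. exact Z0.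
  + intros z Hz. apply (cder_eq _ _ _ _ (cder_plus _ _ _ _ _ (DG0 z Hz) (cder_const C0 z))). rewrite a0. ring.
Qed.

(** The iterated primitives of [G], scaled so that the Taylor polynomial at 0 of the first one has
    leading coefficient [G - g 0]. *)
Lemma eichler_seq (g : nat -> C) (G f : C -> C) (N : nat) : Wf g G -> (forall tau, upper tau -> cder G tau (tpi * f tau)) ->
  exists E : nat -> C -> C, (forall j, W (E j)) /\ (forall j tau, upper tau -> cder (E j) tau (E (S j) tau)) /\
    (forall tau, upper tau -> E (S N) tau = (- (1)) ^ N * nC (fact N) * (tpi * f tau)).
Proof.
intros Hg DG. set (cN := (- (1)) ^ N * nC (fact N)).
set (e := fun n : nat => match n with O => RtoC 0 | S _ => cN * g n / (tpi * nC n) ^ N end).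
(* Hence division by [(tpi n)^N] does not enlarge the coefficients. *)
assert (tp : 1 <= Cmod tpi).
{ unfold tpi. rewrite !Cmod_mult, Cmod_Ci, !Cmod_R, !Rabs_pos_eq; generalize PI2_3_2; unfold PI2; lra. }
assert (He : forall j, subexp (fun n => (tpi * nC n) ^ j * e n)).
{ intros j. apply (subexp_poly g _ (Cmod tpi ^ j * Cmod cN)%R j (proj1 Hg)).
  intros n. rewrite Cmod_mult, Cmod_pow, Cmod_mult, Cmod_nC, Rpow_mult_distr.
  assert (P := pos_INR n). assert (0 <= Cmod tpi ^ j) by (apply pow_le; lra).
  assert (Bn : Cmod (e n) <= Cmod cN * Cmod (g n)).
  { destruct n; unfold e. { rewrite Cmod_0. apply Rmult_le_pos; apply Cmod_ge_0. }
    assert (M1 : tpi * nC (S n) <> 0) by (apply Cmult_neq_0; [apply tpi_nz|apply nC_neq_0; lia]).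
    rewrite Cmod_div, Cmod_mult, Cmod_pow, Cmod_mult, Cmod_nC by (apply Cpow_nz; assumption).
    assert (1 <= INR (S n)) by (change 1%R with (INR 1); apply le_INR; lia).
    assert (1 <= (Cmod tpi * INR (S n)) ^ N) by (apply pow_R1_Rle; nra).
    apply Rle_div_l; [lra|]. assert (0 <= Cmod cN * Cmod (g (S n))) by (apply Rmult_le_pos; apply Cmod_ge_0). nra. }
  replace (Cmod tpi ^ j * Cmod cN * (INR n + 1) ^ j * Cmod (g n))%R with (Cmod tpi ^ j * (INR n + 1) ^ j * (Cmod cN * Cmod (g n)))%R by ring.
  apply Rmult_le_compat; [|apply Cmod_ge_0| |assumption].
  - apply Rmult_le_pos; [assumption|apply pow_le; assumption].
  - apply Rmult_le_compat_l; [assumption|]. apply pow_incr; lra. }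
set (E := fun j tau => psum (fun n => (tpi * nC n) ^ j * e n) (q tau)).
assert (WE : forall j, Wf (fun n => (tpi * nC n) ^ j * e n) (E j)) by (intros j; split; [apply He|reflexivity]).
assert (DE : forall j tau, upper tau -> cder (E j) tau (E (S j) tau)).
{ intros j tau Ht. apply (cder_eq _ _ _ _ (Wf_cder _ _ tau (WE j) Ht)). unfold E.
  rewrite <- psum_scal; [|..].
  - apply psum_ext. intros n. unfold nC. simpl. ring.
  - apply (subexp_poly _ _ 1%R 1 (He j)). intros n. rewrite Cmod_mult, Cmod_R. assert (P := pos_INR n).
    rewrite Rabs_pos_eq by assumption. simpl. rewrite Rmult_1_r, Rmult_1_l. apply Rmult_le_compat_r; [apply Cmod_ge_0|lra].
  - apply Cmod_q_lt; assumption. }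
exists E. split; [intros j; eexists; apply WE|]. split; [assumption|].
intros tau Ht. apply (cder_unique_upper (E N) (fun t => cN * (G t + - g O)) tau _ _ Ht); [|apply DE; assumption|].
- intros z Hz. destruct Hg as [Sg Eg]. rewrite Eg by assumption.
  assert (Hq := Cmod_q_lt z Hz).
  rewrite <- (psum_cseq (- g O) (q z) Hq), <- psum_plus, <- psum_scal; auto using subexp_cseq, subexp_plus.
  apply psum_ext. intros [|n]; unfold e; simpl cseq; [ring|].
  field. apply Cpow_nz, Cmult_neq_0; [apply tpi_nz|apply nC_neq_0; lia].
- apply (cder_eq _ _ _ _ (cder_scal cN _ _ _ (cder_plus _ _ _ _ _ (DG tau Ht) (cder_const (- g O) tau)))). ring.
Qed.

Lemma kappa_nz : kappa <> 0.
Proof. unfold kappa, Cdiv. apply Cmult_neq_0; [apply RtoC_neq; lra|]. intros E. apply C1_nz. rewrite <- (Cinv_r tpi tpi_nz), E. ring. Qed.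

(** In [u = v G] all three factors, taken at [-1/z], are polynomials in [z] over [W]: [G(-1/z)] is
    the Taylor polynomial at 0 of the Eichler integral plus a constant. Comparison of the bottom
    coefficients shows that the Eichler integral, suitably normalized, is a quotient of modular
    coefficients of [u] and [v], and gives its law up to the factor [c]. *)
Lemma no_homogeneous_primitive (lu lv : list qterm) (u' v' f : C -> C) (m n N : nat) :
  List.Forall modular_term lu -> List.Forall modular_term lv -> (forall t, In t lu -> qwt t = m) -> (forall t, In t lv -> qwt t = n) ->
  not_zero (qeval lv) -> modular_wt (N + 2) f -> (1 <= N)%nat -> (m = n + N)%nat ->
  (forall tau, upper tau -> cder (qeval lu) tau (u' tau)) -> (forall tau, upper tau -> cder (qeval lv) tau (v' tau)) ->
  (forall tau, upper tau -> u' tau * qeval lv tau - qeval lu tau * v' tau = tpi * f tau * (qeval lv tau * qeval lv tau)) ->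
  ~ not_zero f.
Proof.
intros Hu Hv Wu Wv Nv [[a Ha] Sf] HN Hm Du Dv Rel Nf.
destruct (const_primitive _ _ u' v' f a (W_qeval lu Hu) (W_qeval lv Hv) Ha Nv Du Dv Rel) as [_ [g [G [HG [EG DG]]]]].
destruct (eichler_seq g G f N HG DG) as [E0 [WE0 [DE0 EE0]]].
set (H0 := fun tau => taylor E0 N 0 tau).
assert (DD : forall z, 0 < Im z -> cder (fun t => G (- / t) - H0 t) z 0).
{ intros z Hz. assert (Nz := upper_nz z Hz).
  assert (D1 := cder_S G z _ Hz (DG _ (upper_S z Hz))).
  assert (D2 := taylor_cder E0 N 0 z (fun j => DE0 j z Hz)).
  apply (cder_eq _ _ _ _ (cder_minus _ _ _ _ _ D1 D2)). rewrite EE0, Sf by assumption. unfold dpow.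
  replace (0 - z) with (- (1) * z) by ring. rewrite Cpow_mult_l, Cpow_add_r.
  replace ((- (1)) ^ N * nC (fact N) * (tpi * f z) * ((- (1)) ^ N * z ^ N / nC (fact N))) with
    ((- (1) * - (1)) ^ N * (tpi * f z * z ^ N)) by (rewrite Cpow_mult_l; field; apply nC_fact_nz).
  replace (- (1) * - (1)) with (RtoC 1) by ring. rewrite Cpow_1_l. field. assumption. }
set (C0 := G (- / Ci) - H0 Ci).
assert (EH : forall z, upper z -> G (- / z) = H0 z + C0).
{ intros z Hz. unfold C0. rewrite <- (cder_zero_const _ 0%R DD z Ci Hz); [ring|simpl; lra]. }
(* The constant of integration is absorbed in the Eichler integral itself; its derivatives are
   unaffected. *)
set (E := fun j => match j with O => fun z => E0 O z + C0 | S _ => E0 j end).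
assert (WE : forall j, W (E j)) by (intros [|j]; simpl; [apply W_plus; [apply WE0|apply W_const]|apply WE0]).
assert (DE : forall j z, upper z -> cder (E j) z (E (S j) z)).
{ intros [|j] z Hz; simpl; [|apply DE0; assumption].
  apply (cder_eq _ _ _ _ (cder_plus _ _ _ _ _ (DE0 O z Hz) (cder_const C0 z))). ring. }
assert (ES : forall z, upper z -> E (S N) (- / z) = z ^ (N + 2) * E (S N) z).
{ intros z Hz. simpl. rewrite !EE0, Sf by (try apply upper_S; assumption). ring. }
set (ep := E 0%nat).
(* In the Taylor polynomial at 0 with base point [z], the jth derivative carries the factor [z ^ j],
   so the bottom coefficient is the function itself. *)
assert (LH : trailing 0 ep (fun z => G (- / z))).
{ split; [apply WE|]. 
  exists (S N), (fun z => csum (fun j => ((- (1)) ^ S j / nC (fact (S j))) * (z ^ j * E0 (S j) z)) N). split.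
  - apply WT_csum. intros j Hj. apply (WT_scalW _ (fun _ => (- (1)) ^ S j / nC (fact (S j)))); [apply W_const|].
    apply (WT_le (S j)); [lia|]. apply WT_monomial, WE0.
  - intros z Hz. rewrite EH by assumption. unfold H0, taylor. rewrite csum_S, <- csum_scal. simpl Cpow at 1. unfold ep, E.
    rewrite (csum_ext (fun i => E0 (S i) z * dpow (0 - z) (S i)) (fun i => z * ((- (1)) ^ S i / nC (fact (S i)) * (z ^ i * E0 (S i) z)))).
    + unfold dpow at 1. simpl. change (nC 1) with (RtoC 1). field.
    + intros i _. unfold dpow. replace (0 - z) with (- (1) * z) by ring. rewrite Cpow_mult_l.
      change (z ^ S i) with (z * z ^ i). field. apply nC_fact_nz. }
assert (Nu : not_zero (qeval lu)).
{ destruct (not_zero_dec (qeval lu)) as [|Z]; [assumption|exfalso]. destruct Nf as [s [Us Ns]].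
  assert (Z' : forall tau, upper tau -> u' tau = 0).
  { intros tau Ht. apply (cder_unique_upper (qeval lu) (fun _ => 0) tau _ _ Ht Z (Du tau Ht) (cder_const 0 tau)). }
  assert (Wq := W_qeval lv Hv).
  apply Ns. apply (W_cancel (fun t => qeval lv t * qeval lv t) f (W_mult _ _ Wq Wq) (ex_intro _ a Ha) (not_zero_mult _ _ Wq Wq Nv Nv)); [|assumption].
  intros t Ht. specialize (Rel t Ht). rewrite Z', Z in Rel by assumption.
  destruct (Ceq_dec (qeval lv t * qeval lv t * f t) 0); [assumption|exfalso].
  assert (K : tpi * (qeval lv t * qeval lv t * f t) <> 0) by (apply Cmult_neq_0; [apply tpi_nz|assumption]).
  apply K. transitivity (tpi * f t * (qeval lv t * qeval lv t)); [ring|]. rewrite <- Rel. ring. }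
destruct (trailing_homogeneous lu m Hu Wu Nu) as [d' [b [Hd' [Wb [Nb [Sb Lb]]]]]].
destruct (trailing_homogeneous lv n Hv Wv Nv) as [d [c [Hd [Wc [Nc [Sc Lc]]]]]].
destruct (not_zero_dec ep) as [Nep|Zep].
2: { assert (Z : forall j z, upper z -> E j z = 0).
  { induction j; [exact Zep|]. intros z Hz.
    apply (cder_unique_upper (E j) (fun _ => 0) z _ _ Hz IHj (DE j z Hz) (cder_const 0 z)). }
  destruct Nf as [s [Us Ns]]. specialize (Z (S N) s Us). simpl in Z. rewrite EE0 in Z by assumption. revert Z.
  apply Cmult_neq_0; apply Cmult_neq_0; [apply Cpow_nz; rewrite <- RtoC_opp; apply RtoC_neq; lra|apply nC_fact_nz|apply tpi_nz|assumption]. }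
assert (kn : forall i, kappa ^ i <> 0) by (intros; apply Cpow_nz, kappa_nz).
assert (Ks : forall i h, not_zero h -> not_zero (fun t => kappa ^ i * h t)).
{ intros i h [s [Us Ns]]. exists s. split; [assumption|]. apply Cmult_neq_0; auto. }
assert (LL := trailing_mult _ _ _ _ _ _ Lc LH).
destruct (trailing_unique _ _ _ _ _ _ 0%R LL Lb) as [Edeg Ecoef].
- intros t _ Ht. cbv beta. rewrite (EG (- / t) (upper_S t Ht)). reflexivity.
- apply (not_zero_mult (fun t => kappa ^ d * c t) ep); [apply W_scal; assumption|apply WE|apply Ks; assumption|assumption].
- apply Ks; assumption.
(* Equal bottom exponents mean [n - d = m - d'], and [m = n + N]. *)
- rewrite Nat.add_0_r in Edeg. assert (Ed : d' = (d + N)%nat) by lia.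
  (* The coefficient identity [kappa^d c ep = kappa^d' b] is used at [z] and at [-1/z], and the laws
     of [b] and [c] eliminate [b]. *)
  assert (Law : forall z, upper z -> c z * (z ^ N * ep (- / z) - ep z) = 0).
  { intros z Hz. assert (Nz := upper_nz z Hz). assert (E1 := Ecoef z Hz). assert (E2 := Ecoef _ (upper_S z Hz)).
    assert (M1 : z ^ (2 * d') * (kappa ^ d * c (- / z) * ep (- / z)) = z ^ m * (kappa ^ d' * b z)).
    { cbv beta in E2. rewrite E2.
      transitivity (kappa ^ d' * (z ^ (2 * d') * b (- / z))); [ring|]. rewrite Sb by assumption. ring. }
    cbv beta in E1. rewrite <- E1 in M1. rewrite Ed, Hm in M1.
    replace (2 * (d + N))%nat with (2 * d + (N + N))%nat in M1 by lia. rewrite !Cpow_add_r in M1.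
    assert (M2 : z ^ n * z ^ N * kappa ^ d * (c z * (z ^ N * ep (- / z) - ep z)) = 0).
    { apply Ceq_minus in M1. rewrite <- M1. specialize (Sc z Hz).
      transitivity (kappa ^ d * z ^ N * (z ^ N * (z ^ n * c z) * ep (- / z)) - z ^ n * z ^ N * (kappa ^ d * c z * ep z)); [ring|].
      rewrite <- Sc. ring. }
    destruct (Ceq_dec (c z * (z ^ N * ep (- / z) - ep z)) 0); [assumption|exfalso]. revert M2.
    apply Cmult_neq_0; [|assumption]. apply Cmult_neq_0; [apply Cmult_neq_0; apply Cpow_nz; assumption|apply kn]. }
  destruct (W_nonzero_large c Wc Nc) as [Y [HY NY]].
  (* The law is so far known only where [c] does not vanish, hence for large [Im z]. *)
  assert (BE := bol_extend E N Y DE ES).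
  assert (Hlarge : forall z, Y < Im z -> upper z -> ep z = z ^ N * ep (- / z)).
  { intros z H1 H2. symmetry. apply Ceq_minus. destruct (Ceq_dec (z ^ N * ep (- / z) - ep z) 0); [assumption|exfalso].
    apply (Cmult_neq_0 (c z) (z ^ N * ep (- / z) - ep z)); auto. }
  specialize (BE Hlarge).
  destruct Nep as [s [Us Ns]]. apply Ns. apply (neg_weight_zero ep N (WE O) HN BE); assumption.
Qed.

(** A nonconstant monomial in [E4], [E6] has weight at least 4, so the terms of an element of C E2 +
    M are constants, multiples of [E2], or [E2]-free of weight at least 4. *)
Definition CE2M_term (t : qterm) : Prop := let '(k, i, c) := t in
  (i = 0%nat /\ (4 <= k)%nat /\ modular_wt k c) \/ (k = 0%nat /\ (i <= 1)%nat /\ exists c0, forall tau, c tau = c0).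

Lemma CE2M_term_ok (t : qterm) : CE2M_term t -> modular_term t.
Proof.
destruct t as [[k i] c]. intros [[_ [_ H]]|[Hk [_ [c0 H]]]]; [assumption|]. simpl. subst.
split; [apply (W_ext _ _ (W_const c0)); auto|]. intros. rewrite !H. simpl. ring.
Qed.

Lemma Forall_CE2M_term_ok (l : list qterm) : List.Forall CE2M_term l -> List.Forall modular_term l.
Proof. rewrite !Forall_forall. intros H t I. apply CE2M_term_ok, H, I. Qed.

Lemma CE2M_component (l : list qterm) (k : nat) : List.Forall CE2M_term l ->
  (not_zero (qeval (keyeq qwt k l)) -> k = 0%nat \/ k = 2%nat \/ (4 <= k)%nat) /\
  (k = 0%nat -> exists c0, forall tau, qeval (keyeq qwt k l) tau = c0) /\
  (k = 2%nat -> exists c0, forall tau, qeval (keyeq qwt k l) tau = c0 * E2 tau) /\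
  ((4 <= k)%nat -> modular_wt k (qeval (keyeq qwt k l))).
Proof.
intros H. assert (HF := Forall_incl _ _ _ (keyeq_incl qwt k l) H).
assert (HK : forall t, In t (keyeq qwt k l) -> qwt t = k) by (intros; eapply keyeq_key; eassumption).
revert HF HK. generalize (keyeq qwt k l). clear. intros l HF HK.
assert (Hcase : forall t, In t l -> CE2M_term t /\ qwt t = k) by (rewrite Forall_forall in HF; auto).
split; [|split; [|split]].
- intros [s [_ N]]. destruct l as [|t r]; [exfalso; apply N; reflexivity|].
  destruct (Hcase t (or_introl eq_refl)) as [F K]. destruct t as [[j i] c]. simpl in *. lia.
- intros K0. clear HF HK. induction l as [|t r IH]; [exists 0; reflexivity|].
  destruct IH as [c1 IH]; [intros; apply Hcase; simpl; auto|].
  destruct (Hcase t (or_introl eq_refl)) as [F K]. destruct t as [[j i] c]. simpl in K, F.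
  destruct F as [F|[Hj [Hi [c0 F]]]]; [lia|]. exists (c0 + c1). intros tau. unfold qeval in *. rewrite Csum_cons, IH.
  simpl. rewrite F. replace i with 0%nat by lia. simpl. ring.
- intros K0. clear HF HK. induction l as [|t r IH]; [exists 0; intros; unfold qeval, Csum; simpl; ring|].
  destruct IH as [c1 IH]; [intros; apply Hcase; simpl; auto|].
  destruct (Hcase t (or_introl eq_refl)) as [F K]. destruct t as [[j i] c]. simpl in K, F.
  destruct F as [F|[Hj [Hi [c0 F]]]]; [lia|]. exists (c0 + c1). intros tau. unfold qeval in *. rewrite Csum_cons, IH.
  simpl. rewrite F. replace i with 1%nat by lia. simpl. ring.
- intros K4. split; [apply W_qeval, Forall_CE2M_term_ok; assumption|]. clear HF HK. intros tau Ht. 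
  unfold qeval. rewrite <- Csum_scal. apply Csum_ext. intros t I. destruct (Hcase t I) as [F K]. destruct t as [[j i] c]. simpl in K, F.
  destruct F as [[Hi [Hj [_ Hc]]]|[Hj [Hi _]]]; [|lia]. subst i. simpl. rewrite Hc by assumption. replace j with k by lia. ring.
Qed.

(** Induction on a strict bound [mu] for the weights in [u]. The relation is taken at [-1/t] and its
    top coefficients in [t] are compared. If the Wronskian of the top components of [u] and [v] is
    nonzero, they satisfy a homogeneous relation of the same form; if it is zero, a multiple of [v]
    is subtracted from [u] and the bound drops. *)
Lemma no_primitive (lf lv lu : list qterm) (u' v' : C -> C) :
  List.Forall CE2M_term lf -> List.Forall modular_term lv -> List.Forall modular_term lu -> not_zero (qeval lv) -> W u' -> W v' ->
  (forall tau, upper tau -> cder (qeval lu) tau (u' tau)) -> (forall tau, upper tau -> cder (qeval lv) tau (v' tau)) ->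
  (forall tau, upper tau -> u' tau * qeval lv tau - qeval lu tau * v' tau = tpi * qeval lf tau * (qeval lv tau * qeval lv tau)) ->
  forall tau, upper tau -> qeval lf tau = 0.
Proof.
intros Hf0 Hv0 Hu Nv0 Wu' Wv' Du Dv0 Rel0.
destruct (max_key qwt lf) as [mf Hmf]. destruct (qeval_trim qwt lf mf Hmf) as [|[k [lf' [_ [If [Kf [Ef Nf]]]]]]]; [assumption|exfalso].
destruct (max_key qwt lv) as [mv Hmv]. destruct (qeval_trim qwt lv mv Hmv) as [Zv|[n [lv' [_ [Iv [Kv [Ev Nv]]]]]]].
{ destruct Nv0 as [s [Us Ns]]; auto. }
assert (Hf := Forall_incl _ _ _ If Hf0). assert (Hv := Forall_incl _ _ _ Iv Hv0).
assert (Hfq := Forall_CE2M_term_ok _ Hf).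
set (f := qeval lf') in *. set (v := qeval lv') in *.
assert (Nv' : not_zero v). { destruct Nv0 as [s [Us Ns]]. exists s. unfold v. rewrite Ev; auto. }
assert (Nff : not_zero f).
{ destruct (not_zero_dec f) as [|Z]; [assumption|exfalso].
  destruct Nf as [s [Us Ns]]. apply Ns. apply (leading_zero k _ (fun t => qeval lf' (- / t)) 0%R (leading_qeval lf' k Hfq Kf)); [right|assumption].
  intros t _ Ht. apply Z, upper_S, Ht. }
assert (Wv := W_qeval lv' Hv : W v). assert (Wf' := W_qeval lf' Hfq : W f).
assert (Dv : forall tau, upper tau -> cder v tau (v' tau)) by (intros t Ht; apply (cder_ext_upper (qeval lv)); auto; intros; symmetry; auto).
assert (Rel : forall tau, upper tau -> u' tau * v tau - qeval lu tau * v' tau = tpi * f tau * (v tau * v tau)) by (intros; unfold v, f; rewrite Ev, Ef by assumption; auto).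
clear Rel0 Dv0 Nv0 Hv0 Hf0 Ev Ef If Iv mf Hmf mv Hmv lf lv.
destruct (max_key qwt lu) as [mu Hmu].
assert (Hmu' : forall t, In t lu -> (qwt t < S mu)%nat) by (intros t I; specialize (Hmu t I); lia).
revert Hmu'. generalize (S mu). clear Hmu mu. intros mu. revert lu u' Hu Wu' Du Rel.
induction mu; intros lu u' Hu Wu' Du Rel Hmu.
- destruct lu as [|t r]; [|exfalso; specialize (Hmu t (or_introl eq_refl)); lia].
  assert (Z' : forall tau, upper tau -> u' tau = 0).
  { intros tau Ht. apply (cder_unique (fun _ => 0) tau); [|apply cder_const]. apply (Du tau Ht). }
  destruct Nff as [s [Us Ns]]. apply Ns. apply (W_cancel (fun t => v t * v t) f (W_mult _ _ Wv Wv) Wf' (not_zero_mult _ _ Wv Wv Nv' Nv')); [|assumption].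
  intros t Ht. specialize (Rel t Ht). rewrite Z' in Rel by assumption. change (qeval [] t) with (RtoC 0) in Rel.
  destruct (Ceq_dec (v t * v t * f t) 0); [assumption|exfalso].
  apply (Cmult_neq_0 tpi (v t * v t * f t) tpi_nz); [assumption|]. transitivity (tpi * f t * (v t * v t)); [ring|]. rewrite <- Rel. ring.
- assert (Kle : forall t, In t lu -> (qwt t <= mu)%nat) by (intros t I; specialize (Hmu t I); lia).
  set (um := keyeq qwt mu lu). set (vn := keyeq qwt n lv'). set (fk := qeval (keyeq qwt k lf')).
  assert (Hum : List.Forall modular_term um) by (apply (Forall_incl _ lu); [apply keyeq_incl|assumption]).
  assert (Hvn : List.Forall modular_term vn) by (apply (Forall_incl _ lv'); [apply keyeq_incl|assumption]).
  (* A numerator whose component of weight [mu] is the zero function can be rewritten with all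
     weights below [mu], to which the induction hypothesis applies. *)
  assert (Drop : forall lu2 u2', List.Forall modular_term lu2 -> W u2' -> (forall tau, upper tau -> cder (qeval lu2) tau (u2' tau)) ->
     (forall tau, upper tau -> u2' tau * v tau - qeval lu2 tau * v' tau = tpi * f tau * (v tau * v tau)) ->
     (forall t, In t lu2 -> (qwt t <= mu)%nat) -> (forall tau, upper tau -> qeval (keyeq qwt mu lu2) tau = 0) -> False).
  { intros lu2 u2' H2 W2 D2 R2 K2 Z2.
    set (l3 := filter (fun t => negb (Nat.eqb (qwt t) mu)) lu2).
    assert (E3 : forall tau, upper tau -> qeval l3 tau = qeval lu2 tau).
    { intros tau Ht. rewrite (qeval_split (fun t => Nat.eqb (qwt t) mu) lu2). unfold keyeq in Z2. rewrite Z2 by assumption. unfold l3. ring. }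
    apply (IHmu l3 u2').
    - apply (Forall_incl _ lu2); [intros t I; apply filter_In in I; apply I|assumption].
    - assumption.
    - intros tau Ht. apply (cder_ext_upper (qeval lu2)); auto. intros; symmetry; auto.
    - intros; rewrite E3; auto.
    - intros t I. apply filter_In in I. destruct I as [I K]. apply Bool.negb_true_iff, Nat.eqb_neq in K. specialize (K2 t I). lia. }
  destruct (not_zero_dec (qeval um)) as [Num|Zum]; [|exact (Drop lu u' Hu Wu' Du Rel Kle Zum)].
  assert (TU := leading_qeval lu mu Hu Kle). assert (TV := leading_qeval lv' n Hv Kv). assert (TF := leading_qeval lf' k Hfq Kf).
  fold um in TU. fold vn v in TV. fold fk f in TF.
  destruct (W_der _ (W_qeval um Hum)) as [um' [Wum' Dum]]. destruct (W_der _ (W_qeval vn Hvn)) as [vn' [Wvn' Dvn]].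
  destruct (leading_der _ _ _ _ TU Wum' Dum) as [U1 [TU1 DU1]]. destruct (leading_der _ _ _ _ TV Wvn' Dvn) as [V1 [TV1 DV1]].
  set (U := fun tau => qeval lu (- / tau)) in *. set (V := fun tau => v (- / tau)) in *.
  (* The factor [t ^ 2] compensates the derivative [t^-2] of the inner function [-1/t]. *)
  assert (TL : leading (2 + (mu + n)) (fun t => um' t * qeval vn t + - (1) * (qeval um t * vn' t)) (fun t => t ^ 2 * (U1 t * V t + - (1) * (U t * V1 t)))).
  { apply leading_tau_pow, leading_plus; [apply leading_mult; assumption|]. apply (leading_scalW _ (fun _ => - (1))); [apply W_const|]. apply leading_mult; assumption. }
  assert (TR : leading (k + (n + n)) (fun t => tpi * (fk t * (qeval vn t * qeval vn t))) (fun t => tpi * (f (- / t) * (V t * V t)))).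
  { apply (leading_scalW _ (fun _ => tpi)); [apply W_const|]. apply leading_mult; [assumption|]. apply leading_mult; assumption. }
  assert (ELR : forall t, upper t -> t ^ 2 * (U1 t * V t + - (1) * (U t * V1 t)) = tpi * (f (- / t) * (V t * V t))).
  { intros t Ht. assert (Nt := upper_nz t Ht). assert (HS := upper_S t Ht).
    assert (F1 := cder_unique _ _ _ _ (DU1 t Ht) (cder_S (qeval lu) t _ Ht (Du _ HS))).
    assert (F2 := cder_unique _ _ _ _ (DV1 t Ht) (cder_S v t _ Ht (Dv _ HS))).
    rewrite F1, F2. specialize (Rel _ HS). unfold U, V.
    transitivity (u' (- / t) * v (- / t) - qeval lu (- / t) * v' (- / t)); [field; assumption|]. rewrite Rel. ring. }
  assert (WL : W (fun t => um' t * qeval vn t + - (1) * (qeval um t * vn' t))) by apply TL.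
  assert (Wfk : W fk) by apply TF. assert (Wvn := W_qeval vn Hvn). assert (Wum := W_qeval um Hum).
  assert (NR : not_zero (fun t => tpi * (fk t * (qeval vn t * qeval vn t)))).
  { destruct (not_zero_mult fk (fun t => qeval vn t * qeval vn t) Wfk (W_mult _ _ Wvn Wvn) Nf (not_zero_mult _ _ Wvn Wvn Nv Nv)) as [s [Us Ns]].
    exists s. split; [assumption|]. apply Cmult_neq_0; [apply tpi_nz|assumption]. }
  destruct (not_zero_dec (fun t => um' t * qeval vn t + - (1) * (qeval um t * vn' t))) as [NL|ZL].
  (* Equal degrees [2 + mu + n = k + 2 n] give [mu = n + (k - 2)], the weight condition of
     [no_homogeneous_primitive]. *)
  + destruct (leading_unique _ _ _ _ _ _ 0%R TL TR (fun t _ Ht => ELR t Ht) NL NR) as [Edeg Ecoef].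
    assert (Rel2 : forall tau, upper tau -> um' tau * qeval vn tau - qeval um tau * vn' tau = tpi * fk tau * (qeval vn tau * qeval vn tau)).
    { intros t Ht. specialize (Ecoef t Ht). cbv beta in Ecoef. transitivity (um' t * qeval vn t + - (1) * (qeval um t * vn' t)); [ring|]. rewrite Ecoef. ring. }
    destruct (CE2M_component lf' k Hf) as [Fk [Fk0 [Fk2 Fk4]]]. fold fk in Fk, Fk0, Fk2, Fk4.
    destruct (Fk Nf) as [K|[K|K]].
    * destruct (Fk0 K) as [c0 Hc0]. destruct (const_primitive _ _ um' vn' fk (cseq c0) Wum Wvn (Wf_ext _ _ _ _ (Wf_const c0) (fun _ => eq_refl) (fun t _ => Hc0 t)) Nv Dum Dvn Rel2) as [Z _].
      simpl in Z. destruct Nf as [s [_ Ns]]. apply Ns. fold fk. rewrite Hc0. exact Z.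
    * destruct (Fk2 K) as [c0 Hc0]. destruct (const_primitive _ _ um' vn' fk _ Wum Wvn (Wf_ext _ _ _ _ (Wf_scal c0 _ _ Wf_E2) (fun _ => eq_refl) (fun t _ => Hc0 t)) Nv Dum Dvn Rel2) as [Z _].
      unfold eis_seq in Z. rewrite divsum_0 in Z. simpl in Z. destruct Nf as [s [_ Ns]]. apply Ns. fold fk. rewrite Hc0.
      replace c0 with (c0 * (1 + -24 * 0)) by ring. rewrite Z. ring.
    * specialize (Fk4 K). replace k with ((k - 2) + 2)%nat in Fk4 by lia.
      apply (no_homogeneous_primitive um vn um' vn' fk mu n (k - 2) Hum Hvn); try assumption; try lia; intros; eapply keyeq_key; eassumption.
  (* A vanishing Wronskian makes the top components proportional, [um = c vn]. As [u = v] solves the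
     homogeneous relation, [u - c v] satisfies the same relation as [u], and its component of weight
     [mu = n] vanishes. *)
  + destruct (W_nonzero_large _ Wvn Nv) as [Y [HY NY]].
    assert (DQ : forall z, Y < Im z -> cder (fun t => qeval um t * / qeval vn t) z 0).
    { intros z Hz. assert (Uz : upper z) by (unfold upper; lra). assert (Nz := NY z Hz).
      apply (cder_eq _ _ _ _ (cder_mult _ _ _ _ _ (Dum z Uz) (cder_comp Cinv (qeval vn) _ _ _ (cder_inv _ Nz) (Dvn z Uz)))).
      specialize (ZL z Uz). cbv beta in ZL.
      transitivity ((um' z * qeval vn z + - (1) * (qeval um z * vn' z)) / (qeval vn z * qeval vn z)); [field; assumption|]. rewrite ZL. field. assumption. }
    set (t0 := (0, Y + 1)%R : C). set (c := qeval um t0 * / qeval vn t0).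
    assert (Ht0 : Y < Im t0) by (unfold t0; simpl; lra).
    assert (EU : forall z, upper z -> qeval um z = c * qeval vn z).
    { intros z Hz. apply Ceq_minus. apply (W_zero_large (fun z => qeval um z - c * qeval vn z) Y); [|intros w H1 H2|assumption].
      - apply W_minus; [assumption|apply W_scal; assumption].
      - assert (K := cder_zero_const _ Y DQ w t0 H1 Ht0). cbv beta in K. fold c in K. rewrite <- K. field. apply NY; assumption. }
    assert (Ncv : not_zero (fun z => c * qeval vn z)). { destruct Num as [s [Us Ns]]. exists s. rewrite <- EU; auto. }
    assert (Tum := leading_homogeneous um mu Hum (fun t I => keyeq_key _ _ _ _ I)).
    assert (Tvn := leading_scalW _ (fun _ => c) _ _ (W_const c) (leading_homogeneous vn n Hvn (fun t I => keyeq_key _ _ _ _ I))).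
    destruct (leading_unique _ _ _ _ _ _ 0%R Tum Tvn (fun t _ Ht => EU _ (upper_S t Ht)) Num Ncv) as [Emn _].
    set (sc := fun t : qterm => let '(j, i, h) := t in (j, i, fun z => - c * h z) : qterm).
    assert (Esc : forall r z, qeval (map sc r) z = - c * qeval r z).
    { intros r z. unfold qeval. rewrite Csum_map, <- Csum_scal. apply Csum_ext. intros [[j i] h] _. simpl. ring. }
    assert (Wsc : forall t, qwt (sc t) = qwt t) by (intros [[j i] h]; reflexivity).
    apply (Drop (lu ++ map sc lv') (fun z => u' z - c * v' z)).
    * apply Forall_app. split; [assumption|]. apply Forall_map. rewrite Forall_forall in Hv |- *. intros [[j i] h] I. specialize (Hv _ I).
      exact (modular_wt_mult 0 j _ _ (modular_wt_const (- c)) Hv).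
    * apply W_minus; [assumption|apply W_scal; assumption].
    * intros z Hz. apply (cder_ext_upper (fun z => qeval lu z - c * v z)); [assumption|intros; rewrite qeval_app, Esc; fold v; ring|].
      apply cder_minus; [auto|apply cder_scal; auto].
    * intros z Hz. rewrite qeval_app, Esc. fold v. rewrite <- Rel by assumption. ring.
    * intros t I. apply in_app_iff in I. destruct I as [I|I]; [auto|]. apply in_map_iff in I. destruct I as [s [Es Is]]. subst t. rewrite Wsc, Emn. auto.
    * intros z Hz. unfold keyeq. rewrite filter_app, qeval_app.
      assert (Efm : forall l, filter (fun t => Nat.eqb (qwt t) mu) (map sc l) = map sc (keyeq qwt mu l)).
      { unfold keyeq. induction l as [|t r IH]; [reflexivity|]. simpl. rewrite Wsc. destruct (Nat.eqb (qwt t) mu); simpl; rewrite IH; reflexivity. }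
      rewrite Efm, Esc, Emn. fold vn. rewrite <- Emn. fold (keyeq qwt mu lu). fold um. rewrite EU by assumption. ring.
Qed.

(** * Linear independence over quotients of quasimodular forms *)

Lemma modular_rep (f : C -> C) : modular f ->
  exists l, List.Forall (fun t => CE2M_term t /\ qdeg t = 0%nat) l /\ forall tau, upper tau -> f tau = qeval l tau.
Proof.
unfold modular. induction 1 as [c|f H|f g _ [l [L E]] _ [m [M E']]|f g _ [l [L E]] _ [m [M E']]|f g _ [l [L E]] E'].
- exists [(0%nat, 0%nat, fun _ => c)]. split; [|intros; unfold qeval, Csum; simpl; ring].
  constructor; [|constructor]. split; [|reflexivity]. right. split; [reflexivity|]. split; [lia|]. exists c; reflexivity.
- destruct H as [H|[H|[]]]; subst.
  + exists [(4%nat, 0%nat, E4)]. split; [|intros; unfold qeval, Csum; simpl; ring].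
    constructor; [|constructor]. split; [|reflexivity]. left. split; [reflexivity|]. split; [lia|apply modular_wt_E4].
  + exists [(6%nat, 0%nat, E6)]. split; [|intros; unfold qeval, Csum; simpl; ring].
    constructor; [|constructor]. split; [|reflexivity]. left. split; [reflexivity|]. split; [lia|apply modular_wt_E6].
- exists (l ++ m). split; [apply Forall_app; split; assumption|]. intros; rewrite qeval_app, E, E' by assumption; reflexivity.
- exists (flat_map (fun t => map (fun s : qterm => let '(k, i, c) := t in let '(k', i', c') := s in
    ((k + k')%nat, 0%nat, fun tau => c tau * c' tau)) m) l). split.
  + apply Forall_flat_map. apply Forall_forall. intros t It. apply Forall_map, Forall_forall. intros s Is.
    rewrite Forall_forall in L, M. destruct (L _ It) as [Lt Zt], (M _ Is) as [Ms Zs].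
    assert (Qt := CE2M_term_ok _ Lt). assert (Qs := CE2M_term_ok _ Ms).
    destruct t as [[k i] c], s as [[k' i'] c']. assert (MM := modular_wt_mult _ _ _ _ Qt Qs). simpl in *. subst. split; [|reflexivity].
    destruct Lt as [[_ [Hk _]]|[Hk [_ [c0 Hc]]]]; [left; split; [reflexivity|split; [lia|assumption]]|].
    destruct Ms as [[_ [Hk' _]]|[Hk' [_ [c1 Hc']]]]; [left; split; [reflexivity|split; [lia|assumption]]|].
    right. split; [lia|]. split; [lia|]. exists (c0 * c1). intros; rewrite Hc, Hc'; reflexivity.
  + intros tau Ht. rewrite E, E' by assumption. unfold qeval. rewrite Csum_flat_map, Cmult_comm, <- Csum_scal.
    apply Csum_ext. intros t It. rewrite Csum_map, Cmult_comm, <- Csum_scal. apply Csum_ext. intros s Is.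
    rewrite Forall_forall in L, M. destruct (L _ It) as [_ Zt], (M _ Is) as [_ Zs].
    destruct t as [[k i] c], s as [[k' i'] c']. simpl in *. subst. simpl. ring.
- exists l. split; [assumption|]. intros. rewrite <- E' by assumption. auto.
Qed.

Lemma CE2_plus_modular_rep (f : C -> C) : CE2_plus_modular f ->
  quasimodular f /\ exists l, List.Forall CE2M_term l /\ forall tau, upper tau -> f tau = qeval l tau.
Proof.
intros [c [g [Hg E]]]. split.
- apply (alg_ext _ (fun tau => c * E2 tau + g tau)); [|intros; symmetry; auto].
  apply alg_add; [apply (alg_mul _ (fun _ => c)); [apply alg_const|apply alg_gen; simpl; auto]|].
  clear E. induction Hg; [apply alg_const|apply alg_gen; simpl in *; tauto|apply alg_add; assumption|apply alg_mul; assumption|eapply alg_ext; eassumption].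
- destruct (modular_rep g Hg) as [l [L El]]. exists ((0%nat, 1%nat, fun _ => c) :: l). split.
  + constructor; [right; split; [reflexivity|split; [lia|exists c; reflexivity]]|]. revert L. apply Forall_impl. tauto.
  + intros tau Ht. rewrite E, El by assumption. unfold qeval. rewrite Csum_cons. simpl. ring.
Qed.

(** * Relations between functions indexed by words *)

Lemma Csum_switch {K L : Type} (F : K -> L -> C) (l : list K) (m : list L) :
  Csum (fun x => Csum (F x) m) l = Csum (fun y => Csum (fun x => F x y) l) m.
Proof.
induction l as [|x l IH].
- induction m; [reflexivity|]. rewrite Csum_cons, <- IHm. unfold Csum; simpl; ring.
- rewrite Csum_cons, IH, <- Csum_plus. reflexivity.
Qed.

Lemma Csum_zero {K : Type} (F : K -> C) (l : list K) : (forall x, In x l -> F x = 0) -> Csum F l = 0.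
Proof.
intros H. induction l as [|x l IH]; [reflexivity|]. rewrite Csum_cons, H, IH; simpl; auto; [ring|intros; apply H; simpl; auto].
Qed.

(** Decided classically, because the index type of the family is arbitrary. *)
Definition word_dec {J : Type} (u v : J) : {u = v} + {u <> v} := excluded_middle_informative (u = v).

Lemma Csum_support {K : Type} (F : K -> C) (l m : list K) : NoDup l -> NoDup m ->
  (forall x, In x l -> ~ In x m -> F x = 0) -> (forall x, In x m -> ~ In x l -> F x = 0) -> Csum F l = Csum F m.
Proof.
intros Nl Nm Hl Hm.
set (mem := fun (k : list K) x => if in_dec word_dec x k then true else false).
assert (Z : forall a b, (forall x, In x a -> ~ In x b -> F x = 0) -> Csum F (filter (fun x => negb (mem b x)) a) = 0).
{ intros a b H. apply Csum_zero. intros x I. apply filter_In in I. destruct I as [I E]. unfold mem in E.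
  destruct (in_dec word_dec x b); [discriminate|auto]. }
rewrite (Csum_filter (mem m) F l), (Csum_filter (mem l) F m), !Z by assumption.
f_equal. apply Csum_perm, NoDup_Permutation; try (apply NoDup_filter; assumption).
intros x. rewrite !filter_In. unfold mem. destruct (in_dec word_dec x l), (in_dec word_dec x m); intuition discriminate.
Qed.

Lemma Csum_indicator {K : Type} (F : K -> C) (v : K) (l : list K) : NoDup l -> In v l ->
  Csum (fun u => if word_dec v u then F u else 0) l = F v.
Proof.
intros N I. rewrite (Csum_support _ l [v] N).
- unfold Csum; simpl. destruct (word_dec v v) as [_|E]; [ring|congruence].
- constructor; [intros []|constructor].
- intros x _ H. destruct (word_dec v x); [subst; exfalso; apply H; simpl; auto|reflexivity].
- intros x [E|[]]; subst; tauto.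
Qed.

Lemma cder_Csum {K : Type} (F F' : K -> C -> C) (tau : C) (l : list K) :
  (forall x, In x l -> cder (F x) tau (F' x tau)) ->
  cder (fun t => Csum (fun x => F x t) l) tau (Csum (fun x => F' x tau) l).
Proof.
induction l as [|x l IH]; intros H; [exact (cder_const 0 tau)|].
apply (cder_plus (F x)); [apply H; simpl; auto|]. apply IH. intros; apply H; simpl; auto.
Qed.

(** Differentiating [Psi (j :: v)] produces [Psi v]; this is the resulting contribution of the word
    [w] to the coefficient of [Psi u], up to the factor [- tpi]. *)
Definition head_coef {J : Type} (B : J -> C -> C) (c : list J -> C -> C) (u w : list J) (tau : C) : C :=
  match w with [] => 0 | j :: v => if word_dec v u then B j tau * c w tau else 0 end.

Definition tails {J : Type} (s : list (list J)) : list (list J) :=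
  flat_map (fun w => match w with [] => [] | _ :: v => [v] end) s.

Lemma in_tails {J : Type} (s : list (list J)) (j : J) (v : list J) : In (j :: v) s -> In v (tails s).
Proof. intros I. apply in_flat_map. exists (j :: v). simpl; auto. Qed.

(** The derivative of the relation divided by [c w0], multiplied by [c w0 ^ 2 / tpi] to clear
    denominators. The coefficient of [Psi w0] itself cancels, so [s'] has to contain only the other
    words and the tails. *)
Lemma derived_relation {J : Type} (B : J -> C -> C) (Psi c d : list J -> C -> C) (s s' : list (list J)) (w0 : list J) (Y : R) :
  (forall tau, upper tau -> Psi [] tau = 1) ->
  (forall j w tau, upper tau -> cder (Psi (j :: w)) tau (- (tpi * B j tau * Psi w tau))) ->
  (forall w tau, upper tau -> cder (c w) tau (tpi * d w tau)) ->
  (forall w, ~ In w s -> forall tau, upper tau -> c w tau = 0) ->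
  (forall w, ~ In w s -> forall tau, upper tau -> d w tau = 0) ->
  NoDup s -> NoDup s' -> (forall w, In w s -> w = w0 \/ In w s') -> (forall w, In w (tails s) -> In w s') -> 0 <= Y ->
  (forall tau, Y < Im tau -> Csum (fun w => c w tau * Psi w tau) s = 0) ->
  forall tau, Y < Im tau ->
  Csum (fun u => (c w0 tau * d u tau - d w0 tau * c u tau - c w0 tau * Csum (fun w => head_coef B c u w tau) s) * Psi u tau) s' = 0.
Proof.
intros P0 P1 Dc Zc Zd Ns Ns' Is It HY Rel tau Ht. assert (Ut : upper tau) by (unfold upper; lra).
set (psi' := fun w => match w with [] => RtoC 0 | j :: v => - (B j tau * Psi v tau) end).
assert (DP : forall w, cder (Psi w) tau (tpi * psi' w)).
{ intros [|j v]; simpl.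
  - rewrite Cmult_0_r. apply (cder_ext_upper (fun _ => 1)); [assumption|intros; symmetry; auto|apply cder_const].
  - apply (cder_eq _ _ _ _ (P1 j v tau Ut)). ring. }
assert (DR : Csum (fun w => d w tau * Psi w tau + c w tau * psi' w) s = 0).
{ assert (K := cder_Csum (fun w t => c w t * Psi w t) (fun w _ => tpi * d w tau * Psi w tau + c w tau * (tpi * psi' w)) tau s
    (fun w _ => cder_mult _ _ _ _ _ (Dc w tau Ut) (DP w))).
  assert (K0 : cder (fun t => Csum (fun w => c w t * Psi w t) s) tau 0).
  { apply (cder_ext_loc (fun _ => 0) _ tau 0 (Im tau - Y)); [lra| |apply cder_const].
    intros h Hh. symmetry. apply Rel. assert (Rm := Rmax_Cmod h). assert (M := Rmax_r (Rabs (fst h)) (Rabs (snd h))).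
    assert (A : Rabs (snd h) < Im tau - Y) by lra. apply Rabs_def2 in A. unfold Im in *. simpl. lra. }
  assert (E := cder_unique _ _ _ _ K K0). cbv beta in E.
  rewrite (Csum_ext _ (fun w => tpi * (d w tau * Psi w tau + c w tau * psi' w))), Csum_scal in E by (intros; ring).
  destruct (Ceq_dec (Csum (fun w => d w tau * Psi w tau + c w tau * psi' w) s) 0); [assumption|].
  exfalso; revert E. apply Cmult_neq_0; [apply tpi_nz|assumption]. }
specialize (Rel tau Ht).
rewrite (Csum_ext _ (fun u => (c w0 tau * d u tau - d w0 tau * c u tau) * Psi u tau +
   - c w0 tau * Csum (fun w => head_coef B c u w tau * Psi u tau) s)).
2: { intros u _. rewrite (Csum_ext (fun w => head_coef B c u w tau * Psi u tau) (fun w => Psi u tau * head_coef B c u w tau)), Csum_scal by (intros; ring). ring. }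
rewrite Csum_plus, Csum_scal, Csum_switch.
rewrite <- (Csum_support (fun u => (c w0 tau * d u tau - d w0 tau * c u tau) * Psi u tau) s s' Ns Ns').
2: { intros u I I'. destruct (Is u I) as [E|]; [subst; ring|contradiction]. }
2: { intros u I I'. rewrite (Zc u), (Zd u) by assumption. ring. }
rewrite (Csum_ext (fun y => Csum _ s') (fun w => - (c w tau * psi' w))).
2: { intros [|j v] I.
  - simpl. rewrite (Csum_zero _ s'); [ring|intros; ring].
  - rewrite (Csum_ext _ (fun u => if word_dec v u then (fun u => B j tau * c (j :: v) tau * Psi u tau) u else 0)).
    + rewrite Csum_indicator; [simpl; ring|assumption|]. apply It, (in_tails s j); assumption.
    + intros u _. simpl. destruct (word_dec v u); ring. }
rewrite (Csum_ext (fun w => - (c w tau * psi' w)) (fun w => - (1) * (c w tau * psi' w))) by (intros; ring).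
rewrite (Csum_ext _ (fun w => c w0 tau * (d w tau * Psi w tau) + - d w0 tau * (c w tau * Psi w tau))) by (intros; ring).
rewrite Csum_plus, !Csum_scal, Rel. rewrite Csum_plus in DR.
transitivity (c w0 tau * (Csum (fun w => d w tau * Psi w tau) s + Csum (fun w => c w tau * psi' w) s)); [ring|]. rewrite DR. ring.
Qed.

(** A double induction replaces the choice of a minimal relation: on a strict bound for the lengths,
    and within it on a bound [k] for the number of words of top length. Only the differential system
    for [Psi] enters, so the argument is independent of how the integrals are regularized. *)
Lemma iterated_integrals_independent {J : Type} (B : J -> C -> C) (Psi : list J -> C -> C) (Y : R) :
  (forall j, CE2_plus_modular (B j)) -> lin_indep_C B ->
  (forall tau, upper tau -> Psi [] tau = 1) ->
  (forall j w tau, upper tau -> cder (Psi (j :: w)) tau (- (tpi * B j tau * Psi w tau))) -> 0 <= Y ->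
  forall n s c, NoDup s -> (forall w, quasimodular (c w)) -> (forall w, ~ In w s -> forall tau, upper tau -> c w tau = 0) ->
    (forall w, In w s -> (length w < n)%nat) ->
    (forall tau, Y < Im tau -> Csum (fun w => c w tau * Psi w tau) s = 0) ->
    forall w tau, upper tau -> c w tau = 0.
Proof.
intros HB HI P0 P1 HY. induction n as [|n IHn].
{ intros s c _ _ Z L _ w. apply Z. intros I. specialize (L w I). lia. }
assert (Main : forall k s c, NoDup s -> (forall w, quasimodular (c w)) -> (forall w, ~ In w s -> forall tau, upper tau -> c w tau = 0) ->
    (forall w, In w s -> (length w < S n)%nat) -> (length (filter (fun w => Nat.eqb (length w) n) s) <= k)%nat ->
    (forall tau, Y < Im tau -> Csum (fun w => c w tau * Psi w tau) s = 0) ->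
    forall w tau, upper tau -> c w tau = 0).
2: { intros s c N Q Z L Rel. exact (Main _ s c N Q Z L (le_n _) Rel). }
assert (Hfil : forall (s : list (list J)) w, In w s -> length w = n -> In w (filter (fun w => Nat.eqb (length w) n) s)).
{ intros s w I E. apply filter_In. split; [assumption|apply Nat.eqb_eq; assumption]. }
induction k as [|k IHk]; intros s c N Q Z L K Rel.
{ apply (IHn s c N Q Z); [|assumption]. intros w I. specialize (L w I).
  destruct (Nat.eq_dec (length w) n) as [E|]; [exfalso|lia]. specialize (Hfil s w I E).
  destruct (filter _ s); [exact Hfil|simpl in K; lia]. }
destruct (filter (fun w => Nat.eqb (length w) n) s) as [|w0 r0] eqn:Ef.
{ apply (IHk s c N Q Z L); [rewrite Ef; simpl; lia|assumption]. }
assert (I0 : In w0 s /\ length w0 = n).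
{ assert (I : In w0 (filter (fun w => Nat.eqb (length w) n) s)) by (rewrite Ef; simpl; auto). apply filter_In in I. rewrite Nat.eqb_eq in I. exact I. }
destruct I0 as [I0 L0].
set (ne := fun w : list J => if word_dec w w0 then false else true).
assert (Hne : forall (t : list (list J)) w, In w (filter ne t) <-> In w t /\ w <> w0).
{ intros t w. rewrite filter_In. unfold ne. destruct (word_dec w w0); intuition discriminate. }
assert (Hk : forall t : list (list J), NoDup t -> (forall w, In w t -> length w = n -> In w s) -> (length (filter (fun w => Nat.eqb (length w) n) (filter ne t)) <= k)%nat).
{ intros t Nt Ht. apply Nat.succ_le_mono. apply Nat.le_trans with (2 := K).
  apply (NoDup_incl_length (l := w0 :: _)).
  - constructor; [|apply NoDup_filter, NoDup_filter; assumption]. intros I. apply filter_In in I. destruct I as [I _]. apply Hne in I. tauto.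
  - rewrite <- Ef. intros w [E|I]; [subst; apply Hfil; auto|].
    apply filter_In in I. destruct I as [I E]. apply Nat.eqb_eq in E. apply Hne in I. apply Hfil; [apply Ht; tauto|assumption]. }
destruct (not_zero_dec (c w0)) as [N0|Z0].
2: { apply (IHk (filter ne s) c); auto using NoDup_filter.
  - intros w I tau Ht. destruct (word_dec w w0); [subst; auto|]. apply Z; [|assumption]. intros I'. apply I, Hne. auto.
  - intros w I. apply Hne in I. apply L; tauto.
  - intros tau Ht. rewrite <- (Rel tau Ht). assert (upper tau) by (unfold upper; lra). apply Csum_support; [apply NoDup_filter; assumption|assumption| |].
    + intros x I I'. apply Hne in I. tauto.
    + intros x I I'. destruct (word_dec x w0); [subst; rewrite Z0 by assumption; ring|]. exfalso. apply I', Hne. auto. }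
set (d := fun w => proj1_sig (constructive_indefinite_description _ (quasimodular_der (c w) (Q w)))).
assert (Qd : forall w, quasimodular (d w)) by (intros w; unfold d; destruct constructive_indefinite_description as [x [H1 H2]]; exact H1).
assert (Dc : forall w tau, upper tau -> cder (c w) tau (tpi * d w tau)) by (intros w; unfold d; destruct constructive_indefinite_description as [x [H1 H2]]; exact H2).
clearbody d.
assert (Zd : forall w, ~ In w s -> forall tau, upper tau -> d w tau = 0).
{ intros w I tau Ht. assert (E := cder_unique_upper (c w) (fun _ => 0) tau _ _ Ht (Z w I) (Dc w tau Ht) (cder_const 0 tau)).
  destruct (Ceq_dec (d w tau) 0); [assumption|]. exfalso; revert E. apply Cmult_neq_0; [apply tpi_nz|assumption]. }
set (c' := fun u tau => c w0 tau * d u tau - d w0 tau * c u tau - c w0 tau * Csum (fun w => head_coef B c u w tau) s).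
set (s' := filter ne (nodup word_dec (s ++ tails s))).
assert (It : forall v, In v (tails s) -> (length v < n)%nat).
{ intros v I. apply in_flat_map in I. destruct I as [[|j x] [I Iv]]; [destruct Iv|]. destruct Iv as [E|[]]. subst. specialize (L _ I). simpl in L. lia. }
assert (Zh : forall u w tau, In w s -> ~ In u (tails s) -> head_coef B c u w tau = 0).
{ intros u [|j v] tau I H; [reflexivity|]. simpl. destruct (word_dec v u); [|reflexivity]. subst. exfalso. apply H, (in_tails s j). assumption. }
(* The derived relation has lost [w0] and gained only tails, which are shorter than [n]; it
   therefore has fewer words of top length. *)
assert (Zc' : forall u tau, upper tau -> c' u tau = 0).
{ apply (IHk s' c').
  - apply NoDup_filter, NoDup_nodup.
  - intros u. unfold c', Cminus. assert (Qm : forall f g, quasimodular f -> quasimodular g -> quasimodular (fun t => - (f t * g t))).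
    { intros f g Hf Hg. apply (alg_ext _ (fun t => - (1) * (f t * g t))); [|intros; ring].
      apply (alg_mul _ (fun _ => - (1))); [apply alg_const|apply alg_mul; assumption]. }
    apply alg_add; [apply alg_add|]; [apply alg_mul; [apply Q|apply Qd]|apply Qm; [apply Qd|apply Q]|apply Qm; [apply Q|]].
    clear - s HB Q. induction s as [|w s IH]; [exact (alg_const _ 0)|]. apply (alg_add _ (head_coef B c u w)); [|exact IH].
    destruct w as [|j v]; [exact (alg_const _ 0)|]. unfold head_coef. destruct (word_dec v u); [|exact (alg_const _ 0)].
    apply alg_mul; [apply CE2_plus_modular_rep, HB|apply Q].
  - intros u I tau Ht. unfold c'. destruct (word_dec u w0) as [E|E].
    + subst u. rewrite Csum_zero; [ring|]. intros w Iw. apply Zh; [assumption|]. intros I'. specialize (It _ I'). lia.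
    + assert (I' : ~ In u s /\ ~ In u (tails s)).
      { unfold s' in I. rewrite Hne, nodup_In, in_app_iff in I. tauto. }
      rewrite (Z u), (Zd u), Csum_zero by (tauto || assumption || (intros; apply Zh; tauto)). ring.
  - intros w I. unfold s' in I. rewrite Hne, nodup_In, in_app_iff in I. destruct I as [[I|I] _]; [auto|]. specialize (It w I). lia.
  - apply Hk; [apply NoDup_nodup|]. intros w I E. rewrite nodup_In, in_app_iff in I. destruct I as [I|I]; [assumption|]. specialize (It w I). lia.
  - apply (derived_relation B Psi c d s s' w0 Y); auto.
    + apply NoDup_filter, NoDup_nodup.
    + intros w I. destruct (word_dec w w0); [auto|right]. apply Hne. rewrite nodup_In, in_app_iff. auto.
    + intros w I. apply Hne. rewrite nodup_In, in_app_iff. split; [auto|]. intros E. subst. specialize (It _ I). lia. }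
destruct (W_nonzero_large (c w0) (quasimodular_W _ (Q w0)) N0) as [Y0 [HY0 NY0]].
(* A word of top length is not a tail, so for it [c' u = 0] says that [c u / c w0] has derivative
   zero. *)
assert (Hlam : forall u, length u = n -> exists lam, forall tau, upper tau -> c u tau = lam * c w0 tau).
{ intros u Lu. set (t0 := (0, Y0 + 1)%R : C). assert (Ht0 : Y0 < Im t0) by (unfold t0; simpl; lra).
  assert (DQ : forall z, Y0 < Im z -> cder (fun t => c u t * / c w0 t) z 0).
  { intros z Hz. assert (Uz : upper z) by (unfold upper; lra). assert (Nz := NY0 z Hz).
    apply (cder_eq _ _ _ _ (cder_mult _ _ _ _ _ (Dc u z Uz) (cder_comp Cinv (c w0) _ _ _ (cder_inv _ Nz) (Dc w0 z Uz)))).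
    assert (E := Zc' u z Uz). unfold c' in E. rewrite Csum_zero in E.
    - transitivity (tpi * (c w0 z * d u z - d w0 z * c u z - c w0 z * 0) / (c w0 z * c w0 z)); [field; assumption|]. rewrite E. field. assumption.
    - intros w I. apply Zh; [assumption|]. intros I'. specialize (It _ I'). lia. }
  exists (c u t0 * / c w0 t0). intros z Hz. apply Ceq_minus.
  apply (W_zero_large (fun z => c u z - c u t0 * / c w0 t0 * c w0 z) Y0); [|intros w H1 H2|assumption].
  - apply W_minus; [|apply W_scal]; apply quasimodular_W, Q.
  - assert (E := cder_zero_const _ Y0 DQ w t0 H1 Ht0). cbv beta in E. rewrite <- E. field. apply NY0; assumption. }
(* If the longest word is empty, the relation is [c [] = 0] for large [Im tau], against the choice
   of [w0]. *)
exfalso. destruct n as [|n].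
{ destruct w0; [|discriminate]. set (t0 := (0, Y + Y0 + 1)%R : C).
  assert (H1 : Y < Im t0) by (unfold t0; simpl; lra). assert (H2 : Y0 < Im t0) by (unfold t0; simpl; lra).
  apply (NY0 t0 H2). rewrite <- (Rel t0 H1). rewrite (Csum_support _ s [[]] N).
  - unfold Csum; simpl. rewrite P0 by (unfold upper; lra). ring.
  - constructor; [intros []|constructor].
  - intros x I H. specialize (L x I). destruct x; [exfalso; apply H; simpl; auto|simpl in L; lia].
  - intros x [E|[]]; subst; tauto. }
destruct w0 as [|j0 u0]; [discriminate|]. simpl in L0. injection L0 as L0.
set (lam := fun j => epsilon (inhabits (RtoC 0)) (fun l => forall tau, upper tau -> c (j :: u0) tau = l * c (j0 :: u0) tau)).
assert (Elam : forall j tau, upper tau -> c (j :: u0) tau = lam j * c (j0 :: u0) tau).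
{ intros j. unfold lam. apply epsilon_spec. apply Hlam. simpl; lia. }
clearbody lam.
(* The letters [j] for which [j :: u0] occurs. The multipliers [lam j] of these words are the
   coefficients of the combination [f], and [j0] is among the letters. *)
set (js := flat_map (fun w => match w with [] => [] | j :: v => if word_dec v u0 then [j] else [] end) s).
assert (Ijs : In j0 js).
{ apply in_flat_map. exists (j0 :: u0). split; [assumption|]. destruct (word_dec u0 u0); [simpl; auto|congruence]. }
assert (Njs : NoDup js).
{ clear - N. unfold js. induction N as [|w s H N IH]; [constructor|]. simpl. destruct w as [|j v]; [exact IH|].
  destruct (word_dec v u0); [|exact IH]. subst. constructor; [|exact IH]. intros I. apply H. apply in_flat_map in I.
  destruct I as [[|i v] [I E]]; [destruct E|]. destruct (word_dec v u0); [|destruct E]. subst. destruct E as [E|[]]. subst. exact I. }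
set (f := fun tau => Csum (fun j => lam j * B j tau) js).
assert (Ef' : forall tau, upper tau -> Csum (fun w => head_coef B c u0 w tau) s = f tau * c (j0 :: u0) tau).
{ intros tau Ht. unfold f, js. rewrite Csum_flat_map, Cmult_comm, <- Csum_scal. apply Csum_ext. intros [|j v] _; [unfold Csum; simpl; ring|].
  simpl. destruct (word_dec v u0); [|unfold Csum; simpl; ring]. subst. rewrite Elam by assumption. unfold Csum; simpl. ring. }
assert (Hf : exists lf, List.Forall CE2M_term lf /\ forall tau, upper tau -> f tau = qeval lf tau).
{ unfold f. clear - HB. induction js as [|j js [lf [H E]]]; [exists []; split; [constructor|reflexivity]|].
  destruct (CE2_plus_modular_rep _ (HB j)) as [_ [l [Hl El]]].
  exists (map (fun t : qterm => let '(k, i, h) := t in (k, i, fun z => lam j * h z)) l ++ lf). split.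
  - apply Forall_app. split; [|assumption]. apply Forall_map. revert Hl. apply Forall_impl. intros [[k i] h].
    intros [[H1 [H2 H3]]|[H1 [H2 [c0 H3]]]]; [left|right].
    + split; [assumption|]. split; [assumption|]. exact (modular_wt_mult 0 k _ _ (modular_wt_const (lam j)) H3).
    + split; [assumption|]. split; [assumption|]. exists (lam j * c0). intros; rewrite H3; reflexivity.
  - intros tau Ht. rewrite Csum_cons, E, qeval_app, El by assumption. f_equal. unfold qeval. rewrite Csum_map, <- Csum_scal.
    apply Csum_ext. intros [[k i] h] _. simpl. ring. }
destruct Hf as [lf [Hlf Elf]].
destruct (quasimodular_rep _ (Q (j0 :: u0))) as [lv [Hlv Ev]]. destruct (quasimodular_rep _ (Q u0)) as [lu [Hlu Eu]].
(* At the tail [u0] of [w0], [c' u0 = 0] is the cross-multiplied form of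
   [(c u0 / c w0)' = tpi f]. *)
assert (ZF : forall tau, upper tau -> qeval lf tau = 0).
{ apply (no_primitive lf lv lu (fun t => tpi * d u0 t) (fun t => tpi * d (j0 :: u0) t) Hlf Hlv Hlu).
  - destruct N0 as [z [Uz Nz]]. exists z. rewrite <- Ev; auto.
  - apply W_scal, quasimodular_W, Qd.
  - apply W_scal, quasimodular_W, Qd.
  - intros z Hz. apply (cder_ext_upper (c u0)); auto.
  - intros z Hz. apply (cder_ext_upper (c (j0 :: u0))); auto.
  - intros z Hz. rewrite <- Ev, <- Eu, <- Elf by assumption. assert (E := Zc' u0 z Hz). unfold c' in E. rewrite Ef' in E by assumption.
    transitivity (tpi * (c (j0 :: u0) z * d u0 z - d (j0 :: u0) z * c u0 z - c (j0 :: u0) z * (f z * c (j0 :: u0) z)) +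
      tpi * f z * (c (j0 :: u0) z * c (j0 :: u0) z)); [ring|]. rewrite E. ring. }
assert (Zlam := HI js lam Njs (fun tau Ht => eq_trans (Elf tau Ht) (ZF tau Ht)) j0 Ijs).
destruct N0 as [z [Uz Nz]]. apply Nz. rewrite (Elam j0 z Uz), Zlam. ring.
Qed.

(** [d] is the product of all denominators, and [c k] is the quasimodular function [d g_k / h_k],
    built along the list so that no division occurs. *)
Lemma clear_denominators {K : Type} (s : list K) (g h : K -> C -> C) :
  (forall k, In k s -> quasimodular (g k) /\ quasimodular (h k) /\ not_zero (h k)) ->
  exists (d : C -> C) (c : K -> C -> C), quasimodular d /\ not_zero d /\ (forall k, quasimodular (c k)) /\
    (forall k, ~ In k s -> forall tau, c k tau = 0) /\
    forall k, In k s -> forall tau, h k tau * c k tau = d tau * g k tau.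
Proof.
induction s as [|a s IH]; intros H.
- exists (fun _ => 1), (fun _ _ => 0). split; [apply alg_const|]. split; [|split; [intros; apply alg_const|split; [reflexivity|intros k []]]].
  exists Ci. split; [unfold upper; simpl; lra|apply C1_nz].
- destruct IH as [d [c [Qd [Nd [Qc [Z E]]]]]]; [intros; apply H; simpl; auto|].
  destruct (H a (or_introl eq_refl)) as [Qg [Qh Nh]].
  exists (fun t => h a t * d t), (fun k t => if word_dec k a then d t * g a t else h a t * c k t).
  split; [|split; [|split; [|split]]].
  + apply alg_mul; assumption.
  + apply not_zero_mult; auto using quasimodular_W.
  + intros k. destruct (word_dec k a); apply alg_mul; assumption || apply Qc.
  + intros k I tau. destruct (word_dec k a); [subst; exfalso; apply I; simpl; auto|]. rewrite Z; [ring|]. intros I'. apply I. simpl; auto.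
  + intros k I tau. destruct (word_dec k a); [subst; ring|]. destruct I as [I|I]; [congruence|].
    transitivity (h a tau * (h k tau * c k tau)); [ring|]. rewrite E by assumption. ring.
Qed.

Lemma FracQM_independent {J : Type} (B : J -> C -> C) (Psi : list J -> C -> C) :
  (forall j, CE2_plus_modular (B j)) -> lin_indep_C B ->
  (forall tau, upper tau -> Psi [] tau = 1) ->
  (forall j w tau, upper tau -> cder (Psi (j :: w)) tau (- (tpi * B j tau * Psi w tau))) ->
  lin_indep_FracQM Psi.
Proof.
intros HB HI P0 P1 s g h N QH Rel.
destruct (clear_denominators s g h QH) as [d [c [Qd [Nd [Qc [Z E]]]]]].
(* Above a common height all denominators are nonzero, so the hypothesis applies at every point
   there. *)
assert (HY : exists Y, 0 <= Y /\ forall tau, Y < Im tau -> forall k, In k s -> h k tau <> 0).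
{ clear - QH. induction s as [|a s IH]; [exists 0%R; split; [lra|intros tau _ k []]|].
  destruct IH as [Y [HY NY]]; [intros; apply QH; simpl; auto|]. destruct (QH a (or_introl eq_refl)) as [_ [Qh Nh]].
  destruct (W_nonzero_large _ (quasimodular_W _ Qh) Nh) as [Y' [HY' NY']]. exists (Y + Y')%R. split; [lra|].
  intros tau Ht k [K|K]; [subst; apply NY'; lra|]. apply NY; [lra|assumption]. }
destruct HY as [Y [HY NY]].
assert (Lb : exists n, forall w, In w s -> (length w < n)%nat).
{ clear. induction s as [|a s [n IH]]; [exists O; intros w []|]. exists (S (length a) + n)%nat. intros w [E|I]; [subst; lia|]. specialize (IH w I). lia. }
destruct Lb as [n Ln].
assert (Rc : forall t, Y < Im t -> Csum (fun w => c w t * Psi w t) s = 0).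
{ intros t Yt. assert (Ut : upper t) by (unfold upper; lra).
rewrite (Csum_ext _ (fun w => d t * (g w t / h w t * Psi w t))).
- rewrite Csum_scal, Rel; [ring|assumption|]. apply NY; assumption.
- intros w Iw. specialize (E w Iw t). assert (Nw := NY t Yt w Iw). transitivity (h w t * c w t * / h w t * Psi w t); [field; assumption|]. rewrite E. field. assumption. }
assert (Zc := iterated_integrals_independent B Psi Y HB HI P0 P1 HY n s c N Qc (fun w I tau _ => Z w I tau) Ln Rc).
intros k I. destruct (QH k I) as [Qg [Qh Nh]].
apply (W_cancel d (g k) (quasimodular_W _ Qd) (quasimodular_W _ Qg) Nd).
intros tau Ht. rewrite <- E, Zc by assumption. ring.
Qed.

(** * Iterated integrals along segments *)

(** Taken componentwise so that the theorems on derivatives and integrals of real-valued functions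
    apply to each part. *)
Definition rder (f : R -> C) (s : R) (l : C) : Prop :=
  is_derive (fun t => Re (f t)) s (Re l) /\ is_derive (fun t => Im (f t)) s (Im l).

Definition rcont (f : R -> C) (s : R) : Prop :=
  continuous (fun t => Re (f t)) s /\ continuous (fun t => Im (f t)) s.

Lemma is_derive_conv (f g : R -> R) (s a b : R) : is_derive f s a -> (forall t, f t = g t) -> a = b -> is_derive g s b.
Proof. intros H E e. subst. apply (is_derive_ext f); assumption. Qed.

Lemma rder_eq (f : R -> C) (s : R) (a b : C) : rder f s a -> a = b -> rder f s b.
Proof. intros H E; subst; exact H. Qed.

Lemma rder_ext (f g : R -> C) (s : R) (l : C) : (forall t, f t = g t) -> rder f s l -> rder g s l.
Proof. intros E [H1 H2]. split; [apply (is_derive_ext (fun t => Re (f t)))|apply (is_derive_ext (fun t => Im (f t)))]; auto; intros; rewrite E; reflexivity. Qed.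

Lemma rder_const (c : C) (s : R) : rder (fun _ => c) s 0.
Proof. split; apply @is_derive_const. Qed.

Lemma rder_plus (f g : R -> C) (s : R) (a b : C) : rder f s a -> rder g s b -> rder (fun t => f t + g t) s (a + b).
Proof. intros [F1 F2] [G1 G2]. split; apply @is_derive_plus; assumption. Qed.

Lemma rder_mult (f g : R -> C) (s : R) (a b : C) : rder f s a -> rder g s b -> rder (fun t => f t * g t) s (a * g s + f s * b).
Proof.
intros [F1 F2] [G1 G2]. split.
- apply (is_derive_conv _ _ _ _ _ (is_derive_minus _ _ _ _ _ (is_derive_mult _ _ _ _ _ F1 G1 Rmult_comm) (is_derive_mult _ _ _ _ _ F2 G2 Rmult_comm)));
  intros; unfold minus, plus, opp, mult, Re, Im; simpl; ring.
- apply (is_derive_conv _ _ _ _ _ (is_derive_plus _ _ _ _ _ (is_derive_mult _ _ _ _ _ F1 G2 Rmult_comm) (is_derive_mult _ _ _ _ _ F2 G1 Rmult_comm)));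
  intros; unfold plus, mult, Re, Im; simpl; ring.
Qed.

Lemma rder_Csum {K : Type} (F : K -> R -> C) (F' : K -> C) (s : R) (l : list K) :
  (forall x, In x l -> rder (F x) s (F' x)) -> rder (fun t => Csum (fun x => F x t) l) s (Csum F' l).
Proof.
induction l as [|x l IH]; intros H; [exact (rder_const 0 s)|].
apply (rder_plus (F x)); [apply H; simpl; auto|]. apply IH. intros; apply H; simpl; auto.
Qed.

Lemma rder_line (f : C -> C) (a v l : C) (t : R) : cder f (a + RtoC t * v) l -> rder (fun s => f (a + RtoC s * v)) t (v * l).
Proof.
intros H. assert (K := cder_line f a v l t H). split.
- exact (filterdiff_comp' (V := C_R_NormedModule) _ (fun z : C => fst z) t _ _ K (filterdiff_linear _ is_linear_fst)).
- exact (filterdiff_comp' (V := C_R_NormedModule) _ (fun z : C => snd z) t _ _ K (filterdiff_linear _ is_linear_snd)).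
Qed.

Lemma rder_rcont (f : R -> C) (s : R) (l : C) : rder f s l -> rcont f s.
Proof. intros [H1 H2]. split; apply @ex_derive_continuous; eexists; eassumption. Qed.

Lemma rcont_mult (f g : R -> C) (s : R) : rcont f s -> rcont g s -> rcont (fun t => f t * g t) s.
Proof.
intros [F1 F2] [G1 G2]. split.
- apply @continuous_minus; apply @continuous_mult; assumption.
- apply @continuous_plus; apply @continuous_mult; assumption.
Qed.

Lemma is_derive_zero_const (h : R -> R) (s0 a b : R) : (forall t, s0 < t -> is_derive h t 0) -> s0 < a -> s0 < b -> h a = h b.
Proof.
intros H. assert (K : forall a b, s0 < a -> a < b -> h a = h b).
{ intros x y Hx Hxy. apply (eq_is_derive h); [|assumption]. intros t Ht. apply H. lra. }
intros Ha Hb. destruct (Rtotal_order a b) as [L|[E|L]]; [auto|subst; reflexivity|symmetry; auto].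
Qed.

(** Identities between iterated integrals are proved as identities between functions of the lower
    limit [s]; the value at the upper limit 1, where nonempty integrals vanish, is the initial
    condition. *)
Lemma rder_determined (F G : R -> C) (l : R -> C) (s0 : R) : s0 < 1 -> (forall s, s0 < s -> rder F s (l s)) ->
  (forall s, s0 < s -> rder G s (l s)) -> F 1%R = G 1%R -> forall s, s0 < s -> F s = G s.
Proof.
intros H0 HF HG E s Hs.
assert (K : forall p : C -> R, (forall s, s0 < s -> is_derive (fun t => p (F t)) s (p (l s))) ->
   (forall s, s0 < s -> is_derive (fun t => p (G t)) s (p (l s))) -> p (F s) = p (G s)).
{ intros p PF PG. assert (D := is_derive_zero_const (fun t => p (F t) - p (G t))%R s0 s 1%R).
  cbv beta in D. rewrite E in D. apply Rminus_diag_uniq. rewrite D; [ring| |assumption|assumption].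
  intros t Ht. apply (is_derive_conv _ _ _ _ _ (is_derive_minus _ _ _ _ _ (PF t Ht) (PG t Ht))); unfold minus, plus, opp; simpl; intros; ring. }
apply injective_projections; apply K; intros t Ht; apply (HF t Ht) || apply (HG t Ht).
Qed.

Lemma rder_RInt (h : R -> C) (s0 : R) : s0 < 1 -> (forall s, s0 < s -> rcont h s) ->
  forall s, s0 < s -> rder (fun x => RInt (V := C_R_CompleteNormedModule) h x 1) s (- h s).
Proof.
intros H0 Hc.
assert (Ex : forall (p : C -> R), (forall s, s0 < s -> continuous (fun t => p (h t)) s) ->
   forall s, s0 < s -> is_RInt (fun t => p (h t)) s 1 (RInt (fun t => p (h t)) s 1)).
{ intros p Hp s Hs. apply @RInt_correct. apply @ex_RInt_continuous. intros z [Hz _]. apply Hp.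
  eapply Rlt_le_trans; [|exact Hz]. unfold Rmin; destruct Rle_dec; assumption. }
assert (E : forall s, s0 < s -> (RInt (fun t => Re (h t)) s 1, RInt (fun t => Im (h t)) s 1) = RInt (V := C_R_CompleteNormedModule) h s 1).
{ intros s Hs. symmetry. apply (is_RInt_unique (V := C_R_CompleteNormedModule)).
  apply (is_RInt_fct_extend_pair (U := R_NormedModule) (V := R_NormedModule) h); [apply (Ex Re)|apply (Ex Im)]; auto; intros; apply Hc; assumption. }
intros s Hs.
assert (K : forall (p : C -> R), (forall s, s0 < s -> continuous (fun t => p (h t)) s) ->
   (forall x, s0 < x -> p (RInt (V := C_R_CompleteNormedModule) h x 1) = RInt (fun t => p (h t)) x 1) ->
   is_derive (fun x => p (RInt (V := C_R_CompleteNormedModule) h x 1)) s (- p (h s))%R).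
{ intros p Hp Ep.
  apply (is_derive_ext_loc (fun x => RInt (fun t => p (h t)) x 1)).
  - apply (filter_imp (fun x => s0 < x)); [intros x Hx; symmetry; apply Ep; assumption|apply (open_gt s0 s Hs)].
  - apply (is_derive_RInt' (fun t => p (h t)) _ s 1); [|apply Hp; assumption].
    apply (filter_imp (fun x => s0 < x)); [intros x Hx; apply (Ex p); assumption|apply (open_gt s0 s Hs)]. }
split; apply K; try (intros; apply Hc; assumption); intros x Hx; rewrite <- E by assumption; reflexivity.
Qed.

(** [iter_int_from] after pullback to the parameter interval, for arbitrary integrands; it treats
    integrals of functions of [W] and of constants alike, including those along the segment from
    0. *)
Fixpoint pull_int (w : list (R -> C)) (s : R) : C :=
  match w with
  | [] => 1
  | g :: u => RInt (V := C_R_CompleteNormedModule) (fun t => g t * pull_int u t) s 1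
  end.

Lemma pull_int_1 (g : R -> C) (u : list (R -> C)) : pull_int (g :: u) 1 = 0.
Proof. exact (RInt_point (V := C_R_CompleteNormedModule) 1%R _). Qed.

Lemma rder_pull_int (s0 : R) (g : R -> C) (u : list (R -> C)) : s0 < 1 ->
  List.Forall (fun h => forall s, s0 < s -> rcont h s) (g :: u) ->
  forall s, s0 < s -> rder (pull_int (g :: u)) s (- (g s * pull_int u s)).
Proof.
intros H0 H. inversion H as [|? ? Hg Hu]; subst.
apply (rder_RInt (fun t => g t * pull_int u t)); [assumption|]. intros s Hs. apply rcont_mult; [apply Hg; assumption|].
revert s Hs. clear - H0 Hu. induction u as [|h u IH]; intros s Hs; [apply (rder_rcont _ _ 0), rder_const|].
inversion Hu; subst. eapply rder_rcont. apply (rder_RInt (fun t => h t * pull_int u t) s0); [assumption| |assumption].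
intros x Hx. apply rcont_mult; auto.
Qed.

Lemma iter_int_pull (a b : C) (w : word) : iter_int a b w = pull_int (map (fun f t => f (a + RtoC t * (b - a)) * (b - a)) w) 0.
Proof.
unfold iter_int. generalize 0%R. induction w as [|f w IH]; intros s; [reflexivity|].
simpl. apply (RInt_ext (V := C_R_CompleteNormedModule)). intros t _. rewrite IH. reflexivity.
Qed.

Lemma Forall_shuffle (P : (C -> C) -> Prop) (u v : word) : List.Forall P u -> List.Forall P v ->
  List.Forall (List.Forall P) (shuffle u v).
Proof.
intros Hu. revert v. induction Hu as [|f u Hf Hu IHu]; intros v Hv; [simpl; auto|].
induction Hv as [|g v Hg Hv IHv]; [simpl; auto|].
change (shuffle (f :: u) (g :: v)) with (map (cons f) (shuffle u (g :: v)) ++ map (cons g) (shuffle (f :: u) v)).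
apply Forall_app. split; apply Forall_map.
- generalize (IHu (g :: v) (Forall_cons _ Hg Hv)). apply Forall_impl. auto.
- revert IHv. apply Forall_impl. auto.
Qed.

(** Both sides have the same derivative with respect to the lower endpoint. *)
Lemma pull_int_shuffle (p : (C -> C) -> R -> C) (s0 : R) (u v : word) : s0 < 1 ->
  List.Forall (fun f => forall s, s0 < s -> rcont (p f) s) u -> List.Forall (fun f => forall s, s0 < s -> rcont (p f) s) v ->
  forall s, s0 < s -> Csum (fun w => pull_int (map p w) s) (shuffle u v) = pull_int (map p u) s * pull_int (map p v) s.
Proof.
intros H0 Hu. revert v. induction Hu as [|f u Hf Hu IHu]; intros v Hv.
{ intros s _. unfold Csum; simpl; ring. }
induction Hv as [|g v Hg Hv IHv].
{ intros s _. unfold Csum; simpl; ring. }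
change (shuffle (f :: u) (g :: v)) with (map (cons f) (shuffle u (g :: v)) ++ map (cons g) (shuffle (f :: u) v)).
assert (Hgv := Forall_cons g Hg Hv). assert (Hfu := Forall_cons f Hf Hu).
assert (Hmap : forall h w, (forall s, s0 < s -> rcont (p h) s) -> List.Forall (fun f => forall s, s0 < s -> rcont (p f) s) w ->
   forall s, s0 < s -> rder (pull_int (map p (h :: w))) s (- (p h s * pull_int (map p w) s))).
{ intros h w Hh Hw. apply rder_pull_int; [assumption|]. constructor; [assumption|]. apply Forall_map. assumption. }
assert (Dsum : forall h l, (forall s, s0 < s -> rcont (p h) s) -> List.Forall (List.Forall (fun f => forall s, s0 < s -> rcont (p f) s)) l ->
   forall s, s0 < s -> rder (fun s => Csum (fun w => pull_int (map p (h :: w)) s) l) s (- (p h s * Csum (fun w => pull_int (map p w) s) l))).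
{ intros h l Hh Hl s Hs. rewrite Forall_forall in Hl.
  apply (rder_eq _ _ _ _ (rder_Csum (fun w s => pull_int (map p (h :: w)) s) (fun w => - (p h s * pull_int (map p w) s)) s l (fun w I => Hmap h w Hh (Hl w I) s Hs))).
  rewrite (Csum_ext _ (fun w => - p h s * pull_int (map p w) s)), Csum_scal by (intros; ring). ring. }
apply (rder_determined _ _ (fun s => - (p f s * (pull_int (map p u) s * pull_int (map p (g :: v)) s)) +
   - (p g s * (pull_int (map p (f :: u)) s * pull_int (map p v) s))) s0 H0).
- intros s Hs. apply (rder_ext (fun s => Csum (fun w => pull_int (map p (f :: w)) s) (shuffle u (g :: v)) +
     Csum (fun w => pull_int (map p (g :: w)) s) (shuffle (f :: u) v))).
  { intros t. rewrite Csum_app, !Csum_map. reflexivity. }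
  rewrite <- IHu, <- IHv by assumption.
  apply rder_plus; apply Dsum; try assumption; apply Forall_shuffle; assumption.
- intros s Hs. apply (rder_eq _ _ _ _ (rder_mult _ _ _ _ _ (Hmap f u Hf Hu s Hs) (Hmap g v Hg Hv s Hs))). ring.
- rewrite Csum_app, !Csum_map. rewrite (Csum_zero _ (shuffle u (g :: v))), (Csum_zero _ (shuffle (f :: u) v)) by (intros; apply pull_int_1).
  simpl map. rewrite !pull_int_1. ring.
Qed.

Definition Cprod {K : Type} (c : K -> C) (l : list K) : C := fold_right (fun x a => c x * a) 1 l.

Lemma pull_int_const {K : Type} (c : K -> C) (l : list K) (s : R) : 
  pull_int (map (fun x _ => c x) l) s = Cprod c l * (RtoC (1 - s) ^ length l / nC (fact (length l))).
Proof.
revert s. assert (H : forall s0 s, s0 < 1 -> s0 < s -> pull_int (map (fun x _ => c x) l) s = Cprod c l * (RtoC (1 - s) ^ length l / nC (fact (length l)))).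
2: { intros s. apply (H (Rmin 0 s - 1)%R); unfold Rmin; destruct Rle_dec; lra. }
intros s0 s H0. revert s. induction l as [|x l IH]; intros s Hs.
{ simpl. change (nC 1) with (RtoC 1). field. }
revert s Hs. apply (rder_determined _ _ (fun s => - (c x * pull_int (map (fun x _ => c x) l) s)) s0 H0).
- apply (rder_pull_int s0 (fun _ => c x)); [assumption|].
  change ((fun _ : R => c x) :: map (fun x _ => c x) l) with (map (fun x (_ : R) => c x) (x :: l)).
  apply Forall_map, Forall_forall. intros y _ s _. apply (rder_rcont _ _ 0), rder_const.
- intros s Hs. 
  apply (rder_ext (fun s => Cprod c (x :: l) / nC (fact (length (x :: l))) * (1 + RtoC s * - (1)) ^ length (x :: l))).
  { intros t. replace (RtoC (1 - t)) with (1 + RtoC t * - (1)) by (unfold Rminus; rewrite RtoC_plus, RtoC_opp; ring). unfold Cdiv; ring. }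
  apply (rder_eq _ _ _ _ (rder_mult _ _ _ _ _ (rder_const _ s) (rder_line (fun z => z ^ length (x :: l)) 1 (- (1)) _ s (cder_pow _ _)))).
  rewrite IH by assumption. replace (RtoC (1 - s)) with (1 + RtoC s * - (1)) by (unfold Rminus; rewrite RtoC_plus, RtoC_opp; ring).
  generalize (1 + RtoC s * - (1)). intros z. simpl length. replace (S (length l) - 1)%nat with (length l) by lia. unfold Cprod; simpl fold_right. fold (Cprod c l).
  rewrite fact_simpl. unfold nC. rewrite mult_INR, RtoC_mult. field. split; apply RtoC_neq; [apply INR_fact_neq_0|apply not_0_INR; lia].
- simpl map. rewrite pull_int_1. rewrite Rminus_diag. simpl. rewrite Cmult_0_l. unfold Cdiv. ring.
Qed.

(** * Regularized iterated integrals *)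

Lemma is_series_clim (u : nat -> C) (l : C) :
  is_series (K := C_AbsRing) (V := C_NormedModule) u l <-> clim (csum u) l.
Proof.
assert (E : forall n, sum_n (G := C_NormedModule) u n = csum u (S n)).
{ induction n as [|n IH]; [rewrite sum_O; simpl; ring|]. rewrite sum_Sn, IH, (csum_Sr u (S n)). reflexivity. }
split.
- intros H eps He. destruct (proj1 (filterlim_locally_ball_norm (U := C_NormedModule) _ _) H (mkposreal eps He)) as [N HN].
  exists (S N). intros n Hn. destruct n as [|n]; [lia|]. rewrite <- E. exact (HN n ltac:(lia)).
- intros H. apply (filterlim_locally_ball_norm (U := C_NormedModule)). intros [eps He].
  destruct (H eps He) as [N HN]. exists N. intros n Hn. rewrite E. exact (HN (S n) ltac:(lia)).
Qed.

Lemma eventually_bounded (u : nat -> R) (N : nat) (M : R) : (forall n, 0 <= u n) -> (forall n, (N <= n)%nat -> u n <= M) ->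
  exists K : R, forall n, u n <= K.
Proof.
intros P. revert M. induction N as [|N IH]; intros M H; [exists M; intros; apply H; lia|].
apply (IH (Rmax M (u N))). intros n Hn. destruct (Nat.eq_dec n N); [subst; apply Rmax_r|].
eapply Rle_trans; [apply H; lia|apply Rmax_l].
Qed.

(** On the imaginary axis [|q|] takes every value [r] in (0, 1), and the terms of a convergent
    series are bounded. *)
Lemma fourier_series_Wf (f : C -> C) (a : nat -> C) : fourier_series f a <-> Wf a f.
Proof.
split.
- intros H. assert (S : subexp a).
  { intros r Hr. set (t := (0, - ln r / (2 * PI))%R : C). assert (P := PI_RGT_0).
    assert (L : ln r < 0) by (rewrite <- ln_1; apply ln_increasing; lra).
    assert (Ut : upper t). { unfold upper, t. simpl. apply Rdiv_lt_0_compat; lra. }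
    assert (Q : Cmod (q t) = r). { rewrite Cmod_q. rewrite <- (exp_ln r) by lra. f_equal. unfold t; simpl. field. lra. }
    assert (K := proj1 (is_series_clim _ _) (H t Ut)). destruct (K 1%R ltac:(lra)) as [N HN].
    apply (eventually_bounded (fun n => Cmod (a n) * r ^ n)%R N 2%R).
    - intros n. apply Rmult_le_pos; [apply Cmod_ge_0|apply pow_le; lra].
    - intros n Hn. rewrite <- Q, <- Cmod_pow, <- Cmod_mult.
      replace (a n * q t ^ n) with ((csum (fun n => a n * q t ^ n) (S n) - f t) - (csum (fun n => a n * q t ^ n) n - f t)) by (rewrite csum_Sr; ring).
      assert (H1 := HN n Hn). assert (H2 := HN (S n) ltac:(lia)).
      unfold Cminus at 1. eapply Rle_trans; [apply Cmod_triangle|]. rewrite Cmod_opp. lra. }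
  split; [assumption|]. intros t Ht. symmetry. apply psum_eq; [assumption|apply Cmod_q_lt; assumption|]. apply is_series_clim, H. assumption.
- intros [S H] t Ht. apply is_series_clim. rewrite H by assumption. apply psum_lim; [assumption|apply Cmod_q_lt; assumption].
Qed.

Lemma Wf_f_infty (f : C -> C) : W f -> exists a, Wf a f /\ a O = f_infty f.
Proof.
intros [a Ha].
assert (K : exists a0 a, fourier_series f a /\ a O = a0) by (exists (a O), a; split; [apply fourier_series_Wf; assumption|reflexivity]).
destruct (epsilon_spec (inhabits (RtoC 0)) _ K) as [b [Hb Eb]].
exists b. split; [apply fourier_series_Wf; assumption|exact Eb].
Qed.

(** The span of the functions tau^j f with [f] in [W] without constant term: a space stable under
    multiplication by [W] and by powers of [tau], and under primitives, whose elements decay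
    exponentially at i oo. *)
Inductive decT : (C -> C) -> Prop :=
| decT_mono (j : nat) (a : nat -> C) (f : C -> C) : Wf a f -> a O = 0 -> decT (fun tau => tau ^ j * f tau)
| decT_plus (F G : C -> C) : decT F -> decT G -> decT (fun tau => F tau + G tau)
| decT_ext (F G : C -> C) : decT F -> (forall tau, upper tau -> G tau = F tau) -> decT G.

Lemma decT_mult (k : nat) (f F : C -> C) : W f -> decT F -> decT (fun tau => tau ^ k * (f tau * F tau)).
Proof.
intros [b Hb]. induction 1 as [j a h Ha Za|F G _ IF _ IG|F G _ IF E].
- apply (decT_ext (fun tau => tau ^ (k + j) * (f tau * h tau))).
  + apply (decT_mono _ _ _ (Wf_mult _ _ _ _ Hb Ha)). unfold cauchy_prod. simpl. rewrite Za. ring.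
  + intros. rewrite Cpow_add_r. ring.
- apply (decT_ext _ _ (decT_plus _ _ IF IG)). intros; ring.
- apply (decT_ext _ _ IF). intros; rewrite E by assumption; reflexivity.
Qed.

Lemma decT_zero : decT (fun _ => 0).
Proof. apply (decT_ext _ _ (decT_mono 0 _ _ (Wf_const 0) eq_refl)). intros; simpl; ring. Qed.

Lemma decT_scal (c : C) (F : C -> C) : decT F -> decT (fun tau => c * F tau).
Proof. intros H. apply (decT_ext _ _ (decT_mult 0 (fun _ => c) F (W_const c) H)). intros; simpl; ring. Qed.

(** Integration by parts: a function of [W] without constant term has a primitive of the same kind,
    and each step lowers the power of [tau]. *)
Lemma decT_prim (F : C -> C) : decT F -> exists G, decT G /\ forall tau, upper tau -> cder G tau (F tau).
Proof.
induction 1 as [j a f Ha Za|F G _ [F' [HF DF]] _ [G' [HG DG]]|F G _ [F' [HF DF]] E].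
- revert a f Ha Za. induction j as [|j IH]; intros a f Ha Za.
  + destruct (Wf_prim a f Ha) as [b [G [Hb [Zb DG]]]]. exists (fun t => / tpi * G t). split.
    * apply decT_scal. apply (decT_ext _ _ (decT_mono 0 _ _ Hb Zb)). intros; simpl; ring.
    * intros t Ht. apply (cder_eq _ _ _ _ (cder_scal (/ tpi) _ _ _ (DG t Ht))). rewrite Za. simpl. field. apply tpi_nz.
  + destruct (Wf_prim a f Ha) as [b [G [Hb [Zb DG]]]].
    assert (Hb' := Wf_scal (/ tpi) _ _ Hb). assert (Zb' : / tpi * b O = 0) by (rewrite Zb; ring).
    destruct (IH _ _ Hb' Zb') as [K [HK DK]].
    exists (fun t => t ^ S j * (/ tpi * G t) + - RtoC (INR (S j)) * K t). split.
    * apply decT_plus; [exact (decT_mono (S j) _ _ Hb' Zb')|apply decT_scal; assumption].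
    * intros t Ht. apply (cder_eq _ _ _ _ (cder_plus _ _ _ _ _ (cder_mult _ _ _ _ _ (cder_pow (S j) t) (cder_scal (/ tpi) _ _ _ (DG t Ht))) (cder_scal (- RtoC (INR (S j))) _ _ _ (DK t Ht)))).
      rewrite Za. replace (S j - 1)%nat with j by lia. generalize (RtoC (INR (S j))). intros n. field. apply tpi_nz.
- exists (fun t => F' t + G' t). split; [apply decT_plus; assumption|]. intros; apply cder_plus; auto.
- exists F'. split; [assumption|]. intros. rewrite E by assumption. auto.
Qed.

(** The value of a regularized iterated integral of constants: [x] is the difference of the endpoints. *)
Definition exp_word {J : Type} (c : J -> C) (x : C) (w : list J) : C := Cprod c w * (x ^ length w / nC (fact (length w))).

Lemma cder_exp_word {J : Type} (c : J -> C) (j : J) (w : list J) (t : C) :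
  cder (fun t => exp_word c (- t) (j :: w)) t (- (c j * exp_word c (- t) w)).
Proof.
unfold exp_word.
assert (K := cder_scal (Cprod c (j :: w) / nC (fact (length (j :: w)))) _ _ _ (cder_comp (fun z => z ^ length (j :: w)) (fun t => - t) t _ _ (cder_pow _ _) (cder_opp _ _ _ (cder_id t)))).
eapply (cder_ext_loc _ _ _ _ 1%R); [lra| |apply (cder_eq _ _ _ _ K)]; [intros; unfold Cdiv; ring|].
simpl length. replace (S (length w) - 1)%nat with (length w) by lia. unfold Cprod; simpl fold_right. fold (Cprod c w).
rewrite fact_simpl. unfold nC. rewrite mult_INR, RtoC_mult. field. split; apply RtoC_neq; [apply INR_fact_neq_0|apply not_0_INR; lia].
Qed.

(** The equation is what remains of [psi' = - B psi] after subtraction of the exponential part,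
    which solves the system of the constant terms. Requiring [decT] selects the primitive that
    vanishes at i oo. *)
Fixpoint dec_part {J : Type} (B : J -> C -> C) (w : list J) : C -> C :=
  match w with
  | [] => fun _ => 0
  | j :: v => epsilon (inhabits (fun _ => RtoC 0)) (fun G => decT G /\ forall tau, upper tau ->
      cder G tau (- ((B j tau - f_infty (B j)) * exp_word (fun j => f_infty (B j)) (- tau) v + B j tau * dec_part B v tau)))
  end.

(** The regularized iterated integral without its factor [tpi ^ length w], see [I_reg_psi]. *)
Definition psi {J : Type} (B : J -> C -> C) (w : list J) (tau : C) : C :=
  exp_word (fun j => f_infty (B j)) (- tau) w + dec_part B w tau.

Lemma dec_part_spec {J : Type} (B : J -> C -> C) (w : list J) : (forall j, W (B j)) -> decT (dec_part B w) /\
  forall j tau, upper tau -> cder (dec_part B (j :: w)) tau (- ((B j tau - f_infty (B j)) * exp_word (fun j => f_infty (B j)) (- tau) w + B j tau * dec_part B w tau)).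
Proof.
intros HB.
assert (Step : forall j v, decT (dec_part B v) -> decT (dec_part B (j :: v)) /\ forall tau, upper tau ->
   cder (dec_part B (j :: v)) tau (- ((B j tau - f_infty (B j)) * exp_word (fun j => f_infty (B j)) (- tau) v + B j tau * dec_part B v tau))).
{ intros j v Hv. apply (epsilon_spec (inhabits (fun _ => RtoC 0)) (fun G => decT G /\ forall tau, upper tau ->
      cder G tau (- ((B j tau - f_infty (B j)) * exp_word (fun j => f_infty (B j)) (- tau) v + B j tau * dec_part B v tau)))).
  apply (decT_prim (fun tau => - ((B j tau - f_infty (B j)) * exp_word (fun j => f_infty (B j)) (- tau) v + B j tau * dec_part B v tau))).
  destruct (Wf_f_infty _ (HB j)) as [a [Ha Ea]].
  set (k := - (Cprod (fun j => f_infty (B j)) v * ((- (1)) ^ length v / nC (fact (length v))))).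
  apply (decT_ext (fun tau => k * (tau ^ length v * (B j tau + - f_infty (B j))) + - (1) * (tau ^ 0 * (B j tau * dec_part B v tau)))).
  - apply decT_plus; apply decT_scal; [|apply decT_mult; auto].
    apply (decT_mono _ (fun n => a n + cseq (- f_infty (B j)) n)); [apply (Wf_plus _ _ _ _ Ha (Wf_const _))|]. rewrite Ea. simpl. ring.
  - intros t Ht. unfold exp_word, k. replace (- t) with (- (1) * t) by ring. rewrite Cpow_mult_l. unfold Cdiv. simpl (t ^ 0). ring. }
assert (D : decT (dec_part B w)) by (induction w as [|j w IH]; [apply decT_zero|apply Step; assumption]).
split; [assumption|]. intros j. apply Step. assumption.
Qed.

Lemma psi_nil {J : Type} (B : J -> C -> C) (tau : C) : psi B [] tau = 1.
Proof. unfold psi, exp_word. simpl. change (nC 1) with (RtoC 1). field. Qed.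

Lemma cder_psi {J : Type} (B : J -> C -> C) (j : J) (w : list J) (tau : C) : (forall j, W (B j)) -> upper tau ->
  cder (psi B (j :: w)) tau (- (B j tau * psi B w tau)).
Proof.
intros HB Ht. apply (cder_eq _ _ _ _ (cder_plus _ _ _ _ _ (cder_exp_word (fun j => f_infty (B j)) j w tau) (proj2 (dec_part_spec B w HB) j tau Ht))).
unfold psi. ring.
Qed.

(** The sum of [X u Y v] over all splittings [w = u v], that is the product of noncommutative
    generating series. The recursion moves the first letter into [X], so that inductions follow the
    list with [X] varying. *)
Fixpoint conv {J : Type} (X Y : list J -> C) (w : list J) : C :=
  match w with
  | [] => X [] * Y []
  | j :: v => X [] * Y (j :: v) + conv (fun u => X (j :: u)) Y v
  end.

Lemma conv_Csum {J : Type} (X Y : list J -> C) (w : list J) :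
  Csum (fun i => X (firstn i w) * Y (skipn i w)) (seq 0 (S (length w))) = conv X Y w.
Proof.
revert X. induction w as [|j w IH]; intros X; [unfold Csum; simpl; ring|].
simpl conv. rewrite <- IH. simpl length. rewrite <- cons_seq, <- (seq_shift (S (length w)) 0), Csum_cons, Csum_map. reflexivity.
Qed.

Lemma conv_ext {J : Type} (X Y X' Y' : list J -> C) (w : list J) :
  (forall u, X u = X' u) -> (forall u, Y u = Y' u) -> conv X Y w = conv X' Y' w.
Proof.
intros HX HY. revert X X' HX. induction w as [|j w IH]; intros X X' HX; simpl; rewrite HX, HY; [reflexivity|].
f_equal. apply IH. intros; apply HX.
Qed.

Lemma conv_plus_l {J : Type} (X X' Y : list J -> C) (w : list J) : conv (fun u => X u + X' u) Y w = conv X Y w + conv X' Y w.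
Proof. revert X X'. induction w as [|j w IH]; intros; simpl; [ring|]. rewrite IH. ring. Qed.

Lemma conv_plus_r {J : Type} (X Y Y' : list J -> C) (w : list J) : conv X (fun u => Y u + Y' u) w = conv X Y w + conv X Y' w.
Proof. revert X. induction w as [|j w IH]; intros; simpl; [ring|]. rewrite IH. ring. Qed.

Lemma conv_scal_l {J : Type} (c : C) (X Y : list J -> C) (w : list J) : conv (fun u => c * X u) Y w = c * conv X Y w.
Proof. revert X. induction w as [|j w IH]; intros; simpl; [ring|]. rewrite IH. ring. Qed.

Lemma conv_assoc {J : Type} (X Y Z : list J -> C) (w : list J) : conv (conv X Y) Z w = conv X (conv Y Z) w.
Proof.
revert X. induction w as [|j w IH]; intros X; simpl; [ring|].
rewrite conv_plus_l, conv_scal_l, IH. ring.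
Qed.

Lemma Cprod_app {J : Type} (c : J -> C) (u v : list J) : Cprod c (u ++ v) = Cprod c u * Cprod c v.
Proof. unfold Cprod. induction u as [|j u IH]; simpl; [ring|]. rewrite IH. ring. Qed.

Lemma Cprod_rev {J : Type} (c : J -> C) (w : list J) : Cprod c (rev w) = Cprod c w.
Proof. induction w as [|j w IH]; [reflexivity|]. simpl rev. rewrite Cprod_app, IH. unfold Cprod; simpl. ring. Qed.

Lemma binomial_dpow (x y : C) (n : nat) : csum (fun i => dpow x i * dpow y (n - i)) (S n) = dpow (x + y) n.
Proof.
assert (D : forall z m, nC (S m) * dpow z (S m) = z * dpow z m).
{ intros z m. unfold dpow. rewrite fact_simpl. unfold nC. rewrite mult_INR, RtoC_mult. simpl Cpow. field. split; apply RtoC_neq; [apply INR_fact_neq_0|apply not_0_INR; lia]. }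
induction n as [|n IH].
{ simpl. unfold dpow; simpl. change (nC 1) with (RtoC 1). field. }
assert (Nn := nC_neq_0 (S n) ltac:(lia)).
assert (M : nC (S n) * csum (fun i => dpow x i * dpow y (S n - i)) (S (S n)) = nC (S n) * dpow (x + y) (S n)).
2: { rewrite <- (Cmult_1_l (csum _ _)), <- (Cinv_l _ Nn), <- Cmult_assoc, M. field. assumption. }
rewrite D, <- IH, <- csum_scal.
rewrite (csum_ext _ (fun i => nC i * dpow x i * dpow y (S n - i) + dpow x i * (nC (S n - i) * dpow y (S n - i)))).
2: { intros i Hi. replace (nC (S n)) with (nC i + nC (S n - i)); [ring|]. unfold nC. rewrite <- RtoC_plus, <- plus_INR. replace (i + (S n - i))%nat with (S n) by lia. reflexivity. }
rewrite csum_plus, csum_S, (csum_Sr (fun i => dpow x i * (nC (S n - i) * dpow y (S n - i))) (S n)). replace (S n - S n)%nat with 0%nat by lia. change (nC 0) with (RtoC 0).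
rewrite (csum_ext _ (fun i => x * (dpow x i * dpow y (n - i)))), csum_scal.
2: { intros i _. simpl (S n - S i)%nat. rewrite D. ring. }
rewrite (csum_ext (fun i => dpow x i * (nC (S n - i) * dpow y (S n - i))) (fun i => y * (dpow x i * dpow y (n - i)))), csum_scal.
2: { intros i Hi. replace (S n - i)%nat with (S (n - i)) by lia. rewrite D. ring. }
ring.
Qed.

(** The generating series of [exp_word c x] is an exponential, and this is its functional equation,
    the binomial theorem in each length. *)
Lemma conv_exp_word {J : Type} (c : J -> C) (x y : C) (w : list J) : conv (exp_word c x) (exp_word c y) w = exp_word c (x + y) w.
Proof.
rewrite <- conv_Csum, Csum_seq. change (exp_word c (x + y) w) with (Cprod c w * dpow (x + y) (length w)).
rewrite <- binomial_dpow, <- csum_scal. apply csum_ext. intros i Hi. unfold exp_word.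
rewrite length_firstn, length_skipn, Nat.min_l by lia. rewrite <- (firstn_skipn i w) at 5. rewrite Cprod_app. unfold dpow. ring.
Qed.

Lemma rder_conv {J : Type} (X : list J -> R -> C) (X' Y : list J -> C) (s : R) (w : list J) :
  (forall u, rder (X u) s (X' u)) -> rder (fun t => conv (fun u => X u t) Y w) s (conv X' Y w).
Proof.
assert (K : forall u v (X : list J -> R -> C) (X' : list J -> C), rder (X u) s (X' u) -> rder (fun t => X u t * Y v) s (X' u * Y v)).
{ intros u v Z Z' H. apply (rder_eq _ _ _ _ (rder_mult _ _ _ _ _ H (rder_const (Y v) s))). ring. }
revert X X'. induction w as [|j w IH]; intros X X' H; simpl.
- apply (K [] [] X X'), H.
- apply rder_plus; [apply (K [] (j :: w) X X'), H|]. apply (IH (fun u => X (j :: u)) (fun u => X' (j :: u))). intros; apply H.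
Qed.

(** Splits the path from [a] to i oo at [b]: both sides have the same derivative along the segment. *)
Lemma conv_path {J : Type} (B : J -> C -> C) (a b : C) (s0 : R) (w : list J) : (forall j, W (B j)) -> s0 < 0 ->
  (forall s, s0 < s -> upper (a + RtoC s * (b - a))) ->
  conv (fun u => iter_int a b (map B u)) (fun v => psi B v b) w = psi B w a.
Proof.
intros HB H0 Hup. set (p := fun (f : C -> C) t => f (a + RtoC t * (b - a)) * (b - a)).
set (X := fun (u : list J) t => pull_int (map p (map B u)) t).
assert (Hc : forall u, List.Forall (fun h => forall s, s0 < s -> rcont h s) (map p (map B u))).
{ intros u. rewrite map_map. apply Forall_map, Forall_forall. intros j _ s Hs. apply rcont_mult; [|apply (rder_rcont _ _ 0), rder_const].
  destruct (W_der (B j) (HB j)) as [f' [_ D]]. eapply rder_rcont, rder_line, D, Hup, Hs. }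
assert (HX : forall j u s, s0 < s -> rder (X (j :: u)) s (- p (B j) s * X u s)).
{ intros j u s Hs. apply (rder_eq _ _ (- (p (B j) s * X u s))); [|ring].
  apply (rder_pull_int s0 (p (B j)) (map p (map B u)) ltac:(lra) (Hc (j :: u)) s Hs). }
assert (Main : forall s, s0 < s -> conv (fun u => X u s) (fun v => psi B v b) w = psi B w (a + RtoC s * (b - a))).
{ assert (H1 : s0 < 1) by lra.
  induction w as [|j w IH]; intros s Hs.
  { simpl. unfold X. simpl. rewrite !psi_nil. ring. }
  revert s Hs. apply (rder_determined _ _ (fun s => - p (B j) s * psi B w (a + RtoC s * (b - a))) s0 H1).
  - intros s Hs. rewrite <- IH, <- conv_scal_l by assumption. simpl conv.
    replace (conv (fun u => - p (B j) s * X u s) (fun v => psi B v b) w) with (0 + conv (fun u => - p (B j) s * X u s) (fun v => psi B v b) w) by ring.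
    apply (rder_ext (fun s => psi B (j :: w) b + conv (fun u => X (j :: u) s) (fun v => psi B v b) w)); [intros t; unfold X at 2; simpl pull_int; ring|].
    apply rder_plus; [apply rder_const|]. apply (rder_conv (fun u => X (j :: u))). intros u. apply HX; assumption.
  - intros s Hs. apply (rder_eq _ _ _ _ (rder_line _ a (b - a) _ s (cder_psi B j w _ HB (Hup s Hs)))). unfold p. ring.
  - simpl conv. rewrite (conv_ext (fun u => X (j :: u) 1%R) (fun v => psi B v b) (fun u => 0 * X (j :: u) 1%R) (fun v => psi B v b));
      [|intros; unfold X; simpl map; rewrite pull_int_1; ring|reflexivity].
    rewrite conv_scal_l. unfold X; simpl pull_int. replace (a + 1 * (b - a)) with b by ring. ring. }
assert (E := Main 0%R H0). replace (a + 0 * (b - a)) with a in E by ring. rewrite <- E. apply conv_ext; [|reflexivity].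
intros u. apply iter_int_pull.
Qed.

Lemma iter_int_const {J : Type} (c : J -> C) (a b : C) (w : list J) :
  iter_int a b (rev (map (fun j (_ : C) => c j) w)) = exp_word c (b - a) w.
Proof.
rewrite <- map_rev, iter_int_pull, map_map.
assert (K := pull_int_const (fun j => c j * (b - a)) (rev w) 0). cbv beta in K |- *. rewrite K. rewrite Rminus_0_r, length_rev.
rewrite (Cprod_rev (fun j => c j * (b - a))). unfold exp_word. rewrite Cpow_1_l.
assert (E : Cprod (fun j => c j * (b - a)) w = Cprod c w * (b - a) ^ length w).
{ clear. unfold Cprod. induction w as [|j w IH]; simpl; [ring|]. rewrite IH. ring. }
rewrite E. unfold Cdiv. ring.
Qed.

Lemma exp_word_opp {J : Type} (c : J -> C) (x : C) (w : list J) : (- (1)) ^ length w * exp_word c x w = exp_word c (- x) w.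
Proof. unfold exp_word. replace (- x) with (- (1) * x) by ring. rewrite Cpow_mult_l. unfold Cdiv. ring. Qed.

Lemma rev_infty_map {J : Type} (B : J -> C -> C) (i : nat) (w : list J) :
  rev_infty i (map B w) = rev (map (fun j (_ : C) => f_infty (B j)) (skipn i w)).
Proof. unfold rev_infty. rewrite skipn_map, map_map. reflexivity. Qed.

(** By the shuffle relation every shuffle product integrates to a product, so R becomes a
    convolution. For constants the sign and the reversal amount to traversing the segment backwards,
    whence the argument [a - b]. *)
Lemma iter_int_lin_Rmap {J : Type} (B : J -> C -> C) (a b : C) (s0 : R) (w : list J) : (forall j, W (B j)) -> s0 < 0 ->
  (forall s, s0 < s -> upper (a + RtoC s * (b - a))) ->
  iter_int_lin a b (Rmap (map B w)) = conv (fun u => iter_int a b (map B u)) (exp_word (fun j => f_infty (B j)) (a - b)) w.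
Proof.
intros HB H0 Hup. unfold iter_int_lin, Rmap. rewrite Csum_flat_map, length_map, <- conv_Csum. apply Csum_ext. intros i Hi.
apply in_seq in Hi. rewrite Csum_map. cbn [fst snd]. rewrite Csum_scal.
replace (length w - i)%nat with (length (skipn i w)) by apply length_skipn.
rewrite (Csum_ext _ (fun v => pull_int (map (fun f t => f (a + RtoC t * (b - a)) * (b - a)) v) 0)) by (intros; apply iter_int_pull).
rewrite (pull_int_shuffle _ s0); [|lra| | |assumption].
- rewrite <- !iter_int_pull, firstn_map, rev_infty_map, iter_int_const. replace (a - b) with (- (b - a)) by ring.
  rewrite <- (exp_word_opp _ (b - a)). ring.
- rewrite firstn_map. apply Forall_map, Forall_forall. intros j _ s Hs. apply rcont_mult; [|apply (rder_rcont _ _ 0), rder_const].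
  destruct (W_der (B j) (HB j)) as [f' [_ D]]. eapply rder_rcont, rder_line, D, Hup, Hs.
- rewrite rev_infty_map, <- map_rev. apply Forall_map, Forall_forall. intros j _ s Hs. apply (rder_rcont _ _ 0), rder_const.
Qed.

(** * Growth and decay along vertical rays *)

Definition poly_growth (F : R -> C) : Prop := exists (N : nat) (K : R), forall T, 1 <= T -> Cmod (F T) <= K * T ^ N.

Definition rapid_decay (F : R -> C) : Prop := forall N : nat, exists K : R, forall T, 1 <= T -> T ^ N * Cmod (F T) <= K.

Lemma poly_growth_const (c : C) : poly_growth (fun _ => c).
Proof. exists O, (Cmod c). intros; simpl; lra. Qed.

Lemma pow_ge_1 (T : R) (n : nat) : 1 <= T -> 1 <= T ^ n.
Proof. apply pow_R1_Rle. Qed.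

Lemma poly_growth_plus (F G : R -> C) : poly_growth F -> poly_growth G -> poly_growth (fun T => F T + G T).
Proof.
intros [n [K HK]] [m [L HL]]. exists (n + m)%nat, (Rabs K + Rabs L)%R. intros T HT. rewrite pow_add.
specialize (HK T HT). specialize (HL T HT). assert (A := pow_ge_1 T n HT). assert (A' := pow_ge_1 T m HT).
eapply Rle_trans; [apply Cmod_triangle|].
assert (K * T ^ n <= Rabs K * (T ^ n * T ^ m))%R.
{ apply Rle_trans with (Rabs K * T ^ n)%R; [apply Rmult_le_compat_r; [lra|apply Rle_abs]|apply Rmult_le_compat_l; [apply Rabs_pos|nra]]. }
assert (L * T ^ m <= Rabs L * (T ^ n * T ^ m))%R.
{ apply Rle_trans with (Rabs L * T ^ m)%R; [apply Rmult_le_compat_r; [lra|apply Rle_abs]|apply Rmult_le_compat_l; [apply Rabs_pos|nra]]. }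
nra.
Qed.

Lemma poly_growth_mult (F G : R -> C) : poly_growth F -> poly_growth G -> poly_growth (fun T => F T * G T).
Proof.
intros [n [K HK]] [m [L HL]]. exists (n + m)%nat, (K * L)%R. intros T HT. rewrite pow_add, Cmod_mult.
replace (K * L * (T ^ n * T ^ m))%R with ((K * T ^ n) * (L * T ^ m))%R by ring.
apply Rmult_le_compat; try apply Cmod_ge_0; auto.
Qed.

Lemma poly_growth_Csum {K : Type} (F : K -> R -> C) (l : list K) : (forall x, In x l -> poly_growth (F x)) ->
  poly_growth (fun T => Csum (fun x => F x T) l).
Proof.
induction l as [|x l IH]; intros H; [apply (poly_growth_const 0)|].
apply (poly_growth_plus (F x)); [apply H; simpl; auto|]. apply IH. intros; apply H; simpl; auto.
Qed.

Lemma rapid_decay_plus (F G : R -> C) : rapid_decay F -> rapid_decay G -> rapid_decay (fun T => F T + G T).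
Proof.
intros HF HG N. destruct (HF N) as [K HK], (HG N) as [L HL]. exists (K + L)%R. intros T HT.
specialize (HK T HT). specialize (HL T HT). assert (A := pow_ge_1 T N HT). assert (M := Cmod_triangle (F T) (G T)). nra.
Qed.

Lemma rapid_decay_mult (F G : R -> C) : poly_growth F -> rapid_decay G -> rapid_decay (fun T => F T * G T).
Proof.
intros [n [K HK]] HG N. destruct (HG (n + N)%nat) as [L HL]. exists (Rabs K * L)%R. intros T HT. rewrite Cmod_mult.
specialize (HK T HT). specialize (HL T HT). rewrite pow_add in HL. assert (A := pow_ge_1 T n HT). assert (A' := pow_ge_1 T N HT).
assert (P := Cmod_ge_0 (G T)).
apply Rle_trans with (T ^ N * ((Rabs K * T ^ n) * Cmod (G T)))%R.
- apply Rmult_le_compat_l; [lra|]. apply Rmult_le_compat_r; [assumption|]. eapply Rle_trans; [exact HK|].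
  apply Rmult_le_compat_r; [lra|apply Rle_abs].
- replace (T ^ N * (Rabs K * T ^ n * Cmod (G T)))%R with (Rabs K * (T ^ n * T ^ N * Cmod (G T)))%R by ring.
  apply Rmult_le_compat_l; [apply Rabs_pos|assumption].
Qed.

Lemma rapid_decay_poly_growth (F : R -> C) : rapid_decay F -> poly_growth F.
Proof. intros H. destruct (H O) as [K HK]. exists O, K. intros T HT. specialize (HK T HT). simpl in *. lra. Qed.

Lemma rapid_decay_conv {J : Type} (X Y : R -> list J -> C) (w : list J) :
  (forall u v, rapid_decay (fun T => X T u * Y T v)) -> rapid_decay (fun T => conv (X T) (Y T) w).
Proof.
revert X. induction w as [|j w IH]; intros X H; simpl; [apply H|].
apply rapid_decay_plus; [apply H|]. apply (IH (fun T u => X T (j :: u))). intros; apply H.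
Qed.

Lemma pow_exp_bound (T : R) (n : nat) : 0 <= T -> T ^ n <= INR n ^ n * exp T.
Proof.
intros HT. destruct n as [|n]; [simpl; generalize (exp_ineq1_le T); lra|].
assert (P : 0 < INR (S n)) by (apply lt_0_INR; lia).
replace T with (INR (S n) * (T / INR (S n)))%R at 1 by (field; lra). rewrite Rpow_mult_distr.
apply Rmult_le_compat_l; [apply pow_le; lra|].
assert (E : exp T = (exp (T / INR (S n)) ^ S n)%R).
{ assert (K : forall x m, (exp x ^ m = exp (INR m * x))%R).
  { intros x m. induction m as [|m IH]; [simpl; rewrite Rmult_0_l, exp_0; reflexivity|].
    rewrite S_INR, Rmult_plus_distr_r, exp_plus, <- IH, Rmult_1_l. simpl. ring. }
  rewrite K. f_equal. field. lra. }
rewrite E. apply pow_incr. split; [apply Rle_mult_inv_pos; assumption|]. generalize (exp_ineq1_le (T / INR (S n))). lra.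
Qed.

Lemma Cmod_vertical (tau : C) (T : R) : 1 <= T -> Cmod (tau + RtoC T * Ci) <= (Cmod tau + 1) * T.
Proof.
intros HT. eapply Rle_trans; [apply Cmod_triangle|]. rewrite Cmod_mult, Cmod_Ci, Cmod_R, Rabs_pos_eq by lra.
assert (P := Cmod_ge_0 tau). nra.
Qed.

Lemma upper_vertical (tau : C) (T : R) : upper tau -> 0 <= T -> upper (tau + RtoC T * Ci).
Proof. unfold upper, Im. intros. simpl. lra. Qed.

Lemma decT_rapid_decay (F : C -> C) (tau : C) : upper tau -> decT F -> rapid_decay (fun T => F (tau + RtoC T * Ci)).
Proof.
intros Ht. induction 1 as [j a f [Sa Ea] Za|F G _ IF _ IG|F G _ IF E].
- apply rapid_decay_mult.
  + exists j, ((Cmod tau + 1) ^ j)%R. intros T HT. rewrite Cmod_pow, <- Rpow_mult_distr. apply pow_incr.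
    split; [apply Cmod_ge_0|apply Cmod_vertical; assumption].
  + intros N. destruct (psum_near_0 a Sa) as [K [HK B]]. exists (K * INR N ^ N)%R. intros T HT.
    assert (U := upper_vertical tau T Ht ltac:(lra)).
    assert (Q : Cmod (q (tau + RtoC T * Ci)) <= exp (- T)).
    { rewrite Cmod_q. unfold upper, Im in *. simpl. assert (P := PI2_3_2). unfold PI2 in P. left. apply exp_increasing.
      assert (T < 2 * PI * (snd tau + T)) by nra. lra. }
    assert (Q2 : exp (- T) <= 1 / 2).
    { rewrite exp_Ropp. generalize (exp_ineq1_le T). intros. replace (1 / 2)%R with (/ 2)%R by field. apply Rinv_le_contravar; lra. }
    specialize (B (q (tau + RtoC T * Ci)) ltac:(lra)). rewrite Za, <- Ea in B by assumption.
    replace (f (tau + RtoC T * Ci) - 0) with (f (tau + RtoC T * Ci)) in B by ring.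
    assert (PE := pow_exp_bound T N ltac:(lra)). assert (P0 := pow_le T N ltac:(lra)). assert (E0 := exp_pos (- T)).
    apply Rle_trans with (INR N ^ N * exp T * (K * exp (- T)))%R.
    * apply Rmult_le_compat; [assumption|apply Cmod_ge_0|assumption|]. eapply Rle_trans; [exact B|]. apply Rmult_le_compat_l; assumption.
    * replace (INR N ^ N * exp T * (K * exp (- T)))%R with (K * INR N ^ N * (exp T * exp (- T)))%R by ring.
      rewrite <- exp_plus, Rplus_opp_r, exp_0. lra.
- apply rapid_decay_plus; assumption.
- intros N. destruct (IF N) as [K HK]. exists K. intros T HT. rewrite E by (apply upper_vertical; [assumption|lra]). auto.
Qed.

Lemma poly_growth_psi {J : Type} (B : J -> C -> C) (w : list J) (tau : C) : (forall j, W (B j)) -> upper tau ->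
  poly_growth (fun T => psi B w (tau + RtoC T * Ci)).
Proof.
intros HB Ht. apply poly_growth_plus.
- apply (poly_growth_mult (fun _ => _)); [apply poly_growth_const|]. apply (poly_growth_mult _ (fun _ => _)); [|apply poly_growth_const].
  exists (length w), ((Cmod tau + 1) ^ length w)%R. intros T HT. rewrite Cmod_pow, Cmod_opp, <- Rpow_mult_distr. apply pow_incr.
  split; [apply Cmod_ge_0|apply Cmod_vertical; assumption].
- apply rapid_decay_poly_growth, decT_rapid_decay; [assumption|]. apply dec_part_spec, HB.
Qed.

(** The segment is prolonged beyond its end [tau], so that the parameter 0 is an interior point at
    which two-sided derivatives make sense. *)
Lemma vertical_path (tau : C) (T : R) : upper tau -> 1 <= T ->
  - Im tau / T < 0 /\ forall s, - Im tau / T < s -> upper (tau + RtoC s * (tau + RtoC T * Ci - tau)).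
Proof.
unfold upper. intros Ht HT. split.
- apply Rmult_lt_reg_r with T; [lra|]. unfold Rdiv. rewrite Rmult_assoc, Rinv_l by lra. lra.
- intros s Hs. apply Rlt_div_l in Hs; [|lra]. simpl. unfold Im in *. nra.
Qed.

(** Strong induction on the length: [conv_path] is solved for the term in which the whole word is
    integrated, the other terms having shorter left factors. *)
Lemma poly_growth_iter_int {J : Type} (B : J -> C -> C) (w : list J) (tau : C) : (forall j, W (B j)) -> upper tau ->
  poly_growth (fun T => iter_int tau (tau + RtoC T * Ci) (map B w)).
Proof.
intros HB Ht. remember (length w) as n eqn:En. revert w En. induction n as [n IH] using lt_wf_ind. intros w En.
assert (P : poly_growth (fun T => psi B w tau + - (1) * Csum (fun i => iter_int tau (tau + RtoC T * Ci) (map B (firstn i w)) * psi B (skipn i w) (tau + RtoC T * Ci)) (seq 0 n))).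
{ apply poly_growth_plus; [apply poly_growth_const|]. apply (poly_growth_mult (fun _ => _)); [apply poly_growth_const|].
  apply poly_growth_Csum. intros i Hi. apply in_seq in Hi. apply poly_growth_mult; [|apply poly_growth_psi; assumption].
  apply (IH i); [lia|]. rewrite length_firstn. lia. }
destruct P as [N [K HK]]. exists N, K. intros T HT. specialize (HK T HT).
destruct (vertical_path tau T Ht HT) as [V1 V2].
assert (E := conv_path B tau (tau + RtoC T * Ci) _ w HB V1 V2). rewrite <- conv_Csum, <- En, seq_S, Csum_app in E.
unfold Csum at 2 in E. simpl in E. rewrite En, firstn_all, skipn_all, psi_nil, <- En in E.
rewrite <- E in HK. 
match type of HK with Cmod ?z <= _ => replace z with (iter_int tau (tau + RtoC T * Ci) (map B w)) in HK by ring end. exact HK.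
Qed.

Lemma CLim_rapid (F : R -> C) (l : C) (G : R -> C) : rapid_decay G -> (forall T, 1 <= T -> F T = l + G T) -> CLim F = l.
Proof.
intros HG E. destruct (HG 1%nat) as [K HK].
assert (H : forall p : C -> R, (forall z w : C, p (z + w) = (p z + p w)%R) -> (forall z : C, Rabs (p z) <= Cmod z) ->
   real (Lim (fun T => p (F T)) p_infty) = p l).
{ intros p Hp Bp. replace (p l) with (real (Finite (p l))) by reflexivity. f_equal. apply is_lim_unique, is_lim_spec. intros [eps He].
  exists (Rmax 1 (K / eps)). intros T HT. simpl. assert (H1 := Rmax_l 1 (K / eps)). assert (H2 := Rmax_r 1 (K / eps)).
  rewrite E, Hp by lra. replace (p l + p (G T) - p l)%R with (p (G T)) by ring.
  eapply Rle_lt_trans; [apply Bp|]. specialize (HK T ltac:(lra)). simpl in HK.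
  assert (K < T * eps)%R by (apply Rlt_div_l; lra). nra. }
unfold CLim. rewrite (H Re), (H Im); [destruct l; reflexivity|reflexivity| |reflexivity|apply re_le_Cmod].
intros z. assert (R := Rmax_Cmod z). assert (M := Rmax_r (Rabs (fst z)) (Rabs (snd z))). unfold Im. lra.
Qed.

(** Write J for the integrals from tau to b = tau + i T, e for the exponentials, and products for
    convolutions. The integral of R up to b is J e(tau - b) = J e(-b) e(tau), whereas [conv_path]
    gives psi(tau) = J (e(-b) + dec(b)). After multiplication by e(tau) the two differ by J dec(b)
    e(tau), of polynomial growth times rapid decay in T. *)
Lemma iter_int_R_ioo_psi {J : Type} (B : J -> C -> C) (w : list J) (tau : C) : (forall j, W (B j)) -> upper tau ->
  iter_int_R_ioo tau (map B w) = conv (fun u => psi B u tau) (exp_word (fun j => f_infty (B j)) tau) w.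
Proof.
intros HB Ht. set (e := exp_word (fun j => f_infty (B j))).
apply (CLim_rapid _ _ (fun T => - (1) * conv (fun u => iter_int tau (tau + RtoC T * Ci) (map B u))
   (conv (fun u => dec_part B u (tau + RtoC T * Ci)) (e tau)) w)).
- apply rapid_decay_mult; [apply poly_growth_const|].
  apply (rapid_decay_conv (fun T u => iter_int tau (tau + RtoC T * Ci) (map B u)) (fun T => conv (fun u => dec_part B u (tau + RtoC T * Ci)) (e tau))).
  intros u v. apply rapid_decay_mult; [apply poly_growth_iter_int; assumption|].
  apply (rapid_decay_conv (fun T u => dec_part B u (tau + RtoC T * Ci)) (fun _ => e tau)). intros u' v' N.
  destruct (rapid_decay_mult (fun _ => e tau v') _ (poly_growth_const _) (decT_rapid_decay _ tau Ht (proj1 (dec_part_spec B u' HB))) N) as [K HK].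
  exists K. intros T HT. rewrite Cmult_comm. auto.
- intros T HT. destruct (vertical_path tau T Ht HT) as [V1 V2]. rewrite (iter_int_lin_Rmap B _ _ _ w HB V1 V2).
  set (b := tau + RtoC T * Ci) in *. fold e.
  rewrite (conv_ext (fun u => psi B u tau) (e tau) (conv (fun u => iter_int tau b (map B u)) (fun v => psi B v b)) (e tau)); [|intros; symmetry; apply (conv_path B tau b _ u HB V1 V2)|reflexivity].
  rewrite conv_assoc.
  rewrite (conv_ext (fun u => iter_int tau b (map B u)) (e (tau - b)) (fun u => iter_int tau b (map B u)) (conv (e (- b)) (e tau))); [|reflexivity|].
  2: { intros u. unfold e. rewrite conv_exp_word. f_equal. ring. }
  rewrite (conv_ext (fun u => iter_int tau b (map B u)) (conv (fun v => psi B v b) (e tau)) (fun u => iter_int tau b (map B u))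
     (fun u => conv (e (- b)) (e tau) u + conv (fun v => dec_part B v b) (e tau) u)); [|reflexivity|].
  + rewrite conv_plus_r. ring.
  + intros u. rewrite <- conv_plus_l. reflexivity.
Qed.

(** The integrals of constants from 0 to [tau], with their signs, form the exponential at [- tau];
    it cancels the exponential at [tau] left over by [iter_int_R_ioo_psi]. *)
Lemma I_reg_psi {J : Type} (B : J -> C -> C) (w : list J) (tau : C) : (forall j, W (B j)) -> upper tau ->
  I_reg (map B w) tau = tpi ^ length w * psi B w tau.
Proof.
intros HB Ht. unfold I_reg. rewrite length_map. change (2 * RtoC PI * Ci) with tpi. f_equal.
set (e := exp_word (fun j => f_infty (B j))).
transitivity (conv (conv (fun u => psi B u tau) (e tau)) (e (- tau)) w).
- rewrite <- conv_Csum. apply Csum_ext. intros i Hi. apply in_seq in Hi.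
  rewrite firstn_map, iter_int_R_ioo_psi, rev_infty_map, iter_int_const by assumption. fold e.
  replace (tau - 0) with tau by ring. unfold e. rewrite <- (exp_word_opp _ tau), length_skipn. ring.
- rewrite conv_assoc. rewrite (conv_ext _ _ (fun u => psi B u tau) (fun u => match u with [] => 1 | _ => 0 end)); [|reflexivity|].
  + clear. change (psi B w tau) with ((fun u => psi B u tau) w). generalize (fun u => psi B u tau). induction w as [|j w IH]; intros X; simpl; [ring|]. rewrite IH. ring.
  + intros u. unfold e. rewrite conv_exp_word. replace (tau + - tau) with (RtoC 0) by ring. unfold exp_word.
    destruct u as [|j u]; [simpl; change (nC 1) with (RtoC 1); field|]. simpl (0 ^ _). unfold Cdiv. ring.
Qed.

Theorem theorem3p1 (J : Type) (B : J -> C -> C)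
  (hB : forall j : J, CE2_plus_modular (B j))
  (hindep : lin_indep_C B) :
  lin_indep_FracQM (fun (w : list J) (tau : C) => I_reg (map B w) tau).
Proof.
assert (HW : forall j, W (B j)) by (intros j; apply quasimodular_W, CE2_plus_modular_rep, hB).
intros s g h N QH Rel.
(* One factor [tpi] per letter brings the equation of [psi] into the required form; [I_reg_psi]
   identifies this family with the integrals on the upper half-plane. *)
apply (FracQM_independent B (fun w tau => tpi ^ length w * psi B w tau) hB hindep) with (h := h); try assumption.
- intros tau _. rewrite psi_nil. simpl. ring.
- intros j w tau Ht. apply (cder_eq _ _ _ _ (cder_scal (tpi ^ length (j :: w)) _ _ _ (cder_psi B j w tau HW Ht))). simpl. ring.
- intros tau Ht Nz. rewrite <- (Rel tau Ht Nz). apply Csum_ext. intros w _. rewrite I_reg_psi by assumption. reflexivity.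
Qed.
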